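(* Let $x$ and $y$ be complex random variables with zero mean and unit variance. Let $X_n$ and $Y_n$ be $n\times n$ random matrices whose entries are iid copies of $x$ and $y$, respectively. Let $M_n,K_n,L_n$ be random $n\times n$ complex matrices, independent of $X_n,Y_n$, with $K_n,L_n$ invertible, and let $A_n:=M_n+K_nX_nL_n$ and $B_n:=M_n+K_nY_nL_n$. Assume that the expressions $$\frac{1}{n^2}\|A_n\|_2^2+\frac{1}{n^2}\|B_n\|_2^2+\frac{1}{n^2}\|K_n^{-1}M_nL_n^{-1}\|_2^2+\frac1n\|K_n^{-1}L_n^{-1}\|_2^2\qquad( * )$$ are bounded in probability. Then $\mu_{\frac{1}{\sqrt n}A_n}-\mu_{\frac{1}{\sqrt n}B_n}$ converges in probability to zero. If furthermore the expressions $( * )$ are almost surely bounded, and for (Lebesgue) almost every $z\in\mathbb{C}$ the ESDs $$\mu_{(\frac{1}{\sqrt n}K_n^{-1}M_nL_n^{-1}-zK_n^{-1}L_n^{-1})(\frac{1}{\sqrt n}K_n^{-1}M_nL_n^{-1}-zK_n^{-1}L_n^{-1})^*}$$ converge almost surely to a limit as $n\to\infty$, then $\mu_{\frac{1}{\sqrt n}A_n}-\mu_{\frac{1}{\sqrt n}B_n}$ converges almost surely to zero.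
   Context: For an $n\times n$ complex matrix $A$ with eigenvalues $\lambda_1,\dots,\lambda_n$ (with algebraic multiplicity), the empirical spectral distribution (ESD) is the probability measure $\mu_A=\frac1n\sum_{i=1}^n\delta_{\lambda_i}$ on $\mathbb{C}$. $\|A\|_2:=\mathrm{trace}(AA^* )^{1/2}$ is the Hilbert-Schmidt norm. Zero mean and unit variance means $\mathbf{E}x=0$, $\mathbf{E}|x|^2=1$. Scalar random variables $Z_n$ are bounded in probability if $\lim_{C\to\infty}\liminf_{n\to\infty}\mathbf{P}(|Z_n|\le C)=1$, and almost surely bounded if $\mathbf{P}(\limsup_n|Z_n|<\infty)=1$. Measures are given the vague topology (convergence of integrals against every continuous compactly supported $f:\mathbb{C}\to\mathbb{R}$). For random probability measures, $\mu_n-\mu_n'$ converges in probability to zero if $\int f\,d\mu_n-\int f\,d\mu_n'\to0$ in probability for every such $f$; it converges almost surely to zero if with probability $1$, $\int f\,d\mu_n-\int f\,d\mu_n'\to0$ for all such $f$. The $X_n$ are the upper-left $n\times n$ blocks of a single infinite array $(x_{ij})_{i,j\ge1}$ of iid copies of $x$, likewise the $Y_n$ for an array $(y_{ij})_{i,j\ge1}$ of iid copies of $y$, and the independence hypothesis means that the sequence $(M_n,K_n,L_n)_n$ is independent of these arrays. *)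

(* Defs.v *)
From HB Require Import structures.
From mathcomp Require Import all_boot all_order all_algebra.
From mathcomp Require Import complex.
From mathcomp Require Import all_classical all_reals all_analysis.

Set Implicit Arguments.
Unset Strict Implicit.
Unset Printing Implicit Defensive.

Import Order.TTheory GRing.Theory Num.Theory.
Import numFieldNormedType.Exports.

Local Open Scope classical_set_scope.
Local Open Scope ring_scope.
Local Open Scope complex_scope.
Local Open Scope sesquilinear_scope.

(* R[i] has the topology of its modulus and the corresponding Borel
   sigma-algebra. *)
HB.instance Definition _ (R : realType) := NormedModule.copy R[i] R[i]^o.
HB.instance Definition _ (R : realType) :=
  Measurable.copy R[i] (g_sigma_algebraType (@open R[i])).

Section linear_algebra.
Context {R : realType}.

(* The roots of the (monic) characteristic polynomial, repeated according to
   multiplicity. *)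
Definition eigenvalues n (A : 'M[R[i]]_n) : seq R[i] :=
  sval (closed_field_poly_normal (char_poly A)).

(* The sum of the Dirac masses at the eigenvalues, divided by n; there are
   exactly n of them.  For n = 0 this is the zero measure. *)
Definition esd n (A : 'M[R[i]]_n) : {measure set R[i] -> \bar R} :=
  mscale (n%:R^-1)%:nng (msum (fun k => \d_((eigenvalues A)`_k)) n).

(* The trace is a nonnegative real element of R[i]; its real part is taken to
   land in R. *)
Definition hs_norm n (A : 'M[R[i]]_n) : R :=
  Num.sqrt (complex.Re (\tr (A *m A ^t*))).

Definition normalize n (A : 'M[R[i]]_n) : 'M[R[i]]_n :=
  ((Num.sqrt n%:R)^-1)%:C *: A.

Definition bound_expr n (A B M K L : 'M[R[i]]_n) : R :=
  n%:R ^- 2 * hs_norm A ^+ 2 + n%:R ^- 2 * hs_norm B ^+ 2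
  + n%:R ^- 2 * hs_norm (invmx K *m M *m invmx L) ^+ 2
  + n%:R^-1 * hs_norm (invmx K *m invmx L) ^+ 2.

Definition shifted n (M K L : 'M[R[i]]_n) (z : R[i]) : 'M[R[i]]_n :=
  normalize (invmx K *m M *m invmx L) - z *: (invmx K *m invmx L).

End linear_algebra.

Section vague_topology.
Context {R : realType}.

Definition test_function (f : R[i] -> R) : Prop :=
  continuous f /\ compact (closure [set z | f z != 0]).

Definition vague_cvg (mu : nat -> {measure set R[i] -> \bar R})
    (nu : {measure set R[i] -> \bar R}) : Prop :=
  forall f, test_function f ->
    \int[mu n]_z f z @[n --> \oo] --> \int[nu]_z f z.

Definition lebesgueC : set R[i] -> \bar R :=
  pushforward (lebesgue_measure \x lebesgue_measure)%E
    (fun p : R * R => p.1 +i* p.2).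

End vague_topology.

Section probability.
Context {d : measure_display} {T : measurableType d} {R : realType}.
Variable P : probability T R.

Definition bounded_in_probability (Z : nat -> T -> R) : Prop :=
  limn_einf (fun n => P [set w | `|Z n w| <= C]) @[C --> +oo] --> 1%E.

Definition as_bounded (Z : nat -> T -> R) : Prop :=
  {ae P, forall w, (limn_esup (fun n => `|Z n w|%:E) < +oo)%E}.

Definition cvg_in_probability (Z : nat -> T -> R) (l : R) : Prop :=
  forall e : R, 0 < e -> P [set w | e < `|Z n w - l|] @[n --> \oo] --> 0%E.

Definition diff_cvg0_in_probability
    (mu nu : nat -> T -> {measure set R[i] -> \bar R}) : Prop :=
  forall f, test_function f ->
    cvg_in_probability (fun n w => \int[mu n w]_z f z - \int[nu n w]_z f z) 0.

Definition diff_cvg0_as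
    (mu nu : nat -> T -> {measure set R[i] -> \bar R}) : Prop :=
  {ae P, forall w, forall f, test_function f ->
    \int[mu n w]_z f z - \int[nu n w]_z f z @[n --> \oo] --> 0}.

(* The limit may depend on w.  Vague limits of probability measures have mass
   at most 1, so it is enough to look for a limit among finite measures. *)
Definition cvg_as (mu : nat -> T -> {measure set R[i] -> \bar R}) : Prop :=
  {ae P, forall w, exists nu : {finite_measure set R[i] -> \bar R},
    vague_cvg (mu ^~ w) nu}.

(* Zero mean and unit variance; the latter makes x integrable. *)
Definition standardized (x : {RV P >-> R[i]}) : Prop :=
  [/\ ('E_P[fun w => complex.Re (x w)] = 0)%E,
      ('E_P[fun w => complex.Im (x w)] = 0)%E &
      ('E_P[fun w => complex.Re (`|x w| ^+ 2)%R] = 1)%E].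

Definition mutually_independent (I : choiceType)
    (X : I -> {RV P >-> R[i]}) : Prop :=
  forall (s : seq I) (B : I -> set R[i]), uniq s ->
    (forall i, measurable (B i)) ->
    P (\bigcap_(i in [set` s]) (X i @^-1` B i)) =
    (\prod_(i <- s) P (X i @^-1` B i))%E.

(* On non-measurable sets the values of P carry no meaning, hence the
   comparison of laws on measurable sets only. *)
Definition iid_copies (x : {RV P >-> R[i]})
    (X : nat -> nat -> {RV P >-> R[i]}) : Prop :=
  mutually_independent (fun ij : nat * nat => X ij.1 ij.2) /\
  forall i j (B : set R[i]), measurable B ->
    distribution P (X i j) B = distribution P x B.

Definition random_matrices (M : forall n, T -> 'M[R[i]]_n) : Prop :=
  forall n (i j : 'I_n), measurable_fun setT (fun w => M n w i j).

Definition top_left_block (X : nat -> nat -> {RV P >-> R[i]}) n (w : T) :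
    'M[R[i]]_n :=
  \matrix_(i, j) X i j w.

Definition sigma_of (F : set (T -> R[i])) : set (set T) :=
  <<s [set A | exists2 f, F f &
         exists2 B : set R[i], measurable B & A = f @^-1` B] >>.

Definition independent_families (F G : set (T -> R[i])) : Prop :=
  forall A B, sigma_of F A -> sigma_of G B -> P (A `&` B) = (P A * P B)%E.

Definition matrix_entries (M : forall n, T -> 'M[R[i]]_n) : set (T -> R[i]) :=
  [set f : T -> R[i] | exists n (i j : 'I_n), f = fun w => M n w i j].

Definition array_entries (X : nat -> nat -> {RV P >-> R[i]}) :
    set (T -> R[i]) :=
  [set f : T -> R[i] | exists i j, f = X i j].

End probability.

(* Main.v *)
(* Write [F_z] for the shifted matrix at [z].  As [A / sqrt n - z = K (X / sqrt n
   + F_z) L], the logarithmic potentials of the two spectral measures at [z]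
   differ by [1/n] times [ln |det (X / sqrt n + F_z)| - ln |det (Y / sqrt n + F_z)|],
   where [F_z] may be frozen by independence and has Hilbert-Schmidt norm
   [O(sqrt n)].  A regularized version of [ln |det|^2] concentrates around a
   centre (Laplace transforms, resampling one row at a time) that hardly depends
   on the law of the entries (Lindeberg replacement).  The regularization is
   removed by lower bounds on the distance from a row to the span of others;
   for the last rows these come from a polynomial bound valid for every
   anticoncentrated array, improved recursively through a Littlewood-Offord
   inequality on the cube whose exceptional coincidences are again events of the
   same kind for a smaller matrix.  Averaging the potentials over
   [a + r zeta], [zeta] a root of unity of order [n ^ 3], turns them into sums of
   [ln max(|lambda - a|, r)], and linear combinations of these functions
   approximate every test function uniformly.  All exceptional probabilities are
   [O(n ^ (-9/8))], which is summable, so that the same estimate serves for both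
   modes of convergence. *)
Require Import Defs.
From HB Require Import structures.
From mathcomp Require Import all_boot all_order all_algebra.
From mathcomp Require Import complex.
From mathcomp Require Import all_classical all_reals all_analysis.
From mathcomp Require Import measurable_realfun measurable_fun_approximation.
From mathcomp Require Import separable cyclotomic.
From mathcomp Require Import ring lra zify.

Set Implicit Arguments.
Unset Strict Implicit.
Unset Printing Implicit Defensive.

Import Order.TTheory GRing.Theory Num.Theory.
Import numFieldNormedType.Exports.

Local Open Scope classical_set_scope.
Local Open Scope ring_scope.
Local Open Scope complex_scope.
Local Open Scope sesquilinear_scope.
Local Notation Re := complex.Re.
Local Notation Im := complex.Im.
Local Notation sqrt := Num.sqrt.
Local Notation mble := (measurable_fun setT).
Local Notation mcomp := measurableT_comp.
Local Notation mbleD := measurable_funD.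
Local Notation mbleB := measurable_funB.
Local Notation mbleM := measurable_funM.
Local Notation mbleN := measurable_funN.
Local Notation mbleX := measurable_funX.
Local Notation mble_ltr := measurable_fun_ltr.
Local Notation mble_ler := measurable_fun_ler.
Local Notation mble_EFinP := measurable_EFinP.

(** * Borel measurability of complex-valued functions *)

Section complex_measurability.
Context {R : realType}.
Implicit Types z : R[i].

(** Only second moments are available, yet every exceptional probability has to be summable.
    Changing one row moves the regularized [ln det] by at most the logarithm of a quantity of
    bounded mean, so a small power [u] of the determinant satisfies
    [E u * E u^-1 <= (1 + O(lam ^ 2)) ^ n], which is exponential concentration at scale [n]. The
    centre is read off the mean of the same power: exchanging the law of one row multiplies that
    mean by a factor close to [1], uniform integrability of the squared entries replacing a third
    moment. For the last rows the plain inequality on the cube is too weak; the version used is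
    [l ^ (-5/2)] times the number of coincidences, which improves a bound [n ^ (-k/2)] into
    [n ^ (-(k+1)/2)] and stops at [n ^ (-3/2)], the share of the diagonal coincidences. That
    exponent is enough: at most [O(n ^ (1/4))] rows rely on it, which leaves [n ^ (-5/4)], and
    Markov's inequality for the number of roots of unity with a bad determinant costs [n ^ (1/8)].
    Rows are added one at a time by a rank-one formula covering regularized inverses and orthogonal
    projections alike. *)

Definition sqnorm z : R := Re z ^+ 2 + Im z ^+ 2.

Lemma sqnorm_ge0 z : 0 <= sqnorm z.
Proof. by rewrite addr_ge0 ?sqr_ge0. Qed.

Lemma normr_sqnorm z : `|z| = (sqrt (sqnorm z))%:C.
Proof. exact: normc_def. Qed.

Lemma ler_normRe z : `|Re z| <= sqrt (sqnorm z).
Proof. by rewrite -sqrtr_sqr ler_sqrt ?sqnorm_ge0// lerDl sqr_ge0. Qed.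

Lemma ler_normIm z : `|Im z| <= sqrt (sqnorm z).
Proof. by rewrite -sqrtr_sqr ler_sqrt ?sqnorm_ge0// lerDr sqr_ge0. Qed.

Lemma ReB z1 z2 : Re (z1 - z2) = Re z1 - Re z2.
Proof. by case: z1 z2 => [a b] [c d]. Qed.
Lemma ImB z1 z2 : Im (z1 - z2) = Im z1 - Im z2.
Proof. by case: z1 z2 => [a b] [c d]. Qed.
Lemma ReD z1 z2 : Re (z1 + z2) = Re z1 + Re z2.
Proof. by case: z1 z2 => [a b] [c d]. Qed.
Lemma ImD z1 z2 : Im (z1 + z2) = Im z1 + Im z2.
Proof. by case: z1 z2 => [a b] [c d]. Qed.
Lemma ReM z1 z2 : Re (z1 * z2) = Re z1 * Re z2 - Im z1 * Im z2.
Proof. by case: z1 z2 => [a b] [c d]. Qed.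
Lemma ImM z1 z2 : Im (z1 * z2) = Re z1 * Im z2 + Im z1 * Re z2.
Proof. by case: z1 z2 => [a b] [c d]. Qed.
Lemma ReN z : Re (- z) = - Re z. Proof. by case: z. Qed.
Lemma ImN z : Im (- z) = - Im z. Proof. by case: z. Qed.
Lemma ReJ z : Re (z^*) = Re z. Proof. by case: z. Qed.
Lemma ImJ z : Im (z^*) = - Im z. Proof. by case: z. Qed.
Lemma ReV z : Re z^-1 = Re z / sqnorm z. Proof. by case: z. Qed.
Lemma ImV z : Im z^-1 = - (Im z / sqnorm z). Proof. by case: z. Qed.

Lemma nbhs_complexP z (A : set R[i]) :
 nbhs z A <-> exists2 e : R, 0 < e &
  forall w, sqnorm (z - w) < e ^+ 2 -> A w.
Proof.
split.
(* A positive element of [R[i]] is real, so the radius can be read in [R]. *)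
- move=> /nbhs_ballP[e /=]; case: e => e ei; rewrite ltcE /= => /andP[/eqP ei0 e0].
 subst ei => h; exists e => // w hw; apply: h; rewrite /ball /= normr_sqnorm.
 by rewrite ltcE /= eqxx /= -(ltr_pXn2r (n:=2)) ?nnegrE ?sqrtr_ge0 ?ltW// sqr_sqrtr// sqnorm_ge0.
- move=> [e e0 h]; apply/nbhs_ballP; exists e%:C; rewrite /= ?ltcR// => w.
 rewrite /ball /= normr_sqnorm ltcR => hw; apply: h.
 by rewrite -(sqr_sqrtr (sqnorm_ge0 _)) ltr_pXn2r ?nnegrE ?sqrtr_ge0 ?ltW.
Qed.

Lemma continuous_Re : continuous (@Re R : R[i] -> R).
Proof.
move=> z A /nbhs_ballP[e e0 h]; apply/nbhs_complexP; exists e => // w hw.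
apply: h; rewrite /ball /= -ReB; apply: le_lt_trans (ler_normRe _) _.
by rewrite -(ltr_pXn2r (n:=2)) ?nnegrE ?sqrtr_ge0 ?ltW// sqr_sqrtr// sqnorm_ge0.
Qed.

Lemma continuous_Im : continuous (@Im R : R[i] -> R).
Proof.
move=> z A /nbhs_ballP[e e0 h]; apply/nbhs_complexP; exists e => // w hw.
apply: h; rewrite /ball /= -ImB; apply: le_lt_trans (ler_normIm _) _.
by rewrite -(ltr_pXn2r (n:=2)) ?nnegrE ?sqrtr_ge0 ?ltW// sqr_sqrtr// sqnorm_ge0.
Qed.

Lemma meas_continuousC (f : R[i] -> R) : continuous f ->
 measurable_fun [set: R[i]] f.
Proof.
move=> /continuousP cf; apply: (measurability _ (RGenOpens.measurableE R)).
by move=> _ [_ [a [b ->] <-]]; rewrite setTI; apply: sub_sigma_algebra; apply: cf; exact: interval_open.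
Qed.

Lemma meas_Re : measurable_fun [set: R[i]] (@Re R).
Proof. exact: meas_continuousC continuous_Re. Qed.

Lemma meas_Im : measurable_fun [set: R[i]] (@Im R).
Proof. exact: meas_continuousC continuous_Im. Qed.

Lemma rat_between (a b : R) : a < b -> exists q : rat, a < ratr q < b.
Proof.
by move=> /rat_in_itvoo[q h]; exists q; move: h; rewrite in_itv.
Qed.

(** Second countability of the plane: the sigma-algebra of [R[i]] is generated by open sets, so
    measurability reduces to countably many conditions on real and imaginary parts. *)
Lemma open_complex_rat (U : set R[i]) : open U ->
 U = \bigcup_(q in [set q : rat * rat * rat | 0 < q.2 /\
     forall w : R[i], `|Re w - ratr q.1.1| < ratr q.2 ->
      `|Im w - ratr q.1.2| < ratr q.2 -> U w])
   [set w | `|Re w - ratr q.1.1| < ratr q.2 /\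
        `|Im w - ratr q.1.2| < ratr q.2].
Proof.
move=> oU; apply/seteqP; split; last by move=> w [q [q0 h] [h1 h2]]; exact: h.
move=> w Uw; have /nbhs_complexP[e e0 h] : nbhs w U by exact: open_nbhs_nbhs.
have [r /andP[r0 re]] := rat_between (divr_gt0 e0 (ltr0n _ 4)).
have [p] : exists p : rat, `|Re w - ratr p| < ratr r.
 have hh : Re w - ratr r < Re w + ratr r by lra.
 have [p h12] := rat_between hh.
 by exists p; rewrite ltr_norml; lra.
move=> hp; have [q] : exists q : rat, `|Im w - ratr q| < ratr r.
 have hh : Im w - ratr r < Im w + ratr r by lra.
 have [q h12] := rat_between hh.
 by exists q; rewrite ltr_norml; lra.
move=> hq; exists (p, q, r) => //=; split; first by move: r0; rewrite ltr0q.
move=> v h1 h2; apply: h; rewrite /sqnorm ReB ImB.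
move: hp hq h1 h2; rewrite !ltr_norml => *.
have {}re : ratr r < e / 4 by [].
have h1 : -(e/2) < Re w - Re v < e/2 by lra.
have h2 : -(e/2) < Im w - Im v < e/2 by lra.
have s (u : R) : - (e/2) < u < e/2 -> u ^+2 < e^+2/4.
 move=> hu; rewrite -subr_gt0 (_ : _ - _ = (e/2 - u) * (e/2 + u)); last by field.
 by apply: mulr_gt0; lra.
have : 0 < e ^+ 2 by exact: exprn_gt0.
have := s _ h1; have := s _ h2; lra.
Qed.

Context {d} {T : measurableType d}.

Lemma meas_complexP (f : T -> R[i]) : measurable_fun [set: T] f <->
 measurable_fun [set: T] (fun w => Re (f w)) /\
 measurable_fun [set: T] (fun w => Im (f w)).
Proof.
split=> [mf|[mr mi]].
 by split; [exact: mcomp meas_Re mf|exact: mcomp meas_Im mf].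
apply: (measurability (@open R[i])) => //.
move=> _ [U oU <-]; rewrite setTI (open_complex_rat oU) preimage_bigcup bigcup_mkcond.
apply: countable_bigcupT_measurable => // q; case: ifPn => _ //.
rewrite (_ : _ @^-1` _ = ((fun w => `|Re (f w) - ratr q.1.1|) @^-1` [set t | t < ratr q.2])
  `&` ((fun w => `|Im (f w) - ratr q.1.2|) @^-1` [set t | t < ratr q.2]))//.
have mi' : measurable [set t : R | t < ratr q.2].
 by rewrite -set_itvNyo; exact: measurable_itv.
apply: measurableI.
- rewrite -[X in measurable X]setTI.
 have : measurable_fun [set: T] (fun w => `|Re (f w) - ratr q.1.1|).
  by apply: mcomp => //; exact: mbleB.
 exact.
- rewrite -[X in measurable X]setTI.
 have : measurable_fun [set: T] (fun w => `|Im (f w) - ratr q.1.2|).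
  by apply: mcomp => //; exact: mbleB.
 exact.
Qed.

Implicit Types f g : T -> R[i].

Lemma meas_addC f g : mble f -> mble g ->
 mble (fun w => f w + g w).
Proof.
move=> /meas_complexP[f1 f2] /meas_complexP[g1 g2].
apply/meas_complexP; split.
 by under eq_fun do rewrite ReD; exact: mbleD.
by under eq_fun do rewrite ImD; exact: mbleD.
Qed.

Lemma meas_oppC f : mble f ->
 mble (fun w => - f w).
Proof.
move=> /meas_complexP[f1 f2]; apply/meas_complexP; split.
 by under eq_fun do rewrite ReN; exact: mbleN.
by under eq_fun do rewrite ImN; exact: mbleN.
Qed.

Lemma meas_mulC f g : mble f -> mble g ->
 mble (fun w => f w * g w).
Proof.
move=> /meas_complexP[f1 f2] /meas_complexP[g1 g2].
apply/meas_complexP; split.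
 by under eq_fun do rewrite ReM; apply: mbleB; exact: mbleM.
by under eq_fun do rewrite ImM; apply: mbleD; exact: mbleM.
Qed.

Lemma meas_conjC f : mble f ->
 mble (fun w => (f w)^*).
Proof.
move=> /meas_complexP[f1 f2]; apply/meas_complexP; split.
 by under eq_fun do rewrite ReJ.
by under eq_fun do rewrite ImJ; exact: mbleN.
Qed.

Lemma meas_sqnorm f : mble f ->
 mble (fun w => sqnorm (f w)).
Proof.
move=> /meas_complexP[f1 f2].
by apply: mbleD; exact: mbleX.
Qed.

Lemma meas_invR (h : T -> R) : mble h ->
 mble (fun w => (h w)^-1).
Proof.
move=> mh; have mi : measurable_fun [set: R] (fun x : R => x^-1).
 (* Reduction to the measurability of real powers; the factor [x] restores the sign and the value
    [0] at [0]. *)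
 rewrite (_ : (fun x : R => x^-1) =
   (fun x : R => x * powR (x ^+ 2) (-1))); last first.
  apply/funext => x; rewrite powRN powRr1 ?sqr_ge0//.
  have [->|x0] := eqVneq x 0; first by rewrite invr0 mul0r.
  by rewrite expr2 invfM mulrA divff// mul1r.
 apply: mbleM => //; apply: (mcomp (measurable_powR (-1))).
 exact: exprn_measurable.
exact: mcomp mi mh.
Qed.

Lemma meas_invC f : mble f ->
 mble (fun w => (f w)^-1).
Proof.
move=> mf; have ms := meas_invR (meas_sqnorm mf).
move/meas_complexP: mf => [f1 f2]; apply/meas_complexP; split.
 by under eq_fun do rewrite ReV; exact: mbleM.
by under eq_fun do rewrite ImV; apply: mbleN; exact: mbleM.
Qed.

Lemma meas_sumC (I : Type) (s : seq I) (P : pred I) (F : I -> T -> R[i]) :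
 (forall i, P i -> mble (F i)) ->
 mble (fun w => \sum_(i <- s | P i) F i w).
Proof.
move=> mF; elim: s => [|i s ih]; first by under eq_fun do rewrite big_nil; exact: measurable_cst.
have [Pi|Pi] := boolP (P i); last by under eq_fun do rewrite big_cons (negbTE Pi).
under eq_fun do rewrite big_cons Pi.
by apply: meas_addC => //; exact: mF.
Qed.

Lemma meas_prodC (I : Type) (s : seq I) (P : pred I) (F : I -> T -> R[i]) :
 (forall i, P i -> mble (F i)) ->
 mble (fun w => \prod_(i <- s | P i) F i w).
Proof.
move=> mF; elim: s => [|i s ih]; first by under eq_fun do rewrite big_nil; exact: measurable_cst.
have [Pi|Pi] := boolP (P i); last by under eq_fun do rewrite big_cons (negbTE Pi).
under eq_fun do rewrite big_cons Pi.
by apply: meas_mulC => //; exact: mF.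
Qed.

End complex_measurability.

(** * Measurability of random matrices *)

Section measurable_matrices.
Context {R : realType} {d} {T : measurableType d}.

Definition meas_mx m n (A : T -> 'M[R[i]]_(m, n)) :=
 forall i j, mble (fun w => A w i j).

Lemma meas_mx_cst m n (A : 'M[R[i]]_(m, n)) : meas_mx (fun=> A).
Proof. by move=> i j; exact: measurable_cst. Qed.

Lemma meas_mxD m n (A B : T -> 'M[R[i]]_(m, n)) :
 meas_mx A -> meas_mx B -> meas_mx (fun w => A w + B w).
Proof. by move=> mA mB i j; under eq_fun do rewrite mxE; exact: meas_addC. Qed.

Lemma meas_mxN m n (A : T -> 'M[R[i]]_(m, n)) :
 meas_mx A -> meas_mx (fun w => - A w).
Proof. by move=> mA i j; under eq_fun do rewrite mxE; exact: meas_oppC. Qed.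

Lemma meas_mxM m n p (A : T -> 'M[R[i]]_(m, n)) (B : T -> 'M[R[i]]_(n, p)) :
 meas_mx A -> meas_mx B -> meas_mx (fun w => A w *m B w).
Proof.
move=> mA mB i j; under eq_fun do rewrite mxE.
by apply: meas_sumC => k _; exact: meas_mulC.
Qed.

Lemma meas_mxZ m n (c : T -> R[i]) (A : T -> 'M[R[i]]_(m, n)) :
 mble c -> meas_mx A -> meas_mx (fun w => c w *: A w).
Proof. by move=> mc mA i j; under eq_fun do rewrite mxE; exact: meas_mulC. Qed.

Lemma meas_mxadj m n (A : T -> 'M[R[i]]_(m, n)) :
 meas_mx A -> meas_mx (fun w => (A w)^t*).
Proof. by move=> mA i j; under eq_fun do rewrite !mxE; exact: meas_conjC. Qed.

Lemma meas_det n (A : T -> 'M[R[i]]_n) : meas_mx A ->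
 mble (fun w => \det (A w)).
Proof.
move=> mA; apply: meas_sumC => s _; apply: meas_mulC => //.
by apply: meas_prodC => i _; exact: mA.
Qed.

Lemma meas_invmx n (A : T -> 'M[R[i]]_n) : meas_mx A ->
 (forall w, A w \in unitmx) -> meas_mx (fun w => invmx (A w)).
Proof.
move=> mA uA i j; rewrite (_ : (fun w => _) = fun w =>
 (\det (A w))^-1 * cofactor (A w) j i); last first.
 by apply/funext => w; rewrite /invmx uA !mxE.
apply: meas_mulC; first exact/meas_invC/meas_det.
apply: meas_mulC => //; apply: meas_det => k l.
by under eq_fun do rewrite !mxE; exact: mA.
Qed.

End measurable_matrices.

(** * Families of complex numbers with the product sigma-algebra *)

Section arrays.
Context {R : realType} {I : Type}.

(** The index type is arbitrary, so that rows, columns, corners and pairs of matrices are all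
    covered by the same independence statements. *)
Definition arr := I -> R[i].

Definition cylinder : set (set arr) :=
 [set A | exists i (B : set R[i]), measurable B /\ A = (fun f => f i) @^-1` B].

HB.instance Definition _ := Pointed.copy arr (I -> R[i]).
HB.instance Definition _ := Measurable.copy arr (g_sigma_algebraType cylinder).

Lemma meas_coord i : measurable_fun [set: arr] (fun f => f i).
Proof. by move=> _ B mB; rewrite setTI; apply: sub_sigma_algebra; exists i, B. Qed.

Lemma meas_arrP {d} {T : measurableType d} (g : T -> arr) :
 mble g <-> forall i, mble (fun w => g w i).
Proof.
split=> [mg i|mg]; first exact: mcomp (meas_coord i) mg.
apply: (measurability cylinder) => // _ [A [i [B [mB ->]]] <-].
by rewrite setTI -[X in measurable X]setTI; exact: (mg i).
Qed.

Definition mix (J : pred I) (f g : arr) : arr := fun i => if J i then f i else g i.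

Lemma meas_mix {d} {T : measurableType d} J (f g : T -> arr) :
 mble f -> mble g ->
 mble (fun w => mix J (f w) (g w)).
Proof.
move=> /meas_arrP mf /meas_arrP mg; apply/meas_arrP => i.
by rewrite /mix; case: (J i).
Qed.

End arrays.
Arguments arr R I : clear implicits.
#[global] Hint Extern 0 (measurable_fun _ (fun f : arr _ _ => f _)) =>
 solve [exact: meas_coord] : core.

(** * Independence as invariance under resampling *)

Section independence.
Context {R : realType} {d} {T : measurableType d} (P : probability T R).

(* Invariance of the law under replacing any set of coordinates by those of an
  independent copy; it is what is used of the independence of the coordinates. *)
Definition indep {I} (X : T -> arr R I) : Prop :=
 forall (J : pred I) (A : set (arr R I)), measurable A ->
  (P \x P)%E [set p | A (mix J (X p.1) (X p.2))] = P (X @^-1` A).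

(** Fubini form of independence: the inner integral is the conditional expectation given the
    coordinates outside [J]. *)
Lemma indep_integral {I} (X : T -> arr R I) (J : pred I) (g : arr R I -> \bar R) :
 mble X -> indep X -> mble g ->
 (forall f, 0 <= g f)%E ->
 (\int[P]_w g (X w) = \int[P]_v \int[P]_w g (mix J (X w) (X v)))%E.
Proof.
move=> mX iX mg g0.
pose phi (p : T * T) := mix J (X p.1) (X p.2).
have mphi : mble phi.
 by apply: meas_mix; apply: mcomp.
rewrite -(ge0_integral_pushforward mX P measurableT mg) ?preimage_setT//.
transitivity (\int[pushforward (P \x P)%E phi]_f g f)%E.
 by apply: eq_measure_integral => A mA _; exact: esym (iX J A mA).
rewrite ge0_integral_pushforward//= preimage_setT.
rewrite (fubini_tonelli2 (fun p => g (phi p)))//.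
exact: mcomp.
Qed.

(** The condition on [phi] says that each output coordinate reads a group of input coordinates of
    its own, as for reindexing, translation by constants and merging of columns. *)
Lemma indep_comp {I I'} (X : T -> arr R I) (phi : arr R I -> arr R I') :
 (forall (J' : pred I'), exists J : pred I, forall f g,
   mix J' (phi f) (phi g) = phi (mix J f g)) ->
 mble phi -> indep X -> indep (phi \o X).
Proof.
move=> h mphi iX J' A mA; have [J hJ] := h J'.
rewrite comp_preimage -(iX J); last by rewrite -[X in measurable X]setTI; exact: mphi.
by congr ((P \x P)%E _); apply/seteqP; split => p /=; rewrite hJ.
Qed.

End independence.

Section independence_facts.
Context {R : realType} {d} {T : measurableType d} (P : probability T R).

(** After resampling, the two factors depend on different draws and the double integral splits. *)
Lemma indep_split {I} (X : T -> arr R I) (J : pred I) (g h : arr R I -> R) :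
 mble X -> indep P X ->
 mble g -> mble h ->
 (forall f, 0 <= g f) -> (forall f, 0 <= h f) ->
 (forall f f', g (mix J f f') = g f) -> (forall f f', h (mix J f f') = h f') ->
 (\int[P]_w (g (X w) * h (X w))%:E =
  \int[P]_w (g (X w))%:E * \int[P]_w (h (X w))%:E)%E.
Proof.
move=> mX iX mg mh g0 h0 gJ hJ.
have mgX : mble (g \o X) by exact: mcomp.
have mhX : mble (h \o X) by exact: mcomp.
rewrite (indep_integral J (g := fun f => (g f * h f)%:E) mX iX) => [||f]; last first.
- by rewrite lee_fin mulr_ge0.
- by apply/mble_EFinP; exact: mbleM.
under eq_integral => v _.
 under eq_integral => w _ do rewrite gJ hJ EFinM.
 rewrite ge0_integralZr//; [|by apply/mble_EFinP|by move=> w _; rewrite lee_fin|by rewrite lee_fin].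
 over.
rewrite ge0_integralZl//; first by apply/mble_EFinP.
- by move=> w _; rewrite lee_fin.
- by apply: integral_ge0 => w _; rewrite lee_fin.
Qed.

Lemma indep_integral_prod {I : eqType} (X : T -> arr R I) (s : seq I)
  (phi : I -> R[i] -> R) :
 mble X -> indep P X -> uniq s ->
 (forall i, mble (phi i)) -> (forall i z, 0 <= phi i z) ->
 (\int[P]_w (\prod_(i <- s) phi i (X w i))%:E =
  \prod_(i <- s) \int[P]_w (phi i (X w i))%:E)%E.
Proof.
move=> mX iX + mphi phi0; elim: s => [|j s ih] /= us.
 under eq_integral do rewrite big_nil.
 rewrite big_nil integral_cst//.
 by rewrite mul1e; exact: probability_setT.
move: us => /andP[js us]; rewrite big_cons -ih//.
under eq_integral do rewrite big_cons.
have mc i : mble (fun f : arr R I => phi i (f i)).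
 by apply: mcomp => //; exact: meas_coord.
rewrite (@indep_split _ X (pred1 j) (fun f => phi j (f j))
 (fun f => \prod_(i <- s) phi i (f i)))//.
- by apply: measurable_prod => i _.
- by move=> f; apply: prodr_ge0 => i _.
- by move=> f f'; rewrite /mix /= eqxx.
- move=> f f'; apply: eq_big_seq => i si; rewrite /mix /=.
 by case: eqP => // ij; move: js; rewrite -ij si.
Qed.

(** Boxes over finitely many coordinates generate the sigma-algebra and are stable under
    intersection. On a box the law of the mixture is the product of the factors inside and outside
    [J], which is also the original probability. *)
Lemma mutually_independent_indep {I : choiceType} (X : I -> {RV P >-> R[i]}) :
 mutually_independent X -> indep P (fun w i => X i w).
Proof.
move=> miX J.
pose xi w : arr R I := fun i => X i w.
have mxi : mble xi by apply/meas_arrP => i; exact: measurable_funPT.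
pose phi (p : T * T) := mix J (xi p.1) (xi p.2).
have mphi : mble phi by apply: meas_mix; apply: mcomp.
pose box (s : seq I) (B : I -> set R[i]) : set (arr R I) :=
 [set f | forall i, i \in s -> B i (f i)].
pose G : set (set (arr R I)) :=
 [set A | exists s B, [/\ uniq s, forall i, measurable (B i) & A = box s B]].
have GT : G [set: arr R I].
 by exists [::], (fun=> setT); split => //; apply/seteqP; split.
have GI : setI_closed G.
 move=> _ _ [s [B [us mB ->]]] [s' [B' [us' mB' ->]]].
 exists (undup (s ++ s')), (fun i => (if i \in s then B i else setT) `&`
   (if i \in s' then B' i else setT)); split; first exact: undup_uniq.
  by move=> i; apply: measurableI; case: ifP.
 apply/seteqP; split => f.
  move=> [h h'] i _; split; case: ifPn => // si; [exact: h|exact: h'].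
 move=> h; split => i si; have := h i; rewrite mem_undup mem_cat si ?orbT => /(_ isT).
  by case=> [].
 by case=> [].
have boxE (s : seq I) B : box s B = \bigcap_(i in [set` s]) ((fun f => f i) @^-1` B i).
 by apply/seteqP; split.
have mbox s B : (forall i, measurable (B i)) -> measurable (box s B).
 move=> mB; rewrite boxE; apply: fin_bigcap_measurable => // i _.
 by rewrite -[X in measurable X]setTI; exact: meas_coord.
have PE s B : uniq s -> (forall i, measurable (B i)) ->
  P (xi @^-1` box s B) = (\prod_(i <- s) P (X i @^-1` B i))%E.
 by move=> us mB; rewrite -miX// boxE preimage_bigcap.
apply: (measure_unique G (fun=> setT) _ GI (fun=> GT) _
 (pushforward (P \x P)%E phi) (pushforward P xi)).
- apply/seteqP; split.
  apply: smallest_sub; first exact: smallest_sigma_algebra.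
  move=> _ [i [B [mB ->]]]; apply: sub_sigma_algebra.
  exists [:: i], (fun=> B); split => //; apply/seteqP; split => f /=.
   by move=> fB j; rewrite inE => /eqP ->.
  by move=> /(_ i); rewrite inE eqxx; exact.
 apply: smallest_sub; first exact: sigma_algebra_measurable.
 by move=> _ [s [B [us mB ->]]]; exact: mbox.
- by rewrite bigcup_const//; exists 0.
- move=> _ [s [B [us mB ->]]].
 rewrite -[RHS]/(P (xi @^-1` box s B)) PE//.
 rewrite -[LHS]/((P \x P)%E (phi @^-1` box s B)).
 rewrite (_ : phi @^-1` _ = (xi @^-1` box [seq i <- s | J i] B) `*`
   (xi @^-1` box [seq i <- s | ~~ J i] B)); last first.
  apply/seteqP; split => [[w v] /= h|[w v] /= [h h'] i si].
   split=> i /=; rewrite mem_filter /= => /andP[Ji si]; have := h i si;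
    by rewrite /phi /mix /= ?Ji ?(negbTE Ji).
  rewrite /phi /mix /=; case: ifPn => Ji; [apply: h|apply: h'];
   by rewrite mem_filter /= Ji.
 transitivity (P (xi @^-1` box [seq i <- s | J i] B) *
        P (xi @^-1` box [seq i <- s | ~~ J i] B))%E.
  by apply: product_measure1E; (rewrite -[X in measurable X]setTI; apply: mxi => //; exact: mbox).
 by rewrite !PE ?filter_uniq// !big_filter [RHS](bigID J).
- move=> k; apply: (@le_lt_trans _ _ 1%E); last exact: ltry.
 have := @probability_le1 _ _ _ (P \x P)%E setT measurableT.
 exact.
Qed.

End independence_facts.

Section adjoint.
Context {R : realType}.

Lemma adjM m n p (A : 'M[R[i]]_(m, n)) (B : 'M[R[i]]_(n, p)) :
 (A *m B)^t* = B^t* *m A^t*.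
Proof. by rewrite trmx_mul map_mxM. Qed.

Lemma adjK m n (A : 'M[R[i]]_(m, n)) : (A^t*)^t* = A.
Proof. by apply/matrixP => i j; rewrite !mxE conjCK. Qed.

End adjoint.

Section conjugation.
Context {R : realType}.
Implicit Types z : R[i].

Definition cj z : R[i] := conjc z.

Lemma cjM z1 z2 : cj (z1 * z2) = cj z1 * cj z2. Proof. exact: rmorphM. Qed.
Lemma cjD z1 z2 : cj (z1 + z2) = cj z1 + cj z2. Proof. exact: rmorphD. Qed.
Lemma cjN z : cj (- z) = - cj z. Proof. exact: rmorphN. Qed.
Lemma cj_sum (I : Type) (s : seq I) (P : pred I) (F : I -> R[i]) :
 cj (\sum_(i <- s | P i) F i) = \sum_(i <- s | P i) cj (F i).
Proof. exact: rmorph_sum. Qed.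
Lemma cjK z : cj (cj z) = z. Proof. exact: conjcK. Qed.
Lemma cj_real (x : R) : cj x%:C = x%:C. Proof. exact: conjc_real. Qed.
Lemma cj0 : cj 0 = 0. Proof. exact: conjc0. Qed.
Lemma cj1 : cj 1 = 1. Proof. exact: conjc1. Qed.
Lemma Re_cj z : Re (cj z) = Re z. Proof. exact: ReJ. Qed.
Lemma adjE m n (A : 'M[R[i]]_(m, n)) i j : (A^t*) i j = cj (A j i).
Proof. by rewrite !mxE. Qed.

End conjugation.

(** * Hermitian inner product of row vectors *)

Section inner_product.
Context {R : realType} {n : nat}.
Local Notation C := R[i].
Implicit Types (u v w h : 'rV[C]_n) (A B : 'M[C]_n) (a : C).

Definition dot u v : C := (u *m v^t*) 0 0.
Definition sqn v : R := \sum_j sqnorm (v 0 j).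

Lemma dotE u v : dot u v = \sum_j u 0 j * cj (v 0 j).
Proof. by rewrite /dot mxE; apply: eq_bigr => j _; rewrite adjE. Qed.

Lemma mulJ_sqnorm (z : C) : z * cj z = (sqnorm z)%:C.
Proof. by case: z => a b; rewrite /cj /sqnorm /=; simpc; congr Complex; ring. Qed.

Lemma sqnormM (z1 z2 : C) : sqnorm (z1 * z2) = sqnorm z1 * sqnorm z2.
Proof. by case: z1 z2 => [a b] [c e]; rewrite /sqnorm /=; ring. Qed.

Lemma sqnormJ (z : C) : sqnorm (cj z) = sqnorm z.
Proof. by case: z => [a b]; rewrite /sqnorm /= sqrrN. Qed.

Lemma sqnormN (z : C) : sqnorm (- z) = sqnorm z.
Proof. by case: z => [a b]; rewrite /sqnorm /= !sqrrN. Qed.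

Lemma sqnorm_eq0 (z : C) : (sqnorm z == 0) = (z == 0).
Proof. by case: z => a b; rewrite /sqnorm paddr_eq0 ?sqr_ge0// !sqrf_eq0 eq_complex. Qed.

Lemma sqnorm_real (x : R) : sqnorm x%:C = x ^+ 2.
Proof. by rewrite /sqnorm /= expr0n addr0. Qed.

Lemma sqnorm0 : sqnorm (0 : C) = 0.
Proof. by rewrite -[0]/(0%:C) sqnorm_real expr0n. Qed.

Lemma sqnormV (z : C) : sqnorm z^-1 = (sqnorm z)^-1.
Proof.
have [->|z0] := eqVneq z 0; first by rewrite invr0 -[0]/(0%:C) sqnorm_real expr0n invr0.
have s0 : sqnorm z != 0 by rewrite sqnorm_eq0.
by apply: (mulfI s0); rewrite -sqnormM !divff// -[1]/(1%:C) sqnorm_real expr1n.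
Qed.

Lemma sqn_ge0 v : 0 <= sqn v.
Proof. by apply: sumr_ge0 => j _; exact: sqnorm_ge0. Qed.

Lemma sqnorm_le_sqn v j : sqnorm (v 0 j) <= sqn v.
Proof.
by rewrite /sqn (bigD1 j)//= lerDl; apply: sumr_ge0 => k _; exact: sqnorm_ge0.
Qed.

Lemma dotvv v : dot v v = (sqn v)%:C.
Proof.
rewrite dotE /sqn (eq_bigr (fun j => (sqnorm (v 0 j))%:C)) => [|j _]; last exact: mulJ_sqnorm.
by rewrite -(rmorph_sum (real_complex R)).
Qed.

Lemma sqn_eq0 v : (sqn v == 0) = (v == 0).
Proof.
apply/idP/eqP => [/eqP s0|->]; last first.
 by rewrite /sqn big1// => j _; rewrite mxE -[0]/(0%:C) sqnorm_real expr0n.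
apply/rowP => j; rewrite mxE; apply/eqP; rewrite -sqnorm_eq0 -(inj_eq (@complexI R)).
by rewrite eq_le ler0c sqnorm_ge0 andbT lecR -s0 sqnorm_le_sqn.
Qed.

Lemma dotC u v : dot v u = cj (dot u v).
Proof. by rewrite !dotE cj_sum; apply: eq_bigr => j _; rewrite cjM cjK mulrC. Qed.

Lemma dotDl u v w : dot (u + v) w = dot u w + dot v w.
Proof. by rewrite /dot mulmxDl mxE. Qed.
Lemma dotNl u w : dot (- u) w = - dot u w.
Proof. by rewrite /dot mulNmx mxE. Qed.
Lemma dotBl u v w : dot (u - v) w = dot u w - dot v w.
Proof. by rewrite dotDl dotNl. Qed.
Lemma dotZl a u w : dot (a *: u) w = a * dot u w.
Proof. by rewrite /dot -scalemxAl mxE. Qed.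
Lemma dot0l w : dot 0 w = 0.
Proof. by rewrite /dot mul0mx mxE. Qed.
Lemma dotDr u v w : dot w (u + v) = dot w u + dot w v.
Proof. by rewrite dotC dotDl cjD -!dotC. Qed.
Lemma dotNr u w : dot w (- u) = - dot w u.
Proof. by rewrite dotC dotNl cjN -!dotC. Qed.
Lemma dotBr u v w : dot w (u - v) = dot w u - dot w v.
Proof. by rewrite dotDr dotNr. Qed.
Lemma dotZr a u w : dot w (a *: u) = cj a * dot w u.
Proof. by rewrite dotC dotZl cjM -dotC. Qed.
Lemma dot0r w : dot w 0 = 0.
Proof. by rewrite dotC dot0l cj0. Qed.

Lemma dot_mulmx u v A : dot (u *m A) v = dot u (v *m A^t*).
Proof.
by rewrite /dot -mulmxA adjM adjK.
Qed.

Lemma sqnZ a v : sqn (a *: v) = sqnorm a * sqn v.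
Proof. by rewrite /sqn mulr_sumr; apply: eq_bigr => j _; rewrite mxE sqnormM. Qed.

Lemma Re_dotC u v : Re (dot v u) = Re (dot u v).
Proof. by rewrite dotC Re_cj. Qed.

Lemma sqnE v : sqn v = Re (dot v v).
Proof. by rewrite dotvv. Qed.

Lemma sqnD u v : sqn (u + v) = sqn u + 2 * Re (dot u v) + sqn v.
Proof. by rewrite !sqnE dotDl !dotDr !ReD (Re_dotC v u); ring. Qed.

Lemma sqnB u v : sqn (u - v) = sqn u - 2 * Re (dot u v) + sqn v.
Proof. by rewrite !sqnE dotBl !dotBr !ReB (Re_dotC v u); ring. Qed.

Lemma sqnN u : sqn (- u) = sqn u.
Proof. by apply: eq_bigr => j _; rewrite mxE sqnormN. Qed.

Lemma sqnD_le u v : sqn (u + v) <= 2 * sqn u + 2 * sqn v.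
Proof. by have := sqn_ge0 (u - v); rewrite sqnB sqnD; lra. Qed.

Lemma Re_dot_le u v : 2 * Re (dot u v) <= sqn u + sqn v.
Proof. by have := sqn_ge0 (u - v); rewrite sqnB; lra. Qed.

Lemma cauchy_schwarz u v : sqnorm (dot u v) <= sqn u * sqn v.
Proof.
have [->|v0] := eqVneq v 0.
 by rewrite dot0r -[0]/(0%:C) sqnorm_real expr0n mulr_ge0 ?sqn_ge0.
have sv : 0 < sqn v by rewrite lt_def sqn_ge0 sqn_eq0 v0.
have := sqn_ge0 ((sqn v)%:C *: u - dot u v *: v).
rewrite sqnB !sqnZ sqnorm_real dotZl dotZr (mulrC (cj (dot u v))) mulJ_sqnorm.
rewrite -rmorphM /= => h.
have : 0 <= sqn v * (sqn u * sqn v - sqnorm (dot u v)) by nra.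
by rewrite pmulr_rge0// subr_ge0.
Qed.

End inner_product.

(** * Regularized projections and Gram determinants *)

Section weighted_projection.
Context {R : realType} {n : nat}.
Local Notation C := R[i].
Implicit Types (u v w h : 'rV[C]_n) (A B Q : 'M[C]_n) (e : R)
 (s : seq (R * 'rV[C]_n)).

(* One rank-one step of the inversion of [e + sum h^* h], normalized so that a
  zero weight [e] yields orthogonal projections (with [0^-1 = 0] when the new
  row is in the span of the previous ones). *)
Definition upd e h Q : 'M[C]_n :=
 Q - ((e + Re (dot (h *m Q) h))^-1)%:C *: (Q *m h^t* *m (h *m Q)).

Fixpoint Qm s : 'M[C]_n := if s is x :: s' then upd x.1 x.2 (Qm s') else 1%:M.

Definition gain s e h : R := e + Re (dot (h *m Qm s) h).

(** For positive weights this is the determinant of [H H^*] plus the diagonal matrix of the weights,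
    [H] having the rows of [s], computed by Schur complements; with zero weights it is the Gram
    determinant of the rows. *)
Fixpoint Wm s : R := if s is x :: s' then gain s' x.1 x.2 * Wm s' else 1.

Definition wge0 s := all (fun x => 0 <= x.1) s.

Lemma mul_row_outer v u w : v *m (u^t* *m w) = dot v u *: w.
Proof. by rewrite mulmxA [v *m _]mx11_scalar mul_scalar_mx. Qed.

Lemma mulmx_upd e h Q v : v *m upd e h Q =
 (v - (((e + Re (dot (h *m Q) h))^-1)%:C * dot (v *m Q) h) *: h) *m Q.
Proof.
rewrite /upd mulmxBr mulmxBl -!scalemxAl -scalemxAr; congr (_ - _).
have -> : v *m (Q *m h^t* *m (h *m Q)) = dot (v *m Q) h *: (h *m Q).
 by rewrite -mul_row_outer !mulmxA.
by rewrite scalerA.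
Qed.

Lemma Qm_herm s : (Qm s)^t* = Qm s.
Proof.
elim: s => [|[e h] s ih] /=.
 by apply/matrixP => i j; rewrite !mxE eq_sym rmorph_nat.
rewrite /upd linearB /= map_mxB /= ih; congr (_ - _).
rewrite linearZ /= map_mxZ /= !adjM adjK ih mulmxA; congr (_ *: _).
exact: conjc_real.
Qed.

Lemma dot_Qm s u v : dot (u *m Qm s) v = dot u (v *m Qm s).
Proof. by rewrite dot_mulmx Qm_herm. Qed.

Lemma dot_Qm_real s v : dot (v *m Qm s) v = (Re (dot (v *m Qm s) v))%:C.
Proof.
have : dot (v *m Qm s) v = cj (dot (v *m Qm s) v) by rewrite -dotC dot_Qm.
by case: (dot _ _) => a b [] /= /eqP; rewrite -addr_eq0 -mulr2n mulrn_eq0 /= => /eqP ->.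
Qed.

(** Read as [Q ^ 2 <= Q] for the Hermitian matrix [Q = Qm s]: its spectrum lies in the unit
    interval. The positivity and contraction bounds below come from this single inequality, which
    survives a rank-one update. *)
Lemma sqn_Qm_le s v : wge0 s -> sqn (v *m Qm s) <= Re (dot (v *m Qm s) v).
Proof.
elim: s v => [|[e h] s ih] v /=; first by rewrite mulmx1 -sqnE.
move=> /andP[/= e0 s0]; rewrite mulmx_upd.
set q := Re (dot (h *m Qm s) h); set c := (_ + _)^-1; set b := dot (v *m Qm s) h.
have q0 : 0 <= q by apply: le_trans (ih h s0); exact: sqn_ge0.
have c0 : 0 <= c by rewrite invr_ge0 addr_ge0.
have cq : 0 <= 1 - c * q.
 rewrite subr_ge0 /c; have [->|ne] := eqVneq (e + q) 0; first by rewrite invr0 mul0r.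
 by rewrite ler_pdivrMl ?mulr1 ?lerDr// lt_def ne addr_ge0.
apply: (le_trans (ih _ s0)).
(* For [w = v - c b h] both sides differ by [c (1 - c q) |b| ^ 2]; [c q <= 1] holds also when
   [e + q = 0], the inverse being [0] then. *)
rewrite -[X in Re (dot _ X) <= _](subrK ((c%:C * b) *: h)).
set w := v - _; rewrite -[w + _]/(w + _).
rewrite [X in _ <= Re X](_ : _ = dot (w *m Qm s) w + dot (w *m Qm s) ((c%:C * b) *: h)); last first.
 by rewrite -dotDr /w subrK.
rewrite subrK ReD lerDl dotZr.
have -> : dot (w *m Qm s) h = b * (1 - c * q)%:C.
 rewrite /w mulmxBl dotBl -scalemxAl dotZl -/b [dot (h *m _) h]dot_Qm_real -/q.
 by rewrite rmorphB rmorph1 rmorphM /=; ring.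
rewrite cjM cj_real [X in Re X](_ : _ = (c * (1 - c * q))%:C * (b * cj b)); last first.
 by rewrite rmorphM /=; ring.
by rewrite mulJ_sqnorm -rmorphM /= !mulr_ge0 ?sqnorm_ge0.
Qed.

Lemma dot_Qm_ge0 s v : wge0 s -> 0 <= Re (dot (v *m Qm s) v).
Proof. by move=> s0; apply: le_trans (sqn_Qm_le v s0); exact: sqn_ge0. Qed.

Lemma gain_ge0 s e h : 0 <= e -> wge0 s -> 0 <= gain s e h.
Proof. by move=> e0 s0; rewrite addr_ge0 ?dot_Qm_ge0. Qed.

Lemma Wm_ge0 s : wge0 s -> 0 <= Wm s.
Proof.
elim: s => //= x s ih /andP[x0 s0]; rewrite mulr_ge0 ?gain_ge0 ?ih//.
Qed.

Lemma dot_Qm_le s v : wge0 s -> Re (dot (v *m Qm s) v) <= sqn v.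
Proof.
move=> s0; have := sqn_Qm_le v s0; have := Re_dot_le (v *m Qm s) v.
lra.
Qed.

Lemma mulmx_Qm_orth s v : (forall x, x \in s -> dot v x.2 = 0) -> v *m Qm s = v.
Proof.
elim: s => [|[e h] s ih] /= vs; first by rewrite mulmx1.
have vQ : v *m Qm s = v by apply: ih => x xs; apply: vs; rewrite inE xs orbT.
rewrite mulmx_upd vQ (vs (e, h)) ?inE ?eqxx// mulr0 scale0r subr0 vQ//.
Qed.

(** The orthogonal projection onto the orthogonal complement of the span of [r], so that [dist2]
    below is the squared distance to that span. *)
Definition proj (r : seq 'rV[C]_n) : 'M[C]_n := Qm [seq (0, h) | h <- r].

Lemma wge0_map0 (r : seq 'rV[C]_n) : wge0 [seq (0, h) | h <- r].
Proof. by rewrite /wge0 all_map; apply/allP => h _ /=. Qed.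

Lemma mulmx_proj0 r h : h \in r -> h *m proj r = 0.
Proof.
elim: r => // g r ih; rewrite inE /proj /= mulmx_upd add0r.
have := sqn_Qm_le g (wge0_map0 r); rewrite -/(proj r).
set q := Re _ => gq; have [->|hg] := eqVneq h g; last first.
 move=> /= /ih h0; rewrite h0 dot0l mulr0 scale0r subr0; exact: h0.
move=> _; have [q0|q0] := eqVneq q 0.
 have /eqP : sqn (g *m proj r) = 0 by apply/eqP; rewrite eq_le sqn_ge0 andbT -q0.
 by rewrite sqn_eq0 q0 invr0 mul0r scale0r subr0 => /eqP.
rewrite (dot_Qm_real [seq (0, h) | h <- r]) -/(proj r) -/q -rmorphM /= mulVf//.
by rewrite scale1r subrr mul0mx.
Qed.

Lemma dot_proj0 r v h : h \in r -> dot (v *m proj r) h = 0.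
Proof. by move=> hr; rewrite dot_Qm mulmx_proj0// dot0r. Qed.

Lemma mulmx_proj_orth r v : (forall h, h \in r -> dot v h = 0) -> v *m proj r = v.
Proof. by move=> vr; apply: mulmx_Qm_orth => x /mapP[h hr ->]; exact: vr. Qed.

Lemma mulmx_projK r v : v *m proj r *m proj r = v *m proj r.
Proof. by apply: mulmx_proj_orth => h; exact: dot_proj0. Qed.

Definition dist2 r h : R := sqn (h *m proj r).

Lemma dist2_ge0 r h : 0 <= dist2 r h. Proof. exact: sqn_ge0. Qed.

Lemma dist2E r h : dist2 r h = Re (dot (h *m proj r) h).
Proof. by rewrite /dist2 sqnE -dot_Qm mulmx_projK. Qed.

Lemma dist2_le_orth r v h : (forall g, g \in r -> dot v g = 0) ->
 sqnorm (dot h v) <= sqn v * dist2 r h.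
Proof.
move=> vr; rewrite -(mulmx_proj_orth vr) -dot_Qm mulmx_proj_orth// mulrC.
exact: cauchy_schwarz.
Qed.

Lemma dist2_subset r r' h : {subset r <= r'} -> dist2 r' h <= dist2 r h.
Proof.
move=> rr'; have := Re_dot_le (h *m proj r') (h *m proj r).
rewrite -dot_Qm (mulmx_proj_orth (v := h *m proj r')) => [|g /rr' gr']; last exact: dot_proj0.
by rewrite -/(dist2 r h) -[Re (dot _ h)]dist2E -/(dist2 r' h); lra.
Qed.

(** [Qm s] fixes every vector orthogonal to the rows of [s]. Splitting [h] into its projection and
    the rest, the cross terms vanish and the rest contributes a nonnegative amount. *)
Lemma dist2_le_gain s e h : wge0 s -> e + dist2 (unzip2 s) h <= gain s e h.
Proof.
move=> s0; rewrite /gain lerD2l /dist2; set P := proj _.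
set u := h *m P; have uQ : u *m Qm s = u.
 by apply: mulmx_Qm_orth => x xs; apply: dot_proj0; apply/mapP; exists x.
pose t := h - u; have ut : dot u t = 0.
 by rewrite /t dotBr {2}/u -[dot u (_ *m _)]dot_Qm mulmx_proj_orth ?subrr// => g; exact: dot_proj0.
have hE : h = t + u by rewrite /t subrK.
clearbody t; rewrite hE mulmxDl uQ dotDl !dotDr ut (dot_Qm _ t u) uQ (dotC u t) ut cj0.
by rewrite addr0 add0r ReD -sqnE lerDr dot_Qm_ge0.
Qed.

(** A rank-one update lowers the trace by [sqn (h *m Qm s) / (e + q)], which [sqn_Qm_le] bounds by
    [1]. *)
Lemma Re_trace_Qm s : wge0 s -> n%:R - (size s)%:R <= Re (\tr (Qm s)).
Proof.
elim: s => [|[e h] s ih] /=; first by rewrite mxtrace1 subr0 -(rmorph_nat (real_complex R)).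
move=> /andP[/= e0 s0]; rewrite /upd raddfB /= ReB linearZ /=.
rewrite mxtrace_mulC.
have -> : \tr (h *m Qm s *m (Qm s *m h^t*)) = (sqn (h *m Qm s))%:C.
 by rewrite mulmxA trace_mx11 -[(_ *m _) 0 0]/(dot _ _) dot_Qm dotvv.
rewrite -rmorphM /=; have := sqn_Qm_le h s0; set q := Re _ => hq.
suff : (e + q)^-1 * sqn (h *m Qm s) <= 1 by have := ih s0; rewrite -natr1; lra.
have [->|ne] := eqVneq (e + q) 0; first by rewrite invr0 mul0r.
have q0 : 0 <= q by exact: dot_Qm_ge0.
have eq0 : 0 < e + q by rewrite lt_def ne addr_ge0.
by rewrite ler_pdivrMl// mulr1; lra.
Qed.

Lemma Qm_diag s i : Qm s i i = (Re (Qm s i i))%:C.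
Proof.
have h : Qm s i i = dot (delta_mx 0 i *m Qm s) (delta_mx 0 i).
 rewrite dotE (bigD1 i)//= big1 => [|j ji]; first by rewrite -rowE !mxE !eqxx cj1 mulr1 addr0.
 by rewrite [delta_mx _ _ _ j]mxE (negbTE ji) andbF cj0 mulr0.
by rewrite h -dot_Qm_real.
Qed.

Lemma sqn_row_Qm s i : wge0 s -> \sum_j sqnorm (Qm s i j) <= Re (Qm s i i).
Proof.
move=> s0; have := sqn_Qm_le (delta_mx 0 i) s0; rewrite -rowE.
rewrite dotE (bigD1 i)//= big1 => [|j ji]; last first.
 by rewrite [delta_mx _ _ _ j]mxE (negbTE ji) andbF cj0 mulr0.
rewrite !mxE !eqxx cj1 mulr1 addr0; apply: le_trans.
by rewrite /sqn; under [leRHS]eq_bigr do rewrite mxE.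
Qed.

Lemma Qm_diag_ge0 s i : wge0 s -> 0 <= Re (Qm s i i).
Proof. by move=> s0; apply: le_trans (sqn_row_Qm i s0); apply: sumr_ge0 => j _; exact: sqnorm_ge0. Qed.

Lemma Qm_diag_le1 s i : wge0 s -> Re (Qm s i i) <= 1.
Proof.
move=> s0; have := sqn_row_Qm i s0; rewrite (bigD1 i)//= => h.
have : sqnorm (Qm s i i) <= Re (Qm s i i).
 by apply: le_trans h; rewrite lerDl; apply: sumr_ge0 => j _; exact: sqnorm_ge0.
by rewrite Qm_diag sqnorm_real /=; have := Qm_diag_ge0 i s0; nra.
Qed.

End weighted_projection.

(** * Independence of the order of the rows *)

Section permutation_invariance.
Context {R : realType} {n : nat}.
Local Notation C := R[i].
Implicit Types (u v w h : 'rV[C]_n) (e : R) (x y : R * 'rV[C]_n)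
 (s t : seq (R * 'rV[C]_n)).

Lemma Wm_cons x s : Wm (x :: s) = gain s x.1 x.2 * Wm s. Proof. by []. Qed.

Lemma gain_cons x y s : gain (y :: s) x.1 x.2 =
 gain s x.1 x.2 - (gain s y.1 y.2)^-1 * sqnorm (dot (x.2 *m Qm s) y.2).
Proof.
case: x y => [e1 h1] [e2 h2] /=; rewrite /gain /= mulmx_upd mulmxBl dotBl -scalemxAl dotZl.
set c := (_ + _)^-1; rewrite (dot_Qm _ h2 h1) (dotC (h1 *m _) h2) ReB addrA; congr (_ - _).
by rewrite -mulrA mulJ_sqnorm -rmorphM.
Qed.

Lemma dot_Qm_eq0 s h1 h2 : wge0 s -> Re (dot (h2 *m Qm s) h2) = 0 ->
 dot (h1 *m Qm s) h2 = 0.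
Proof.
move=> s0 q0; have := sqn_Qm_le h2 s0; rewrite q0 => h.
have /eqP : sqn (h2 *m Qm s) = 0 by apply/eqP; rewrite eq_le sqn_ge0 andbT.
by rewrite sqn_eq0 dot_Qm => /eqP ->; rewrite dot0r.
Qed.

Lemma gain_eq0_dot s x h : 0 <= x.1 -> wge0 s -> gain s x.1 x.2 = 0 ->
 dot (h *m Qm s) x.2 = 0.
Proof.
move=> x0 s0 g0; apply: dot_Qm_eq0 => //; have := dot_Qm_ge0 x.2 s0.
by move: g0; rewrite /gain; lra.
Qed.

(** A two by two determinant, symmetric in the rows up to conjugating the off-diagonal entry. If the
    gain of [y] vanishes, so does that entry, and the formula holds without dividing by zero. *)
Lemma Wm_cons2 x y s : 0 <= x.1 -> 0 <= y.1 -> wge0 s ->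
 Wm (x :: y :: s) =
 (gain s x.1 x.2 * gain s y.1 y.2 - sqnorm (dot (x.2 *m Qm s) y.2)) * Wm s.
Proof.
move=> x0 y0 s0; rewrite /= -/(Qm (y :: s)) gain_cons mulrA; congr (_ * _).
have [g0|g0] := eqVneq (gain s y.1 y.2) 0; last by field.
by rewrite g0 gain_eq0_dot// sqnorm0; ring.
Qed.

Lemma Wm_swap x y s : 0 <= x.1 -> 0 <= y.1 -> wge0 s ->
 Wm (x :: y :: s) = Wm (y :: x :: s).
Proof.
move=> x0 y0 s0; have e1 : sqnorm (dot (x.2 *m Qm s) y.2) = sqnorm (dot (y.2 *m Qm s) x.2).
 by rewrite (dot_Qm s y.2 x.2) (dotC (x.2 *m _)) sqnormJ.
by rewrite (Wm_cons2 x0 y0 s0) (Wm_cons2 y0 x0 s0) e1 (mulrC (gain s x.1 _)).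
Qed.

Lemma mulmx_Qm_cons2 x y s v : gain s y.1 y.2 != 0 ->
 let g := dot (x.2 *m Qm s) y.2 in
 let D := gain s x.1 x.2 * gain s y.1 y.2 - sqnorm g in
 D != 0 ->
 v *m Qm (x :: y :: s) =
 (v - ((D^-1)%:C * ((gain s y.1 y.2)%:C * dot (v *m Qm s) x.2 - cj g * dot (v *m Qm s) y.2)) *: x.2
   - ((D^-1)%:C * ((gain s x.1 x.2)%:C * dot (v *m Qm s) y.2 - g * dot (v *m Qm s) x.2)) *: y.2)
  *m Qm s.
Proof.
move=> g0 /=; set g := dot (x.2 *m _) _; set a := gain s x.1 _; set b := gain s y.1 _.
set D := _ - _ => D0.
rewrite mulmx_upd -/(gain (y :: s) x.1 x.2) gain_cons -/g -/a -/b.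
have cb : b%:C != 0 by rewrite -[0]/(0%:C) (inj_eq (@complexI R)).
have cD : D%:C != 0 by rewrite -[0]/(0%:C) (inj_eq (@complexI R)).
have aD : a - b^-1 * sqnorm g = D / b by rewrite /D; field.
have DE : D%:C = a%:C * b%:C - g * cj g by rewrite mulJ_sqnorm /D rmorphB rmorphM.
rewrite aD invf_div !mulmx_upd -!/(gain s y.1 y.2) -/b; congr (_ *m _).
have e1 : dot (y.2 *m Qm s) x.2 = cj g by rewrite dot_Qm -dotC.
set p := dot (v *m Qm s) x.2; set q := dot (v *m Qm s) y.2.
set c1 := (_ / _)%:C * _; set c2 := (b^-1)%:C * dot _ _.
have c1E : c1 = (D^-1)%:C * (b%:C * p - cj g * q).
 rewrite /c1 mulmxBl -scalemxAl dotBl dotZl e1 -/p -/q.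
 rewrite rmorphM !fmorphV /=.
 have f1 (b' D' p' q' g' : C) : b' != 0 -> D' != 0 ->
   b' / D' * (p' - b'^-1 * q' * g') = D'^-1 * (b' * p' - g' * q').
  by move=> b0 D0'; field; rewrite b0 D0'.
 exact: f1.
have c2E : c2 = (D^-1)%:C * (a%:C * q - g * p).
 rewrite /c2 mulmxBl -scalemxAl dotBl dotZl -/q -/g c1E.
 rewrite !fmorphV /=.
 have f2 (a' b' D' p' q' g' h' : C) : b' != 0 -> D' != 0 -> D' = a' * b' - g' * h' ->
   b'^-1 * (q' - D'^-1 * (b' * p' - h' * q') * g') = D'^-1 * (a' * q' - g' * p').
  move=> b0 D0' DE'; have -> : a' = (D' + g' * h') / b' by rewrite DE' subrK mulfK.
  by field; rewrite b0 D0'.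
 exact: f2.
by rewrite c1E c2E.
Qed.

(** Since [Wm] does not vanish, both gains and the two by two determinant are invertible, and the
    closed formula of [mulmx_Qm_cons2] is symmetric in the two rows. *)
Lemma Qm_swap x y s : 0 <= x.1 -> 0 <= y.1 -> wge0 s ->
 Wm (x :: y :: s) != 0 -> Qm (x :: y :: s) = Qm (y :: x :: s).
Proof.
move=> x0 y0 s0 W0.
have gy : gain s y.1 y.2 != 0.
 by apply: contraNneq W0 => g0; rewrite /= g0 !(mul0r, mulr0).
have gx : gain s x.1 x.2 != 0.
 by apply: contraNneq W0 => g0; rewrite Wm_swap//= g0 !(mul0r, mulr0).
have e1 : dot (y.2 *m Qm s) x.2 = cj (dot (x.2 *m Qm s) y.2) by rewrite dot_Qm -dotC.
have D0 : gain s x.1 x.2 * gain s y.1 y.2 - sqnorm (dot (x.2 *m Qm s) y.2) != 0.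
 by apply: contraNneq W0 => g0; rewrite Wm_cons2// g0 mul0r.
have D0' : gain s y.1 y.2 * gain s x.1 x.2 - sqnorm (dot (y.2 *m Qm s) x.2) != 0.
 by rewrite e1 sqnormJ mulrC.
have E v : v *m Qm (x :: y :: s) = v *m Qm (y :: x :: s).
 apply: etrans (mulmx_Qm_cons2 v gy D0) (esym (etrans (mulmx_Qm_cons2 v gx D0') _)).
 rewrite e1 cjK sqnormJ (mulrC (gain s y.1 y.2)).
 by congr (_ *m _); rewrite addrAC.
move: E; generalize (Qm (x :: y :: s)) (Qm (y :: x :: s)) => A B E.
by apply/row_matrixP => i; rewrite !rowE E.
Qed.

(** The two matrices are only known to agree where the determinant is nonzero; where it is zero it
    stays zero after one more row, so the conditional statement propagates. *)
Lemma Wm_Qm_cons_congr y s t : Wm s = Wm t -> (Wm s != 0 -> Qm s = Qm t) ->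
 Wm (y :: s) = Wm (y :: t) /\ (Wm (y :: s) != 0 -> Qm (y :: s) = Qm (y :: t)).
Proof.
rewrite !Wm_cons; move: (Wm s) (Wm t) => a b <-; have [->|a0] := eqVneq a 0.
 move=> _; rewrite !mulr0; split; first reflexivity.
 move=> /eqP h; case: (h erefl).
move=> /(_ isT) QE; have gE : gain s y.1 y.2 = gain t y.1 y.2 by rewrite /gain QE.
rewrite gE; split; first reflexivity.
by move=> _; rewrite -[LHS]/(upd y.1 y.2 (Qm s)) QE.
Qed.

Lemma Wm_Qm_move s1 x s2 : 0 <= x.1 -> wge0 s1 -> wge0 s2 ->
 Wm (s1 ++ x :: s2) = Wm (x :: s1 ++ s2) /\
 (Wm (s1 ++ x :: s2) != 0 -> Qm (s1 ++ x :: s2) = Qm (x :: s1 ++ s2)).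
Proof.
move=> x0; elim: s1 => [//|y s1 ih] /= /andP[y0 s10] s20.
have s0 : wge0 (s1 ++ s2) by rewrite /wge0 all_cat [all _ s1]s10.
have [ihW ihQ] := ih s10 s20.
have E := Wm_Qm_cons_congr y ihW ihQ.
case: E => EW EQ; have EW' := etrans EW (Wm_swap y0 x0 s0); split; first exact: EW'.
move=> W0; apply: (etrans (EQ W0)); apply: Qm_swap; [exact: y0|exact: x0|exact: s0|].
by rewrite -EW.
Qed.

Lemma Wm_move s1 x s2 : wge0 (s1 ++ x :: s2) ->
 Wm (s1 ++ x :: s2) = Wm (x :: s1 ++ s2).
Proof.
by rewrite /wge0 all_cat /= => /and3P[? ? ?]; have [] := @Wm_Qm_move s1 x s2.
Qed.


End permutation_invariance.

(** * The determinant as a product of distances *)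

Section determinant.
Context {R : realType}.
Local Notation C := R[i].

(** The latest row comes first: [Wm] then measures each row against the span of the rows of smaller
    index. *)
Fixpoint pre n (r : nat -> 'rV[C]_n) m := if m is m'.+1 then r m' :: pre r m' else [::].

Lemma size_pre n (r : nat -> 'rV[C]_n) m : size (pre r m) = m.
Proof. by elim: m => //= m ->. Qed.

Lemma mem_pre n (r : nat -> 'rV[C]_n) m k : (k < m)%N -> r k \in pre r m.
Proof.
elim: m => // m ih; rewrite ltnS leq_eqVlt inE => /orP[/eqP ->|/ih ->].
 by rewrite eqxx.
by rewrite orbT.
Qed.

Lemma proj_span n (r : nat -> 'rV[C]_n) m v : exists c : nat -> C,
 v *m proj (pre r m) = v - \sum_(k < m) c k *: r k.
Proof.
elim: m v => [|m ih] v; first by exists (fun=> 0); rewrite /= mulmx1 big_ord0 subr0.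
rewrite /proj /= -/(proj _) mulmx_upd add0r; set a := _ * dot _ _.
have [c1 h1] := ih v; have [c2 h2] := ih (r m).
exists (fun k => if k == m then a else c1 k - a * c2 k).
rewrite mulmxBl h1 -scalemxAl h2 big_ord_recr /= eqxx scalerBr.
rewrite [in RHS](eq_bigr (fun k : 'I_m => c1 k *: r k - a *: (c2 k *: r k))) => [|k _]; last first.
 by rewrite /= ltn_eqF// scalerBl scalerA.
rewrite sumrB -scaler_sumr !opprD !opprK -!addrA; congr (_ + (_ + _)).
by rewrite addrC.
Qed.

Lemma Wm_pre0 n (r : nat -> 'rV[C]_n) m :
 Wm [seq (0, h) | h <- pre r m] = \prod_(k < m) dist2 (pre r k) (r k).
Proof.
elim: m => [|m ih]; first by rewrite big_ord0.
by rewrite big_ord_recr /= ih /gain add0r -/(proj _) -dist2E mulrC.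
Qed.

Lemma sqnorm_prod (I : Type) (s : seq I) (P : pred I) (F : I -> C) :
 sqnorm (\prod_(i <- s | P i) F i) = \prod_(i <- s | P i) sqnorm (F i).
Proof.
by apply: big_morph; [exact: sqnormM|rewrite -[1]/(1%:C) sqnorm_real expr1n].
Qed.

(** Gram-Schmidt: subtracting from each row its component along the earlier ones is left
    multiplication by a unit lower triangular matrix, after which the rows are orthogonal with
    squared lengths [dist2]. *)
Lemma sqnorm_det n (H : 'M[C]_n.+1) :
 sqnorm (\det H) = \prod_(k < n.+1) dist2 (pre (fun k => row (inord k) H) k) (row k H).
Proof.
set r := fun k : nat => row (inord k) H.
have rE (k : 'I_n.+1) : r k = row k H by rewrite /r inord_val.
have /choice[c hc] : forall i : 'I_n.+1, exists c : nat -> C,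
  row i H *m proj (pre r i) = row i H - \sum_(k < i) c k *: r k.
 by move=> i; exact: proj_span.
pose L : 'M[C]_n.+1 := \matrix_(i, j) (if (j < i)%N then - c i j else (i == j)%:R).
have detL : \det L = 1.
 rewrite det_trig; first by rewrite big1// => i _; rewrite mxE ltnn eqxx.
 apply/is_trig_mxP => i j ij; rewrite mxE ltnNge (ltnW ij) /=.
 by rewrite -val_eqE /= ltn_eqF.
pose G := L *m H.
have GE i : row i G = row i H *m proj (pre r i).
 rewrite hc row_mul mulmx_sum_row (bigID (fun j : 'I_n.+1 => (j < i)%N)) /= addrC.
 congr (_ + _).
  rewrite (bigD1 i) ?ltnn//= !mxE ltnn eqxx scale1r big1 ?addr0// => j /andP[ij ji].
  by rewrite !mxE (negbTE ij) eq_sym (negbTE ji) scale0r.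
 rewrite -sumrN (big_ord_widen_cond n.+1 xpredT (fun k => - (c i k *: r k)) (ltnW (ltn_ord i))).
 by apply: eq_bigr => j ji; rewrite !mxE ji scaleNr rE.
have Gorth (i j : 'I_n.+1) : (j < i)%N -> dot (row i G) (row j G) = 0.
 move=> ji; rewrite (GE i) dot_Qm -/(proj _) GE hc.
 suff -> : (row j H - \sum_(k < j) c j k *: r k) *m proj (pre r i) = 0 by rewrite dot0r.
 rewrite mulmxBl -rE mulmx_proj0 ?mem_pre// mulmx_suml big1 ?subr0// => k _.
 by rewrite -scalemxAl mulmx_proj0 ?scaler0// mem_pre// (ltn_trans (ltn_ord k)).
have GG : G *m G^t* = diag_mx (\row_i (sqn (row i G))%:C).
 apply/matrixP => i j; have -> : (G *m G^t*) i j = dot (row i G) (row j G).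
  by rewrite dotE mxE; apply: eq_bigr => k _; rewrite adjE !mxE.
 rewrite !mxE; have [<-|ij] := eqVneq i j; first by rewrite dotvv mulr1n.
 rewrite mulr0n; case: (ltngtP i j) => [h|h|/val_inj h]; [|exact: Gorth|by rewrite h eqxx in ij].
 by rewrite dotC Gorth// cj0.
have : \det G * cj (\det G) = (\prod_i sqn (row i G))%:C.
 have -> : cj (\det G) = \det (G^t*) by rewrite det_map_mx det_tr.
 rewrite -det_mulmx GG det_diag.
 by rewrite rmorph_prod; apply: eq_bigr => i _; rewrite mxE.
rewrite mulJ_sqnorm => /complexI; rewrite det_mulmx detL mul1r => ->.
by apply: eq_bigr => i _; rewrite GE.
Qed.

(** The columns of [E] are orthonormal, as for a selection of coordinates. The component of [v *m E]
    orthogonal to the images is carried back by the adjoint of [E] to a vector of the same length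
    orthogonal to [s], which tests the distance of [v]. *)
Lemma dist2_isometry n m (E : 'M[C]_(n, m)) (s : seq 'rV[C]_n) v :
 E^t* *m E = 1%:M -> dist2 [seq h *m E | h <- s] (v *m E) <= dist2 s v.
Proof.
move=> EE; set s' := map _ _; set u := v *m E *m proj s'.
have dE (h : 'rV[C]_n) (w : 'rV[C]_m) : dot h (w *m E^t*) = dot (h *m E) w.
 by rewrite /dot adjM adjK mulmxA.
have h1 : sqn (u *m E^t*) = sqn u.
 by rewrite sqnE dE -mulmxA EE mulmx1 -sqnE.
have : sqnorm (dot v (u *m E^t*)) <= sqn (u *m E^t*) * dist2 s v.
 apply: dist2_le_orth => g gs; rewrite dotC dE (dotC u) cjK.
 by apply: dot_proj0; apply: map_f.
rewrite dE h1.
have -> : dot (v *m E) u = (sqn u)%:C.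
 have hu : u *m proj s' = u by exact: mulmx_projK.
 by rewrite -{1}hu -dot_Qm -/(proj s') -/u dotvv.
rewrite sqnorm_real expr2 -[dist2 s' _]/(sqn u); have [->|u0] := eqVneq (sqn u) 0.
 by move=> _; exact: dist2_ge0.
by rewrite ler_pM2l// lt_def u0 sqn_ge0.
Qed.

End determinant.

(** * Effect of the weights on Gram determinants *)

Section weights.
Context {R : realType} {n : nat}.
Local Notation C := R[i].
Implicit Types (A B : seq 'rV[C]_n).

Definition wts (e : R) A := [seq (e, h) | h <- A].

Lemma wge0_wts e A : 0 <= e -> wge0 (wts e A).
Proof. by move=> e0; rewrite /wge0 all_map; apply/allP. Qed.

Lemma wge0_cat (s t : seq (R * 'rV[C]_n)) : wge0 (s ++ t) = wge0 s && wge0 t :> bool.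
Proof. by rewrite /wge0 all_cat. Qed.

Lemma unzip2_wts e A : unzip2 (wts e A) = A.
Proof. by rewrite /unzip2 -map_comp map_id_in. Qed.

(** Raising the weight of one row from [0] to [e] adds [e] to a gain that is at least [d], hence
    costs a factor at most [1 + e / d]; the rows of [A2] are treated one after another. *)
Lemma Wm_le_regularized (e d : R) A1 A2 : 0 <= e -> 0 < d ->
 (forall A' A'' h, A1 ++ A2 = A' ++ h :: A'' -> d <= dist2 (A' ++ A'') h) ->
 Wm (wts 0 A1 ++ wts e A2) <= Wm (wts 0 (A1 ++ A2)) * (1 + e / d) ^+ size A2.
Proof.
move=> e0 d0; elim: A2 A1 => [|h A2 ih] A1 hd.
 by rewrite cats0 expr0 mulr1 /wts cats0.
have w0 : wge0 (wts 0 A1 ++ wts e A2) by rewrite wge0_cat !wge0_wts.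
have gd : d <= gain (wts 0 A1 ++ wts e A2) 0 h.
 apply: le_trans (dist2_le_gain 0 h w0); rewrite add0r.
 by rewrite /unzip2 map_cat -/(unzip2 _) -/(unzip2 (wts e A2)) !unzip2_wts; exact: hd.
rewrite [wts e (_ :: _)]/= Wm_move /=; last by rewrite wge0_cat /= e0 !wge0_wts.
have := ih (rcons A1 h); rewrite cat_rcons => /(_ hd).
rewrite /wts map_rcons cat_rcons -!/(wts _ _) Wm_move /=; last by rewrite wge0_cat /= lexx !wge0_wts.
move=> ihh; apply: (@le_trans _ _ ((1 + e / d) *
  (gain (wts 0 A1 ++ wts e A2) 0 h * Wm (wts 0 A1 ++ wts e A2)))); last first.
 by rewrite [size _]/= exprS [leRHS]mulrCA ler_wpM2l// addr_ge0// divr_ge0// ltW.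
rewrite mulrA ler_wpM2r ?Wm_ge0// mulrDl mul1r.
have -> : gain (wts 0 A1 ++ wts e A2) e h = gain (wts 0 A1 ++ wts e A2) 0 h + e.
 by rewrite /gain add0r addrC.
rewrite lerD2l mulrAC ler_pdivlMr//.
by rewrite ler_wpM2l.
Qed.

Lemma Wm_pre_le (e : R) (r : nat -> 'rV[C]_n) m p : 0 <= e -> (m <= p)%N ->
 Wm (wts e (pre r p)) <= Wm (wts e (pre r m)) * \prod_(m <= k < p) (e + sqn (r k)).
Proof.
move=> e0 /subnK <-; elim: (p - m)%N => [|k ih]; first by rewrite add0n big_geq ?mulr1.
rewrite addSn big_nat_recr ?leq_addl//= mulrA mulrC.
by apply: ler_pM => //; rewrite ?gain_ge0 ?Wm_ge0 ?wge0_wts// /gain lerD2l dot_Qm_le ?wge0_wts.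
Qed.

End weights.

(** * Measurability of regularized determinants and distances *)

Section measurability_of_weights.
Context {R : realType} {d} {T : measurableType d} {n : nat}.
Local Notation C := R[i].

Lemma meas_dot (u v : T -> 'rV[C]_n) : meas_mx u -> meas_mx v ->
 mble (fun w => dot (u w) (v w)).
Proof. by move=> mu mv; apply: meas_mxM => //; exact: meas_mxadj. Qed.

Lemma meas_ReT (f : T -> C) : mble f ->
 mble (fun w => Re (f w)).
Proof. by move=> /meas_complexP[]. Qed.

Lemma meas_ofR (f : T -> R) : mble f ->
 mble (fun w => (f w)%:C).
Proof. by move=> mf; apply/meas_complexP; split. Qed.

Lemma meas_sqn (u : T -> 'rV[C]_n) : meas_mx u ->
 mble (fun w => sqn (u w)).
Proof. by move=> mu; apply: measurable_sum => j; exact: meas_sqnorm. Qed.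

Variables (I : Type) (e : R) (r : I -> T -> 'rV[C]_n).
Hypothesis mr : forall i, meas_mx (r i).

Lemma meas_Qm s : meas_mx (fun w => Qm (wts e [seq r i w | i <- s])).
Proof.
elim: s => [|i s ih] /=; first exact: meas_mx_cst.
apply: meas_mxD => //; apply: meas_mxN; apply: meas_mxZ.
 apply: meas_ofR; apply: meas_invR; apply: mbleD => //.
 by apply: meas_ReT; apply: meas_dot => //; exact: meas_mxM.
by apply: meas_mxM; apply: meas_mxM => //; exact: meas_mxadj.
Qed.

Lemma meas_Wm s : mble (fun w => Wm (wts e [seq r i w | i <- s])).
Proof.
elim: s => [|i s ih] //=; apply: mbleM => //; apply: mbleD => //.
apply: meas_ReT; apply: meas_dot => //; apply: meas_mxM => //.
exact: meas_Qm.
Qed.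

End measurability_of_weights.

Section measurability_of_dist.
Context {R : realType} {d} {T : measurableType d} {n : nat}.

Lemma meas_dist2 (I : Type) (r : I -> T -> 'rV[R[i]]_n) (h : T -> 'rV[R[i]]_n) s :
 (forall i, meas_mx (r i)) -> meas_mx h ->
 mble (fun w => dist2 [seq r i w | i <- s] (h w)).
Proof.
move=> mr mh; apply: meas_sqn; apply: meas_mxM => //.
exact: meas_Qm.
Qed.

End measurability_of_dist.

(** * Elementary integral inequalities *)

Section integral_bounds.
Context {R : realType} {d} {T : measurableType d} (P : probability T R).

Lemma prob_le_integral (A : set T) (g : T -> R) : measurable A ->
 mble g -> (forall w, 0 <= g w) -> (forall w, A w -> 1 <= g w) ->
 (P A <= \int[P]_w (g w)%:E)%E.
Proof.
move=> mA mg g0 gA; rewrite -[A]setIT -integral_indic//; apply: ge0_le_integral => //.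
- exact/mble_EFinP/measurable_indic.
- exact/mble_EFinP.
- move=> w _; rewrite lee_fin indicE; case: (boolP (w \in A)) => [|_]; last exact: g0.
 by rewrite inE; exact: gA.
Qed.

Lemma int_Zl (c : R) (f : T -> R) : mble f ->
 (forall w, 0 <= f w) -> 0 <= c ->
 (\int[P]_w (c * f w)%:E = c%:E * \int[P]_w (f w)%:E)%E.
Proof.
move=> mf f0 c0; under eq_integral do rewrite EFinM.
rewrite ge0_integralZl ?lee_fin//; first exact/mble_EFinP.
by move=> w _; rewrite lee_fin.
Qed.

Lemma int_Zr (c : R) (f : T -> R) : mble f ->
 (forall w, 0 <= f w) -> 0 <= c ->
 (\int[P]_w (f w * c)%:E = \int[P]_w (f w)%:E * c%:E)%E.
Proof.
move=> mf f0 c0; rewrite muleC -int_Zl//.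
by apply: eq_integral => w _; rewrite mulrC.
Qed.

Lemma int_D (f g : T -> R) : mble f -> mble g ->
 (forall w, 0 <= f w) -> (forall w, 0 <= g w) ->
 (\int[P]_w (f w + g w)%:E = \int[P]_w (f w)%:E + \int[P]_w (g w)%:E)%E.
Proof.
move=> mf mg f0 g0; under eq_integral do rewrite EFinD.
rewrite ge0_integralD//; [by move=> w _; rewrite lee_fin|exact/mble_EFinP
 |by move=> w _; rewrite lee_fin|exact/mble_EFinP].
Qed.

Lemma int_le (f g : T -> R) : mble f -> mble g ->
 (forall w, 0 <= f w) -> (forall w, f w <= g w) ->
 (\int[P]_w (f w)%:E <= \int[P]_w (g w)%:E)%E.
Proof.
move=> mf mg f0 fg; apply: ge0_le_integral => //.
- by move=> w _; rewrite lee_fin.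
- exact/mble_EFinP.
- exact/mble_EFinP.
- by move=> w _; rewrite lee_fin.
Qed.

Lemma int_ge0 (f : T -> R) : (forall w, 0 <= f w) -> (0 <= \int[P]_w (f w)%:E)%E.
Proof. by move=> f0; apply: integral_ge0 => w _; rewrite lee_fin. Qed.

Lemma int_cst (c : R) : (\int[P]_w c%:E = c%:E)%E.
Proof. by rewrite integral_cst//= [P _]probability_setT mule1. Qed.

Lemma integral_le_cst (g : T -> R) (c : R) : mble g ->
 (forall w, 0 <= g w <= c) -> (\int[P]_w (g w)%:E <= c%:E)%E.
Proof.
move=> mg gc; apply: (@le_trans _ _ (\int[P]_w (c%:E))%E); last first.
 by rewrite integral_cst//= [P _]probability_setT mule1.
apply: ge0_le_integral => //.
- by move=> w _; rewrite lee_fin; case/andP: (gc w).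
- exact/mble_EFinP.
- by move=> w _; rewrite lee_fin; case/andP: (gc w).
Qed.

Lemma integral_le_two (A : set T) (g : T -> R) (a t : R) : measurable A ->
 mble g -> (forall w, 0 <= g w <= 1) ->
 (forall w, ~ A w -> g w <= t) -> 0 <= t <= 1 -> (P A <= a%:E)%E ->
 (\int[P]_w (g w)%:E <= (a + (1 - a) * t)%:E)%E.
Proof.
move=> mA mg g01 gA /andP[t0 t1] PA.
apply: (@le_trans _ _ (\int[P]_w (t + (1 - t) * \1_A w)%:E)%E).
 apply: ge0_le_integral => //.
 - by move=> w _; rewrite lee_fin; case/andP: (g01 w).
 - exact/mble_EFinP.
 - by apply/mble_EFinP; apply: mbleD => //; apply: mbleM.
 - move=> w _; rewrite lee_fin indicE; have /andP[_ g1] := g01 w.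
  case: (boolP (w \in A)); rewrite ?inE ?notin_setE => hw /=.
   by rewrite mulr1 addrC subrK.
  by rewrite mulr0 addr0; exact: gA.
under eq_integral do rewrite EFinD EFinM.
rewrite ge0_integralD//=; last 2 first.
- by move=> w _; rewrite -EFinM lee_fin mulr_ge0 ?subr_ge0.
- by under eq_fun do rewrite -EFinM; apply/mble_EFinP; apply: mbleM.
rewrite integral_cst//= [P _]probability_setT mule1 ge0_integralZl//; last 2 first.
- exact/mble_EFinP/measurable_indic.
- by rewrite lee_fin subr_ge0.
rewrite integral_indic// setIT.
apply: (@le_trans _ _ (t%:E + (1 - t)%:E * a%:E)%E).
 by apply: leeD => //; apply: lee_wpmul2l => //; rewrite lee_fin subr_ge0.
by rewrite -EFinM -EFinD lee_fin; lra.
Qed.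

End integral_bounds.

(** * Small ball estimate for the distance from a random row to a subspace *)

Section small_ball.
Context {R : realType} {d} {T : measurableType d} (P : probability T R).
Local Notation C := R[i].

(* [kap] is the square of the radius. *)
Definition anticonc {I} (X : T -> arr R I) (kap p : R) := forall i (c : C),
 (P [set w | sqnorm (X w i - c)%R <= kap]%R <= (1 - p)%:E)%E.

Definition rv n (f : arr R 'I_n) : 'rV[C]_n := \row_j f j.

Lemma meas_rv n : meas_mx (fun f : arr R 'I_n => rv f).
Proof. by move=> i j; under eq_fun do rewrite mxE; exact: meas_coord. Qed.

Lemma meas_mx_comp d' (T' : measurableType d') m n (A : T' -> 'M[C]_(m, n)) (f : T -> T') :
 meas_mx A -> mble f -> meas_mx (fun w => A (f w)).
Proof. by move=> mA mf i j; exact: mcomp (mA i j) mf. Qed.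

(** With probability at least [p] the coordinate is away from the point where the argument vanishes,
    so the integral is at most [1 - p + p t], which is below the exponential on the right. *)
Lemma exp_sqnorm_le I (X : T -> arr R I) kap p i (b c : C) (s : R) :
 mble X -> anticonc X kap p -> 0 <= kap -> 0 <= p -> 0 <= s ->
 (\int[P]_w (expR (- (s * sqnorm (b * X w i + c))))%:E <=
  (expR (- (p * (1 - expR (- (s * sqnorm b * kap))))))%:E)%E.
Proof.
move=> mX aX k0 p0 s0; set t := expR (- (s * sqnorm b * kap)).
have t01 : 0 <= t <= 1.
 by rewrite expR_ge0 /= -[leRHS]expR0 ler_expR oppr_le0 !mulr_ge0 ?sqnorm_ge0.
have mXi : mble (fun w => X w i) by move/meas_arrP: mX.
have mg : mble (fun w => expR (- (s * sqnorm (b * X w i + c)))).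
 apply: mcomp => //; apply: mbleN; apply: mbleM => //.
 by apply: meas_sqnorm; apply: meas_addC => //; exact: meas_mulC.
have g01 w : 0 <= expR (- (s * sqnorm (b * X w i + c))) <= 1.
 by rewrite expR_ge0 /= -[leRHS]expR0 ler_expR oppr_le0 mulr_ge0 ?sqnorm_ge0.
have [b0|b0] := eqVneq b 0.
 have -> : t = 1 by rewrite /t b0 sqnorm0 mulr0 mul0r oppr0 expR0.
 by rewrite subrr mulr0 oppr0 expR0; exact: integral_le_cst.
apply: (@le_trans _ _ ((1 - p) + (1 - (1 - p)) * t)%:E).
 apply: (integral_le_two (A := [set w | sqnorm (X w i - (- c / b)) <= kap])) => //.
  rewrite -[X in measurable X]setTI; apply: measurable_fun_le => //.
  by apply: meas_sqnorm; apply: meas_addC.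
 move=> w /= /negP; rewrite -ltNge => h; rewrite ler_expR lerN2 -mulrA ler_wpM2l//.
 have -> : b * X w i + c = b * (X w i - - c / b) by field.
 by rewrite sqnormM ler_wpM2l ?sqnorm_ge0// ltW.
rewrite lee_fin; apply: le_trans (expR_ge1Dx _); lra.
Qed.

Lemma Re_trace n (A : 'M[C]_n) : Re (\tr A) = \sum_i Re (A i i).
Proof.
rewrite /mxtrace (big_morph (@complex.Re R) (id1 := 0) (op1 := +%R))//.
by move=> x y; rewrite ReD.
Qed.

(** The trace of the projection is at least [k], so some diagonal entry reaches the average
    [k / n]. *)
Lemma exists_diag n k (r : seq 'rV[C]_n) : (size r + k <= n)%N -> (0 < k)%N ->
 exists j : 'I_n, k%:R / n%:R <= Re (proj r j j).
Proof.
move=> rk k0; apply: contrapT => /forallNP h.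
have n0 : (0 < n)%N by lia.
have := Re_trace_Qm (wge0_map0 r); rewrite -/(proj r) Re_trace size_map.
suff : \sum_i Re (proj r i i) < k%:R.
 have : (size r)%:R + k%:R <= n%:R :> R by rewrite -natrD ler_nat.
 lra.
have -> : k%:R = \sum_(i < n) (k%:R / n%:R) :> R.
 by rewrite sumr_const card_ord -[RHS]mulr_natr divfK// pnatr_eq0 -lt0n.
apply: ltr_sum => [|i _]; last by rewrite ltNge; apply/negP; exact: h.
by apply/hasP; exists (Ordinal n0) => //; rewrite mem_index_enum.
Qed.

(** Induction on the codimension. Some diagonal entry [a] of the projection is at least the
    codimension divided by [n]; removing the direction [ej] splits off a term in which [X j] has
    coefficient [a], while the remainder does not depend on [X j]. Integrating that coordinate first
    yields one factor of the product. *)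
Lemma exp_dist_le n k (r : seq 'rV[C]_n) (X : T -> arr R 'I_n) (u : 'rV[C]_n) kap p s :
 mble X -> indep P X -> anticonc X kap p ->
 0 <= kap -> 0 <= p -> 0 <= s -> (size r + k <= n)%N ->
 (\int[P]_w (expR (- (s * dist2 r (rv (X w) + u))))%:E <=
  (expR (- (p * \sum_(i < k) (1 - expR (- (s * kap * (i.+1%:R / n%:R)))))))%:E)%E.
Proof.
move=> mX iX aX k0 p0 s0; elim: k r => [|k ih] r rk.
 rewrite big_ord0 mulr0 oppr0 expR0; apply: integral_le_cst.
  apply: mcomp => //; apply: mbleN; apply: mbleM => //.
  apply: meas_sqn; apply: meas_mxM; last exact: meas_mx_cst.
  apply: meas_mxD; last exact: meas_mx_cst.
  exact: meas_mx_comp (@meas_rv n) mX.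
 by move=> w; rewrite expR_ge0 /= -[leRHS]expR0 ler_expR oppr_le0 mulr_ge0 ?dist2_ge0.
have [j hj] := exists_diag rk (ltn0Sn k).
set a := Re (proj r j j) in hj.
have n0 : 0 < n%:R :> R by rewrite ltr0n (leq_ltn_trans _ (ltn_ord j)).
have a0 : 0 < a by apply: lt_le_trans hj; rewrite divr_gt0.
pose ej : 'rV[C]_n := delta_mx 0 j.
pose r' := ej :: r.
have rk' : (size r' + k <= n)%N by rewrite /= addSn -addnS.
have dej v : dot v ej = v 0 j.
 rewrite dotE (bigD1 j)//= big1 => [|l lj]; first by rewrite mxE !eqxx cj1 mulr1 addr0.
 by rewrite mxE (negbTE lj) andbF cj0 mulr0.
have aE : Re (dot (ej *m proj r) ej) = a by rewrite dej -rowE mxE.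
have key v : dist2 r v = dist2 r' v + a^-1 * sqnorm ((v *m proj r) 0 j).
 rewrite !dist2E {1}/proj /= mulmx_upd add0r aE mulmxBl dotBl -scalemxAl dotZl.
 rewrite -!/(proj r) (dot_Qm _ ej v) -/(proj r) (dotC (v *m _)) !dej.
 by rewrite -mulrA mulJ_sqnorm -rmorphM ReB /= subrK.
have inv (f : arr R 'I_n) z : dist2 r' (rv (mix (pred1 j) (fun=> z) f) + u) = dist2 r' (rv f + u).
 rewrite /dist2; congr sqn.
 have -> : rv (mix (pred1 j) (fun=> z) f) + u = rv f + u + (z - f j) *: ej.
  apply/rowP => l; rewrite !mxE /mix /=; case: (eqVneq l j) => [->|lj]; last by rewrite mulr0 addr0.
  by rewrite mulr1; ring.
 by rewrite mulmxDl -scalemxAl (mulmx_proj0 (h := ej)) ?scaler0 ?addr0// inE eqxx.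
have mD q : mble (fun f : arr R 'I_n => expR (- (s * dist2 q (rv f + u)))).
 apply: mcomp => //; apply: mbleN; apply: mbleM => //.
 apply: meas_sqn; apply: meas_mxM; last exact: meas_mx_cst.
 by apply: meas_mxD; [exact: meas_rv|exact: meas_mx_cst].
set E := (X in (_ <= X%:E)%E).
rewrite (@indep_integral _ _ _ P _ X (pred1 j)
 (fun f => (expR (- (s * dist2 r (rv f + u))))%:E) mX iX); last 2 first.
- by apply/mble_EFinP; exact: mD.
- by move=> f; rewrite lee_fin expR_ge0.
set c := expR (- (p * (1 - expR (- (s * kap * (k.+1%:R / n%:R)))))).
have inner v : (\int[P]_w (expR (- (s * dist2 r (rv (mix (pred1 j) (X w) (X v)) + u))))%:E
  <= (expR (- (s * dist2 r' (rv (X v) + u))) * c)%:E)%E.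
 set b := proj r j j.
 pose z := ((rv (X v) + u) *m proj r) 0 j - X v j * b.
 have fE w : dist2 r (rv (mix (pred1 j) (X w) (X v)) + u) =
   dist2 r' (rv (X v) + u) + a^-1 * sqnorm (b * X w j + z).
  have -> : mix (pred1 j) (X w) (X v) = mix (pred1 j) (fun=> X w j) (X v).
   by apply/funext => l; rewrite /mix /=; case: eqP => // ->.
  rewrite key inv; congr (_ + _ * sqnorm _).
  rewrite /z /b !mxE (bigD1 j)//= [in RHS](bigD1 j)//= !mxE /mix /= eqxx.
  rewrite [X in _ + X = _](eq_bigr (fun l => (rv (X v) + u) 0 l * proj r l j)) => [|l lj]; last first.
   by rewrite !mxE (negbTE lj).
  ring.
 under eq_integral => w _ do rewrite fE mulrDr opprD expRD mulrA.
 rewrite int_Zl ?expR_ge0//; last first.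
  apply: mcomp => //; apply: mbleN.
  apply: mbleM => //; apply: meas_sqnorm; apply: meas_addC => //.
  by apply: meas_mulC => //; move/meas_arrP: mX.
 rewrite EFinM; apply: lee_wpmul2l; first by rewrite lee_fin expR_ge0.
 apply: le_trans (exp_sqnorm_le j b z mX aX k0 p0 _) _; first by rewrite mulr_ge0// invr_ge0 ltW.
 rewrite lee_fin ler_expR lerN2 ler_wpM2l// lerD2l lerN2 ler_expR lerN2.
 have -> : sqnorm b = a ^+ 2 by rewrite /b Qm_diag sqnorm_real.
 have -> : s / a * a ^+ 2 * kap = s * kap * a by field; rewrite gt_eqF.
 by rewrite ler_wpM2l// mulr_ge0.
apply: (@le_trans _ _ (\int[P]_v (expR (- (s * dist2 r' (rv (X v) + u))) * c)%:E)%E).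
 apply: ge0_le_integral => //.
 - by move=> v _; apply: integral_ge0 => w _; rewrite lee_fin expR_ge0.
 - apply: (measurable_fun_fubini_tonelli_G (m1 := P) (fun q : T * T =>
   (expR (- (s * dist2 r (rv (mix (pred1 j) (X q.1) (X q.2)) + u))))%:E)).
   apply/mble_EFinP; apply: (mcomp (mD r)).
   by apply: meas_mix; apply: mcomp.
  by move=> q; rewrite lee_fin expR_ge0.
 - by apply/mble_EFinP; apply: mbleM => //; exact: mcomp (mD r') mX.
rewrite int_Zr ?expR_ge0//; last exact: mcomp (mD r') mX.
apply: le_trans (lee_wpmul2r _ (ih r' rk')) _; first by rewrite lee_fin expR_ge0.
by rewrite -EFinM lee_fin /c -expRD /E big_ord_recr /= [X in _ <= expR (- X)]mulrDr opprD.
Qed.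

Lemma dist_small_ball n k (r : seq 'rV[C]_n) (X : T -> arr R 'I_n) (u : 'rV[C]_n) kap p :
 mble X -> indep P X -> anticonc X kap p ->
 0 < kap -> 0 <= p -> (size r + k <= n)%N ->
 (P [set w | dist2 r (rv (X w) + u)%R <= p * kap / 12 * (k%:R ^+ 2 / n%:R)]%R
  <= (expR (- (p / 6 * k%:R)))%:E)%E.
Proof.
move=> mX iX aX kap0 p0 rk.
have [->|k0] := posnP k.
 by rewrite mulr0 oppr0 expR0; apply: probability_le1; rewrite -[X in measurable X]setTI;
  apply: measurable_fun_le => //; apply: meas_sqn; apply: meas_mxM; [
  apply: meas_mxD; [exact: meas_mx_comp (@meas_rv n) mX|exact: meas_mx_cst]
  |exact: meas_mx_cst].
have n0 : 0 < n%:R :> R by rewrite ltr0n; lia.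
have kk : 0 < k%:R :> R by rewrite ltr0n.
(* This [s] makes the exponents equal to [2 (i + 1) / k], so that the sum below is at least [k / 3];
   [s * tau = p k / 6] then spends half of the gain [p k / 3]. *)
pose s := 2 * n%:R / (kap * k%:R).
have s0 : 0 <= s by rewrite divr_ge0// ?mulr_ge0// ltW.
set tau := p * kap / 12 * _.
have mD : mble (fun w => dist2 r (rv (X w) + u)).
 apply: meas_sqn; apply: meas_mxM; last exact: meas_mx_cst.
 apply: meas_mxD; last exact: meas_mx_cst.
 exact: meas_mx_comp (@meas_rv n) mX.
have mE : mble (fun w => expR (- (s * dist2 r (rv (X w) + u)))).
 apply: mcomp => //; apply: mbleN; exact: mbleM.
apply: (@le_trans _ _ (\int[P]_w (expR (s * tau) * expR (- (s * dist2 r (rv (X w) + u))))%:E)%E).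
 apply: prob_le_integral.
 - by rewrite -[X in measurable X]setTI; apply: measurable_fun_le.
 - exact: mbleM.
 - by move=> w; rewrite mulr_ge0 ?expR_ge0.
 - move=> w /= h; rewrite -expRD -[leLHS]expR0 ler_expR -mulrBr mulr_ge0// subr_ge0//.
rewrite int_Zl ?expR_ge0//.
apply: le_trans (lee_wpmul2l _ (exp_dist_le u mX iX aX (ltW kap0) p0 s0 rk)) _.
 by rewrite lee_fin expR_ge0.
rewrite -EFinM lee_fin -expRD ler_expR.
have h1 : s * tau = p / 6 * k%:R.
 by rewrite /s /tau; field; rewrite !gt_eqF.
have h2 : k%:R / 3 <= \sum_(i < k) (1 - expR (- (s * kap * (i.+1%:R / n%:R)))).
 have sE : \sum_(i < k) (i.+1%:R : R) = k%:R * (k%:R + 1) / 2.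
  elim: (k) => [|m ihm]; first by rewrite big_ord0 mul0r mul0r.
  by rewrite big_ord_recr /= ihm -!natr1; field.
 apply: (@le_trans _ _ (\sum_(i < k) (2 * i.+1%:R / (3 * k%:R)))).
  rewrite -mulr_suml -mulr_sumr sE.
  have -> : 2 * (k%:R * (k%:R + 1) / 2) / (3 * k%:R) = (k%:R + 1) / 3 :> R.
   by field; rewrite gt_eqF.
  lra.
 apply: ler_sum => i _.
 have -> : s * kap * (i.+1%:R / n%:R) = 2 * i.+1%:R / k%:R.
  by rewrite /s; field; rewrite !gt_eqF.
 set x := 2 * i.+1%:R / k%:R.
 have -> : 2 * i.+1%:R / (3 * k%:R) = x / 3 by rewrite /x; field; rewrite gt_eqF.
 have x0 : 0 <= x by rewrite divr_ge0// ltW.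
 have x2 : x <= 2 by rewrite /x ler_pdivrMr// ler_wpM2l// ler_nat.
 (* [1 - expR (- x) >= x / (1 + x) >= x / 3] for [x] between [0] and [2]. *)
 have : expR (- x) * (1 + x) <= 1.
  rewrite -[leRHS](expRxMexpNx_1 x) mulrC ler_wpM2r ?expR_ge0// expR_ge1Dx.
  done.
 have := expR_gt0 (- x); nra.
rewrite h1; have : p * (k%:R / 3) <= p * \sum_(i < k) (1 - expR (- (s * kap * (i.+1%:R / n%:R)))).
 by rewrite ler_wpM2l.
lra.
Qed.

End small_ball.

(** * Counting paths by central binomial coefficients *)

Section sperner.
Local Open Scope nat_scope.

(* Number of +-1 paths of length [n] started at [k] that stay positive, as a sum
  of central binomial coefficients (reflection principle). *)
Definition nchains k n := \sum_(e < n.+1 | (n <= e.*2 + k) && (e.*2 < n + k)) 'C(n, e).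

Lemma nchains_n0 k : 0 < k -> nchains k 0 = 1.
Proof. by move=> k0; rewrite /nchains (big_pred1 ord0) ?bin0// => e; rewrite ord1 /= add0n k0 eqxx. Qed.

Lemma nchainsE k n m : n < m ->
 nchains k n = \sum_(e < m) ((n <= e.*2 + k) && (e.*2 < n + k)) * 'C(n, e).
Proof.
move=> nm; rewrite /nchains (big_ord_widen_cond m (fun e => (n <= e.*2 + k) && (e.*2 < n + k)) (fun e => 'C(n, e))) //.
rewrite big_mkcond; apply: eq_bigr => e _.
have [h|h] := ltnP e n.+1; first by rewrite andbT; case: (_ && _); rewrite ?mul1n ?mul0n.
by rewrite andbF bin_small ?muln0.
Qed.

(** Decomposition by the first step, through Pascal's rule; [nchains 0 n = 0] accounts for
    absorption at [0]. *)
Lemma nchainsS k n : 0 < k -> nchains k n.+1 = nchains k.+1 n + nchains k.-1 n.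
Proof.
move=> k0; have n3 : n < n.+3 by lia.
rewrite (@nchainsE k n.+1 n.+3)// (@nchainsE k.+1 n n.+3)// (@nchainsE k.-1 n n.+3)//.
rewrite -big_split /=.
pose f e := ((n.+1 <= e.*2 + k) && (e.*2 < n.+1 + k)) * 'C(n, e).
pose g e := ((n.+1 <= e.+1.*2 + k) && (e.+1.*2 < n.+1 + k)) * 'C(n, e).
transitivity (\sum_(e < n.+3) f e + \sum_(e < n.+3) g e).
 rewrite [LHS]big_ord_recl [X in _ = X + _]big_ord_recl [X in _ = _ + X]big_ord_recr /=.
 have -> : g n.+2 = 0 by rewrite /g bin_small ?muln0.
 rewrite addn0 -addnA -big_split /= /f !bin0; congr (_ + _).
 apply: eq_bigr => e _; rewrite /bump /= add1n binS /g /f; lia.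
rewrite -big_split /=; apply: eq_bigr => e _; rewrite /f /g -!mulnDl; congr (_ * _).
by lia.
Qed.

Lemma nchains1 n : nchains 1 n = 'C(n, n./2).
Proof.
have h : n./2 < n.+1 by lia.
by rewrite /nchains (big_pred1 (Ordinal h)) // => e; apply/idP/eqP => [he|->/=]; [apply: val_inj => /=|]; lia.
Qed.

(** The factor [2 m + 1] closes the induction because [(2 m + 1) (2 m + 3) <= (2 m + 2) ^ 2]. *)
Lemma central_bin m : 'C(m.*2, m) ^ 2 * m.*2.+1 <= 4 ^ m.*2.
Proof.
elim: m => // m ih.
have h : 'C(m.+1.*2, m.+1) * m.+1 = 'C(m.*2, m) * 2 * m.*2.+1.
 have h1 : m.*2.+1 * 'C(m.*2, m) = m.+1 * 'C(m.*2.+1, m.+1) by exact: mul_bin_diag.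
 have h3 : 'C(m.*2.+1, m) = 'C(m.*2.+1, m.+1).
  by rewrite -[in RHS]bin_sub; [congr 'C(_, _); lia|lia].
 have -> : 'C(m.+1.*2, m.+1) = 2 * 'C(m.*2.+1, m.+1) by rewrite doubleS binS h3; lia.
 by move: h1; move: 'C(_, _) 'C(_, _) => a b; nia.
have e3 : m.+1.*2.+1 = m.*2 + 3 by lia.
have : ('C(m.+1.*2, m.+1) * m.+1) ^ 2 * (m.*2 + 3) <= 16 * 4 ^ m.*2 * m.+1 ^ 2.
 rewrite h; set c := 'C(_, _) in ih *.
 have : 4 * m.*2.+1 * (m.*2 + 3) <= 16 * m.+1 ^ 2 by rewrite -mulnn; nia.
 move=> h'; apply: (@leq_trans (c ^ 2 * m.*2.+1 * (4 * m.*2.+1 * (m.*2 + 3)))).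
  by apply/eq_leq; rewrite !expnMn -!mulnn; ring.
 by rewrite (mulnC 16) -[leqRHS]mulnA leq_mul.
rewrite e3 expnMn mulnAC leq_pmul2r ?expn_gt0//.
by rewrite doubleS !expnS; lia.
Qed.

Lemma central_bin_half n : 'C(n, n./2) ^ 2 * n <= 4 ^ n.
Proof.
have [m nE] : exists m, n = m.*2 \/ n = m.*2.+1 by exists n./2; lia.
case: nE => ->.
 have -> : m.*2./2 = m by lia.
 by apply: leq_trans (central_bin m); rewrite leq_mul2l leqnSn orbT.
have -> : m.*2.+1./2 = m by lia.
have h := central_bin m.+1.
have h2 : 'C(m.+1.*2, m.+1) = 2 * 'C(m.*2.+1, m).
 rewrite doubleS binS; have -> : 'C(m.*2.+1, m.+1) = 'C(m.*2.+1, m); last lia.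
 by rewrite -bin_sub; [congr 'C(_, _); lia|lia].
move: h; rewrite h2 doubleS expnMn (expnS 4 m.*2.+1).
by set c := 'C(_, _); nia.
Qed.

End sperner.

(** * Littlewood-Offord inequality on the line *)

Section littlewood_offord_real.
Local Open Scope set_scope.
Local Notation set0 := finset.set0.
Context {R : realType}.
Variables (c dl : R).
Hypothesis dl0 : 0 < dl.

Fixpoint hits (l : seq R) (x : R) : nat :=
 if l is a :: l' then (hits l' x + hits l' (x + a)%R)%N
 else nat_of_bool ((c <= x) && (x < c + dl)).

(** The doubling step of symmetric chain decompositions: [s] together with its translate by [a] is
    regrouped into [s] extended by its last element plus [a], and the translate of the other
    elements. Both remain [dl]-separated, and their lengths follow the recurrence of [nchains]. With
    no steps left, a half-open window of length [dl] contains at most one point of a chain. *)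
Lemma hits_chain (l s : seq R) : all (fun a => dl <= a) l ->
 pairwise (fun x y => x + dl <= y) s ->
 (\sum_(x <- s) hits l x <= nchains (size s) (size l))%N.
Proof.
elim: l s => [|a l ih] s /=.
 move=> _; elim: s => [|x s ihs]; first by rewrite big_nil.
 move=> /= /andP[xs ss]; rewrite big_cons nchains_n0//.
 have [/andP[cx xc]|_] := boolP ((c <= x) && (x < c + dl)); last first.
  rewrite add0n; have := ihs ss; case: (s) => [|y t]; first by rewrite big_nil.
  by rewrite nchains_n0.
 rewrite big_seq big1// => y ys; move/allP : xs => /(_ _ ys) h.
 have h2 : c + dl <= y by apply: le_trans h; rewrite lerD2r.
 by rewrite [X in _ && X]ltNge h2 andbF.
move=> /andP[da dl']; case/lastP: s => [|s x]; first by rewrite big_nil.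
move=> ss; rewrite big_split /= nchainsS ?size_rcons//= addnC.
have -> : (\sum_(y <- rcons s x) hits l (y + a)%R = \sum_(y <- [seq (y + a)%R | y <- s]) hits l y + hits l (x + a)%R)%N.
 by rewrite -cats1 big_cat big_seq1 big_map.
rewrite -addnA addnC; apply: leq_add; last first.
 rewrite -(size_map (fun y => y + a)); apply: ih => //.
 move: ss; rewrite pairwise_map pairwise_rcons => /andP[_]; apply: sub_pairwise => y z /= h.
 by rewrite addrAC lerD2r.
rewrite -(size_rcons _ x) -(size_rcons _ (x + a)).
have -> : (hits l (x + a)%R + \sum_(y <- rcons s x) hits l y = \sum_(y <- rcons (rcons s x) (x + a)%R) hits l y)%N.
 by rewrite -[in RHS]cats1 big_cat big_seq1 addnC.
apply: ih => //; rewrite pairwise_rcons ss andbT all_rcons lerD2l da /=.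
move: ss; rewrite pairwise_rcons => /andP[/allP h _]; apply/allP => y /h hy.
by apply: le_trans hy _; rewrite lerDl (le_trans (ltW dl0)).
Qed.

(** Exchanging the two choices for a negative [a] replaces it by [|a|] and moves the starting point
    by [a]. *)
Lemma hits_le (l : seq R) x : all (fun a => dl <= `|a|) l ->
 (hits l x <= 'C(size l, (size l)./2))%N.
Proof.
move=> ha; have -> : hits l x = hits [seq `|a| | a <- l] (x + \sum_(a <- l) Num.min a 0).
 elim: l x {ha} => [|a l ih] x /=; first by rewrite big_nil addr0.
 rewrite big_cons; have [a0|a0] := leP 0 a.
  by rewrite ger0_norm// add0r !ih addrAC.
 rewrite ltr0_norm// !ih addnC; congr (hits _ _ + hits _ _)%N; first by rewrite addrA.
 by rewrite addrA addrAC addrK.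
have := @hits_chain [seq `|a| | a <- l] [:: x + \sum_(a <- l) Num.min a 0].
by rewrite big_seq1 /= size_map nchains1; apply => //; rewrite all_map.
Qed.

Lemma hits_cat (l1 l2 : seq R) x (b : nat) : (forall y, (hits l2 y <= b)%N) ->
 (hits (l1 ++ l2) x <= 2 ^ size l1 * b)%N.
Proof.
move=> hb; elim: l1 x => [|a l ih] x /=; first by rewrite mul1n.
by have := ih x; have := ih (x + a); rewrite expnS; lia.
Qed.

Lemma card_subset_hits (I : finType) (alpha : I -> R) (s : seq I) x : uniq s ->
 #|[set E : {set I} | (E \subset s) &&
   (c <= x + \sum_(i in E) alpha i) && (x + \sum_(i in E) alpha i < c + dl)]| =
 hits [seq alpha i | i <- s] x.
Proof.
elim: s x => [|i s ih] x /= us.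
 rewrite (_ : finset _ = if (c <= x) && (x < c + dl) then [set set0] else set0).
  by case: ifP => _; rewrite ?cards1 ?cards0.
 apply/setP => E; rewrite inE; have -> : (E \subset [::]) = (E == set0).
  by by rewrite -finset.subset0; apply: eq_subset_r => y; rewrite in_nil finset.in_set0.
 case: eqVneq => [->|E0] /=; first by rewrite big_set0 addr0; case: ifP; rewrite !inE ?eqxx.
 by case: ifP; rewrite !inE// (negbTE E0).
move: us => /andP[is_ us]; rewrite -!ih//.
set A := finset _; rewrite -(cardsID [set E : {set I} | i \in E] A) addnC; congr (_ + _)%N.
 apply: eq_card => E; rewrite !inE; have [iE|iE] /= := boolP (i \in E).
  by apply/esym/negbTE; rewrite -!andbA; apply: contra is_ => /and3P[/fintype.subsetP h _ _]; exact: h.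
 congr (_ && _ && _); apply/idP/idP => [/fintype.subsetP h|/fintype.subsetP h]; apply/fintype.subsetP => y yE.
  by have := h y yE; rewrite inE => /orP[/eqP yi|//]; rewrite -yi yE in iE.
 by rewrite inE h ?orbT.
rewrite -(card_in_imset (f := fun E => i |: E) (D := mem [set E : {set I} | (E \subset s) &&
   (c <= x + alpha i + \sum_(i in E) alpha i) && (x + alpha i + \sum_(i in E) alpha i < c + dl)])); last first.
 move=> E F; rewrite !inE => /andP[/andP[/fintype.subsetP hE _] _] /andP[/andP[/fintype.subsetP hF _] _] EF.
 have iE : i \notin E by apply: contra is_ => /hE.
 have iF : i \notin F by apply: contra is_ => /hF.
 by rewrite -(finset.setU1K iE) -(finset.setU1K iF) EF.
apply: eq_card => E; rewrite !inE; apply/idP/imsetP.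
 move=> /andP[/andP[/andP[/fintype.subsetP hE h1] h2] iE]; exists (E :\ i); last by rewrite finset.setD1K.
 move: h1 h2; rewrite !inE (big_setD1 i iE) /= !addrA => -> ->; rewrite !andbT.
 apply/fintype.subsetP => y; rewrite !inE => /andP[yi yE]; have := hE y yE.
 by rewrite inE (negbTE yi).
move=> [F]; rewrite !inE => /andP[/andP[/fintype.subsetP hF h1] h2] ->.
have iF : i \notin F by apply: contra is_ => /hF.
rewrite big_setU1//= !addrA h1 h2 finset.setU11 !andbT; apply/fintype.subsetP => y.
by rewrite !inE => /orP[->//|/hF ->]; rewrite orbT.
Qed.

Lemma card_littlewood_offord (I : finType) (alpha : I -> R) (V : {set I}) :
 (forall i, i \in V -> dl <= `|alpha i|) ->
 (#|[set E : {set I} | (c <= \sum_(i in E) alpha i < c + dl)%R]|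
   <= 2 ^ (#|I| - #|V|) * 'C(#|V|, #|V|./2))%N.
Proof.
(* Indices outside [V] come first, where [hits_cat] charges each of them a factor [2]. *)
move=> hV; pose s := enum (~: V) ++ enum V.
have us : uniq s.
 rewrite cat_uniq !enum_uniq /= andbT; apply/hasPn => y; rewrite !mem_enum inE => ->.
 by [].
have ss y : y \in s by rewrite mem_cat !mem_enum inE orNb.
have := card_subset_hits alpha 0 us.
rewrite (_ : finset _ = [set E : {set I} | (c <= \sum_(i in E) alpha i < c + dl)%R]); last first.
 by apply/setP => E; rewrite !inE add0r (introT fintype.subsetP)// => y _; exact: ss.
move=> ->; rewrite map_cat.
have hb y : (hits [seq alpha i | i <- enum V] y <= 'C(#|V|, #|V|./2))%N.
 have := @hits_le [seq alpha i | i <- enum V] y; rewrite size_map -cardE; apply.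
 by rewrite all_map; apply/allP => i; rewrite mem_enum; exact: hV.
apply: leq_trans (hits_cat _ _ hb) _.
by rewrite size_map -cardE cardsCs finset.setCK.
Qed.

End littlewood_offord_real.

(** * Littlewood-Offord inequality on the cube, with coincidences *)

Section cube_littlewood_offord.
Local Open Scope set_scope.
Context {R : realType}.
Local Notation C := R[i].
Variables (I : finType) (a : I -> C).

Definition subset_sum (E : {set I}) : C := \sum_(i in E) a i.

Definition cube_count (D : pred C) : R := \sum_(E : {set I}) (D (subset_sum E))%:R.

(* Exponential Markov with weight [q ^ (4 * #|E :&: L|)], [q = 4/5]. *)
Lemma small_trace_count (L : {set I}) :
 \sum_(E : {set I}) (4 * #|E :&: L| < #|L|)%N%:R <= 2 ^+ #|I| * (9 / 10) ^+ #|L| :> R.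
Proof.
pose q : R := 4 / 5; pose F i : R := if i \in L then q ^+ 4 else 1.
have q0 : 0 < q by rewrite /q; lra.
have q1 : q <= 1 by rewrite /q; lra.
have FE (E : {set I}) : \prod_i (if i \in E then F i else 1) = q ^+ (4 * #|E :&: L|).
 rewrite exprM -prodr_const -big_mkcond /= [in RHS](eq_bigl (fun i => (i \in E) && (i \in L))) => [|i].
  by rewrite -big_mkcondr.
 by rewrite inE.
have h : \sum_(E : {set I}) q ^+ (4 * #|E :&: L|) = \prod_i (F i + 1).
 by rewrite bigA_distr; apply: eq_bigr => E _; rewrite -FE.
have h2 : \prod_i (F i + 1) <= 2 ^+ #|I| * (q * (9 / 10)) ^+ #|L|.
 have -> : 2 ^+ #|I| * (q * (9 / 10)) ^+ #|L| = \prod_i (2 * (if i \in L then q * (9 / 10) else 1)).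
  by rewrite big_split /= prodr_const -big_mkcond prodr_const.
 apply: ler_prod => i _; rewrite /F; case: ifP => _; last by lra.
 by rewrite addr_ge0 ?exprn_ge0 ?ltW//= /q; lra.
have ql : 0 < q ^+ #|L| by rewrite exprn_gt0.
rewrite -(ler_pM2r ql) mulr_suml.
apply: (@le_trans _ _ (\sum_(E : {set I}) q ^+ (4 * #|E :&: L|))).
 apply: ler_sum => E _; case: ltnP => hE; last by rewrite mul0r exprn_ge0// ltW.
 by rewrite mul1r; apply: ler_wiXn2l; [exact: ltW|by []|exact: ltnW].
by rewrite h (le_trans h2)// exprMn -mulrA (mulrC (q ^+ _)).
Qed.

Lemma cube_count_remove (D : pred C) j :
 \sum_(E : {set I} | j \in E) (D (subset_sum E))%:R <= cube_count (fun z => D (z + a j)).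
Proof.
rewrite /cube_count (reindex_onto (fun E : {set I} => j |: E) (fun E => E :\ j)) /=; last first.
 by move=> E jE; rewrite finset.setD1K.
rewrite [X in _ <= X](bigID (fun E => (j \in j |: E) && ((j |: E) :\ j == E))) /=.
rewrite ler_wpDr ?sumr_ge0//; apply: ler_sum => E /andP[_ /eqP hE].
have jE : j \notin E by rewrite -hE !inE eqxx.
by rewrite /subset_sum big_setU1//= addrC.
Qed.

(* A set meeting [L] in at least a quarter of its points has many choices of a
  last element of [L]. *)
Lemma cube_count_last (D : pred C) (L : {set I}) : (0 < #|L|)%N ->
 cube_count D <= 2 ^+ #|I| * (9 / 10) ^+ #|L| +
  4 / #|L|%:R * \sum_(j in L) cube_count (fun z => D (z + a j)).
Proof.
move=> L0; have l0 : 0 < #|L|%:R :> R by rewrite ltr0n.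
apply: (@le_trans _ _ (\sum_(E : {set I}) ((4 * #|E :&: L| < #|L|)%N%:R +
  4 / #|L|%:R * \sum_(j in L) (j \in E)%:R * (D (subset_sum E))%:R))).
 apply: ler_sum => E _; rewrite -mulr_suml.
 have -> : \sum_(j in L) (j \in E)%:R = #|E :&: L|%:R :> R.
  rewrite -natr_sum; congr (_%:R); rewrite -sum1_card [RHS]big_mkcond /= big_mkcond /=.
  by apply: eq_bigr => i _; rewrite inE; do 2 case: (_ \in _).
 case: (D _); last by rewrite !mulr0 addr0.
 rewrite mulr1; case: ltnP => h; first by rewrite lerDl mulr_ge0// divr_ge0.
 rewrite add0r mulrAC ler_pdivlMr// mul1r -natrM ler_nat; exact: h.
rewrite big_split /= lerD ?small_trace_count//.
rewrite -mulr_sumr ler_wpM2l ?divr_ge0// exchange_big /=; apply: ler_sum => j _.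
apply: le_trans (cube_count_remove D j); rewrite [X in _ <= X]big_mkcond /=.
by apply: ler_sum => E _; case: (_ \in _); rewrite ?mul1r ?mul0r.
Qed.

(** Removes the minimum [k] times. The threshold [m] separates small coefficients, from which the
    last summand is chosen, from large ones, to which the one-dimensional inequality applies. *)
Lemma median_split (f : I -> R) (J : {set I}) k : (k < #|J|)%N ->
 exists L : {set I}, exists2 m : R, L \subset J /\ #|L| = k &
  [/\ (forall i, i \in L -> f i <= m), (forall i, i \in J :\: L -> m <= f i) &
    exists2 i, i \in J & m = f i].
Proof.
elim: k => [|k ih] kJ.
 have [i0 iJ] : exists i, i \in J by apply/set0Pn; rewrite -card_gt0.
 have [i iJ' hi] := arg_minP f iJ.
 exists (finset.set0), (f i); first by rewrite finset.sub0set cards0.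
 split; [by move=> ?; rewrite inE|by move=> j; rewrite !inE => /andP[_ /hi]|by exists i].
have [L [m [LJ Lk] [h1 h2 h3]]] := ih (ltnW kJ).
have /card_gt0P [i0 iJ] : (0 < #|J :\: L|)%N by rewrite cardsD (finset.setIidPr LJ) Lk subn_gt0 ltnW.
have [i iJ' hi] := arg_minP f iJ; have iJ2 : i \in J :\: L := iJ'; move: (iJ2); rewrite inE => /andP[iL iJJ].
have /card_gt0P [j0 jJ] : (0 < #|J :\: (i |: L)|)%N.
 rewrite cardsD (finset.setIidPr _) ?cardsU1 ?iL ?Lk ?subn_gt0//.
 by rewrite finset.subUset LJ finset.sub1set iJJ.
have [j jJ' hj] := arg_minP f jJ; have jJ2 : j \in J :\: (i |: L) := jJ'.
have jJL : j \in J :\: L by move: jJ2; rewrite !inE negb_or -andbA => /and3P[_ -> ->].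
exists (i |: L), (f j).
 by rewrite finset.subUset LJ finset.sub1set iJJ cardsU1 iL Lk.
split; last by exists j => //; move: jJ2; rewrite inE => /andP[].
 by move=> x; rewrite !inE => /orP[/eqP ->|/h1 h]; [exact: hi|rewrite (le_trans h)// h2].
by move=> x /hj.
Qed.

Local Notation disc c e := (fun z : C => sqnorm (z - c) <= e).

Lemma eq_ler (x y : R) : x = y -> x <= y. Proof. by move=> ->. Qed.

Lemma second_moment_balance (l N B rho : R) : l != 0 -> N != 0 ->
 4 / l * (4 * N / l / 2 * B + (2 * (4 * N / l))^-1 * (N * rho)) = 8 * N / l ^+ 2 * B + rho / 2.
Proof. by move=> l0 N0; field; rewrite l0. Qed.

Lemma sqnormB_le (z w : C) : sqnorm (z - w) <= 2 * sqnorm z + 2 * sqnorm w.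
Proof.
rewrite /sqnorm ReB ImB -subr_ge0.
have -> : 2 * (Re z ^+ 2 + Im z ^+ 2) + 2 * (Re w ^+ 2 + Im w ^+ 2) -
 ((Re z - Re w) ^+ 2 + (Im z - Im w) ^+ 2) = (Re z + Re w) ^+ 2 + (Im z + Im w) ^+ 2 by ring.
by rewrite addr_ge0 ?sqr_ge0.
Qed.

(** Shifted discs arise in the second moment; a maximizing centre bounds all of them by one
    quantity, which is absorbed at the end. The maximum exists because the counts are integers
    between [0] and the number of subsets. *)
Lemma cube_count_disc_exists_max e : exists c0, forall c,
 cube_count (disc c e) <= cube_count (disc c0 e).
Proof.
pose cnt c := #|[set E : {set I} | sqnorm (subset_sum E - c) <= e]|.
have cntE c : cube_count (disc c e) = (cnt c)%:R.
 rewrite /cnt -sum1_card natr_sum [RHS]big_mkcond /=; apply: eq_bigr => E _.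
 by rewrite inE; case: (_ <= _).
have ex : exists k, `[< exists c, cnt c = k >] by exists (cnt 0); apply/asboolP; exists 0.
have bd k : `[< exists c, cnt c = k >] -> (k <= #|{set I}|)%N.
 by move=> /asboolP[c <-]; exact: max_card.
have [k /asboolP[c0 h0] hk] := ex_maxnP ex bd.
exists c0 => c; rewrite !cntE ler_nat h0; apply: hk; apply/asboolP; by exists c.
Qed.

(** For each [E] let [m E] count the [j] in [L] whose addition brings the sum into the disc. It is
    nonzero only when the sum lies in the larger disc, and [m <= x / 2 + m ^ 2 / (2 x)]. In [m ^ 2]
    only pairs with close coefficients can both hit, and each such pair contributes at most the
    maximal count. *)
Lemma cube_count_disc_second_moment (e r : R) (c c0 : C) (L : {set I}) (x : R) :
 0 < x -> e <= r -> (forall i, i \in L -> sqnorm (a i) <= r) ->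
 (forall c, cube_count (disc c e) <= cube_count (disc c0 e)) ->
 \sum_(j in L) cube_count (fun z => disc c e (z + a j)) <=
  x / 2 * cube_count (disc c (4 * r)) +
  (2 * x)^-1 * (#|[set p : I * I | [&& p.1 \in L, p.2 \in L &
    sqnorm (a p.1 - a p.2) <= 4 * e]]|%:R * cube_count (disc c0 e)).
Proof.
move=> x0 er hL hmax.
pose hit E j : R := ((sqnorm (subset_sum E + a j - c) <= e)%R : bool)%:R.
pose m E := \sum_(j in L) hit E j.
pose W E : R := ((sqnorm (subset_sum E - c) <= 4 * r)%R : bool)%:R.
have -> : \sum_(j in L) cube_count (fun z => disc c e (z + a j)) = \sum_E m E by rewrite exchange_big.
have hitW E j : j \in L -> hit E j = hit E j * W E.
 move=> jL; rewrite /hit /W; case: leP => h; rewrite ?mul0r// mul1r.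
 have -> : subset_sum E - c = (subset_sum E + a j - c) - a j by ring.
 rewrite (le_trans (sqnormB_le _ _))//; have := hL _ jL; lra.
have mW E : m E = m E * W E by rewrite mulr_suml; apply: eq_bigr => j; exact: hitW.
have hm E : m E <= x / 2 * W E + (2 * x)^-1 * m E ^+ 2.
 rewrite mW exprMn; have W2 : W E ^+ 2 = W E by rewrite /W; case: (_ <= _); rewrite expr2 ?mulr1 ?mulr0.
 rewrite W2 -subr_ge0.
 have -> : x / 2 * W E + (2 * x)^-1 * (m E ^+ 2 * W E) - m E * W E = W E * (2 * x)^-1 * (m E - x) ^+ 2.
  by field; lra.
 apply: mulr_ge0; last exact: sqr_ge0.
 by rewrite divr_ge0 ?mulr_ge0 ?(ltW x0)//= /W ler0n.
apply: (le_trans (ler_sum _ (fun E _ => hm E))).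
rewrite big_split /= -[X in X + _]mulr_sumr -[X in _ + X]mulr_sumr; apply: lerD => //.
apply: ler_wpM2l; first by rewrite invr_ge0 mulr_ge0 ?(ltW x0).
rewrite (eq_bigr (fun E => \sum_(i in L) \sum_(j in L) hit E i * hit E j)) => [|E _]; last first.
 by rewrite expr2 mulr_suml; apply: eq_bigr => i _; rewrite mulr_sumr.
rewrite exchange_big /= -sum1_card natr_sum mulr_suml.
rewrite (eq_bigl (fun p : I * I => (p.1 \in L) && ((p.2 \in L) && (sqnorm (a p.1 - a p.2) <= 4 * e)))); last first.
 by move=> p; rewrite inE.
rewrite -(pair_big_dep (fun i => i \in L) (fun i j => (j \in L) && (sqnorm (a i - a j) <= 4 * e))
 (fun _ _ => 1%:R * cube_count (disc c0 e))) /=.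
apply: ler_sum => i iL; rewrite exchange_big /= big_mkcondr /=; apply: ler_sum => j jL.
have [hij|hij] := leP (sqnorm (a i - a j)) (4 * e).
 rewrite mul1r; apply: le_trans (hmax (c - a i)).
 apply: ler_sum => E _; rewrite /hit.
 have -> : subset_sum E - (c - a i) = subset_sum E + a i - c by ring.
 by case: (sqnorm (subset_sum E + a i - c) <= e); case: (sqnorm (subset_sum E + a j - c) <= e); rewrite ?mul1r ?mul0r.
rewrite big1// => E _; rewrite /hit.
have [hi|hi] := leP (sqnorm (subset_sum E + a i - c)) e; rewrite ?mul0r//.
have [hj|hj] := leP (sqnorm (subset_sum E + a j - c)) e; rewrite ?mulr0//.
have := sqnormB_le (subset_sum E + a i - c) (subset_sum E + a j - c).
have -> : subset_sum E + a i - c - (subset_sum E + a j - c) = a i - a j by ring.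
by lra.
Qed.

(* Erdos-Littlewood-Offord for whichever of the real and imaginary parts is
  large for at least half of the indices. *)
Lemma cube_count_disc_erdos (U : {set I}) (r : R) c : 0 < r -> (0 < #|U|)%N ->
 (forall i, i \in U -> r <= sqnorm (a i)) ->
 cube_count (disc c (4 * r)) <= 2 ^+ #|I| * (12 / sqrt #|U|%:R).
Proof.
move=> r0 U0 hU.
pose dl := sqrt (r / 2); have dl0 : 0 < dl by rewrite sqrtr_gt0 divr_gt0.
have dl2 : dl ^+ 2 = r / 2 by rewrite sqr_sqrtr// divr_ge0// ltW.
clearbody dl.
have key (p : C -> R) (V : {set I}) : (forall E, p (subset_sum E) = \sum_(i in E) p (a i)) ->
  (forall i, i \in V -> r / 2 <= p (a i) ^+ 2) -> (forall z, p (z - c) = p z - p c) ->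
  (forall z, p z ^+ 2 <= sqnorm z) -> (#|U| <= 2 * #|V|)%N ->
  cube_count (disc c (4 * r)) <= 2 ^+ #|I| * (12 / sqrt #|U|%:R).
 move=> pS pV pB ps UV.
 have V0 : (0 < #|V|)%N by lia.
 (* [(t - p c) ^ 2 <= 4 r = 8 dl ^ 2] is less than [(3 dl) ^ 2], so six windows of length [dl] cover
    the possible values. *)
 pose w (k : nat) := p c - 3 * dl + dl *+ k.
 have h1 : cube_count (disc c (4 * r)) <= \sum_(k < 6)
   #|[set E : {set I} | (w k <= \sum_(i in E) p (a i) < w k + dl)%R]|%:R.
  rewrite -natr_sum.
  rewrite (eq_bigr (fun k : 'I_6 => \sum_(E : {set I}) nat_of_bool (w k <= \sum_(i in E) p (a i) < w k + dl)%R)%N); last first.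
   by move=> k _; rewrite -sum1_card big_mkcond /=; apply: eq_bigr => E _; rewrite inE; case: (_ <= _ < _).
  rewrite exchange_big /= natr_sum; apply: ler_sum => E _.
  have [hE|_] := leP (sqnorm (subset_sum E - c)) (4 * r); last exact: ler0n.
  rewrite ler_nat; under eq_bigr do rewrite -pS; set t := p _.
  have ht : (t - p c) ^+ 2 <= 8 * dl ^+ 2.
   by rewrite dl2 -pB (le_trans (ps _))//; apply: le_trans hE _; lra.
  have t1 : - (3 * dl) <= t - p c by rewrite leNgt; apply/negP => h; nra.
  have t2 : t - p c < 3 * dl by rewrite ltNge; apply/negP => h; nra.
  have hk (k : 'I_6) : (w k <= t < w k + dl) ->
    (1 <= \sum_(k < 6) nat_of_bool (w k <= t < w k + dl)%R)%N.
   by move=> h; rewrite (bigD1 k)//= h.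
  have hw : forall k : nat, w k = p c - 3 * dl + dl *+ k by [].
  have [?|?] := ltP t (p c - 2 * dl).
   by apply: (hk (@Ordinal 6 0 isT)); rewrite hw /=; apply/andP; split; lra.
  have [?|?] := ltP t (p c - dl).
   by apply: (hk (@Ordinal 6 1 isT)); rewrite hw /=; apply/andP; split; lra.
  have [?|?] := ltP t (p c).
   by apply: (hk (@Ordinal 6 2 isT)); rewrite hw /=; apply/andP; split; lra.
  have [?|?] := ltP t (p c + dl).
   by apply: (hk (@Ordinal 6 3 isT)); rewrite hw /=; apply/andP; split; lra.
  have [?|?] := ltP t (p c + 2 * dl).
   by apply: (hk (@Ordinal 6 4 isT)); rewrite hw /=; apply/andP; split; lra.
  by apply: (hk (@Ordinal 6 5 isT)); rewrite hw /=; apply/andP; split; lra.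
 apply: (le_trans h1).
 have h2 (k : 'I_6) : #|[set E : {set I} | (w k <= \sum_(i in E) p (a i) < w k + dl)%R]|%:R <= 2 ^+ #|I| * (2 / sqrt #|U|%:R) :> R.
  apply: (@le_trans _ _ (2 ^ (#|I| - #|V|) * 'C(#|V|, #|V|./2))%:R).
   rewrite ler_nat; apply: card_littlewood_offord => // i /pV hi.
   by rewrite -(ler_pXn2r (n:=2)) ?nnegrE ?(ltW dl0)// dl2 real_normK ?num_real.
  have VI : (#|V| <= #|I|)%N by exact: max_card.
  have c4 : ('C(#|V|, #|V|./2)%:R : R) <= 2 ^+ #|V| * (2 / sqrt #|U|%:R).
   rewrite mulrA ler_pdivlMr ?sqrtr_gt0 ?ltr0n//.
   rewrite -(ler_pXn2r (n:=2)) ?nnegrE ?mulr_ge0 ?sqrtr_ge0 ?exprn_ge0//.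
   rewrite exprMn sqr_sqrtr// -!natrX -!natrM -natrX ler_nat.
   have := central_bin_half #|V|; rewrite (_ : 4 = 2 ^ 2)%N// (expnAC 2 2) => hc.
   have : ('C(#|V|, #|V|./2) ^ 2 * #|U| <= 'C(#|V|, #|V|./2) ^ 2 * (2 * #|V|))%N by rewrite leq_mul2l UV orbT.
   by rewrite expnMn; lia.
  rewrite natrM natrX -{2}(subnK VI) exprD -mulrA ler_wpM2l// exprn_ge0//.
 apply: (le_trans (ler_sum _ (fun k _ => h2 k))).
 by rewrite sumr_const card_ord -mulrnAr -mulrnAl -[2 *+ 6]mulr_natr -natrM.
pose V1 := [set i in U | r / 2 <= Re (a i) ^+ 2]; pose V2 := [set i in U | r / 2 <= Im (a i) ^+ 2].
have UV : (#|U| <= #|V1| + #|V2|)%N.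
 apply: leq_trans (leq_card_setU V1 V2); apply: subset_leq_card; apply/fintype.subsetP => i iU.
 rewrite !inE iU /=; have := hU _ iU; rewrite /sqnorm => h; case: leP => //= h1.
 by lra.
have [h|h] := leqP #|U| (2 * #|V1|).
 apply: (key (@complex.Re R) V1) => //.
 - by move=> E; rewrite /subset_sum; exact: (big_morph _ ReD erefl).
 - by move=> i; rewrite inE => /andP[].
 - by move=> z; rewrite ReB.
 - by move=> z; rewrite /sqnorm lerDl sqr_ge0.
apply: (key (@complex.Im R) V2) => //; last lia.
- by move=> E; rewrite /subset_sum; exact: (big_morph _ ImD erefl).
- by move=> i; rewrite inE => /andP[].
- by move=> z; rewrite ImB.
- by move=> z; rewrite /sqnorm lerDr sqr_ge0.
Qed.

(** The factor [l ^ (-1/2)] of the one-dimensional inequality for the large coefficients is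
    multiplied by [l ^ -2] times the number of coincidences, a gain from choosing the last summand
    among the [l] small ones. The maximal count reappears on the right with factor [1/2] and is
    absorbed. With diagonal coincidences only, the bound is of order [l ^ (-3/2)]. *)
Lemma cube_littlewood_offord (J : {set I}) (e : R) c : 0 < e -> (1 < #|J|)%N ->
 (forall j, j \in J -> e <= sqnorm (a j)) ->
 cube_count (disc c e) <= 2 ^+ #|I| *
  (192 * #|[set p : I * I | [&& p.1 \in J, p.2 \in J &
    sqnorm (a p.1 - a p.2) <= 4 * e]]|%:R / (#|J|./2%:R ^+ 2 * sqrt #|J|./2%:R)
   + 2 * (9 / 10) ^+ #|J|./2).
Proof.
move=> e0 J1 hJ.
have hJ2 : (#|J|./2 < #|J|)%N by lia.
have [L [r [LJ Ll] [hL hU [i0 i0J rE]]]] := median_split (fun i => sqnorm (a i)) hJ2.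
have er : e <= r by rewrite rE hJ.
have [c0 hc0] := cube_count_disc_exists_max e.
set N := #|[set p : I * I | _]|; set l := #|J|./2 in Ll *.
have l0 : (0 < l)%N by rewrite /l; lia.
pose NL := #|[set p : I * I | [&& p.1 \in L, p.2 \in L & sqnorm (a p.1 - a p.2) <= 4 * e]]|.
have NLN : (NL <= N)%N.
 apply: subset_leq_card; apply/fintype.subsetP => p; rewrite !inE => /and3P[h1 h2 ->].
 by rewrite (fintype.subsetP LJ _ h1) (fintype.subsetP LJ _ h2).
have NL0 : (0 < NL)%N.
 have /card_gt0P[j jL] : (0 < #|L|)%N by rewrite Ll.
 apply/card_gt0P; exists (j, j); rewrite inE /= jL subrr sqnorm0 /=; apply: mulr_ge0 => //; exact: ltW.
have UL : (l <= #|J :\: L|)%N by rewrite cardsD (finset.setIidPr LJ) Ll /l; lia.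
have l0R : 0 < l%:R :> R by rewrite ltr0n.
have NL0R : 0 < NL%:R :> R by rewrite ltr0n.
(* The weight for which the maximal count comes back with coefficient exactly [1/2]. *)
pose x : R := 4 * NL%:R / l%:R.
have x0 : 0 < x by rewrite /x divr_gt0 ?mulr_gt0 ?ltr0n.
have s1 := @cube_count_last (disc c0 e) L; rewrite Ll in s1; have {}s1 := s1 l0.
have s2 := cube_count_disc_second_moment c0 x0 er hL hc0; rewrite -/NL in s2.
have s3 := @cube_count_disc_erdos (J :\: L) r c0 (lt_le_trans e0 er) (leq_trans l0 UL) hU.
apply: le_trans (hc0 c) _; set rho := cube_count _ in s1 s2 *.
set S := \sum_(j in L) _ in s1 s2; set B := cube_count _ in s2 s3; set q := (9 / 10) ^+ l in s1 *.
set t := 2 ^+ #|I| in s1 s3 *.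
have t0 : 0 < t by rewrite exprn_gt0.
have E1 := second_moment_balance B rho (lt0r_neq0 l0R) (lt0r_neq0 NL0R).
clearbody t. have B0 : 0 <= B by rewrite sumr_ge0.
clearbody S B rho q.

have h4 : 4 / l%:R * S <= 8 * NL%:R / l%:R ^+ 2 * B + rho / 2.
 apply: (@le_trans _ _ (4 / l%:R * (x / 2 * B + (2 * x)^-1 * (NL%:R * rho)))).
  by rewrite ler_wpM2l ?divr_ge0.
 by rewrite -E1 /x.
have sl : sqrt l%:R <= sqrt #|J :\: L|%:R :> R by rewrite ler_wsqrtr// ler_nat.
have sl0 : 0 < sqrt l%:R :> R by rewrite sqrtr_gt0.
have hB : B <= t * (12 / sqrt l%:R).
 apply: le_trans s3 _; apply: ler_wpM2l; first exact: ltW.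
 by apply: ler_wpM2l => //; rewrite lef_pV2// posrE// (lt_le_trans sl0).
have h5 : 8 * NL%:R / l%:R ^+ 2 * B <= t * (96 * N%:R / (l%:R ^+ 2 * sqrt l%:R)).
 apply: (@le_trans _ _ (8 * N%:R / l%:R ^+ 2 * (t * (12 / sqrt l%:R)))).
  apply: ler_pM => //.
  apply: ler_wpM2r; first by rewrite invr_ge0 exprn_ge0.
  by apply: ler_wpM2l; rewrite ?ler_nat.
 by apply: eq_ler; field; rewrite !gt_eqF.
have -> : t * (192 * N%:R / (l%:R ^+ 2 * sqrt l%:R) + 2 * q) =
 2 * (t * (96 * N%:R / (l%:R ^+ 2 * sqrt l%:R))) + 2 * (t * q).
 by field; rewrite !gt_eqF.
by lra.
Qed.

End cube_littlewood_offord.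

(** * Probabilities of Boolean events *)

Section events.
Context {R : realType} {d} {T : measurableType d} (P : probability T R).

Lemma meas_natr_bool (b : T -> bool) : mble b ->
 mble (fun w => (b w)%:R : R).
Proof.
move=> mb; rewrite (_ : (fun w => _) = (fun w => if b w then 1 else 0)).
 exact: measurable_fun_ifT.
by apply/funext => w; case: (b w).
Qed.

Lemma meas_set_bool (b : T -> bool) : mble b ->
 measurable [set w | b w].
Proof.
move=> mb; rewrite (_ : [set w | b w] = setT `&` b @^-1` [set true]); first exact: mb.
by rewrite setTI; apply/seteqP; split.
Qed.

Lemma prob_bool (b : T -> bool) : mble b ->
 P [set w | b w] = (\int[P]_w ((b w)%:R)%:E)%E.
Proof.
move=> mb; rewrite -[X in P X]setIT -integral_indic//; last exact: meas_set_bool.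
apply: eq_integral => w _; rewrite indicE; congr ((nat_of_bool _)%:R%:E).
by apply/idP/idP; rewrite inE.
Qed.

Lemma int_sum (I : finType) (f : I -> T -> R) : (forall i, mble (f i)) ->
 (forall i w, 0 <= f i w) ->
 (\int[P]_w (\sum_i f i w)%:E = \sum_i \int[P]_w (f i w)%:E)%E.
Proof.
move=> mf f0; under eq_integral do rewrite -sumEFin.
by rewrite ge0_integral_sum// => [i|i w _]; [exact/mble_EFinP|rewrite lee_fin].
Qed.

Lemma prob_fine (A : set T) : measurable A -> P A = (fine (P A))%:E.
Proof. by move=> mA; rewrite fineK// fin_num_measure. Qed.

Lemma prod_prob_le {d'} {T' : measurableType d'} (P' : probability T' R)
  (A : set (T * T')) (c : R) : measurable A ->
 (forall x, P' [set y | A (x, y)] <= c%:E)%E -> ((P \x P') A <= c%:E)%E.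
Proof.
move=> mA h; rewrite /product_measure1 /=.
apply: (@le_trans _ _ (\int[P]_x c%:E)%E); last by rewrite int_cst.
apply: ge0_le_integral => //=.
- by apply: measurable_fun_xsection.
- move=> x _; rewrite (_ : xsection A x = [set y | A (x, y)]) ?h//.
 by apply/seteqP; split => y /=; rewrite /xsection /= inE.
Qed.

End events.

Section bool_events.
Context {R : realType} {d} {T : measurableType d} (P : probability T R).

Lemma meas_set_le (f g : T -> R) : mble f -> mble g ->
 measurable [set w | f w <= g w].
Proof. by move=> mf mg; apply: meas_set_bool; exact: mble_ler. Qed.

Lemma indep_prob {I} (X : T -> arr R I) (J : pred I) (b : arr R I -> bool) :
 mble X -> indep P X -> mble b ->
 P [set w | b (X w)] = (\int[(P \x P)%E]_p ((b (mix J (X p.1) (X p.2)))%:R)%:E)%E.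
Proof.
move=> mX iX mb.
rewrite -(iX J [set f | b f]); last exact: meas_set_bool.
have mm : mble (fun p : T * T => mix J (X p.1) (X p.2)).
 by apply: meas_mix; exact: mcomp.
by rewrite -(@prob_bool _ _ _ (P \x P)%E)//; exact: mcomp.
Qed.

(** Chernoff's bound with weight [expR (-1)] per large difference: each factor has mean at most
    [1 - p / 2], since [expR (-1) <= 1/2]. *)
Lemma few_large_le n (X : T -> arr R 'I_n) (V : {set 'I_n}) (c : 'I_n -> R[i]) kap p :
 mble X -> indep P X -> anticonc P X kap p -> 0 <= p <= 1 ->
 (P [set w | (#|[set j in V | (kap < sqnorm (X w j - c j))%R]|%:R < p * #|V|%:R / 4)%R] <=
  (expR (- (p * #|V|%:R / 4)))%:E)%E.
Proof.
move=> mX iX aX /andP[p0 p1]; set q := p * _ / 4.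
pose K (f : arr R 'I_n) := #|[set j in V | kap < sqnorm (f j - c j)]|.
pose phi (j : 'I_n) (z : R[i]) : R := if kap < sqnorm (z - c j) then expR (-1) else 1.
have phi01 j z : 0 <= phi j z <= 1.
 by rewrite /phi; case: ifP => _; rewrite ?expR_ge0 ?ler01 ?lexx//= -[leRHS]expR0 ler_expR; lra.
have mphi j : mble (phi j).
 apply: measurable_fun_ifT => //; apply: mble_ltr => //.
 by apply: meas_sqnorm; apply: meas_addC.
have prodE f : \prod_(j <- enum V) phi j (f j) = expR (- (K f)%:R).
 rewrite big_enum /= (_ : - (K f)%:R = (K f)%:R * (-1) :> R); last by rewrite mulrN1.
 rewrite expRM_natl -prodr_const -big_mkcondr /=.
 by apply: eq_bigl => j; rewrite inE.
have mX' : forall j, mble (fun w => X w j) by apply/meas_arrP.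
have mprod : mble (fun w => \prod_(j <- enum V) phi j (X w j)).
 by apply: measurable_prod => j _; exact: mcomp.
have mA : measurable [set w | ((K (X w))%:R < q)%R].
 rewrite (_ : [set w | _] = [set w | expR (- q) < \prod_(j <- enum V) phi j (X w j)]).
  by apply: meas_set_bool; exact: mble_ltr.
 by apply/seteqP; split => w /=; rewrite prodE ltr_expR ltrN2.
apply: (@le_trans _ _ (\int[P]_w (expR q * \prod_(j <- enum V) phi j (X w j))%:E)%E).
 apply: prob_le_integral => //.
 - by apply: mbleM.
 - by move=> w; rewrite mulr_ge0 ?expR_ge0// prodr_ge0// => j _; case/andP: (phi01 j (X w j)).
 - by move=> w /= h; rewrite prodE -expRD -[leLHS]expR0 ler_expR subr_ge0 ltW.
rewrite int_Zl ?expR_ge0//; last by move=> w; rewrite prodr_ge0// => j _; case/andP: (phi01 j (X w j)).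
rewrite indep_integral_prod ?enum_uniq//; last by move=> j z; case/andP: (phi01 j z).
have e1 : expR (-1) <= 1 / 2 :> R.
 rewrite expRN div1r lef_pV2 ?posrE ?expR_gt0 ?ltr0n//.
 by apply: le_trans (expR_ge1Dx 1).
have hj j : (\int[P]_w (phi j (X w j))%:E <= (expR (- (p / 2)))%:E)%E.
 apply: (@le_trans _ _ (((1 - p) + (1 - (1 - p)) * expR (-1))%:E)).
  apply: (integral_le_two (A := [set w | sqnorm (X w j - c j) <= kap])) => //.
  - by apply: meas_set_le => //; apply: meas_sqnorm; apply: meas_addC.
  - exact: mcomp.
  - by move=> w /= /negP; rewrite -ltNge /phi => ->.
  - by rewrite expR_ge0 /= -[leRHS]expR0 ler_expR; lra.
  rewrite lee_fin; apply: le_trans (expR_ge1Dx _).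
 have -> : 1 - (1 - p) = p by ring.
 have : p * expR (-1) <= p * (1 / 2) by rewrite ler_wpM2l.
 by lra.
have hprod : (\prod_(j <- enum V) \int[P]_w (phi j (X w j))%:E <= (\prod_(j <- enum V) expR (- (p / 2)))%:E)%E.
 elim: (enum V) => [|j s ih]; first by rewrite !big_nil.
 rewrite !big_cons EFinM; apply: lee_pmul => //; first by apply: int_ge0 => w; case/andP: (phi01 j (X w j)).
 by apply: prode_ge0 => i _; apply: int_ge0 => w; case/andP: (phi01 i (X w i)).
apply: (@le_trans _ _ ((expR q)%:E * (\prod_(j <- enum V) expR (- (p / 2)))%:E)%E).
 by apply: lee_wpmul2l => //; rewrite lee_fin expR_ge0.
rewrite -EFinM lee_fin big_enum /= prodr_const -expRM_natl -expRD ler_expR /q -mulr_natl.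
lra.
Qed.

End bool_events.

(** * From the cube to sums of independent variables *)

Section sums_of_independent.
Context {R : realType} {d} {T : measurableType d} (P : probability T R).
Local Notation C := R[i].

Lemma card_finset (I : finType) : #|{set I}| = (2 ^ #|I|)%N.
Proof. by have := card_powerset (finset.setT : {set I}); rewrite powersetT !cardsT. Qed.

Definition coincidences n (a x : 'I_n -> C) (V : {set 'I_n}) (kap e : R) : R :=
 \sum_(ij : 'I_n * 'I_n) ([&& ij.1 \in V, ij.2 \in V, kap <= sqnorm (x ij.1),
  kap <= sqnorm (x ij.2) & sqnorm (x ij.1 * a ij.1 - x ij.2 * a ij.2) <= 4 * e])%R%:R.

Lemma coincidences_ge0 n (a x : 'I_n -> C) V kap e : 0 <= coincidences a x V kap e.
Proof. by apply: sumr_ge0 => ij _. Qed.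

Lemma meas_coincidences n (a : 'I_n -> C) V kap e d' (T' : measurableType d')
  (x : T' -> 'I_n -> C) : (forall j, mble (x ^~ j)) ->
 mble (fun w => coincidences a (x w) V kap e).
Proof.
move=> mx; apply: measurable_sum => ij; apply: meas_natr_bool.
do 2 (apply: measurable_and => //).
apply: measurable_and; first by apply: mble_ler => //; exact: meas_sqnorm.
apply: measurable_and; first by apply: mble_ler => //; exact: meas_sqnorm.
apply: mble_ler => //; apply: meas_sqnorm; apply: meas_addC.
 exact: meas_mulC.
by apply: meas_oppC; exact: meas_mulC.
Qed.

Lemma cube_bound n (a x : 'I_n -> C) (V : {set 'I_n}) (kap tau e q : R) c :
 0 < e -> e <= kap * tau -> 0 <= kap -> 0 < tau -> 2 <= q ->
 (forall j, j \in V -> tau <= sqnorm (a j)) ->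
 cube_count (fun j => x j * a j) (fun z => sqnorm (z - c) <= e) <= 2 ^+ n *
  ((#|[set j in V | (kap < sqnorm (x j))%R]|%:R < q)%R%:R + 2 * expR (- (q / 30)) +
  192 / ((q / 3) ^+ 2 * sqrt (q / 3)) * coincidences a x V kap e).
Proof.
move=> e0 ek k0 t0 q2 hV; set J := finset _.
have ef z : 0 <= 2 * expR z :> R by rewrite mulr_ge0 ?expR_ge0.
have ec : 0 <= 192 / ((q / 3) ^+ 2 * sqrt (q / 3)) * coincidences a x V kap e.
 by rewrite mulr_ge0 ?coincidences_ge0// divr_ge0// mulr_ge0 ?sqrtr_ge0// sqr_ge0.
have [Jq|Jq] := ltP (#|J|%:R : R) q.
 apply: (@le_trans _ _ (2 ^+ n)).
  apply: (@le_trans _ _ (\sum_(E : {set 'I_n}) 1)).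
   by apply: ler_sum => E _; rewrite -[1]/(1%:R) ler_nat leq_b1.
  by rewrite sumr_const card_finset card_ord natrX.
 rewrite -[leLHS]mulr1 ler_wpM2l ?exprn_ge0//=; have := ef (- (q / 30)); lra.
have J2 : (2 <= #|J|)%N by rewrite -(ler_nat R); lra.
have hJ j : j \in J -> e <= sqnorm (x j * a j).
 rewrite inE => /andP[jV hj]; rewrite sqnormM; apply: le_trans ek _.
 by apply: ler_pM; [exact: k0|exact: ltW|exact: ltW|exact: hV].
have := @cube_littlewood_offord R _ (fun j => x j * a j) J e c e0 J2 hJ.
rewrite card_ord /=; set N := #|_|; set l := #|J|./2 => h; apply: (le_trans h).
rewrite ler_wpM2l ?exprn_ge0// add0r addrC.
(* As [2 <= #|J|], the half of [#|J|] rounded down is at least a third of it. *)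
have ql : q / 3 <= l%:R.
 have : (#|J| <= 3 * l)%N by move: J2; rewrite /l; clear; lia.
 by rewrite -(ler_nat R) natrM; lra.
have q30 : 0 < q / 3 by lra.
apply: lerD.
 rewrite ler_wpM2l//; apply: (@le_trans _ _ (expR (- (1 / 10)) ^+ l)).
  apply: lerXn2r; rewrite ?nnegrE ?expR_ge0//; try lra.
  by apply: le_trans (expR_ge1Dx _); lra.
 by rewrite -expRM_natl ler_expR; lra.
have NE : N%:R <= coincidences a x V kap e.
 rewrite /N -sum1_card natr_sum big_mkcond /=; apply: ler_sum => ij _.
 rewrite !inE; case: ifP => // /and3P[/andP[-> h1] /andP[-> h2] ->].
 by rewrite (ltW h1) (ltW h2).
rewrite mulrAC; apply: ler_pM => //.
apply: ler_wpM2l => //; rewrite lef_pV2 ?posrE ?mulr_gt0 ?exprn_gt0 ?sqrtr_gt0//; try exact: lt_le_trans ql.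
by apply: ler_pM; rewrite ?sqrtr_ge0 ?ler_sqrt ?exprn_ge0 ?lerXn2r ?nnegrE// ?ltW// (lt_le_trans q30).
all: by lra.
Qed.

(** Replacing the coordinates of a set [E] by those of an independent copy does not change the law.
    Averaging over all [E] turns the probability into a count on the cube, whose steps are [a j]
    times the difference of the two draws and whose centre is fixed by one draw; [cube_bound] is
    then integrated. *)
Lemma sum_small_ball n (X : T -> arr R 'I_n) (a : 'I_n -> C) (V : {set 'I_n}) (kap p tau e q : R) c :
 mble X -> indep P X -> anticonc P X kap p -> 0 <= p <= 1 ->
 0 < e -> e <= kap * tau -> 0 <= kap -> 0 < tau -> 8 <= p * #|V|%:R ->
 (forall j, j \in V -> tau <= sqnorm (a j)) ->
 q = p * #|V|%:R / 4 ->
 (P [set w | sqnorm (\sum_j X w j * a j - c)%R <= e]%R <=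
  (3 * expR (- (q / 30)))%:E + (192 / ((q / 3) ^+ 2 * sqrt (q / 3)))%:E *
   \int[(P \x P)%E]_w (coincidences a (fun j => X w.1 j - X w.2 j) V kap e)%:E)%E.
Proof.
move=> mX iX aX p01 e0 ek k0 t0 q2 hV qE; set co := 192 / _.
pose b (f : arr R 'I_n) := sqnorm (\sum_j f j * a j - c) <= e.
have mX' : forall j, mble (fun w => X w j) by apply/meas_arrP.
have mX1 j : mble (fun w : T * T => X w.1 j) by apply: (mcomp (mX' j)).
have mX2 j : mble (fun w : T * T => X w.2 j) by apply: (mcomp (mX' j)).
have mb : mble b.
 apply: mble_ler => //; apply: meas_sqnorm; apply: meas_addC => //.
 by apply: meas_sumC => j _; apply: meas_mulC => //; exact: meas_coord.
have q2' : 2 <= q by rewrite qE; lra.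
have co0 : 0 <= co by rewrite divr_ge0// mulr_ge0 ?sqrtr_ge0// sqr_ge0.
pose x (w : T * T) j : C := X w.1 j - X w.2 j.
have mx j : mble (x ^~ j) by apply: meas_addC => //; exact: meas_oppC.
pose F (E : {set 'I_n}) (w : T * T) : R := (b (mix (mem E) (X w.1) (X w.2)))%:R.
have mF E : mble (F E).
 apply: meas_natr_bool; apply: mcomp => //.
 by apply: meas_mix; exact: mcomp.
have PA : P [set w | sqnorm (\sum_j X w j * a j - c)%R <= e]%R = (\int[(P \x P)%E]_w (2 ^- n * \sum_E F E w)%:E)%E.
 have mA : measurable [set w | b (X w)] by apply: meas_set_bool; exact: mcomp.
 rewrite -[LHS]/(P [set w | b (X w)]) int_Zl; last first.
 - by rewrite invr_ge0 exprn_ge0.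
 - by move=> w; rewrite sumr_ge0// => E _.
 - by apply: measurable_sum => E; exact: mF.
 rewrite int_sum//; under eq_bigr => E _ do rewrite -indep_prob// prob_fine//.
 rewrite sumEFin -EFinM sumr_const card_finset card_ord -[X in (_ * X)%:E]mulr_natr natrX mulrC mulfK ?expf_neq0//.
 by rewrite -prob_fine.
have FE w : \sum_E F E w = cube_count (fun j => x w j * a j)
  (fun z => sqnorm (z - (c - \sum_j X w.2 j * a j)) <= e).
 apply: eq_bigr => E _; rewrite /F /b; congr (nat_of_bool (sqnorm _ <= _))%:R.
 rewrite opprB addrA; congr (_ - _); rewrite /subset_sum [\sum_(i in E) _]big_mkcond -big_split /=.
 by apply: eq_bigr => j _; rewrite /mix /x /=; case: ifP => _; ring.
pose B w : R := (#|[set j in V | (kap < sqnorm (x w j))%R]|%:R < q)%R%:R.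
have mB : mble (fun w => (#|[set j in V | (kap < sqnorm (x w j))%R]|%:R < q)%R).
 apply: mble_ltr => //.
 rewrite (_ : (fun w => _) = (fun w => \sum_j ((j \in V) && (kap < sqnorm (x w j)))%R%:R)).
  apply: measurable_sum => j; apply: meas_natr_bool; apply: measurable_and => //.
  apply: mble_ltr => //.
  exact: meas_sqnorm.
 apply/funext => w; rewrite -sum1_card natr_sum big_mkcond /=.
 by apply: eq_bigr => j _; rewrite inE; case: ifP.
have mB' : mble B by exact: meas_natr_bool.
have mco : mble (fun w => coincidences a (x w) V kap e) by exact: meas_coincidences.
have c0 w := coincidences_ge0 a (x w) V kap e.
have e30 : 0 <= 2 * expR (- (q / 30)) :> R by rewrite mulr_ge0 ?expR_ge0.
apply: (@le_trans _ _ (\int[(P \x P)%E]_w (B w + 2 * expR (- (q / 30)) + co * coincidences a (x w) V kap e)%:E)%E).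
 rewrite PA; apply: int_le.
 - by apply: mbleM => //; apply: measurable_sum => E; exact: mF.
 - apply: mbleD; first exact: mbleD.
  exact: mbleM.
 - by move=> w; rewrite mulr_ge0 ?invr_ge0 ?exprn_ge0// sumr_ge0.
 - move=> w; rewrite mulrC ler_pdivrMr ?exprn_gt0// FE mulrC.
  exact: (@cube_bound n a (x w) V kap tau e q _ e0 ek k0 t0 q2' hV).
rewrite int_D//; last 4 first.
- exact: mbleD.
- exact: mbleM.
- by move=> w; rewrite addr_ge0.
- by move=> w; rewrite mulr_ge0.
rewrite int_Zl// int_D// int_cst; apply: leeD => //.
have -> : (3 * expR (- (q / 30)) = expR (- (q / 30)) + 2 * expR (- (q / 30)))%R by ring.
rewrite EFinD; apply: leeD => //; rewrite -prob_bool//.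
apply: prod_prob_le; first exact: meas_set_bool.
move=> w; apply: (@le_trans _ _ (expR (- q))%:E); last first.
 by rewrite lee_fin ler_expR; lra.
have := few_large_le V (fun j => X w j) mX iX aX p01; rewrite -qE; apply: le_trans.
rewrite le_eqVlt; apply/orP; left; apply/eqP; congr (P _); apply/seteqP.
have xE w' j : X w j - X w' j = - (X w' j - X w j) by rewrite opprB.
have KE w' : finset (fun j => (j \in V) && (kap < sqnorm (x (w, w') j))) = finset (fun j => (j \in V) && (kap < sqnorm (X w' j - X w j))).
 by apply/setP => j; rewrite !inE /x /= xE sqnormN.
by split => w' /=; rewrite KE.
Qed.

End sums_of_independent.

(** * Linear dependencies and small distances *)

Section small_distance_geometry.
Context {R : realType}.
Local Notation C := R[i].

Lemma sqnorm_sum_mul_le (I : finType) (x y : I -> C) (Q : pred I) :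
 sqnorm (\sum_(j | Q j) x j * y j) <= (\sum_(j | Q j) sqnorm (x j)) * \sum_j sqnorm (y j).
Proof.
pose u : 'rV[C]_#|I| := \row_k (if Q (enum_val k) then x (enum_val k) else 0).
pose v : 'rV[C]_#|I| := \row_k cj (y (enum_val k)).
have h := cauchy_schwarz u v.
have -> : \sum_(j | Q j) x j * y j = dot u v.
 rewrite dotE big_mkcond (reindex (@enum_val I I)) /=; last exact: onW_bij (@enum_val_bij I).
 by apply: eq_bigr => k _; rewrite !mxE cjK; case: ifP; rewrite ?mul0r.
apply: le_trans h _; rewrite le_eqVlt; apply/orP; left; apply/eqP; congr (_ * _).
 rewrite /sqn [RHS]big_mkcond [RHS](reindex (@enum_val I I)) /=; last exact: onW_bij (@enum_val_bij I).
 by apply: eq_bigr => k _; rewrite !mxE; case: ifP; rewrite ?sqnorm0.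
rewrite /sqn [RHS](reindex (@enum_val I I)) /=; last exact: onW_bij (@enum_val_bij I).
by apply: eq_bigr => k _; rewrite !mxE sqnormJ.
Qed.

Lemma sqn_lincomb_le m (I : finType) (x : I -> C) (g : I -> 'rV[C]_m) (Q : pred I) :
 sqn (\sum_(j | Q j) x j *: g j) <= (\sum_(j | Q j) sqnorm (x j)) * \sum_j sqn (g j).
Proof.
rewrite /sqn exchange_big /= mulr_sumr; apply: ler_sum => a _.
rewrite summxE (eq_bigr (fun j => x j * g j 0 a)) => [|j _]; last by rewrite mxE.
exact: sqnorm_sum_mul_le.
Qed.

Lemma sqn_mulmx_proj_le m (r : seq 'rV[C]_m) v : sqn (v *m proj r) <= sqn v.
Proof. by have := Re_dot_le (v *m proj r) v; rewrite -dist2E /dist2; lra. Qed.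

(** The weights are the conjugates of a row of the projection onto the complement: one diagonal
    entry is at least [1 / n], and the row has length at most [1], so pairing with it is bounded by
    the distance. *)
Lemma kernel_vector n (r : seq 'rV[C]_n) : (size r < n)%N ->
 exists (w : 'I_n -> C) (i : 'I_n), [/\ n%:R ^- 2 <= sqnorm (w i),
  (forall g, g \in r -> \sum_j g 0 j * w j = 0) &
  forall h : 'rV[C]_n, sqnorm (\sum_j h 0 j * w j) <= dist2 r h].
Proof.
move=> rn; have [] := @exists_diag R n 1 r; first by rewrite addn1.
 by [].
move=> i hi; pose v : 'rV[C]_n := delta_mx 0 i *m proj r.
have vE j : v 0 j = proj r i j by rewrite /v -rowE mxE.
have vi : proj r i i = (Re (proj r i i))%:C by exact: Qm_diag.
have sv : sqn v <= 1.
 apply: (@le_trans _ _ (Re (proj r i i))).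
  by apply: le_trans (sqn_row_Qm i (wge0_map0 r)); apply: ler_sum => j _; rewrite vE.
 by apply: Qm_diag_le1; exact: wge0_map0.
have dotvE h : dot h v = \sum_j h 0 j * cj (proj r i j).
 by rewrite dotE; apply: eq_bigr => j _; rewrite vE.
exists (fun j => cj (proj r i j)), i; split.
- rewrite sqnormJ vi sqnorm_real -exprVn; apply: lerXn2r; rewrite ?nnegrE ?invr_ge0//.
  by apply: Qm_diag_ge0; exact: wge0_map0.
 by move: hi; rewrite div1r.
- by move=> g gr; rewrite -dotvE dotC dot_proj0// cj0.
- move=> h; rewrite -dotvE.
 apply: (@le_trans _ _ (sqn v * dist2 r h)); last by rewrite ler_piMl ?dist2_ge0.
 by apply: dist2_le_orth => g; exact: dot_proj0.
Qed.

(** Modulo the remaining vectors the dependency reads [w j (g j + rho g i) = - (w i - rho w j) g i]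
    with [rho = d j / d i]: a coincidence of [d i * w i] and [d j * w j] is a small distance for the
    family in which [g i] and [g j] are merged. *)
Lemma dist2_coincidence m (I : finType) (g : I -> 'rV[C]_m) (w d : I -> C) i j
  (s : seq 'rV[C]_m) kap tau e :
 \sum_l w l *: g l = 0 -> i != j -> (forall l, l != i -> l != j -> g l \in s) ->
 0 < tau -> tau <= sqnorm (w j) -> 0 < kap -> kap <= sqnorm (d i) ->
 sqnorm (d i * w i - d j * w j) <= 4 * e ->
 dist2 s (g j + (d j / d i) *: g i) <= 4 * e * sqn (g i) / (kap * tau).
Proof.
move=> wg ij hs tau0 hj k0 hi he; set rho := d j / d i; set u := _ + _.
have di0 : d i != 0 by rewrite -sqnorm_eq0 gt_eqF// (lt_le_trans k0).
have eqv : w j *: (u *m proj s) = - ((w i - rho * w j) *: (g i *m proj s)).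
 apply/eqP; rewrite -subr_eq0 opprK; apply/eqP.
 have : (\sum_l w l *: g l) *m proj s = 0 by rewrite wg mul0mx.
 rewrite (bigD1 i)//= (bigD1 j) 1?eq_sym//= mulmxDl mulmxDl.
 rewrite [X in _ + (_ + X)](_ : _ = 0); last first.
  rewrite mulmx_suml big1// => l /andP[li lj]; rewrite -scalemxAl mulmx_proj0 ?scaler0//.
  exact: hs.
 move=> <-; rewrite /u mulmxDl -!scalemxAl scalerDr scalerA scalerBl addr0.
 by rewrite (mulrC (w j)) [RHS]addrC -addrA [X in _ + X]addrCA subrr addr0.
have : sqnorm (w j) * dist2 s u <= 4 * e / kap * sqn (g i).
 rewrite /dist2 -sqnZ eqv sqnN sqnZ; apply: ler_pM; rewrite ?sqnorm_ge0 ?sqn_ge0 ?sqn_mulmx_proj_le//.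
 have -> : w i - rho * w j = (d i)^-1 * (d i * w i - d j * w j) by rewrite /rho; field.
 rewrite sqnormM sqnormV mulrC; apply: ler_pM; rewrite ?sqnorm_ge0 ?invr_ge0 ?sqnorm_ge0//.
 by rewrite lef_pV2 ?posrE// (lt_le_trans k0).
have -> : 4 * e * sqn (g i) / (kap * tau) = 4 * e / kap * sqn (g i) / tau by rewrite invfM; ring.
rewrite ler_pdivlMr//; apply: le_trans; rewrite mulrC ler_wpM2r ?dist2_ge0//.
Qed.

(** Solving the dependency for [g i] modulo the other vectors indexed by [S] leaves only terms with
    small weights. *)
Lemma dist2_concentrated m (I : finType) (g : I -> 'rV[C]_m) (w : I -> C) i
  (S : {set I}) (s : seq 'rV[C]_m) tau c G :
 \sum_l w l *: g l = 0 -> i \in S -> (forall l, l \in S -> l != i -> g l \in s) ->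
 (forall l, l \notin S -> sqnorm (w l) <= tau) -> 0 <= tau -> 0 < c -> c <= sqnorm (w i) ->
 (forall l, sqn (g l) <= G) ->
 dist2 s (g i) <= (#|I|%:R * tau) * (#|I|%:R * G) / c.
Proof.
move=> wg iS hs hw tau0 c0 hi hG.
have eqv : w i *: (g i *m proj s) = - ((\sum_(l | l \notin S) w l *: g l) *m proj s).
 apply/eqP; rewrite -subr_eq0 opprK; apply/eqP.
 have : (\sum_l w l *: g l) *m proj s = 0 by rewrite wg mul0mx.
 rewrite (bigID (mem S)) /= (bigD1 i)//= !mulmxDl -scalemxAl.
 rewrite [X in _ + X + _](_ : _ = 0) ?addr0// mulmx_suml big1// => l /andP[lS li].
 by rewrite -scalemxAl mulmx_proj0 ?scaler0//; exact: hs.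
rewrite ler_pdivlMr//; apply: (@le_trans _ _ (sqnorm (w i) * dist2 s (g i))).
 by rewrite mulrC ler_wpM2r ?dist2_ge0.
rewrite /dist2 -sqnZ eqv sqnN; apply: le_trans (sqn_mulmx_proj_le _ _) _.
apply: le_trans (sqn_lincomb_le _ _ _) _; apply: ler_pM.
- by apply: sumr_ge0 => l _; exact: sqnorm_ge0.
- by apply: sumr_ge0 => l _; exact: sqn_ge0.
- apply: (@le_trans _ _ (\sum_(l : I) tau)); last by rewrite sumr_const mulr_natl.
 by rewrite big_mkcond; apply: ler_sum => l _; case: ifP => //; exact: hw.
- by apply: (@le_trans _ _ (\sum_(l : I) G)); [exact: ler_sum|rewrite sumr_const mulr_natl].
Qed.

(** Exponential Markov: weighting a set by [expR (L (u - #|S|))] makes the sum factor over the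
    elements of [I]. *)
Lemma card_small_sets (I : finType) (L u : R) : 0 <= L ->
 \sum_(S : {set I}) ((#|S|%:R <= u)%R)%:R <= expR (L * u + #|I|%:R * expR (- L)) :> R.
Proof.
move=> L0; rewrite expRD; apply: (@le_trans _ _ (\sum_(S : {set I}) expR (L * u) * expR (- L) ^+ #|S|)).
 apply: ler_sum => S _; have [h|h] := leP (#|S|%:R) u; last by rewrite mulr_ge0 ?exprn_ge0 ?expR_ge0.
 by rewrite -expRM_natl -expRD -[leLHS]expR0 ler_expR; nra.
rewrite -mulr_sumr ler_wpM2l ?expR_ge0//.
have -> : \sum_(S : {set I}) expR (- L) ^+ #|S| = (expR (- L) + 1) ^+ #|I|.
 rewrite -prodr_const /=.
 rewrite bigA_distr; apply: eq_bigr => S _.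
 by rewrite -big_mkcond prodr_const.
rewrite expRM_natl; apply: lerXn2r; rewrite ?nnegrE ?expR_ge0 ?addr_ge0 ?expR_ge0//.
by rewrite addrC; exact: expR_ge1Dx.
Qed.

End small_distance_geometry.

(** * A class of random arrays stable under merging two columns *)

Section random_matrix_class.
Context {R : realType} {d} {T : measurableType d} (P : probability T R).
Local Notation C := R[i].

Lemma indep_decouple {I} (X : T -> arr R I) (J : pred I) (b : arr R I -> bool) (c : R) :
 mble X -> indep P X -> mble b ->
 (forall v, (P [set w | b (mix J v (X w))] <= c%:E)%E) ->
 (P [set w | b (X w)] <= c%:E)%E.
Proof.
move=> mX iX mb h; rewrite -[X in P X]/(X @^-1` [set f | b f]) -(iX J).
 apply: prod_prob_le => [|x /=]; last exact: h.
 apply: meas_set_bool; apply: mcomp => //.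
 by apply: meas_mix; exact: mcomp.
exact: meas_set_bool.
Qed.

Lemma indep_decouple_prob {I} (X : T -> arr R I) (J : pred I) (b : arr R I -> bool) :
 mble X -> indep P X -> mble b ->
 P [set w | b (X w)] = (\int[P]_v P [set w | b (mix J (X v) (X w))])%E.
Proof.
move=> mX iX mb; rewrite -[X in P X]/(X @^-1` [set f | b f]) -(iX J); last exact: meas_set_bool.
rewrite /product_measure1 /=; apply: eq_integral => v _; congr (P _).
by apply/seteqP; split => w /=; rewrite /xsection /= inE.
Qed.

Definition rowv m n (f : arr R ('I_m * 'I_n)) i : 'rV[C]_n := \row_j f (i, j).

Definition rowdist M n (f : arr R ('I_M.+1 * 'I_n)) r0 : R :=
 dist2 [seq rowv f (lift r0 a) | a <- enum 'I_M] (rowv f r0).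

Lemma meas_rowv m n i : meas_mx (fun f : arr R ('I_m * 'I_n) => rowv f i).
Proof. by move=> a b; under eq_fun do rewrite mxE; exact: meas_coord. Qed.

Lemma meas_rowdist M n r0 : mble (fun f : arr R ('I_M.+1 * 'I_n) => rowdist f r0).
Proof. by apply: meas_dist2 => [a|]; exact: meas_rowv. Qed.

(** Anticoncentration and a tail bound are all that is asked of the entries, because both survive
    the merging of two columns, with worse [B] and [phi]; unit variance would not. *)
Definition matrix_class m n (X : T -> arr R ('I_m * 'I_n)) (kap p B phi : R) : Prop :=
 [/\ mble X, indep P X, anticonc P X kap p &
   forall ij, (P [set w | B < sqnorm (X w ij)]%R <= phi%:E)%E].

Definition colv M n (f : arr R ('I_M.+1 * 'I_n)) (r0 : 'I_M.+1) (j : 'I_n) : 'rV[C]_M :=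
 \row_a f (lift r0 a, j).

Lemma meas_colv M n r0 j : meas_mx (fun f : arr R ('I_M.+1 * 'I_n) => colv f r0 j).
Proof. by move=> a b; under eq_fun do rewrite mxE; exact: meas_coord. Qed.

Lemma anticonc_reindex {I I'} (X : T -> arr R I) (phi : I' -> I) kap p :
 anticonc P X kap p -> anticonc P (fun w i => X w (phi i)) kap p.
Proof. by move=> aX i c; exact: aX. Qed.

Lemma meas_reindex {I I'} (X : T -> arr R I) (phi : I' -> I) :
 mble X -> mble (fun w => (fun i => X w (phi i)) : arr R I').
Proof.
by move=> /meas_arrP mX; apply/meas_arrP => i; exact: mX.
Qed.

Lemma indep_reindex {I I' : eqType} (X : T -> arr R I) (phi : I' -> I) : injective phi ->
 (forall i, (exists j, i = phi j) \/ ~ (exists j, i = phi j)) ->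
 indep P X -> indep P (fun w => (fun i => X w (phi i)) : arr R I').
Proof.
move=> iphi dphi iX.
apply: (@indep_comp _ _ _ P _ _ X (fun f : arr R I => (fun i => f (phi i)) : arr R I')) => // [J'|].
 exists (fun i => `[< exists2 j, i = phi j & J' j >]) => f g; apply/funext => j; rewrite /mix.
 case: asboolP => [[k /iphi -> ->]//|h]; case: ifP => // Jj; exfalso; apply: h; by exists j.
by apply/meas_arrP => i; exact: meas_coord.
Qed.

(** Column [i] is independent of the others, and [S] leaves at least half of the dimension free, so
    the small ball estimate is exponential in the size; this makes a union over small supports
    affordable. *)
Lemma column_concentrated_prob M (X : T -> arr R ('I_M.+1 * 'I_M.+1)) r0 kap p i
  (S : {set 'I_M.+1}) t :
 mble X -> indep P X -> anticonc P X kap p -> 0 < kap -> 0 <= p -> (0 < M)%N ->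
 i \in S -> #|S|%:R <= (M.+1)%:R / 2 :> R -> t <= p * kap / 48 ->
 (P [set w | dist2 [seq colv (X w) r0 l | l <- enum (S :\ i)] (colv (X w) r0 i) <= t]%R
   <= (expR (- (p / 12 * (M.+1)%:R)))%:E)%E.
Proof.
move=> mX iX aX k0 p0 M0 iS hS ht.
pose b (f : arr R ('I_M.+1 * 'I_M.+1)) := dist2 [seq colv f r0 l | l <- enum (S :\ i)] (colv f r0 i) <= t.
have mb : mble b.
 apply: mble_ler => //.
 by apply: meas_dist2 => [l|]; exact: meas_colv.
apply: (@indep_decouple _ X (fun ij => ij.2 != i) b) => // v.
pose X' w : arr R 'I_M := fun a => X w (lift r0 a, i).
have cv w : colv (mix (fun ij => ij.2 != i) v (X w)) r0 i = rv (X' w) + 0.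
 by apply/rowP => a; rewrite !mxE /mix /= eqxx addr0.
have rE w : [seq colv (mix (fun ij => ij.2 != i) v (X w)) r0 l | l <- enum (S :\ i)] =
  [seq colv v r0 l | l <- enum (S :\ i)].
 apply/eq_in_map => l; rewrite mem_enum !inE => /andP[li _].
 by apply/rowP => a; rewrite !mxE /mix /= li.
under eq_set do rewrite /b cv rE.
have SM : (#|S| <= M.+1)%N by apply: leq_trans (max_card _) _; rewrite card_ord.
have S0 : (0 < #|S|)%N by apply/card_gt0P; exists i.
have sz : (size [seq colv v r0 l | l <- enum (S :\ i)] + (M.+1 - #|S|) <= M)%N.
 have -> : size [seq colv v r0 l | l <- enum (S :\ i)] = #|S :\ i| by rewrite size_map cardE.
 have eS := cardsD1 i S; rewrite iS add1n in eS; lia.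
have kR : (M.+1)%:R / 2 <= (M.+1 - #|S|)%:R :> R by rewrite natrB//; lra.
have MR : 1 <= M%:R :> R by rewrite -[1]/(1%:R) ler_nat.
have := @dist_small_ball R _ _ P M (M.+1 - #|S|)%N _ X' 0 kap p _ _ _ k0 p0 sz.
have mX' : mble X' by exact: meas_reindex.
have aX' : anticonc P X' kap p by exact: (@anticonc_reindex _ _ X (fun a => (lift r0 a, i)) kap p aX).
have iX' : indep P X'.
 apply: (indep_reindex (phi := fun a => (lift r0 a, i))) => //.
  by move=> a a' /(congr1 fst) /= /lift_inj.
 by move=> ij; exact: EM.
move=> /(_ mX' iX' aX') => h; apply: le_trans (le_trans _ h) _.
 apply: le_measure; rewrite ?inE.
 - apply: meas_set_le => //; apply: meas_dist2 => [l|]; first exact: meas_mx_cst.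
  by apply: meas_mxD; [exact: (meas_mx_comp (@meas_rv _ _))|exact: meas_mx_cst].
 - apply: meas_set_le => //; apply: meas_dist2 => [l|]; first exact: meas_mx_cst.
  by apply: meas_mxD; [exact: (meas_mx_comp (@meas_rv _ _))|exact: meas_mx_cst].
 - move=> w /= /le_trans; apply; apply: (le_trans ht).
  have h1 : 1 / 4 <= (M.+1 - #|S|)%:R ^+ 2 / M%:R :> R.
   rewrite ler_pdivlMr; last lra.
   apply: (@le_trans _ _ (((M.+1)%:R / 2) ^+ 2)).
    have -> : M.+1%:R = M%:R + 1 :> R by rewrite natr1.
    by nra.
   by apply: lerXn2r; rewrite ?nnegrE.
  have h2 : 0 <= p * kap by rewrite mulr_ge0// ltW.
  by nra.
by rewrite lee_fin ler_expR lerN2; nra.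
Qed.

(** Row [r0] and column [i] are deleted, a multiple of column [i] having been added to another one.
    The result is transposed, so that columns become rows and their distances are again of the form
    [rowdist], in dimension smaller by one. *)
Definition merge M (r0 i : 'I_M.+1) (b0 : 'I_M) (rho : C)
  (f : arr R ('I_M.+1 * 'I_M.+1)) : arr R ('I_M * 'I_M) :=
 fun ba => f (lift r0 ba.2, lift i ba.1) + (if ba.1 == b0 then rho * f (lift r0 ba.2, i) else 0).

Lemma meas_merge M (r0 i : 'I_M.+1) (b0 : 'I_M) rho : mble (merge r0 i b0 rho).
Proof.
apply/meas_arrP => ba; apply: meas_addC; first exact: meas_coord.
case: (ba.1 == b0) => //; apply: meas_mulC => //; exact: meas_coord.
Qed.

(** Column [i] enters only row [b0] of the result, so distinct entries still use disjoint
    coordinates; freezing it turns the added term into a shift of the centre. *)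
Lemma merge_class M (X : T -> arr R ('I_M.+1 * 'I_M.+1)) r0 i b0 rho kap p B phi :
 matrix_class X kap p B phi -> 0 < kap -> sqnorm rho <= 4 * B / kap -> 0 <= B -> 0 <= phi ->
 matrix_class (fun w => merge r0 i b0 rho (X w)) kap p (2 * B + 8 * B ^+ 2 / kap) (2 * phi).
Proof.
move=> [mX iX aX bX] k0 hrho B0 phi0; have mm := meas_merge r0 i b0 rho.
have mXij ij : mble (fun w => X w ij) by move: ij; apply/meas_arrP.
split.
- exact: mcomp.
- apply: indep_comp => // J'.
 exists (fun rc => match unlift r0 rc.1 with
  | Some a => if unlift i rc.2 is Some b then J' (b, a) else J' (b0, a)
  | None => false end) => f g.
 apply/funext => -[b a]; rewrite /merge /mix /= !liftK unlift_none.
 by case: eqP => [->|_]; case: ifP.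
- move=> [b a] c; rewrite /merge /=; case: eqP => _; last first.
  by under eq_set do rewrite addr0; exact: aX.
 pose e (f : arr R ('I_M.+1 * 'I_M.+1)) := sqnorm (f (lift r0 a, lift i b) + rho * f (lift r0 a, i) - c) <= kap.
 apply: (@indep_decouple _ X (fun rc => rc.2 == i) e) => //.
  apply: mble_ler => //; apply: meas_sqnorm; apply: meas_addC => //.
  apply: meas_addC; first exact: meas_coord.
  by apply: meas_mulC => //; exact: meas_coord.
 move=> v; rewrite /e /mix /= eqxx eq_sym (negbTE (neq_lift _ _)).
 have h w : X w (lift r0 a, lift i b) + rho * v (lift r0 a, i) - c =
  X w (lift r0 a, lift i b) - (c - rho * v (lift r0 a, i)) by ring.
 by under eq_set do rewrite h; exact: aX.
- move=> [b a]; rewrite /merge /=.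
 have mlt (g : T -> R) c : mble g -> measurable [set w | (c < g w)%R].
  by move=> mg; apply: meas_set_bool; exact: mble_ltr.
 have ms ij : mble (fun w => sqnorm (X w ij)) by exact: meas_sqnorm.
 apply: (@le_trans _ _ (P ([set w | B < sqnorm (X w (lift r0 a, lift i b))] `|`
    [set w | B < sqnorm (X w (lift r0 a, i))])%R)).
  apply: le_measure; rewrite ?inE.
  - apply: mlt; apply: meas_sqnorm; apply: meas_addC => //.
   by case: (b == b0) => //; exact: meas_mulC.
  - by apply: measurableU; exact: mlt.
  - move=> w /= h; apply: contrapT => /not_orP[/negP h1 /negP h2].
   move: h1 h2; rewrite -!leNgt => h1 h2.
   move: h; set x := X w _ in h1 *; set y := X w (_, i) in h2 *; rewrite ltNge => /negP; apply.
   have hz (z : C) : sqnorm z <= 4 * B / kap -> sqnorm (x + z * y) <= 2 * B + 8 * B ^+ 2 / kap.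
    move=> hz; have := sqnormB_le x (- (z * y)); rewrite opprK sqnormN sqnormM => h3.
    apply: (le_trans h3); apply: lerD; first by rewrite ler_wpM2l.
    have -> : 8 * B ^+ 2 / kap = 2 * (4 * B / kap * B) by ring.
    by rewrite ler_wpM2l// ler_pM ?sqnorm_ge0.
   case: ifP => _; first exact: hz.
   have := hz 0; rewrite mul0r; apply; rewrite sqnorm0 divr_ge0 ?mulr_ge0//; exact: ltW.
 apply: le_trans (measureU2 _ _ _) _; try exact: mlt.
 by have -> : (2 * phi)%:E = (phi%:E + phi%:E)%E; [rewrite -EFinD mulr2n mulrDl mul1r|apply: leeD; exact: bX].
Qed.

End random_matrix_class.

(** * One step of the recursion for the least distance *)

Section least_distance_step.
Context {R : realType} {d} {T : measurableType d} (P : probability T R).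
Local Notation C := R[i].

Lemma int_int_swap {d'} {T' : measurableType d'} (P' : probability T' R) (g : T * T' -> R) :
 mble g -> (forall p, 0 <= g p) ->
 (\int[P]_v \int[P']_q (g (v, q))%:E = \int[P']_q \int[P]_v (g (v, q))%:E)%E.
Proof.
move=> mg g0; apply: (@fubini_tonelli _ _ _ _ _ P P' (fun p => (g p)%:E)).
 exact/mble_EFinP.
by move=> p; rewrite lee_fin.
Qed.

Lemma meas_int_snd {d'} {T' : measurableType d'} (P' : probability T' R) (g : T * T' -> R) :
 mble g -> (forall p, 0 <= g p) ->
 mble (fun v => \int[P']_q (g (v, q))%:E)%E.
Proof.
move=> mg g0; apply: (@measurable_fun_fubini_tonelli_F _ _ _ _ _ P' (fun p => (g p)%:E)).
 exact/mble_EFinP.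
by move=> p; rewrite lee_fin.
Qed.

Variables (M' : nat).
Let M := M'.+1.
Let N := M.+1.
Variables (X : T -> arr R ('I_N * 'I_N)) (r0 : 'I_N) (kap p B phi tau e e' dl L rho : R).
Hypotheses (hX : matrix_class P X kap p B phi) (k0 : 0 < kap) (p0 : 0 < p) (p1 : p <= 1)
 (B0 : 0 <= B) (phi0 : 0 <= phi) (tau0 : 0 < tau) (e0 : 0 < e) (ek : e <= kap * tau)
 (htau : tau <= N%:R ^- 2)
 (hsp : (N%:R * tau) * (N%:R * (M%:R * B)) / N%:R ^- 2 <= p * kap / 48)
 (he' : 4 * e * (M%:R * B) / (kap * tau) <= e')
 (dl0 : 0 < dl) (dl1 : dl <= 1 / 2) (dlN : 8 <= p * (dl * N%:R))
 (L0 : 0 <= L) (hL : L * dl + expR (- L) <= p / 24) (rho0 : 0 <= rho)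
 (hrho : forall (Y : T -> arr R ('I_M * 'I_M)) b0,
   matrix_class P Y kap p (2 * B + 8 * B ^+ 2 / kap) (2 * phi) ->
   (P [set w | rowdist (Y w) b0 <= e']%R <= rho%:E)%E).

Let mX : mble X. Proof. by case: hX. Qed.
Let iX : indep P X. Proof. by case: hX. Qed.
Let aX : anticonc P X kap p. Proof. by case: hX. Qed.
Let mXij ij : mble (fun w => X w ij).
Proof. by move: ij; apply/meas_arrP. Qed.

Let t : R := p * kap / 48.

(** Dominates, by a union over supports, the event that a dependency among the columns deprived of
    row [r0] is carried by at most [dl N] coordinates. *)
Let concentrated (v : T) : R := \sum_(iS : 'I_N * {set 'I_N})
 ([&& iS.1 \in iS.2, #|iS.2|%:R <= dl * N%:R &
  dist2 [seq colv (X v) r0 l | l <- enum (iS.2 :\ iS.1)] (colv (X v) r0 iS.1) <= t])%R%:R.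

Let big (v : T) : R := \sum_(ij : 'I_N * 'I_N) (B < sqnorm (X v ij))%R%:R.

Let df (q : T * T) (j : 'I_N) : C := X q.1 (r0, j) - X q.2 (r0, j).

(** Dominates the event that [i] and [j] form a coincidence: the merged matrix has a small distance,
    or the difference at [j] is too large for the merging ratio to be bounded. The value [1] is for
    [i = j]. *)
Let psi (i j : 'I_N) (vq : T * (T * T)) : R :=
 if unlift i j is Some b0 then
  ([&& kap <= sqnorm (df vq.2 i), sqnorm (df vq.2 j) <= 4 * B &
   rowdist (merge r0 i b0 (df vq.2 j / df vq.2 i) (X vq.1)) b0 <= e'])%R%:R
  + (4 * B < sqnorm (df vq.2 j))%R%:R
 else 1.

Let mcol l : meas_mx (fun v => colv (X v) r0 l).
Proof. by move=> a b; under eq_fun do rewrite mxE; exact: mXij. Qed.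

Let mconc : mble concentrated.
Proof.
apply: measurable_sum => iS; apply: meas_natr_bool.
do 2 (apply: measurable_and => //); apply: mble_ler => //.
by apply: meas_dist2 => [l|]; exact: mcol.
Qed.

Let mbig : mble big.
Proof.
apply: measurable_sum => ij; apply: meas_natr_bool; apply: mble_ltr => //.
exact: meas_sqnorm.
Qed.

Let mdf j : mble (df ^~ j).
Proof.
apply: meas_addC; last apply: meas_oppC.
 exact: (mcomp (mXij (r0, j)) measurable_fst).
exact: (mcomp (mXij (r0, j)) measurable_snd).
Qed.

Let mpsi i j : mble (psi i j).
Proof.
rewrite /psi; case: unliftP => [b0 _|_]; last exact: measurable_cst.
have mdf2 l : mble (fun vq : T * (T * T) => df vq.2 l).
 exact: (mcomp (mdf l) measurable_snd).
have mX1 ij : mble (fun vq : T * (T * T) => X vq.1 ij).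
 exact: (mcomp (mXij ij) measurable_fst).
apply: mbleD; apply: meas_natr_bool; last first.
 by apply: mble_ltr => //; exact: meas_sqnorm.
apply: measurable_and; first by apply: mble_ler => //; exact: meas_sqnorm.
apply: measurable_and; first by apply: mble_ler => //; exact: meas_sqnorm.
apply: mble_ler => //.
apply: (@measurableT_comp _ _ _ _ _ _ (fun f : arr R ('I_M * 'I_M) => rowdist f b0)
 _ (fun vq : T * (T * T) => merge r0 i b0 (df vq.2 j / df vq.2 i) (X vq.1))).
 exact: meas_rowdist.
apply/meas_arrP => ba; apply: meas_addC => //.
case: (ba.1 == b0) => //; apply: meas_mulC => //.
by apply: meas_mulC => //; exact: meas_invC.
Qed.

Let psi0 i j vq : 0 <= psi i j vq.
Proof. by rewrite /psi; case: unliftP => [b0 _|_] //; rewrite addr_ge0. Qed.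

Let q0 : R := p * (dl * N%:R) / 4.
Let co : R := 192 / ((q0 / 3) ^+ 2 * sqrt (q0 / 3)).

Let co0 : 0 <= co.
Proof. by rewrite divr_ge0// mulr_ge0 ?sqrtr_ge0// sqr_ge0. Qed.

Let sum_psi (vq : T * (T * T)) : R := \sum_(ij : 'I_N * 'I_N) psi ij.1 ij.2 vq.

Let msum_psi : mble sum_psi.
Proof. by apply: measurable_sum => ij; exact: mpsi. Qed.

Let sum_psi0 vq : 0 <= sum_psi vq.
Proof. by apply: sumr_ge0. Qed.

Let coincidences_le (w : 'I_N -> C) (V : {set 'I_N}) v q :
 \sum_l w l *: colv (X v) r0 l = 0 -> (forall j, j \in V -> tau <= sqnorm (w j)) ->
 (forall ij, sqnorm (X v ij) <= B) ->
 coincidences w (df q) V kap e <= sum_psi (v, q).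
Proof.
move=> hw hV hB; apply: ler_sum => -[i j] _ /=; rewrite /psi /=.
case: unliftP => [b0 jE|_]; last by rewrite -[1]/(1%:R) ler_nat leq_b1.
have [h4|h4] := ltP (4 * B) (sqnorm (df q j)).
 by rewrite andbF /= add0r -[true%:R]/(1%:R) ler_nat leq_b1.
have [/and5P[iV jV hi hj hij]|_] := boolP [&& i \in V, j \in V, kap <= sqnorm (df q i),
 kap <= sqnorm (df q j) & sqnorm (df q i * w i - df q j * w j) <= 4 * e]; last by rewrite addr_ge0.
rewrite hi /= addr0 -[leLHS]/(1%:R) ler_nat lt0b.
have wi : j != i by rewrite jE eq_sym neq_lift.
apply: le_trans he'.
have hG : sqn (colv (X v) r0 i) <= M%:R * B.
 apply: (@le_trans _ _ (\sum_(a < M) B)); last by rewrite sumr_const card_ord mulr_natl.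
 by apply: ler_sum => a _; rewrite mxE.
apply: (@le_trans _ _ (4 * e * sqn (colv (X v) r0 i) / (kap * tau))); last first.
 rewrite ler_pM2r ?invr_gt0 ?mulr_gt0// ler_wpM2l// mulr_ge0// ltW//.
rewrite /rowdist (_ : rowv (merge _ _ _ _ _) b0 = colv (X v) r0 j + (df q j / df q i) *: colv (X v) r0 i); last first.
 by apply/rowP => a; rewrite !mxE /merge /= eqxx jE.
apply: (dist2_coincidence (I := 'I_N) hw (i := i) (j := j)) => //; first by rewrite eq_sym.
- move=> l li lj; have [b bE|bE] := unliftP i l; last by rewrite bE eqxx in li.
 have [c cE|cE] := unliftP b0 b; last by rewrite bE cE -jE eqxx in lj.
 apply/mapP; exists c; first by rewrite mem_enum.
 apply/rowP => a; rewrite !mxE /merge /= eq_sym (negbTE (neq_lift _ _)) addr0 bE cE.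
 by [].
- exact: hV.
Qed.

(** The rows other than [r0] are frozen, and [w] annihilates them. Either it is carried by few
    coordinates, and then one column is close to the span of a few others; or it has many large
    coordinates, and [sum_small_ball] applies to its pairing with row [r0]. Where a frozen entry is
    too large, [big] makes the bound trivial. *)
Let fiber_bound (v : T) :
 (P [set w | rowdist (mix (fun rc => rc.1 != r0) (X v) (X w)) r0 <= e]%R <=
  (concentrated v + big v + 3 * expR (- (q0 / 30)))%:E +
  co%:E * \int[(P \x P)%E]_q (sum_psi (v, q))%:E)%E.
Proof.
set A := [set w | _].
have mA : measurable A.
 apply: meas_set_le => //.
 apply: (@measurableT_comp _ _ _ _ _ _ (fun f : arr R ('I_N * 'I_N) => rowdist f r0) _
  (fun w => mix (fun rc : 'I_N * 'I_N => rc.1 != r0) (X v) (X w))); first exact: meas_rowdist.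
 by apply: meas_mix => //; exact: measurable_cst.
have c0 : 0 <= concentrated v by apply: sumr_ge0.
have b0 : 0 <= big v by apply: sumr_ge0.
have e30 : 0 <= 3 * expR (- (q0 / 30)) :> R by rewrite mulr_ge0 ?expR_ge0.
have I0 : (0 <= co%:E * \int[(P \x P)%E]_q (sum_psi (v, q))%:E)%E.
 by rewrite mule_ge0 ?lee_fin// int_ge0.
have triv : 1 <= concentrated v + big v -> (P A <= (concentrated v + big v + 3 * expR (- (q0 / 30)))%:E +
  co%:E * \int[(P \x P)%E]_q (sum_psi (v, q))%:E)%E.
 move=> h; apply: (@le_trans _ _ 1%E); first exact: probability_le1.
 by rewrite -[leLHS]adde0; apply: leeD => //; rewrite lee_fin; lra.
have [/existsP[ij hij]|/existsPn hB] := boolP [exists ij, B < sqnorm (X v ij)].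
 apply: triv; rewrite /big (bigD1 ij)//= hij.
 have : 0 <= \sum_(i | i != ij) (B < sqnorm (X v i))%R%:R :> R by apply: sumr_ge0.
 by move: c0; rewrite [true%:R]mulr1n; lra.
have {}hB ij : sqnorm (X v ij) <= B by rewrite leNgt hB.
pose r := [seq rowv (X v) (lift r0 a) | a <- enum 'I_M].
have sr : (size r < N)%N by rewrite size_map size_enum_ord.
have [w [i [hi hw hd]]] := kernel_vector sr.
have wg : \sum_l w l *: colv (X v) r0 l = 0.
 apply/rowP => a; rewrite summxE [RHS]mxE.
 have hr : rowv (X v) (lift r0 a) \in r by apply: map_f; rewrite mem_enum.
 have h := hw _ hr.
 by rewrite -[RHS]h; apply: eq_bigr => l _; rewrite !mxE mulrC.
(* The coordinates of [w] above the cutoff; [i] is one of them because [tau <= N ^ -2]. *)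
pose V : {set 'I_N} := finset (fun l => tau <= sqnorm (w l)); have iV : i \in V by rewrite inE (le_trans htau).
have [hV|hV] := leP (#|V|%:R) (dl * N%:R).
 apply: triv; rewrite /concentrated (bigD1 (i, V))//= iV hV /=.
 have -> : dist2 [seq colv (X v) r0 l | l <- enum (V :\ i)] (colv (X v) r0 i) <= t.
  have := @dist2_concentrated R M _ (fun l => colv (X v) r0 l) w i V
   [seq colv (X v) r0 l | l <- enum (V :\ i)] tau (N%:R ^- 2) (M%:R * B) wg iV.
  rewrite card_ord => h; apply: le_trans (h _ _ _ _ hi _) hsp.
  - by move=> l lV li; apply: map_f; rewrite mem_enum !inE li -[tau <= _]/(_) ; move: lV; rewrite inE.
  - by move=> l; rewrite inE -ltNge => /ltW.
  - exact: ltW.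
  - by rewrite invr_gt0 exprn_gt0.
  - move=> l; apply: (@le_trans _ _ (\sum_(a < M) B)); last by rewrite sumr_const card_ord mulr_natl.
   by apply: ler_sum => a _; rewrite mxE.
 rewrite [true%:R]mulr1n -addrA lerDl addr_ge0//; apply: sumr_ge0 => //.
pose X' u : arr R 'I_N := fun j => X u (r0, j).
have mX' : mble X' by exact: meas_reindex.
have aX' : anticonc P X' kap p by exact: (@anticonc_reindex _ _ _ _ _ _ X (fun j => (r0, j)) kap p aX).
have iX' : indep P X'.
 apply: (@indep_reindex _ _ _ P _ _ X (fun j => (r0, j))) => //; first by move=> j j' [].
 by move=> ij; exact: EM.
have NR : 0 < N%:R :> R by rewrite ltr0n.
have hV8 : 8 <= p * #|V|%:R by apply: le_trans dlN _; rewrite ler_wpM2l// ltW.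
have p01 : 0 <= p <= 1 by rewrite ltW.
have hVt j : j \in V -> tau <= sqnorm (w j) by rewrite inE.
have := @sum_small_ball R d T P N X' w V kap p tau e _ 0 mX' iX' aX' p01 e0 ek (ltW k0) tau0 hV8 hVt erefl.
set q := p * #|V|%:R / 4 => hs.
have qq : q0 <= q by rewrite /q0 /q ler_pM2r ?invr_gt0// ler_wpM2l// ltW.
have q00 : 0 < q0 / 3.
 by apply: divr_gt0 => //; apply: divr_gt0 => //; apply: lt_le_trans dlN.
clearbody q; have qp : 0 < q / 3 by lra.
have pos (x : R) : 0 < x -> 0 < x ^+ 2 * sqrt x by move=> x0; rewrite mulr_gt0 ?exprn_gt0 ?sqrtr_gt0.
apply: (@le_trans _ _ (P [set u | sqnorm (\sum_j X' u j * w j - 0)%R <= e]%R)).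
 apply: le_measure; rewrite ?inE//.
  apply: meas_set_le => //; apply: meas_sqnorm; apply: meas_addC => //.
  by apply: meas_sumC => j _; apply: meas_mulC => //; exact: mXij.
 move=> u; rewrite /A /=; apply: le_trans; rewrite subr0.
 have -> : rowdist (mix (fun rc => rc.1 != r0) (X v) (X u)) r0 = dist2 r (rowv (X u) r0).
  rewrite /rowdist (_ : rowv (mix _ _ _) r0 = rowv (X u) r0); last first.
   by apply/rowP => j; rewrite !mxE /mix /= eqxx.
  congr (dist2 _ _); apply: eq_map => a; apply/rowP => j.
  by rewrite !mxE /mix /= eq_sym neq_lift.
 rewrite (eq_bigr (fun j => rowv (X u) r0 0 j * w j)); first exact: hd.
 by move=> j _; rewrite mxE.
apply: le_trans hs _; apply: leeD.
 rewrite lee_fin; have : expR (- (q / 30)) <= expR (- (q0 / 30)) by rewrite ler_expR; lra.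
 by lra.
apply: lee_pmul.
- by rewrite lee_fin divr_ge0// mulr_ge0 ?sqrtr_ge0// sqr_ge0.
- by apply: int_ge0 => u; exact: coincidences_ge0.
- rewrite lee_fin /co; apply: ler_wpM2l => //; rewrite lef_pV2 ?posrE ?pos//.
 have h3 : q0 / 3 <= q / 3 by lra.
 apply: ler_pM; [by rewrite exprn_ge0// ltW|exact: sqrtr_ge0| |exact: ler_wsqrtr].
 by apply: lerXn2r; rewrite ?nnegrE// ltW.
- apply: int_le.
 + exact: (@meas_coincidences R N w V kap e _ _ df mdf).
 + exact: (mcomp msum_psi (measurable_pair1 v)).
 + by move=> u; exact: coincidences_ge0.
 + by move=> u; exact: coincidences_le.
Qed.

(** In the opposite order of integration the two draws of row [r0] are frozen, the merging ratio is
    a constant, and the hypothesis [hrho] on matrices of smaller size applies. *)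
Let int_psi i j : (\int[P]_v \int[(P \x P)%E]_q (psi i j (v, q))%:E <= ((i == j)%:R + (rho + 2 * phi))%:E)%E.
Proof.
rewrite int_int_swap//.
pose h (q : T * T) : R := (i == j)%:R + rho + (4 * B < sqnorm (df q j))%R%:R.
have mh : mble (fun q => (4 * B < sqnorm (df q j))%R).
 by apply: mble_ltr => //; exact: meas_sqnorm.
apply: (@le_trans _ _ (\int[(P \x P)%E]_q (h q)%:E)%E).
 apply: ge0_le_integral => //.
 - by move=> q _; exact: int_ge0.
 - apply: (@measurable_fun_fubini_tonelli_G _ _ _ _ _ P (fun vq => (psi i j vq)%:E)).
   exact/mble_EFinP.
  by move=> vq; rewrite lee_fin.
 - by apply/mble_EFinP; apply: mbleD => //; exact: meas_natr_bool.
 - move=> q _; rewrite /psi /h; case: unliftP => [b0 jE|->] /=; last first.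
   rewrite int_cst lee_fin eqxx [true%:R]/(1%:R) -addrA lerDl addr_ge0//.
  rewrite jE (negbTE (neq_lift _ _)) add0r -jE.
  set c := (4 * B < _)%R%:R; rewrite int_D//; last first.
   apply: meas_natr_bool; do 2 apply: measurable_and => //.
   apply: mble_ler => //.
   by apply: mcomp (@meas_rowdist _ _ _ _) _; apply: mcomp => //; exact: meas_merge.
  rewrite int_cst EFinD; apply: leeD => //.
  have [h1|h1] := leP kap (sqnorm (df q i)); last first.
   by under eq_integral do rewrite /=; rewrite integral0 lee_fin.
  have [h2|h2] := leP (sqnorm (df q j)) (4 * B); last first.
   by under eq_integral do rewrite /=; rewrite integral0 lee_fin.
  under eq_integral do rewrite /=.
  rewrite -prob_bool; last first.
   apply: mble_ler => //.
   by apply: mcomp (@meas_rowdist _ _ _ _) _; apply: mcomp => //; exact: meas_merge.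
  apply: (hrho (Y := fun v => merge r0 i b0 (df q j / df q i) (X v))).
  apply: merge_class => //.
  rewrite sqnormM sqnormV; apply: ler_pM => //; rewrite ?sqnorm_ge0 ?invr_ge0 ?sqnorm_ge0//.
  by rewrite lef_pV2 ?posrE// (lt_le_trans k0).
have -> : (\int[(P \x P)%E]_q (h q)%:E = ((i == j)%:R + rho)%:E + (P \x P) [set q | (4 * B < sqnorm (df q j))%R])%E.
 rewrite int_D//; [|exact: meas_natr_bool|by move=> q; rewrite addr_ge0].
 by congr (_ + _)%E; [exact: int_cst|apply/esym; exact: prob_bool].
have -> : ((i == j)%:R + (rho + 2 * phi))%:E = (((i == j)%:R + rho)%:E + (phi%:E + phi%:E))%E.
 by rewrite -!EFinD; congr (_%:E); ring.
apply: leeD => //.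
apply: (@le_trans _ _ (P [set w | B < sqnorm (X w (r0, j))]%R + P [set w | B < sqnorm (X w (r0, j))]%R)%E); last first.
 by case: hX => _ _ _ hb; apply: leeD; exact: hb.
have mb : measurable [set w | B < sqnorm (X w (r0, j))].
 by apply: meas_set_bool; apply: mble_ltr => //; exact: meas_sqnorm.
pose Bad := [set w | B < sqnorm (X w (r0, j))].
have -> : P [set w | (B < sqnorm (X w (r0, j)))%R] = (P \x P)%E (Bad `*` setT).
 by rewrite product_measure1E// [X in (_ * X)%E]probability_setT mule1.
rewrite {2}(_ : (P \x P)%E (Bad `*` setT) = (P \x P)%E (setT `*` Bad)); last first.
 rewrite !product_measure1E// [X in (_ * X)%E = _]probability_setT.
 by rewrite [X in _ = (X * _)%E]probability_setT mule1 mul1e.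
apply: le_trans (measureU2 _ _ _) ; try exact: measurableX.
apply: le_measure; rewrite ?inE; first exact: meas_set_bool.
 by apply: measurableU; exact: measurableX.
move=> [w1 w2] /= hq; apply: contrapT => /not_orP[h1 h2].
have {}h1 : sqnorm (X w1 (r0, j)) <= B by rewrite leNgt; apply/negP => h'; apply: h1.
have {}h2 : sqnorm (X w2 (r0, j)) <= B by rewrite leNgt; apply/negP => h'; apply: h2.
by have := sqnormB_le (X w1 (r0, j)) (X w2 (r0, j)); move: hq; rewrite /df /=; lra.
Qed.

(** The four contributions: dependencies with small support, large entries, few large differences,
    coincidences. As [co] is of order [N ^ (-5/2)], the last one turns [rho] into [rho / sqrt N] up
    to the diagonal term [N ^ (-3/2)]. *)
Lemma least_distance_step :
 (P [set w | rowdist (X w) r0 <= e]%R <= (N%:R * expR (- (p / 24 * N%:R)) + N%:R ^+ 2 * phi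
  + 3 * expR (- (q0 / 30)) + co * (N%:R + N%:R ^+ 2 * (rho + 2 * phi)))%:E)%E.
Proof.
have mrow : mble (fun f : arr R ('I_N * 'I_N) => rowdist f r0 <= e).
 by apply: mble_ler => //; exact: meas_rowdist.
rewrite (@indep_decouple_prob _ _ _ P _ X (fun rc => rc.1 != r0) (fun f => rowdist f r0 <= e))//.
have mfin : mble (fun v => (concentrated v + big v + 3 * expR (- (q0 / 30)))%:E).
 apply/mble_EFinP; apply: mbleD; last exact: measurable_cst.
 by apply: mbleD; [exact: mconc|exact: mbig].
have c0 v : 0 <= concentrated v by apply: sumr_ge0.
have b0 v : 0 <= big v by apply: sumr_ge0.
have e30 : 0 <= 3 * expR (- (q0 / 30)) :> R by rewrite mulr_ge0 ?expR_ge0.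
have mint : mble (fun v => \int[(P \x P)%E]_q (sum_psi (v, q))%:E)%E.
 exact: meas_int_snd.
apply: (@le_trans _ _ (\int[P]_v ((concentrated v + big v + 3 * expR (- (q0 / 30)))%:E +
  co%:E * \int[(P \x P)%E]_q (sum_psi (v, q))%:E))%E).
 apply: ge0_le_integral => //.
 - have := @measurable_fun_xsection _ _ _ _ _ P [set vw : T * T |
   rowdist (mix (fun rc => rc.1 != r0) (X vw.1) (X vw.2)) r0 <= e].
  rewrite /comp => h; apply: eq_measurable_fun (h _).
   by move=> v _; congr (P _); apply/seteqP; split => w /=; rewrite /xsection /= inE.
  apply: meas_set_bool; apply: (mcomp mrow).
  by apply: meas_mix; exact: mcomp.
 - apply: emeasurable_funD; first exact: mfin.
  by apply: emeasurable_funM.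
have g0 v : setT v -> (0 <= co%:E * \int[(P \x P)%E]_q (sum_psi (v, q))%:E)%E.
 by move=> _; rewrite mule_ge0 ?lee_fin// int_ge0.
have mg : mble (fun v => co%:E * \int[(P \x P)%E]_q (sum_psi (v, q))%:E)%E.
 exact: emeasurable_funM.
rewrite ge0_integralD//=; last by move=> v _; rewrite lee_fin !addr_ge0.
rewrite [in X in (_ <= X)%E]EFinD; apply: leeD.
 rewrite int_D//; [|exact: mbleD|by move=> v; rewrite addr_ge0].
 rewrite int_cst EFinD; apply: leeD => //; rewrite int_D// EFinD; apply: leeD.
  rewrite int_sum//; last first.
   move=> iS; apply: meas_natr_bool.
   do 2 (apply: measurable_and => //); apply: mble_ler => //.
   by apply: meas_dist2 => [l|]; exact: mcol.
  apply: (@le_trans _ _ (\sum_(iS : 'I_N * {set 'I_N})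
    ((#|iS.2|%:R <= dl * N%:R)%R%:R * expR (- (p / 12 * N%:R)))%:E)%E).
   apply: lee_sum => -[i S] _ /=; have [iS|iS] := boolP (i \in S); last first.
    by under eq_integral do rewrite /=; rewrite integral0 lee_fin mulr_ge0 ?expR_ge0.
   have [hS|hS] := leP (#|S|%:R : R) (dl * N%:R); last first.
    by under eq_integral do rewrite /=; rewrite integral0 mul0r.
   rewrite mul1r -prob_bool; last first.
    apply: mble_ler => //.
    by apply: meas_dist2 => [l|]; exact: mcol.
   apply: column_concentrated_prob => //; first exact: ltW.
   apply: le_trans hS _; rewrite mulrC; apply: ler_wpM2l => //; by move: dl1; rewrite div1r.
  rewrite sumEFin lee_fin -(pair_bigA _ (fun (i : 'I_N) (S : {set 'I_N}) =>
    (#|S|%:R <= dl * N%:R)%R%:R * expR (- (p / 12 * N%:R)))) /=.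
  rewrite sumr_const card_ord -mulr_suml -[leLHS]mulr_natl; apply: ler_wpM2l => //.
  (* By [hL] the number of supports costs at most half of the exponent [p / 12]. *)
  have := @card_small_sets R 'I_N L (dl * N%:R) L0; rewrite card_ord => h.
  apply: (@le_trans _ _ (expR (L * (dl * N%:R) + N%:R * expR (- L)) * expR (- (p / 12 * N%:R)))).
   by rewrite ler_wpM2r ?expR_ge0.
  rewrite -expRD ler_expR; have N0 : 0 <= N%:R :> R by [].
  by have := ler_wpM2r N0 hL; lra.
 rewrite int_sum//; last first.
  by move=> ij; apply: meas_natr_bool; apply: mble_ltr => //; exact: meas_sqnorm.
 apply: (@le_trans _ _ (\sum_(ij : 'I_N * 'I_N) phi%:E)%E).
  apply: lee_sum => ij _; rewrite -prob_bool; first by case: hX => _ _ _; exact.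
  by apply: mble_ltr => //; exact: meas_sqnorm.
 by rewrite sumEFin sumr_const card_prod card_ord -[phi *+ _]mulr_natl natrM -expr2.
rewrite ge0_integralZl//; last by move=> v _; exact: int_ge0.
rewrite [X in (_ <= X)%E]EFinM; apply: lee_wpmul2l; first by rewrite lee_fin; exact: co0.
under eq_integral => v _ do (rewrite int_sum; [|by move=> ij; exact: (mcomp (mpsi _ _) (measurable_pair1 v))|by []]).
rewrite ge0_integral_sum//; last 2 first.
- by move=> ij; exact: meas_int_snd.
- by move=> ij v _; exact: int_ge0.
apply: (@le_trans _ _ (\sum_(ij : 'I_N * 'I_N) ((ij.1 == ij.2)%:R + (rho + 2 * phi))%:E)%E).
 by apply: lee_sum => ij _; exact: int_psi.
rewrite sumEFin lee_fin big_split /= sumr_const card_prod card_ord -[X in _ + X]mulr_natl natrM -expr2 lerD2r.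
rewrite -(pair_bigA _ (fun i j : 'I_N => (i == j)%:R)) /= (eq_bigr (fun=> 1)) ?sumr_const ?card_ord// => i _.
rewrite (bigD1 i)//= eqxx big1 ?addr0// => j ji; by rewrite eq_sym (negbTE ji).
Qed.

End least_distance_step.

(** * Polynomial lower bound for the least distance *)

Section least_distance.
Context {R : realType} {d} {T : measurableType d} (P : probability T R).
Local Notation C := R[i].

Lemma expR_le_pow4 (x : R) : 0 < x -> expR (- x) <= (4 / x) ^+ 4.
Proof.
move=> x0; have -> : expR (- x) = expR (- (x / 4)) ^+ 4.
 by rewrite -expRM_natl; congr expR; field.
apply: lerXn2r; rewrite ?nnegrE ?expR_ge0//; first by rewrite divr_ge0// ltW.
rewrite expRN -(invf_div x 4) lef_pV2 ?posrE ?expR_gt0 ?divr_gt0//.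
by apply: le_trans (expR_ge1Dx _); rewrite lerDr.
Qed.

Lemma matrix_class_le m n (X : T -> arr R ('I_m * 'I_n)) kap p B phi B' phi' :
 B <= B' -> phi <= phi' -> matrix_class P X kap p B phi -> matrix_class P X kap p B' phi'.
Proof.
move=> BB pp [mX iX aX bX]; split => // ij.
have ms : mble (fun w => sqnorm (X w ij)).
 by apply: meas_sqnorm; move: ij; apply/meas_arrP.
apply: (@le_trans _ _ phi%:E); last by rewrite lee_fin.
apply: le_trans (bX ij); apply: le_measure; rewrite ?inE.
- by apply: meas_set_bool; exact: mble_ltr.
- by apply: meas_set_bool; exact: mble_ltr.
- by move=> w /=; apply: le_lt_trans.
Qed.

Lemma meas_rowdist_le M n (X : T -> arr R ('I_M.+1 * 'I_n)) r0 c :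
 mble X -> measurable [set w | rowdist (X w) r0 <= c].
Proof.
by move=> mX; apply: meas_set_le => //; apply: mcomp (@meas_rowdist _ _ _ _) mX.
Qed.

(** All exponents [b] of the entry bound are quantified over, because a merging step replaces [b] by
    [4 b + 2]; the threshold exponent [a] may depend on [b]. *)
Definition lsv_bound (kap p : R) k := forall (b : nat) (beta : R), 0 <= beta ->
 exists (a : nat) (D : R), 0 <= D /\ forall M (X : T -> arr R ('I_M.+1 * 'I_M.+1)) r0,
  matrix_class P X kap p (M.+1%:R ^+ b) (beta * M.+1%:R ^- 4) ->
  (P [set w | rowdist (X w) r0 <= M.+1%:R ^- a]%R <= (D / sqrt M.+1%:R ^+ k)%:E)%E.

Lemma lsv_bound0 kap p : lsv_bound kap p 0.
Proof.
move=> b beta _; exists 0%N, 1; split => // M X r0 [mX _ _ _].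
by rewrite expr0 divr1; apply: probability_le1; exact: meas_rowdist_le.
Qed.

(** The cutoff [tau] absorbs the entry bound and fixed powers of [n]; in return the threshold
    exponent grows from [a'] to [a' + 2 b + 8], and the entries of the merged matrix are bounded by
    [m ^ (4 b + 2)]. *)
Lemma lsv_parameters (n m B kap p tau : R) b a' : 2 <= m -> n = m + 1 -> 0 < kap -> 0 < p ->
 48 / (p * kap) + 8 / kap + 10 <= n ->
 B = n ^+ b -> tau = n ^- (b + 6) ->
 [/\ n ^- (a' + 2 * b + 8) <= kap * tau, tau <= n ^- 2,
   (n * tau) * (n * (m * B)) / n ^- 2 <= p * kap / 48,
   4 * n ^- (a' + 2 * b + 8) * (m * B) / (kap * tau) <= n ^- a' &
   2 * B + 8 * B ^+ 2 / kap <= m ^+ (4 * b + 2)].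
Proof.
move=> m2 nm k0 p0 hn BE tauE.
have pk : 0 < p * kap by rewrite mulr_gt0.
have k8 : 0 < 8 / kap by rewrite divr_gt0.
have pk48 : 0 < 48 / (p * kap) by rewrite divr_gt0.
have n1 : 1 <= n by lra.
have n0 : 0 < n by lra.
have nX k : 0 < n ^+ k by rewrite exprn_gt0.
have nX1 k : 1 <= n ^+ k by rewrite exprn_ege1.
have nne : n != 0 by rewrite gt_eqF.
have kne : kap != 0 by rewrite gt_eqF.
have nk8 : 8 <= n * kap by rewrite -ler_pdivrMr//; lra.
have npk : 48 <= n * (p * kap) by rewrite -ler_pdivrMr//; lra.
split.
- rewrite tauE -[leLHS]div1r ler_pdivrMr// mulrAC ler_pdivlMr// mul1r.
 have -> : (a' + 2 * b + 8 = (b + 6) + (a' + b + 1).+1)%N by clear; lia.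
 rewrite (exprD n (b + 6)) (exprS n (a' + b + 1)).
 have := nX1 (a' + b + 1)%N; move: (n ^+ (a' + b + 1)) (n ^+ (b + 6)) (nX (b + 6)%N) => v u u0 v1.
 have -> : kap * (u * (n * v)) = u * (n * kap * v) by ring.
 by rewrite ler_peMr ?(ltW u0)//; nra.
- by rewrite tauE lef_pV2 ?posrE// ler_weXn2l//; clear; lia.
- rewrite tauE BE invrK.
 apply: (@le_trans _ _ (n^-1)); last by rewrite -[leLHS]div1r ler_pdivrMr//; lra.
 have -> : n / n ^+ (b + 6) * (n * (m * n ^+ b)) * n ^+ 2 = m / n ^+ 2.
  by rewrite exprD; field; rewrite ?expf_neq0 ?nne.
 rewrite ler_pdivrMr// expr2 mulKf//; lra.
- rewrite tauE BE.
 have -> : 4 * n ^- (a' + 2 * b + 8) * (m * n ^+ b) / (kap / n ^+ (b + 6)) = 4 * m / (n ^+ 2 * kap) / n ^+ a'.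
  rewrite (_ : a' + 2 * b + 8 = a' + (b + (b + 8)))%N; last by clear; lia.
  rewrite (_ : b + 8 = (b + 6) + 2)%N; last by clear; lia.
  by rewrite !(exprD n); field; rewrite !expf_neq0 ?nne ?kne.
 rewrite -[leRHS]mul1r ler_pM2r ?invr_gt0// ler_pdivrMr ?mulr_gt0//; nra.
- have mn : n <= m ^+ 2 by rewrite nm; nra.
 have B1 : 1 <= B by rewrite BE.
 apply: (@le_trans _ _ (B ^+ 2 * m ^+ 2)).
  have -> : 8 * B ^+ 2 / kap = B ^+ 2 * (8 / kap) by ring.
  have : 2 * B <= B ^+ 2 * 2 by nra.
  have : B ^+ 2 * (2 + 8 / kap) <= B ^+ 2 * m ^+ 2 by rewrite ler_wpM2l ?sqr_ge0//; nra.
  by lra.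
 rewrite BE exprD; apply: ler_wpM2r; first by rewrite sqr_ge0.
 rewrite -exprM (_ : 4 * b = 2 * (b * 2))%N; last by clear; lia.
 by rewrite (exprM m 2); apply: lerXn2r; rewrite ?nnegrE ?exprn_ge0//; lra.
Qed.

(** With [s = sqrt n] the prefactor is of order [s ^ -5]: the diagonal term becomes [s ^ -3], which
    limits [k.+1] to [3], and the coincidence term gains one factor [s^-1] over [D' / sqrt m ^ k].
    The exponentials are bounded through [expR_le_pow4]. *)
Lemma lsv_sum_bound (n m s p dl c D' beta : R) k : (k < 3)%N -> 0 < p -> 0 < c ->
 c = p * dl / 4 -> 1 <= s -> s ^+ 2 = n -> n = m + 1 -> 2 <= m -> 0 <= D' -> 0 <= beta ->
 n * expR (- (p / 24 * n)) + n ^+ 2 * (beta * n ^- 4) + 3 * expR (- (p * (dl * n) / 4 / 30)) +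
 192 / ((p * (dl * n) / 4 / 3) ^+ 2 * sqrt (p * (dl * n) / 4 / 3)) *
  (n + n ^+ 2 * (D' / sqrt m ^+ k + 2 * (beta * n ^- 4))) <=
 ((4 / (p / 24)) ^+ 4 + beta + 3 * (4 / (c / 30)) ^+ 4 +
  192 / ((c / 3) ^+ 2 * sqrt (c / 3)) * (1 + 2 ^+ k * D' + 2 * beta)) * s ^- k.+1.
Proof.
move=> k3 p0 c0 cE s1 s2 nm m2 D'0 beta0.
have s0 : 0 < s by lra.
have n0 : 0 < n by lra.
have m0 : 0 < m by lra.
have pos4 x : 0 <= (4 / x) ^+ 4 :> R by rewrite (exprM _ 2 2) sqr_ge0.
have sle j : (k.+1 <= j)%N -> s ^- j <= s ^- k.+1.
 by move=> kj; rewrite lef_pV2 ?posrE ?exprn_gt0// ler_weXn2l.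
have decay y j : 0 < y -> (j <= 1)%N -> n ^+ j * expR (- (y * n)) <= (4 / y) ^+ 4 * s ^- k.+1.
 move=> y0 j1; apply: (@le_trans _ _ ((4 / y) ^+ 4 * s ^- (8 - j.*2))); last first.
  by apply: ler_wpM2l => //; apply: sle; clear -k3 j1; lia.
 apply: (@le_trans _ _ (n ^+ j * (4 / (y * n)) ^+ 4)).
  apply: ler_wpM2l; first by rewrite exprn_ge0// ltW.
  by apply: expR_le_pow4; rewrite mulr_gt0.
 apply: eq_ler; rewrite -s2; case: j j1 => [|[|//]] _; rewrite /= ?expr1 ?expr0.
  by field; rewrite !gt_eqF.
 by field; rewrite !gt_eqF.
have t1 : n * expR (- (p / 24 * n)) <= (4 / (p / 24)) ^+ 4 * s ^- k.+1.
 by have := @decay (p / 24) 1 _ isT; rewrite expr1; apply; rewrite divr_gt0.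
have t2 : n ^+ 2 * (beta * n ^- 4) <= beta * s ^- k.+1.
 apply: (@le_trans _ _ (beta * s ^- 4)).
  by apply: eq_ler; rewrite -s2; field; rewrite gt_eqF.
 by apply: ler_wpM2l => //; apply: sle; clear -k3; lia.
have t3 : 3 * expR (- (p * (dl * n) / 4 / 30)) <= 3 * (4 / (c / 30)) ^+ 4 * s ^- k.+1.
 rewrite -[leRHS]mulrA; apply: ler_wpM2l => //.
 have -> : p * (dl * n) / 4 / 30 = c / 30 * n by rewrite cE; ring.
 by have := @decay (c / 30) 0 _ isT; rewrite expr0 mul1r; apply; rewrite divr_gt0.
have -> : p * (dl * n) / 4 / 3 = c / 3 * s ^+ 2 by rewrite cE s2; ring.
have c3 : 0 < c / 3 by rewrite divr_gt0.
rewrite sqrtrM ?(ltW c3)// sqrtr_sqr (gtr0_norm s0).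
have x0 : 0 < sqrt (c / 3) by rewrite sqrtr_gt0.
move: (c / 3) c3 (sqrt (c / 3)) x0 => y y0 x x0.
move: (192 : R) (ler0n R 192) => N N0.
set rho := D' / _.
have t4 : N / ((y * s ^+ 2) ^+ 2 * (x * s)) * (n + n ^+ 2 * (rho + 2 * (beta * n ^- 4))) <=
  N / (y ^+ 2 * x) * (1 + 2 ^+ k * D' + 2 * beta) * s ^- k.+1.
 have -> : N / ((y * s ^+ 2) ^+ 2 * (x * s)) * (n + n ^+ 2 * (rho + 2 * (beta * n ^- 4))) =
   N / (y ^+ 2 * x) * (s ^- 3 + rho / s + 2 * beta * s ^- 9).
  by clearbody rho; rewrite -s2; field; rewrite !gt_eqF.
 rewrite -[leRHS]mulrA; apply: ler_wpM2l.
  by rewrite divr_ge0// mulr_ge0 ?sqr_ge0// ltW.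
 have r1 : rho / s <= 2 ^+ k * D' * s ^- k.+1.
  have -> : 2 ^+ k * D' * s ^- k.+1 = D' * (2 / s) ^+ k / s.
   by rewrite exprS expr_div_n; field; rewrite expf_neq0 gt_eqF.
  rewrite ler_pM2r ?invr_gt0//; apply: ler_wpM2l => //; rewrite -exprVn.
  apply: lerXn2r; rewrite ?nnegrE ?invr_ge0 ?sqrtr_ge0 ?divr_ge0 ?(ltW s0)//.
  rewrite -[2 / s]invf_div lef_pV2 ?posrE ?divr_gt0 ?sqrtr_gt0//.
  rewrite -(ler_pXn2r (n:=2)) ?nnegrE ?sqrtr_ge0 ?divr_ge0 ?(ltW s0)//.
  by rewrite sqr_sqrtr ?(ltW m0)// expr_div_n s2; lra.
 have r2 := sle 3 k3; have r3 : 2 * beta * s ^- 9 <= 2 * beta * s ^- k.+1.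
  by apply: ler_wpM2l; [rewrite mulr_ge0|apply: sle; clear -k3; lia].
 by rewrite !mulrDl mul1r; lra.
by rewrite !(mulrDl _ _ (s ^- k.+1)); lra.
Qed.

Lemma lsv_boundS kap p k : 0 < kap -> 0 < p -> p <= 1 -> (k < 3)%N ->
 lsv_bound kap p k -> lsv_bound kap p k.+1.
Proof.
move=> k0 p0 p1 k3 ih b beta beta0.
have beta20 : 0 <= 2 * beta by rewrite mulr_ge0.
have [a' [D' [D'0 hD']]] := ih (4 * b + 2)%N (2 * beta) beta20.
(* With [dl = y ^ 2] and [L = y^-1] the sum [L * dl + expR (- L)] is at most [2 y = p / 24]. *)
pose y := p / 48; have y0 : 0 < y by rewrite divr_gt0.
have yp : y <= 1 / 48 by rewrite /y; lra.
pose dl := y ^+ 2; pose L := y^-1; pose c := p * dl / 4.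
have dl0 : 0 < dl by rewrite exprn_gt0.
have c0 : 0 < c by rewrite divr_gt0 ?mulr_gt0.
have pk0 : 0 < 48 / (p * kap) by rewrite divr_gt0 ?mulr_gt0.
have k80 : 0 < 8 / kap by rewrite divr_gt0.
have pd0 : 0 < 8 / (p * dl) by rewrite divr_gt0 ?mulr_gt0.
have cE : c = p * dl / 4 by [].
have L0 : 0 <= L by rewrite invr_ge0 ltW.
have hL : L * dl + expR (- L) <= p / 24.
 have -> : L * dl = y by rewrite /L /dl expr2 mulKf// gt_eqF.
 have : expR (- L) <= y.
  rewrite expRN -[leRHS]invrK lef_pV2 ?posrE ?expR_gt0 ?invr_gt0//.
  by apply: le_trans (expR_ge1Dx _); rewrite lerDr.
 by rewrite /y; lra.
have dl1 : dl <= 1 / 2 by rewrite /dl; nra.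
clearbody L c dl; clear y y0 yp.
pose K : R := 48 / (p * kap) + 8 / kap + 10 + 8 / (p * dl).
have [N1 hN1] : exists N1 : nat, K <= N1%:R.
 by exists (Num.truncn K).+1; apply: ltW; exact: truncnS_gt.
pose Dc := (4 / (p / 24)) ^+ 4 + beta + 3 * (4 / (c / 30)) ^+ 4 +
  192 / ((c / 3) ^+ 2 * sqrt (c / 3)) * (1 + 2 ^+ k * D' + 2 * beta).
have D20 : 0 <= Dc.
 have e4 x : 0 <= (4 / x) ^+ 4 :> R by rewrite (exprM _ 2 2) sqr_ge0.
 apply: addr_ge0; first by apply: addr_ge0; [exact: addr_ge0|apply: mulr_ge0].
 apply: mulr_ge0; first by rewrite divr_ge0// mulr_ge0 ?sqrtr_ge0 ?sqr_ge0.
 by apply: addr_ge0 => //; apply: addr_ge0 => //; rewrite mulr_ge0 ?exprn_ge0.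
have hsum n m s := @lsv_sum_bound n m s p dl c D' beta k k3 p0 c0 cE.
rewrite -/Dc in hsum; clearbody Dc.
exists (a' + 2 * b + 8)%N, (N1%:R ^+ k.+1 + Dc); split; first by rewrite addr_ge0 ?exprn_ge0.
have sq (n : R) : 1 <= n -> let s := sqrt n in [/\ 1 <= s, s ^+ 2 = n & 0 < s ^+ k.+1] :> Prop.
 move=> n1 s; have n0 : 0 < n by lra.
 have s2 : s ^+ 2 = n by rewrite sqr_sqrtr// ltW.
 have s0 : 0 < s by rewrite sqrtr_gt0.
 split => //; last by rewrite exprn_gt0.
 by rewrite -(ler_pXn2r (n:=2)) ?nnegrE ?(ltW s0)// s2 expr1n.
move=> M X r0 hX.
have n1 : 1 <= M.+1%:R :> R by rewrite -[1]/(1%:R) ler_nat.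
have [s1 s2 sk] := sq _ n1.
(* For [M.+1 < N1] the term [N1 ^ k.+1] of the constant makes the bound at least [1]. *)
have [MN|NM] := ltnP M.+1 N1.
 apply: (@le_trans _ _ 1%E).
  by apply: probability_le1; apply: meas_rowdist_le; case: hX.
 rewrite lee_fin ler_pdivlMr// mul1r; apply: (@le_trans _ _ (N1%:R ^+ k.+1)); last by rewrite lerDl.
 apply: lerXn2r; rewrite ?nnegrE ?sqrtr_ge0//.
 apply: (@le_trans _ _ M.+1%:R); last by rewrite ler_nat ltnW.
 by rewrite -[X in _ <= X]s2 expr2 ler_peMr// sqrtr_ge0.
have nK : K <= M.+1%:R by apply: le_trans hN1 _; rewrite ler_nat.
case: M X r0 hX n1 s1 s2 sk NM nK => [|M'] X r0 hX n1 s1 s2 sk NM nK.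
 by exfalso; move: nK; rewrite /K; lra.
move: (erefl (M'.+2%:R : R)); rewrite -{2}natr1.
set n : R := M'.+2%:R in n1 s1 s2 sk nK hX *; set m : R := M'.+1%:R => nm.
have m2 : 2 <= m by move: nK; rewrite nm /K; lra.
have hn : 48 / (p * kap) + 8 / kap + 10 <= n by move: nK; rewrite /K; lra.
have [h1 h2 h3 h4 h5] := lsv_parameters a' m2 nm k0 p0 hn (erefl (n ^+ b)) (erefl (n ^- (b + 6))).
have n0 : 0 < n by lra.
have B0 : 0 <= n ^+ b by rewrite exprn_ge0// ltW.
have phi0 : 0 <= beta * n ^- 4 by rewrite mulr_ge0// invr_ge0 exprn_ge0// ltW.
have tau0 : 0 < n ^- (b + 6) by rewrite invr_gt0 exprn_gt0.
have e0 : 0 < n ^- (a' + 2 * b + 8) by rewrite invr_gt0 exprn_gt0.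
have dlN : 8 <= p * (dl * n).
 by rewrite mulrA mulrC -ler_pdivrMr ?mulr_gt0//; move: nK; rewrite /K; lra.
pose rho := D' / sqrt m ^+ k.
have m0 : 0 < m by lra.
have rho0 : 0 <= rho by rewrite divr_ge0// exprn_ge0// sqrtr_ge0.
have mn : m <= n by lra.
have hrho (Y : T -> arr R ('I_M'.+1 * 'I_M'.+1)) b0 :
  matrix_class P Y kap p (2 * n ^+ b + 8 * (n ^+ b) ^+ 2 / kap) (2 * (beta * n ^- 4)) ->
  (P [set w | rowdist (Y w) b0 <= n ^- a']%R <= rho%:E)%E.
 move=> hY; have mY : mble Y by case: hY.
 have hY' : matrix_class P Y kap p (M'.+1%:R ^+ (4 * b + 2)) (2 * beta * M'.+1%:R ^- 4).
  apply: matrix_class_le hY; first exact: h5.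
  rewrite mulrA; apply: ler_wpM2l => //; rewrite lef_pV2 ?posrE ?exprn_gt0//.
  by apply: lerXn2r; rewrite ?nnegrE ?(ltW m0) ?(ltW n0).
 apply: le_trans (hD' _ _ b0 hY'); apply: le_measure; rewrite ?inE.
 - exact: meas_rowdist_le.
 - exact: meas_rowdist_le.
 - move=> w /= /le_trans; apply; rewrite lef_pV2 ?posrE ?exprn_gt0//.
  by apply: lerXn2r; rewrite ?nnegrE ?(ltW m0) ?(ltW n0).
have hstep := @least_distance_step R d T P M' X r0 kap p (n ^+ b) (beta * n ^- 4) (n ^- (b + 6))
 (n ^- (a' + 2 * b + 8)) (n ^- a') dl L rho hX k0 p0 p1 B0 phi0 tau0 e0 h1 h2 h3 h4 dl1 dlN L0 hL rho0 hrho.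
apply: le_trans hstep _; rewrite lee_fin.
apply: le_trans (hsum n m (sqrt n) s1 s2 nm m2 D'0 beta0) _.
rewrite -[X in _ <= X]/((N1%:R ^+ k.+1 + Dc) * _) mulrDl lerDr.
by rewrite mulr_ge0 ?exprn_ge0// invr_ge0 ltW.
Qed.

Lemma least_distance kap p : 0 < kap -> 0 < p -> p <= 1 -> lsv_bound kap p 3.
Proof. by move=> k0 p0 p1; do 3 (apply: lsv_boundS => //); exact: lsv_bound0. Qed.

End least_distance.

(** * Concentration of Laplace transforms under row resampling *)

Section laplace_concentration.
Context {R : realType} {d} {T : measurableType d} (P : probability T R).

Lemma int_prod (g h : T -> R) : mble g -> mble h ->
 (forall w, 0 <= g w) -> (forall w, 0 <= h w) ->
 (\int[(P \x P)%E]_p (g p.1 * h p.2)%:E = \int[P]_w (g w)%:E * \int[P]_w (h w)%:E)%E.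
Proof.
move=> mg mh g0 h0.
rewrite (fubini_tonelli1 (fun p => (g p.1 * h p.2)%:E)) /fubini_F /=; last 2 first.
- apply/mble_EFinP; apply: mbleM.
  exact: (mcomp mg measurable_fst).
 exact: (mcomp mh measurable_snd).
- by move=> p; rewrite lee_fin mulr_ge0.
under eq_integral => w _ do rewrite int_Zl// muleC -[(\int[P]_w0 _)%E]gee0_abs ?int_ge0//.
rewrite gee0_abs ?int_ge0// ge0_integralZl//; first by rewrite muleC.
- exact/mble_EFinP.
- by move=> w _; rewrite lee_fin.
- exact: int_ge0.
Qed.

(* [cosh (lam * t) - 1 <= 8 * lam ^ 2 * expR t], written for [r = expR (lam * t)]. *)
Lemma cosh_scale_le (lam S r : R) : 0 <= lam <= 1 / 2 -> 1 <= S -> 0 < r ->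
 r <= expR (lam * ln S) -> r^-1 <= expR (lam * ln S) ->
 r + r^-1 <= 2 * (1 + 8 * lam ^+ 2 * S).
Proof.
move=> /andP[l0 l1] S1 r0 h1 h2.
have S0 : 0 < S by lra.
set t := ln S in h1 h2; have t0 : 0 <= t by exact: ln_ge0.
have St : S = expR t by rewrite lnK// posrE.
pose a := lam * t / 2; have a0 : 0 <= a by rewrite divr_ge0// mulr_ge0.
pose e := expR a; have e1 : 1 <= e by rewrite -[leLHS]expR0 ler_expR.
have ee : expR (lam * t) = e ^+ 2 by rewrite -expRM_natl /a; congr expR; field.
rewrite ee in h1 h2.
have key : r + r^-1 <= e ^+ 2 + e ^- 2.
 have e0 : 0 < e by lra.
 have E0 : 0 < e ^+ 2 by rewrite exprn_gt0.
 rewrite -subr_ge0.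
 have -> : e ^+ 2 + e ^- 2 - (r + r^-1) = (e ^+ 2 - r) * (e ^+ 2 - r^-1) * e ^- 2.
  by field; rewrite !gt_eqF.
 by rewrite !mulr_ge0 ?subr_ge0// invr_ge0 ltW.
apply: (le_trans key).
have -> : e ^+ 2 + e ^- 2 = 2 + (e - e^-1) ^+ 2 by field; rewrite gt_eqF//; lra.
have h3 : e - e^-1 <= 2 * a * e.
 have -> : e - e^-1 = e * (1 - expR (- (2 * a))).
  have -> : expR (- (2 * a)) = e ^- 2 by rewrite expRN -expRM_natl.
  by field; rewrite gt_eqF//; lra.
 rewrite mulrC ler_wpM2r//; first by lra.
 by have := expR_ge1Dx (- (2 * a)); lra.
have h4 : 0 <= e - e^-1.
 by rewrite subr_ge0; apply: (@le_trans _ _ 1) => //; rewrite invf_le1//; lra.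
have h5 : (e - e^-1) ^+ 2 <= (2 * a * e) ^+ 2 by apply: lerXn2r; rewrite ?nnegrE// (le_trans h4).
have h6 : e ^+ 2 <= expR (t / 2) by rewrite -ee ler_expR; nra.
have h7 : (t / 4) ^+ 2 <= expR (t / 2).
 have -> : t / 2 = 2 * (t / 4) by field.
 rewrite expRM_natl; apply: lerXn2r; rewrite ?nnegrE ?expR_ge0 ?divr_ge0//.
 by apply: le_trans (expR_ge1Dx _); rewrite lerDr.
have h8 : S = expR (t / 2) ^+ 2 by rewrite St -expRM_natl; congr expR; field.
have h9 : (2 * a * e) ^+ 2 <= 16 * lam ^+ 2 * S.
 have -> : (2 * a * e) ^+ 2 = 16 * lam ^+ 2 * ((t / 4) ^+ 2 * e ^+ 2) by rewrite /a; field.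
 rewrite h8 expr2; apply: ler_wpM2l; first by rewrite mulr_ge0// sqr_ge0.
 by apply: ler_pM; rewrite ?sqr_ge0.
by lra.
Qed.

Lemma expR_ln_le (lam S : R) : 0 <= lam <= 1 / 2 -> 1 <= S -> expR (lam * ln S) <= S.
Proof.
move=> /andP[l0 l1] S1; rewrite -[leRHS]lnK ?posrE; last lra.
by rewrite ler_expR; have := ln_ge0 S1; nra.
Qed.

Variables (n m : nat) (X : T -> arr R ('I_n * 'I_m)).
Local Notation A := (arr R ('I_n * 'I_m)).
Variables (Th : 'I_n -> A -> R) (th lam : R).
Hypotheses (mX : mble X) (iX : indep P X) (hlam : 0 <= lam <= 1 / 2)
 (mTh : forall i, mble (Th i)) (Th1 : forall i f, 1 <= Th i f)
 (Th_row : forall i f g, (forall j, f (i, j) = g (i, j)) -> Th i f = Th i g)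
 (ETh : forall i, (\int[P]_w (Th i (X w))%:E <= th%:E)%E).

Let row (i : 'I_n) : pred ('I_n * 'I_m) := fun ij => ij.1 == i.

(** [Th i] is a size of row [i] with bounded mean; only its logarithm enters the oscillation of
    [ln u], which is what second moments of the entries permit. *)
Definition slowly_varying (u : A -> R) i := forall f g,
 (forall ij, ij.1 != i -> f ij = g ij) -> u f <= expR (lam * ln (Th i f * Th i g)) * u g.

Let Th_mix i j f g : Th i (mix (row j) f g) = if i == j then Th i f else Th i g.
Proof.
by case: eqP => [->|/eqP ij]; apply: Th_row => k; rewrite /mix /row /= ?eqxx// (negbTE ij).
Qed.

Let Th2 i f g : 1 <= Th i f * Th i g.
Proof. by rewrite -[leLHS]mulr1; apply: ler_pM. Qed.

Lemma slowly_varying_inv (u : A -> R) i : (forall f, 0 < u f) -> slowly_varying u i ->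
 slowly_varying (fun f => (u f)^-1) i.
Proof.
move=> u0 hu f g fg; rewrite -ler_pdivrMl ?expR_gt0// -invfM lef_pV2 ?posrE ?mulr_gt0 ?expR_gt0//.
by rewrite [Th i f * _]mulrC; apply: hu => ij h; rewrite fg.
Qed.

Let meas_mix_l j g : mble (fun w => mix (row j) (X w) g).
Proof. by apply: meas_mix => //; exact: measurable_cst. Qed.

Let row_integral_finite (u : A -> R) i g : mble u -> (forall f, 0 < u f) -> slowly_varying u i ->
 (\int[P]_w (u (mix (row i) (X w) g))%:E <= (th * (Th i g * u g))%:E)%E.
Proof.
move=> mu u0 hu.
apply: (@le_trans _ _ (\int[P]_w (Th i (X w) * (Th i g * u g))%:E)%E).
 apply: int_le.
 - exact: mcomp.
 - by apply: mbleM => //; exact: mcomp.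
 - by move=> w; exact: ltW.
 - move=> w; apply: le_trans (hu _ g _) _.
   by move=> ij ji; rewrite /mix /row (negbTE ji).
  rewrite Th_mix eqxx mulrA ler_wpM2r ?(ltW (u0 _))//; exact: expR_ln_le.
rewrite int_Zr//; [|exact: mcomp|by move=> w; exact: le_trans (Th1 _ _)|].
 rewrite [X in (_ <= X)%E]EFinM; apply: lee_wpmul2r => //.
 by rewrite lee_fin mulr_ge0 ?(ltW (u0 _))// (le_trans _ (Th1 _ _)).
by rewrite mulr_ge0 ?(ltW (u0 _))// (le_trans _ (Th1 _ _)).
Qed.

Lemma int_gt0 (g : T -> R) : mble g -> (forall w, 0 < g w) ->
 (0 < \int[P]_w (g w)%:E)%E.
Proof.
move=> mg g0; rewrite lt_neqAle int_ge0 ?andbT; last by move=> w; exact: ltW.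
apply/eqP => /esym h0.
have : ae_eq P setT (EFin \o g) (cst 0%E).
 apply/ae_eq_integral_abs => //; first exact/mble_EFinP.
 by rewrite -h0; apply: eq_integral => w _ /=; rewrite gtr0_norm.
move=> [N [mN N0 hN]]; have : (P setT <= P N)%E.
 apply: le_measure; rewrite ?inE// => w _; apply: hN => /= h.
 by have := h I; rewrite /= => -[] /eqP; rewrite gt_eqF.
by rewrite N0 [P _]probability_setT lee_fin ler10.
Qed.

(** For one row, twice the product of the two integrals is the mean of [r + r^-1] for the ratio [r]
    of the values at two independent draws, and [cosh_scale_le] bounds it through the means of
    [Th i]. Integrating a row out preserves slow variation in the other rows, so the rows can be
    removed in turn. *)
Lemma laplace_concentration (u : A -> R) : mble u -> (forall f, 0 < u f) ->
 (forall i, slowly_varying u i) ->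
 (\int[P]_w (u (X w))%:E * \int[P]_w ((u (X w))^-1)%:E <= ((1 + 8 * lam ^+ 2 * th ^+ 2) ^+ n)%:E)%E.
Proof.
move=> mu u0 hu; set al := 1 + _.
have al0 : 0 <= al by rewrite addr_ge0// mulr_ge0 ?sqr_ge0// mulr_ge0 ?sqr_ge0.
(* The list [s] contains the rows on which [v] depends; the row at its head is integrated out. *)
suff H (s : seq 'I_n) (v : A -> R) : mble v -> (forall f, 0 < v f) ->
  (forall i, slowly_varying v i) ->
  (forall f g, (forall ij, ij.1 \in s -> f ij = g ij) -> v f = v g) ->
  (\int[P]_w (v (X w))%:E * \int[P]_w ((v (X w))^-1)%:E <= (al ^+ size s)%:E)%E.
 have := H (enum 'I_n) u mu u0 hu; rewrite size_enum_ord; apply => f g fg.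
 by congr u; apply/funext => ij; apply: fg; rewrite mem_enum.
elim: s v {u mu u0 hu} => [|i s ih] u mu u0 hu us.
 have uc f : u f = u (fun=> 0) by apply: us.
 under eq_integral do rewrite uc.
 under [X in (_ * X)%E]eq_integral do rewrite uc.
 by rewrite !int_cst -EFinM mulfV ?gt_eqF.
pose I f := (\int[P]_w (u (mix (row i) (X w) f))%:E)%E.
pose V f := (\int[P]_w ((u (mix (row i) (X w) f))^-1)%:E)%E.
have mui : mble (fun f => (u f)^-1) by exact: meas_invR.
have ui0 f : 0 < (u f)^-1 by rewrite invr_gt0.
have If f : I f = (fine (I f))%:E.
 rewrite fineK// ge0_fin_numE; first exact: le_lt_trans (row_integral_finite f mu u0 (hu i)) (ltry _).
 by apply: int_ge0 => w; exact: ltW.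
have Vf f : V f = (fine (V f))%:E.
 rewrite fineK// ge0_fin_numE; last by apply: int_ge0 => w; exact: ltW.
 exact: le_lt_trans (row_integral_finite f mui ui0 (slowly_varying_inv u0 (hu i))) (ltry _).
have mm g : mble (fun w => u (mix (row i) (X w) g)) by exact: mcomp.
have mmi g : mble (fun w => (u (mix (row i) (X w) g))^-1).
 exact: (mcomp mui (meas_mix_l i g)).
pose u1 f := fine (I f).
have u10 f : 0 < u1 f by rewrite -lte_fin -If; apply: int_gt0.
have mmix2 : mble (fun p : A * T => mix (row i) (X p.2) p.1).
 apply: meas_mix; last exact: measurable_fst.
 exact: (mcomp mX measurable_snd).
have mI : mble I.
 apply: (@measurable_fun_fubini_tonelli_F _ _ _ _ _ P (fun p : A * T => (u (mix (row i) (X p.2) p.1))%:E)).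
  by apply/mble_EFinP; exact: (mcomp mu mmix2).
 by move=> p; rewrite lee_fin ltW.
have mV : mble V.
 apply: (@measurable_fun_fubini_tonelli_F _ _ _ _ _ P (fun p : A * T => ((u (mix (row i) (X p.2) p.1))^-1)%:E)).
  by apply/mble_EFinP; exact: (mcomp mui mmix2).
 by move=> p; rewrite lee_fin ltW.
have mu1 : mble u1.
 by apply/mble_EFinP; rewrite (_ : _ \o _ = I)//; apply/funext => f /=; rewrite -If.
have IV f : (V f <= (al / u1 f)%:E)%E.
 rewrite Vf lee_fin ler_pdivlMr//; rewrite -lee_fin EFinM -Vf -If muleC.
 have h2 : (2%:E * (I f * V f) = \int[(P \x P)%E]_p
   (u (mix (row i) (X p.1) f) * (u (mix (row i) (X p.2) f))^-1 +
   (u (mix (row i) (X p.1) f))^-1 * u (mix (row i) (X p.2) f))%:E)%E.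
  rewrite int_D//.
  - rewrite (int_prod (mm f) (mmi f)) ?(int_prod (mmi f) (mm f))//; try by move=> w; exact: ltW.
   rewrite -/(I f) -/(V f) (muleC (V f)).
   by rewrite Vf If -!EFinM -EFinD; congr (_%:E); ring.
  - apply: mbleM; first exact: (mcomp (mm f) measurable_fst).
   exact: (mcomp (mmi f) measurable_snd).
  - apply: mbleM; first exact: (mcomp (mmi f) measurable_fst).
   exact: (mcomp (mm f) measurable_snd).
  - by move=> p; rewrite mulr_ge0// ltW.
  - by move=> p; rewrite mulr_ge0// ltW.
 rewrite -(@lee_pmul2l _ 2%:E)// h2.
 have mThX : mble (fun w => Th i (X w)) by exact: mcomp.
 have Th0 w : 0 <= Th i (X w) by exact: le_trans (Th1 _ _).
 have mTT : mble (fun p : T * T => Th i (X p.1) * Th i (X p.2)).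
  apply: mbleM; first exact: (mcomp mThX measurable_fst).
  exact: (mcomp mThX measurable_snd).
 have c0 : 0 <= 16 * lam ^+ 2 by rewrite mulr_ge0// sqr_ge0.
 apply: (@le_trans _ _ (\int[(P \x P)%E]_p (2 + 16 * lam ^+ 2 * (Th i (X p.1) * Th i (X p.2)))%:E)%E).
  apply: int_le.
  - apply: mbleD; apply: mbleM.
   + exact: (mcomp (mm f) measurable_fst).
   + exact: (mcomp (mmi f) measurable_snd).
   + exact: (mcomp (mmi f) measurable_fst).
   + exact: (mcomp (mm f) measurable_snd).
  - by apply: mbleD => //; exact: mbleM.
  - by move=> p; rewrite addr_ge0// mulr_ge0// ltW.
  - move=> p; set a := mix _ (X p.1) f; set b := mix _ (X p.2) f.
   have ab ij : ij.1 != i -> a ij = b ij by move=> h; rewrite /a /b /mix /row (negbTE h).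
   have ThE : Th i a * Th i b = Th i (X p.1) * Th i (X p.2) by rewrite /a /b !Th_mix eqxx.
   have := @cosh_scale_le lam (Th i (X p.1) * Th i (X p.2)) (u a / u b) hlam (Th2 _ _ _).
   rewrite invf_div divr_gt0// (mulrC (u b)) => h; apply: le_trans (h isT _ _) _.
   + by rewrite ler_pdivrMr// -ThE; exact: hu.
   + rewrite mulrC ler_pdivrMr// -ThE mulrC [X in ln X]mulrC mulrC; apply: hu => ij h'; exact/esym/ab.
   + by apply: eq_ler; ring.
 rewrite int_D//; [|exact: mbleM|by move=> p; rewrite mulr_ge0// mulr_ge0].
 rewrite int_cst int_Zl//; last by move=> p; rewrite mulr_ge0.
 have hth : (\int[(P \x P)%E]_p (Th i (X p.1) * Th i (X p.2))%:E <= (th ^+ 2)%:E)%E.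
  rewrite (int_prod mThX mThX)// expr2 EFinM; apply: lee_pmul => //; exact: int_ge0.
 apply: (@le_trans _ _ (2%:E + (16 * lam ^+ 2)%:E * (th ^+ 2)%:E)%E).
  by apply: leeD => //; apply: lee_wpmul2l; [rewrite lee_fin|exact: hth].
 by rewrite -!EFinM -EFinD lee_fin /al; apply: eq_ler; ring.
have e1 : (\int[P]_w (u (X w))%:E = \int[P]_w (u1 (X w))%:E)%E.
 rewrite (indep_integral (row i) (g := fun f => (u f)%:E) mX iX); last 2 first.
 - exact/mble_EFinP.
 - by move=> f; rewrite lee_fin ltW.
 by apply: eq_integral => v _; rewrite -If.
have e2 : (\int[P]_w ((u (X w))^-1)%:E <= al%:E * \int[P]_w ((u1 (X w))^-1)%:E)%E.
 rewrite (indep_integral (row i) (g := fun f => ((u f)^-1)%:E) mX iX); last 2 first.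
 - exact/mble_EFinP.
 - by move=> f; rewrite lee_fin ltW.
 have mu1i : mble (fun w => (u1 (X w))^-1).
  by apply: meas_invR; exact: mcomp.
 rewrite -int_Zl//; last by move=> w; rewrite invr_ge0 ltW.
 apply: ge0_le_integral => //.
 - by move=> v _; apply: int_ge0 => w; exact: ltW.
 - exact: (mcomp mV mX).
 - by apply/mble_EFinP; exact: mbleM.
 - by move=> v _; exact: IV.
rewrite e1; apply: (@le_trans _ _ (al%:E * (al ^+ size s)%:E)%E); last by rewrite -EFinM -exprS.
apply: (@le_trans _ _ (\int[P]_w (u1 (X w))%:E * (al%:E * \int[P]_w ((u1 (X w))^-1)%:E))%E).
 by apply: lee_wpmul2l => //; apply: int_ge0 => w; exact: ltW.
rewrite muleCA; apply: lee_wpmul2l; first by rewrite lee_fin.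
apply: ih => //.
- move=> j f g fg; rewrite -lee_fin EFinM -If.
 have [ji|ji] := eqVneq j i.
  have -> : I f = I g.
   apply: eq_integral => w _; congr ((u _)%:E); apply/funext => ij; rewrite /mix /row.
   by case: eqP => // /eqP h; apply: fg; rewrite ji.
  rewrite -If -[leLHS]mul1e; apply: lee_wpmul2r; first by rewrite If lee_fin; exact: ltW (u10 g).
  by rewrite lee_fin -[leLHS]expR0 ler_expR mulr_ge0 ?ln_ge0//; case/andP: hlam.
 rewrite -If /I -int_Zl//; last by move=> w; exact: ltW.
 apply: int_le => //; first exact: mbleM.
  by move=> w; exact: ltW.
 move=> w; have := hu j (mix (row i) (X w) f) (mix (row i) (X w) g).
 rewrite !Th_mix (negbTE ji); apply => ij h; rewrite /mix /row; case: ifP => // _; exact: fg.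
- move=> f g fg; rewrite /u1; congr fine; apply: eq_integral => w _; congr (_%:E).
 apply: us => ij; rewrite inE /mix /row => /orP[->//|h]; case: ifP => // _; exact: fg.
Qed.

End laplace_concentration.

(** * Deviation of a quadratic form in a row with independent entries *)

Section quadratic_form_deviation.
Context {R : realType} {d} {T : measurableType d} (P : probability T R).
Local Notation C := R[i].

Lemma sq_shift_le (y : T -> R) (a v : R) : mble y ->
 P.-integrable setT (EFin \o y) -> (\int[P]_w (y w)%:E = 0)%E ->
 (\int[P]_w (y w ^+ 2)%:E <= v%:E)%E -> (\int[P]_w ((a + y w) ^+ 2)%:E <= (a ^+ 2 + v)%:E)%E.
Proof.
move=> my iy y0 hv.
have my2 : mble (fun w => y w ^+ 2) by exact: mbleX.
have i2 : P.-integrable setT (EFin \o (fun w => y w ^+ 2)).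
 apply/integrableP; split; first exact/mble_EFinP.
 rewrite (eq_integral (fun w => (y w ^+ 2)%:E)) => [|w _]; last by rewrite /= ger0_norm ?sqr_ge0.
 exact: le_lt_trans hv (ltry _).
have ia : P.-integrable setT (EFin \o (fun w => a ^+ 2 + 2 * a * y w)).
 rewrite (_ : _ \o _ = (fun w => (a ^+ 2)%:E + (2 * a)%:E * (y w)%:E)%E); last first.
  by apply/funext => w /=; rewrite EFinD EFinM.
 apply: integrableD => //; first exact: finite_measure_integrable_cst.
 exact: integrableZl.
rewrite (eq_integral (fun w => (a ^+ 2 + 2 * a * y w)%:E + (y w ^+ 2)%:E)%E) => [|w _]; last first.
 by rewrite -EFinD; congr (_%:E); ring.
rewrite integralD// EFinD; apply: leeD => //.
rewrite (eq_integral (fun w => (a ^+ 2)%:E + (2 * a)%:E * (y w)%:E)%E) => [|w _]; last by rewrite EFinD EFinM.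
rewrite integralD//; [|exact: finite_measure_integrable_cst|exact: integrableZl].
by rewrite integralZl// y0 mule0 adde0 int_cst.
Qed.

(** Orthogonality of martingale differences, phrased by resampling: coordinate [k] is integrated
    first, the earlier partial sum does not see it, and [xi k] is centred in it with conditional
    variance at most [v k]. *)
Lemma martingale_sq_le n (X : T -> arr R 'I_n) (xi v : 'I_n -> arr R 'I_n -> R) :
 mble X -> indep P X ->
 (forall k, mble (xi k)) -> (forall k, mble (v k)) ->
 (forall k f, 0 <= v k f) ->
 (forall (k : 'I_n) (f g : arr R 'I_n), (forall j : 'I_n, (j <= k)%N -> f j = g j) -> xi k f = xi k g) ->
 (forall k f, let y w := xi k (mix (pred1 k) (X w) f) in
  [/\ P.-integrable setT (EFin \o y), (\int[P]_w (y w)%:E = 0)%E &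
    (\int[P]_w (y w ^+ 2)%:E <= (v k f)%:E)%E]) ->
 (\int[P]_w ((\sum_k xi k (X w)) ^+ 2)%:E <= \sum_k \int[P]_w (v k (X w))%:E)%E.
Proof.
move=> mX iX mxi mv v0 adapt hxi.
suff H m : (\int[P]_w ((\sum_(k < n | (k < m)%N) xi k (X w)) ^+ 2)%:E <=
  \sum_(k < n | (k < m)%N) \int[P]_w (v k (X w))%:E)%E.
 have := H n; rewrite (eq_bigl xpredT) => [|k]; last by rewrite ltn_ord.
 by under eq_integral do (rewrite (eq_bigl xpredT) => [|k]; last by rewrite ltn_ord).
elim: m => [|m ih].
 under eq_integral do rewrite big_pred0// expr0n.
 by rewrite integral0 sume_ge0// => k _; apply: int_ge0.
have [nm|mn] := leqP n m.
 have e (k : 'I_n) : (k < m.+1)%N = (k < m)%N by have := ltn_ord k; lia.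
 rewrite (eq_bigl _ _ e); apply: le_trans ih.
 by under eq_integral do rewrite (eq_bigl _ _ e).
pose k0 := Ordinal mn.
have split_big (V : Type) (idx : V) (op : Monoid.com_law idx) (F : 'I_n -> V) :
  \big[op/idx]_(k < n | (k < m.+1)%N) F k = op (\big[op/idx]_(k < n | (k < m)%N) F k) (F k0).
 rewrite (bigD1 k0) ?ltnS//= Monoid.mulmC; congr (op _ _); apply: eq_bigl => k.
 rewrite -(inj_eq val_inj) /=; lia.
rewrite (split_big _ _ _ (fun k => \int[P]_w (v k (X w))%:E)%E).
under eq_integral do rewrite (split_big _ _ _ (fun k => xi k _)) /=.
pose Z (f : arr R 'I_n) := \sum_(k < n | (k < m)%N) xi k f.
have mZ : mble Z.
 rewrite (_ : Z = fun f => \sum_(k < n) if (k < m)%N then xi k f else 0).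
  by apply: measurable_sum => k; case: (k < m)%N.
 by apply/funext => f; rewrite /Z big_mkcond.
have Zmix f g : Z (mix (pred1 k0) f g) = Z g.
 apply: eq_bigr => k km; apply: adapt => j jk; rewrite /mix /= -(inj_eq val_inj) /=.
 by case: eqP => // jm; have := leq_ltn_trans jk km; rewrite jm ltnn.
rewrite (indep_integral (pred1 k0) (g := fun f => ((Z f + xi k0 f) ^+ 2)%:E) mX iX); last 2 first.
- by apply/mble_EFinP; apply: mbleX; exact: mbleD.
- by move=> f; rewrite lee_fin sqr_ge0.
have mxiX k : mble (fun w => v k (X w)) by exact: mcomp.
have mZX : mble (fun w => Z (X w)) by exact: mcomp.
apply: (@le_trans _ _ (\int[P]_w (Z (X w) ^+ 2 + v k0 (X w))%:E)%E).
 apply: ge0_le_integral => //.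
 - by move=> w _; apply: int_ge0 => u; exact: sqr_ge0.
 - apply: (@meas_int_snd _ _ _ _ _ P (fun p => (Z (mix (pred1 k0) (X p.2) (X p.1)) + xi k0 (mix (pred1 k0) (X p.2) (X p.1))) ^+ 2)); last by move=> p; exact: sqr_ge0.
  have mm : mble (fun p : T * T => mix (pred1 k0) (X p.2) (X p.1)).
   by apply: meas_mix; exact: mcomp.
  by apply: mbleX; apply: mbleD; exact: mcomp.
 - by apply/mble_EFinP; apply: mbleD => //; exact: mbleX.
 - move=> w _; under eq_integral do rewrite Zmix.
  have [h1 h2 h3] := hxi k0 (X w); apply: sq_shift_le => //.
  by apply: mcomp (mxi k0) _; apply: meas_mix => //; exact: measurable_cst.
rewrite int_D//; [|exact: mbleX|by move=> w; exact: sqr_ge0].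
exact: leeD.
Qed.

(** The last clause measures how uniformly integrable the squared entries are; it stands in for
    moments higher than the second. *)
Definition std_entries {I} (X : T -> arr R I) (B tau : R) := forall i,
 [/\ (\int[P]_w (Re (X w i))%:E = 0)%E, (\int[P]_w (Im (X w i))%:E = 0)%E,
   (\int[P]_w (sqnorm (X w i))%:E = 1)%E &
   (\int[P]_w (sqnorm (X w i) - Num.min (sqnorm (X w i)) B)%:E <= tau%:E)%E].

Lemma integrable_le (y z : T -> R) (c : R) : mble y -> mble z ->
 (forall w, `|y w| <= z w) -> (\int[P]_w (z w)%:E <= c%:E)%E -> P.-integrable setT (EFin \o y).
Proof.
move=> my mz h hz; apply/integrableP; split; first exact/mble_EFinP.
apply: le_lt_trans (ltry c); apply: le_trans hz; apply: int_le => //.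
by apply: mcomp => //.
Qed.

Variables (n : nat) (X : T -> arr R 'I_n) (B tau : R).
Hypotheses (mX : mble X) (iX : indep P X) (hX : std_entries X B tau) (B0 : 0 <= B).

Let mXk k : mble (fun w => X w k). Proof. by move: k; apply/meas_arrP. Qed.
Let msq k : mble (fun w => sqnorm (X w k)). Proof. exact: meas_sqnorm. Qed.
Let mReX k : mble (fun w => Re (X w k)).
Proof. exact: (mcomp (@meas_Re R) (mXk k)). Qed.
Let mImX k : mble (fun w => Im (X w k)).
Proof. exact: (mcomp (@meas_Im R) (mXk k)). Qed.

Let int1sq k : (\int[P]_w (1 + sqnorm (X w k))%:E <= 2%:E)%E.
Proof.
rewrite int_D//; last by move=> w; exact: sqnorm_ge0.
by case: (hX k) => _ _ -> _; rewrite int_cst -EFinD.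
Qed.

Let ReX_int k : P.-integrable setT (EFin \o (fun w => Re (X w k))).
Proof.
apply: (integrable_le _ _ _ (int1sq k)) => //; first exact: mbleD.
move=> w; rewrite /sqnorm; have := sqr_ge0 (Im (X w k)); case: (ler0P (Re (X w k))) => h; nra.
Qed.

Let ImX_int k : P.-integrable setT (EFin \o (fun w => Im (X w k))).
Proof.
apply: (integrable_le _ _ _ (int1sq k)) => //; first exact: mbleD.
move=> w; rewrite /sqnorm; have := sqr_ge0 (Re (X w k)); case: (ler0P (Im (X w k))) => h; nra.
Qed.

Let lin_comb k (al be ga : R) (z : T -> R) : P.-integrable setT (EFin \o z) ->
 (\int[P]_w (z w)%:E = 0)%E ->
 P.-integrable setT (EFin \o (fun w => al * Re (X w k) + be * Im (X w k) + ga * z w)) /\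
 (\int[P]_w (al * Re (X w k) + be * Im (X w k) + ga * z w)%:E = 0)%E.
Proof.
move=> iz z0; have [hRe hIm _ _] := hX k.
have e : EFin \o (fun w => al * Re (X w k) + be * Im (X w k) + ga * z w) =
  (fun w => (al%:E * (Re (X w k))%:E + be%:E * (Im (X w k))%:E) + ga%:E * (z w)%:E)%E.
 by apply/funext => w /=; rewrite !EFinD !EFinM.
have i1 := integrableZl measurableT al (ReX_int k).
have i2 := integrableZl measurableT be (ImX_int k).
have i3 := integrableZl measurableT ga iz.
have i12 := integrableD measurableT i1 i2.
split; first by rewrite e; exact: (integrableD measurableT i12 i3).
transitivity (\int[P]_w ((al%:E * (Re (X w k))%:E + be%:E * (Im (X w k))%:E) + ga%:E * (z w)%:E))%E.
 by apply: eq_integral => w _; rewrite !EFinD !EFinM.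
rewrite (integralD measurableT i12 i3) (integralD measurableT i1 i2).
rewrite (integralZl measurableT (ReX_int k)) (integralZl measurableT (ImX_int k)) (integralZl measurableT iz).
by rewrite hRe hIm z0 !mule0 !adde0.
Qed.

Let zero_int : P.-integrable setT (EFin \o (fun=> 0 : R)).
Proof. exact: finite_measure_integrable_cst. Qed.

(** The factor [2] comes from bounding real and imaginary parts separately, the covariance of
    [Re (X w j)] and [Im (X w j)] being arbitrary. *)
Lemma linear_form_second_moment (c : 'I_n -> C) :
 (\int[P]_w (sqnorm (\sum_j X w j * c j))%:E <= (2 * \sum_j sqnorm (c j))%:E)%E.
Proof.
have H (a b : 'I_n -> R) : (forall j, a j ^+ 2 + b j ^+ 2 <= sqnorm (c j)) ->
  (\int[P]_w ((\sum_j (a j * Re (X w j) + b j * Im (X w j))) ^+ 2)%:E <= (\sum_j sqnorm (c j))%:E)%E.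
 move=> hab; pose xi j (f : arr R 'I_n) := a j * Re (f j) + b j * Im (f j).
 have mxi j : mble (xi j).
  apply: mbleD; apply: mbleM => //.
   exact: (mcomp (@meas_Re R) (meas_coord _)).
  exact: (mcomp (@meas_Im R) (meas_coord _)).
 apply: le_trans (@martingale_sq_le n X xi (fun j _ => sqnorm (c j)) mX iX mxi _ _ _ _) _ => //.
 - by move=> j f; exact: sqnorm_ge0.
 - by move=> k f g fg; rewrite /xi fg.
 - move=> k f y; have yE w : y w = a k * Re (X w k) + b k * Im (X w k) + 0 * 0.
   by rewrite /y /xi /mix /= eqxx mul0r addr0.
  have [i1 i2] := @lin_comb k (a k) (b k) 0 (fun=> 0) zero_int (integral0 _ _).
  split.
  + by rewrite (_ : y = (fun w => a k * Re (X w k) + b k * Im (X w k) + 0 * 0)) //; apply/funext.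
  + by rewrite -[RHS]i2; apply: eq_integral => w _; rewrite yE.
  + apply: (@le_trans _ _ (\int[P]_w (sqnorm (c k) * sqnorm (X w k))%:E)%E).
    apply: int_le.
    * under eq_fun do rewrite yE; apply: mbleX; apply: mbleD => //.
     by apply: mbleD; apply: mbleM.
    * exact: mbleM.
    * by move=> w; exact: sqr_ge0.
    * move=> w; rewrite yE mul0r addr0.
     apply: (@le_trans _ _ ((a k ^+ 2 + b k ^+ 2) * sqnorm (X w k))).
      rewrite -subr_ge0 /sqnorm.
      have -> : (a k ^+ 2 + b k ^+ 2) * (Re (X w k) ^+ 2 + Im (X w k) ^+ 2) -
       (a k * Re (X w k) + b k * Im (X w k)) ^+ 2 = (a k * Im (X w k) - b k * Re (X w k)) ^+ 2 by ring.
      exact: sqr_ge0.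
     by rewrite ler_wpM2r ?sqnorm_ge0.
   rewrite int_Zl ?sqnorm_ge0//; last by move=> w; exact: sqnorm_ge0.
   by case: (hX k) => _ _ -> _; rewrite mule1.
 - by under eq_bigr do rewrite int_cst; rewrite sumEFin.
have h1 := H (fun j => Re (c j)) (fun j => - Im (c j)).
have h2 := H (fun j => Im (c j)) (fun j => Re (c j)).
have mlin (a b : 'I_n -> R) : mble (fun w => \sum_j (a j * Re (X w j) + b j * Im (X w j))).
 by apply: measurable_sum => j; apply: mbleD; apply: mbleM.
under eq_integral => w _.
 rewrite /sqnorm [X in X ^+ 2 + _](big_morph _ (@ReD R) (erefl : Re (0 : C) = 0)).
 rewrite [X in _ + X ^+ 2](big_morph _ (@ImD R) (erefl : Im (0 : C) = 0)).
 rewrite (eq_bigr (fun j => Re (c j) * Re (X w j) + - Im (c j) * Im (X w j))) => [|j _]; last by rewrite ReM; ring.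
 rewrite [X in _ + X ^+ 2](eq_bigr (fun j => Im (c j) * Re (X w j) + Re (c j) * Im (X w j))) => [|j _]; last by rewrite ImM; ring.
 over.
rewrite int_D//; try by [move=> w; exact: sqr_ge0 | exact: mbleX].
have -> : (2 * \sum_j sqnorm (c j))%:E = ((\sum_j sqnorm (c j))%:E + (\sum_j sqnorm (c j))%:E)%E.
 by rewrite -EFinD; congr (_%:E); ring.
apply: leeD; [apply: h1|apply: h2] => j; first by rewrite sqrrN.
by rewrite addrC.
Qed.

Lemma sum_sym_split (a : 'I_n -> 'I_n -> R) : (forall i j, a i j = a j i) ->
 \sum_i \sum_j a i j = \sum_i (a i i + 2 * \sum_(j < n | (j < i)%N) a i j).
Proof.
move=> sa; rewrite big_split /=.
have e i : \sum_j a i j = a i i + \sum_(j < n | (j < i)%N) a i j + \sum_(j < n | (i < j)%N) a i j.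
 rewrite (bigD1 i)//= -addrA; congr (_ + _); rewrite (bigID (fun j : 'I_n => (j < i)%N)) /=.
 by congr (_ + _); apply: eq_bigl => j; rewrite -(inj_eq val_inj) /=; lia.
under eq_bigr do rewrite e; rewrite !big_split /= -addrA; congr (_ + _).
rewrite -mulr_sumr mulr2n mulrDl mul1r; congr (_ + _).
rewrite (exchange_big_dep predT)//=; apply: eq_bigr => i _; apply: eq_bigr => j _; exact: sa.
Qed.

Variables (s : seq (R * 'rV[C]_n)) (f : 'rV[C]_n) (eta : R).
Hypotheses (ws : wge0 s) (eta0 : 0 < eta) (n0 : (0 < n)%N).

Let Q := Qm s.
Let sn : R := sqrt n%:R.
Let nR : 0 < n%:R :> R. Proof. by rewrite ltr0n. Qed.
Let sn0 : 0 < sn. Proof. by rewrite sqrtr_gt0. Qed.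
Let sn2 : sn ^+ 2 = n%:R. Proof. by rewrite sqr_sqrtr// ltW. Qed.
Let q : R := Re (dot (f *m Q) f).
Let q0 : 0 <= q. Proof. exact: dot_Qm_ge0. Qed.

Let t w : R := eta + Re (dot (((sn^-1)%:C *: rv (X w) + f) *m Q) ((sn^-1)%:C *: rv (X w) + f)).
Let b : R := eta + q + Re (\tr Q) / n%:R.

(** The earlier coordinates that meet [g k] in the quadratic form; grouping the off-diagonal terms
    by their larger index makes them martingale differences. *)
Let c (g : arr R 'I_n) (k : 'I_n) : C :=
 \sum_(j < n | (j < k)%N) g j * cj (Q k j) .

Let lf (g : arr R 'I_n) (k : 'I_n) : R :=
 2 * Re (g k * cj (c g k)) + 2 * sn * Re (g k * cj ((f *m Q) 0 k)).

Let QkkE k : Q k k = (Re (Q k k))%:C. Proof. exact: Qm_diag. Qed.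

Let expand w : sn ^+ 2 * (t w - b) =
 \sum_k (lf (X w) k + Re (Q k k) * (sqnorm (X w k) - 1)).
Proof.
pose x := rv (X w).
have xE k : x 0 k = X w k by rewrite mxE.
have h1 : Re (dot (x *m Q) x) = \sum_k (Re (Q k k) * sqnorm (X w k) + 2 * Re (X w k * cj (c (X w) k))).
 pose a i j : R := Re (X w i * Q i j * cj (X w j)).
 have -> : Re (dot (x *m Q) x) = \sum_i \sum_j a i j.
  rewrite dotE exchange_big /= (big_morph _ (@ReD R) (erefl : Re (0 : C) = 0)).
  apply: eq_bigr => j _; rewrite mxE mulr_suml (big_morph _ (@ReD R) (erefl : Re (0 : C) = 0)).
  by apply: eq_bigr => i _; rewrite !xE.
 rewrite sum_sym_split => [|i j]; last first.
  rewrite /a -[LHS]Re_cj !cjM cjK.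
  have -> : cj (Q i j) = Q j i by rewrite /Q -adjE Qm_herm.
  by congr Re; ring.
 apply: eq_bigr => k _; congr (_ + _).
  rewrite /a QkkE mulrAC mulJ_sqnorm -rmorphM /= mulrC; ring.
 congr (2 * _); rewrite /c cj_sum mulr_sumr (big_morph _ (@ReD R) (erefl : Re (0 : C) = 0)).
 by apply: eq_bigr => j _; rewrite /a cjM cjK; congr Re; ring.
have h2 : Re (dot (x *m Q) f) = \sum_k Re (X w k * cj ((f *m Q) 0 k)).
 rewrite dot_Qm dotE (big_morph _ (@ReD R) (erefl : Re (0 : C) = 0)).
 by apply: eq_bigr => k _; rewrite xE.
have h3 : Re (dot (f *m Q) x) = Re (dot (x *m Q) f) by rewrite dot_Qm Re_dotC.
have -> : t w - b = sn^-1 ^+ 2 * Re (dot (x *m Q) x) + 2 * sn^-1 * Re (dot (x *m Q) f) - Re (\tr Q) / n%:R.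
 rewrite /t /b -/x mulmxDl dotDl !dotDr -scalemxAl !dotZl !dotZr cj_real !ReD -/q.
 have rr (r : R) (z : C) : Re (r%:C * z) = r * Re z by rewrite ReM /= mul0r subr0.
 by rewrite !rr h3; ring.
rewrite Re_trace -sn2.
have -> : sn ^+ 2 * (sn^-1 ^+ 2 * Re (dot (x *m Q) x) + 2 * sn^-1 * Re (dot (x *m Q) f) -
  (\sum_i Re (Q i i)) / sn ^+ 2) = Re (dot (x *m Q) x) + 2 * sn * Re (dot (x *m Q) f) - \sum_i Re (Q i i).
 by move: sn0; move: (Re (dot _ _)) (Re (dot _ _)) (\sum_i _) sn => u1 u2 u3 u4 u40; field; rewrite gt_eqF.
rewrite h1 h2 mulr_sumr -big_split /= -sumrB; apply: eq_bigr => k _; rewrite /lf; ring.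
Qed.

Let trunc w k : R := Num.min (sqnorm (X w k)) B.
Let mu k : R := fine (\int[P]_w (trunc w k)%:E).

Let trunc01 w k : 0 <= trunc w k <= B.
Proof. by rewrite /trunc ge_min lexx orbT andbT le_min sqnorm_ge0. Qed.

Let mtrunc k : mble (trunc ^~ k).
Proof. exact: measurable_minr. Qed.

Let muE k : (\int[P]_w (trunc w k)%:E = (mu k)%:E)%E.
Proof.
rewrite fineK// ge0_fin_numE; last by apply: int_ge0 => w; case/andP: (trunc01 w k).
apply: (@le_lt_trans _ _ B%:E); last exact: ltry.
by apply: integral_le_cst => // w; exact: trunc01.
Qed.

Let mu01 k : 0 <= mu k <= B.
Proof.
rewrite -!lee_fin -muE integral_le_cst// andbT.
by apply: int_ge0 => w; case/andP: (trunc01 w k).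
Qed.

Let tail_int k : (\int[P]_w (sqnorm (X w k) - trunc w k)%:E = (1 - mu k)%:E)%E.
Proof.
have [_ _ h1 _] := hX k.
have h : (\int[P]_w (sqnorm (X w k) - trunc w k)%:E + (mu k)%:E = 1)%E.
 rewrite -muE -h1 -int_D//; first by apply: eq_integral => w _; rewrite subrK.
 - exact: mbleB.
 - by move=> w; rewrite subr_ge0 /trunc ge_min lexx.
 - by move=> w; case/andP: (trunc01 w k).
by move: h; case: (\int[P]_w _)%E => [r| |]//=; rewrite -EFinD => -[] <-; rewrite addrK.
Qed.

Let tail_le k : 1 - mu k <= tau.
Proof. by rewrite -lee_fin -tail_int; case: (hX k). Qed.

(** The diagonal term is truncated at [B] and centred, which gives it a finite variance; the
    discarded part is small in the mean. *)
Let xi k (g : arr R 'I_n) : R := lf g k + Re (Q k k) * (Num.min (sqnorm (g k)) B - mu k).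
Let vv k (g : arr R 'I_n) : R := 16 * sqnorm (c g k) + 16 * sn ^+ 2 * sqnorm ((f *m Q) 0 k) + 2 * B ^+ 2.

Let mc k : mble (fun g => c g k).
Proof.
by apply: meas_sumC => j _; apply: meas_mulC => //; exact: meas_coord.
Qed.

Let mlf k : mble (fun g => lf g k).
Proof.
have mg : mble (fun g : arr R 'I_n => g k) by exact: meas_coord.
apply: mbleD; apply: mbleM => //; apply: (mcomp (@meas_Re R)).
 by apply: meas_mulC => //; apply: meas_conjC; exact: mc.
exact: meas_mulC.
Qed.

Let mxi k : mble (xi k).
Proof.
apply: mbleD; first exact: mlf.
apply: mbleM => //; apply: mbleB => //; apply: measurable_minr => //.
by apply: meas_sqnorm; exact: meas_coord.
Qed.

Let mvv k : mble (vv k).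
Proof.
apply: mbleD => //; apply: mbleD => //; apply: mbleM => //.
by apply: meas_sqnorm; exact: mc.
Qed.

Let vv0 k g : 0 <= vv k g.
Proof.
have h1 := sqnorm_ge0 (c g k); have h2 := sqr_ge0 B.
have h3 : 0 <= sn ^+ 2 * sqnorm ((f *m Q) 0 k) by rewrite mulr_ge0 ?sqr_ge0 ?sqnorm_ge0.
by rewrite /vv; lra.
Qed.

Let c_adapt (k : 'I_n) (g h : arr R 'I_n) : (forall j : 'I_n, (j < k)%N -> g j = h j) -> c g k = c h k.
Proof. by move=> gh; apply: eq_bigr => j jk; rewrite gh. Qed.

Let sum_xi_sq : (\int[P]_w ((\sum_k xi k (X w)) ^+ 2)%:E <= (n%:R * (32 + 2 * B ^+ 2 + 16 * q))%:E)%E.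
Proof.
apply: le_trans (martingale_sq_le mX iX mxi mvv vv0 _ _) _.
- move=> k g h gh; rewrite /xi /lf gh// (c_adapt (h := h))// => j jk; exact/gh/ltnW.
- move=> k g y; pose C1 := 2 * cj (c g k) + (2 * sn)%:C * cj ((f *m Q) 0 k).
 have yE w : y w = Re C1 * Re (X w k) + - Im C1 * Im (X w k) + Re (Q k k) * (trunc w k - mu k).
  rewrite /y /xi /lf (c_adapt (h := g)); last first.
   by move=> j jk; rewrite /mix /=; case: eqP => // jk'; rewrite jk' ltnn in jk.
  rewrite /mix /= eqxx -/(trunc w k); congr (_ + _).
  rewrite /C1 ReD ImD !ReM !ImM /=; ring.
 have iz : P.-integrable setT (EFin \o (fun w => trunc w k - mu k)).
  apply: (integrable_le (z := fun=> B) (c := B)) => //; [exact: mbleB| |by rewrite int_cst].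
  by move=> w; rewrite ler_norml; have := trunc01 w k; have := mu01 k; lra.
 have z0 : (\int[P]_w (trunc w k - mu k)%:E = 0)%E.
  rewrite (eq_integral (fun w => (trunc w k)%:E + (- mu k)%:E)%E) => [|w _]; last by rewrite -EFinD.
  rewrite integralD//; last exact: finite_measure_integrable_cst.
   by rewrite muE int_cst -EFinD subrr.
  apply: (integrable_le (z := fun=> B) (c := B)) => //; last by rewrite int_cst.
  by move=> w; rewrite ger0_norm; case/andP: (trunc01 w k).
 have [i1 i2] := @lin_comb k (Re C1) (- Im C1) (Re (Q k k)) _ iz z0.
 split.
 + by rewrite (_ : y = (fun w => Re C1 * Re (X w k) + - Im C1 * Im (X w k) + Re (Q k k) * (trunc w k - mu k)))//; apply/funext.
 + by rewrite -[RHS]i2; apply: eq_integral => w _; rewrite yE.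
 + have C1le : sqnorm C1 <= 8 * sqnorm (c g k) + 8 * sn ^+ 2 * sqnorm ((f *m Q) 0 k).
   have := sqnormB_le (2 * cj (c g k)) (- ((2 * sn)%:C * cj ((f *m Q) 0 k))).
   rewrite opprK -/C1 sqnormN !sqnormM !sqnormJ -[2 : C](rmorph_nat (real_complex R)) !sqnorm_real.
   by move=> h; apply: (le_trans h); rewrite exprMn; apply: eq_ler; ring.
  apply: (@le_trans _ _ (\int[P]_w (2 * sqnorm C1 * sqnorm (X w k) + 2 * B ^+ 2)%:E)%E).
   apply: int_le.
   * under eq_fun do rewrite yE; apply: mbleX; apply: mbleD.
     by apply: mbleD; apply: mbleM.
    by apply: mbleM => //; exact: mbleB.
   * by apply: mbleD => //; exact: mbleM.
   * by move=> w; exact: sqr_ge0.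
   * move=> w; rewrite yE; set l := _ + _ * Im _; set z := _ * (trunc w k - _).
    have h1 : l ^+ 2 <= sqnorm C1 * sqnorm (X w k).
     rewrite -subr_ge0 /sqnorm /l.
     have -> : (Re C1 ^+ 2 + Im C1 ^+ 2) * (Re (X w k) ^+ 2 + Im (X w k) ^+ 2) -
      (Re C1 * Re (X w k) + - Im C1 * Im (X w k)) ^+ 2 = (Re C1 * Im (X w k) + Im C1 * Re (X w k)) ^+ 2 by ring.
     exact: sqr_ge0.
    have h2 : z ^+ 2 <= B ^+ 2.
     rewrite /z exprMn -[leRHS]mul1r; apply: ler_pM; rewrite ?sqr_ge0//.
      by rewrite -[leRHS](expr1n _ 2); apply: lerXn2r; rewrite ?nnegrE// ?Qm_diag_ge0// Qm_diag_le1.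
     by have := trunc01 w k; have := mu01 k; nra.
    by have := sqr_ge0 (l - z); nra.
  rewrite int_D//; last 3 first.
  * exact: mbleM.
  * by move=> w; rewrite !mulr_ge0 ?sqnorm_ge0.
  * by move=> _; rewrite mulr_ge0 ?sqr_ge0.
  rewrite int_cst int_Zl//; last 2 first.
  * by move=> w; exact: sqnorm_ge0.
  * by rewrite mulr_ge0 ?sqnorm_ge0.
  case: (hX k) => _ _ -> _; rewrite mule1 -EFinD lee_fin /vv; lra.
have hc k : (\int[P]_w (sqnorm (c (X w) k))%:E <= (2 * \sum_j sqnorm (Q k j))%:E)%E.
 have := linear_form_second_moment (fun j => if (j < k)%N then cj (Q k j) else 0).
 rewrite (eq_integral (fun w => (sqnorm (c (X w) k))%:E)) => [h|w _]; last first.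
  congr ((sqnorm _)%:E); rewrite /c [RHS]big_mkcond /=; apply: eq_bigr => j _.
  by case: ifP => // _; rewrite mulr0.
 apply: (le_trans h); rewrite lee_fin ler_wpM2l//; apply: ler_sum => j _.
 by case: ifP => _; rewrite ?sqnormJ// sqnorm0 sqnorm_ge0.
have hv k : (\int[P]_w (vv k (X w))%:E <= (32 * (\sum_j sqnorm (Q k j)) + 16 * sn ^+ 2 * sqnorm ((f *m Q) 0 k) + 2 * B ^+ 2)%:E)%E.
 have msc : mble (fun w => sqnorm (c (X w) k)).
  by apply: meas_sqnorm; apply: (mcomp (mc k) mX).
 rewrite (eq_integral (fun w => (16 * sqnorm (c (X w) k) + (16 * sn ^+ 2 * sqnorm ((f *m Q) 0 k) + 2 * B ^+ 2))%:E)) => [|w _]; last by rewrite /vv addrA.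
 rewrite int_D//; last 3 first.
 - exact: mbleM.
 - by move=> w; rewrite mulr_ge0 ?sqnorm_ge0.
 - move=> _; have h2 := sqr_ge0 B.
  have h3 : 0 <= sn ^+ 2 * sqnorm ((f *m Q) 0 k) by rewrite mulr_ge0 ?sqr_ge0 ?sqnorm_ge0.
  by lra.
 rewrite int_cst int_Zl//; last by move=> w; exact: sqnorm_ge0.
 apply: (@le_trans _ _ (16%:E * (2 * \sum_j sqnorm (Q k j))%:E + (16 * sn ^+ 2 * sqnorm ((f *m Q) 0 k) + 2 * B ^+ 2)%:E)%E).
  by apply: leeD => //; apply: lee_wpmul2l.
 by rewrite -EFinM -EFinD lee_fin; apply: eq_ler; ring.
apply: (le_trans (lee_sum _ (fun k _ => hv k))); rewrite sumEFin lee_fin !big_split /= -!mulr_sumr.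
have h1 : \sum_k \sum_j sqnorm (Q k j) <= n%:R.
 apply: (@le_trans _ _ (\sum_(k < n) 1)); last by rewrite sumr_const card_ord.
 apply: ler_sum => k _; apply: (le_trans (sqn_row_Qm k ws)); exact: Qm_diag_le1.
have h2 : \sum_k sqnorm ((f *m Q) 0 k) <= q by exact: sqn_Qm_le.
rewrite sumr_const card_ord -mulr_natl sn2.
have : n%:R * (\sum_k sqnorm ((f *m Q) 0 k)) <= n%:R * q by rewrite ler_wpM2l.
by lra.
Qed.

(** The linear and truncated parts are bounded in mean square, the tails of the diagonal in the
    mean. The error is relative to [b], which grows with the size [q] of the deterministic shift, so
    that it becomes a multiplicative error for powers of [t]. *)
Lemma quadratic_form_deviation (eps : R) :
 ((33 + 2 * B ^+ 2) / eta + 16) / (2 * sn) + 2 * tau / eta <= eps ->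
 (\int[P]_w (`|t w - b|)%:E <= (b * eps)%:E)%E.
Proof.
move=> heps; pose Z w := \sum_k xi k (X w).
pose D w := \sum_k (sqnorm (X w k) - trunc w k + (1 - mu k)).
have mZ : mble Z by apply: measurable_sum => k; exact: mcomp.
have mD : mble D.
 by apply: measurable_sum => k; apply: mbleD => //; exact: mbleB.
have tail0 w k : 0 <= sqnorm (X w k) - trunc w k by rewrite subr_ge0 /trunc ge_min lexx.
have mu1 k : 0 <= 1 - mu k.
 by rewrite -lee_fin -tail_int; apply: int_ge0 => w.
have D0 w : 0 <= D w by apply: sumr_ge0 => k _; rewrite addr_ge0.
have pw w : `|t w - b| <= (sn^-1 ^+ 3 / 2) * Z w ^+ 2 + sn^-1 / 2 + (sn ^-2) * D w.
 have -> : t w - b = sn ^- 2 * (Z w + \sum_k Re (Q k k) * ((sqnorm (X w k) - trunc w k) - (1 - mu k))).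
  rewrite /Z -big_split /= (eq_bigr (fun k => lf (X w) k + Re (Q k k) * (sqnorm (X w k) - 1))); last first.
   by move=> k _; rewrite /xi -/(trunc w k); ring.
  by rewrite -expand mulrA mulVf ?mul1r// expf_neq0// gt_eqF.
 rewrite normrM ger0_norm ?invr_ge0 ?sqr_ge0//.
 set S := \sum_k _; have hS : `|S| <= D w.
  apply: (le_trans (ler_norm_sum _ _ _)); apply: ler_sum => k _.
  rewrite normrM -[leRHS]mul1r; apply: ler_pM => //.
   by rewrite ger0_norm ?Qm_diag_ge0// Qm_diag_le1.
  by apply: le_trans (ler_normB _ _) _; rewrite !ger0_norm.
 apply: (@le_trans _ _ (sn ^- 2 * (`|Z w| + D w))).
  rewrite ler_wpM2l ?invr_ge0 ?sqr_ge0//; apply: le_trans (ler_normD _ _) _; by rewrite lerD2l.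
 rewrite mulrDr lerD2r.
 (* The weight [sn] matches the order of [Z], whose second moment is [O(n)] for fixed [B] and
    [q]. *)
 have h : `|Z w| <= (Z w ^+ 2 / sn + sn) / 2.
  rewrite ler_pdivlMr// -(ler_pM2r sn0) mulrDl divfK ?gt_eqF// -expr2.
  by have := sqr_ge0 (`|Z w| - sn); rewrite -(real_normK (num_real (Z w))); nra.
 apply: (@le_trans _ _ (sn ^- 2 * ((Z w ^+ 2 / sn + sn) / 2))).
  by rewrite ler_wpM2l// invr_ge0 sqr_ge0.
 by move: sn0; move: (Z w ^+ 2) (sn) => u v v0; apply: eq_ler; field; rewrite gt_eqF.
have s3 : 0 <= sn^-1 ^+ 3 / 2 by rewrite divr_ge0// exprn_ge0// invr_ge0 ltW.
have s1 : 0 <= sn^-1 / 2 by rewrite divr_ge0// invr_ge0 ltW.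
have s2 : 0 <= sn ^- 2 by rewrite invr_ge0 sqr_ge0.
have mZ2 : mble (fun w => Z w ^+ 2) by exact: mbleX.
have mt : mble t.
 apply: mbleD => //; apply: meas_ReT; apply: meas_dot; first apply: meas_mxM.
 - apply: meas_mxD; last exact: meas_mx_cst.
  by apply: meas_mxZ => //; exact: (meas_mx_comp (@meas_rv _ n)).
 - exact: meas_mx_cst.
 - apply: meas_mxD; last exact: meas_mx_cst.
  by apply: meas_mxZ => //; exact: (meas_mx_comp (@meas_rv _ n)).
apply: (@le_trans _ _ (\int[P]_w ((sn^-1 ^+ 3 / 2) * Z w ^+ 2 + sn^-1 / 2 + (sn ^-2) * D w)%:E)%E).
 apply: int_le => //.
 - by apply: mcomp => //; exact: mbleB.
 - by apply: mbleD; [apply: mbleD => //|]; exact: mbleM.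
rewrite int_D//; last 4 first.
- by apply: mbleD => //; exact: mbleM.
- exact: mbleM.
- by move=> w; rewrite addr_ge0// mulr_ge0// sqr_ge0.
- by move=> w; rewrite mulr_ge0.
rewrite int_D//; last 2 first.
- exact: mbleM.
- by move=> w; rewrite mulr_ge0// sqr_ge0.
rewrite int_cst int_Zl//; last by move=> w; exact: sqr_ge0.
rewrite int_Zl//.
have hD : (\int[P]_w (D w)%:E <= (2 * n%:R * tau)%:E)%E.
 rewrite int_sum; last 2 first.
 - by move=> k; apply: mbleD => //; exact: mbleB.
 - by move=> k w; rewrite addr_ge0.
 apply: (@le_trans _ _ (\sum_(k < n) (2 * tau)%:E)%E); last first.
  by rewrite sumEFin lee_fin sumr_const card_ord -mulr_natl; apply: eq_ler; ring.
 apply: lee_sum => k _; rewrite int_D//; last exact: mbleB.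
 by rewrite int_cst tail_int -EFinD lee_fin; have := tail_le k; lra.
apply: (@le_trans _ _ ((sn^-1 ^+ 3 / 2)%:E * (n%:R * (32 + 2 * B ^+ 2 + 16 * q))%:E + (sn^-1 / 2)%:E + (sn ^- 2)%:E * (2 * n%:R * tau)%:E)%E).
 by apply: leeD; [apply: leeD => //|]; apply: lee_wpmul2l; rewrite ?lee_fin//; exact: sum_xi_sq.
rewrite -!EFinM -!EFinD lee_fin -sn2.
have tr0 : 0 <= Re (\tr Q) / n%:R.
 by rewrite divr_ge0 ?ler0n// Re_trace; apply: sumr_ge0 => k _; exact: Qm_diag_ge0.
have hb : eta + q <= b by rewrite /b lerDl.
have tau0 : 0 <= tau by apply: le_trans (tail_le (Ordinal n0)); exact: mu1.
have B20 : 0 <= B ^+ 2 by exact: sqr_ge0.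
have -> : sn^-1 ^+ 3 / 2 * (sn ^+ 2 * (32 + 2 * B ^+ 2 + 16 * q)) + sn^-1 / 2 + sn ^- 2 * (2 * sn ^+ 2 * tau) =
 (33 + 2 * B ^+ 2 + 16 * q) / (2 * sn) + 2 * tau.
 by move: sn0; move: (sn) => v v0; field; rewrite gt_eqF.
have e0 : 0 <= eps.
 apply: le_trans heps; apply: addr_ge0; last by rewrite divr_ge0 ?mulr_ge0// ltW.
 apply: divr_ge0; last by rewrite mulr_ge0// ltW.
 by rewrite addr_ge0// divr_ge0 ?(ltW eta0)// addr_ge0// mulr_ge0.
apply: (@le_trans _ _ ((eta + q) * eps)); last by rewrite ler_wpM2r.
apply: (@le_trans _ _ ((eta + q) * (((33 + 2 * B ^+ 2) / eta + 16) / (2 * sn) + 2 * tau / eta))); last first.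
 by rewrite ler_wpM2l// addr_ge0// ltW.
rewrite mulrDr; apply: lerD.
 rewrite mulrA ler_wpM2r ?invr_ge0 ?mulr_ge0 ?(ltW sn0)//.
 have -> : (eta + q) * ((33 + 2 * B ^+ 2) / eta + 16) = (33 + 2 * B ^+ 2) + 16 * q + (q * ((33 + 2 * B ^+ 2) / eta) + 16 * eta).
  by field; rewrite gt_eqF.
 rewrite lerDl; apply: addr_ge0; last by rewrite mulr_ge0 ?(ltW eta0).
 by apply: mulr_ge0 => //; rewrite divr_ge0 ?(ltW eta0)// addr_ge0// mulr_ge0.
have -> : (eta + q) * (2 * tau / eta) = 2 * tau + q * (2 * tau / eta) by field; rewrite gt_eqF.
by rewrite lerDl mulr_ge0// divr_ge0 ?mulr_ge0// ltW.
Qed.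

End quadratic_form_deviation.

(** * Concentration of the regularized log-determinant *)

Section log_determinant_concentration.
Context {R : realType} {d} {T : measurableType d} (P : probability T R).
Local Notation C := R[i].
Variable (n : nat).
Local Notation A := (arr R ('I_n * 'I_n)).
Variables (eta lam : R) (F : 'M[C]_n).
Hypotheses (eta0 : 0 < eta) (hlam : 0 < lam <= 1 / 2) (n0 : (0 < n)%N).

Let sn : R := sqrt n%:R.
Let nR : 0 < n%:R :> R. Proof. by rewrite ltr0n. Qed.
Let sn0 : 0 < sn. Proof. by rewrite sqrtr_gt0. Qed.
Let sn2 : sn ^+ 2 = n%:R. Proof. by rewrite sqr_sqrtr// ltW. Qed.

Definition hrow (f : A) i : 'rV[C]_n := ((sqrt n%:R)^-1)%:C *: rowv f i + row i F.

Definition regdet (f : A) : R := Wm (wts eta [seq hrow f i | i <- enum 'I_n]).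

(** A small power, because a row influences the determinant through its squared norm, of which only
    the mean is controlled. *)
Definition regpow (f : A) : R := expR (lam * ln (regdet f)).

Lemma Wm_gt0 (s : seq 'rV[C]_n) : 0 < Wm (wts eta s).
Proof.
elim: s => [|h s ih] //=; rewrite mulr_gt0//.
by apply: lt_le_trans eta0 _; rewrite lerDl dot_Qm_ge0 ?wge0_wts ?ltW.
Qed.

Lemma meas_hrow i : meas_mx (fun f : A => hrow f i).
Proof.
apply: meas_mxD; last exact: meas_mx_cst.
by apply: meas_mxZ => //; exact: meas_rowv.
Qed.

Lemma meas_regdet : mble regdet.
Proof. by apply: meas_Wm => i; exact: meas_hrow. Qed.

Lemma meas_regpow : mble regpow.
Proof.
apply: mcomp => //; apply: mbleM => //.
by apply: mcomp => //; exact: meas_regdet.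
Qed.

Let rowmask (i : 'I_n) : pred ('I_n * 'I_n) := fun ij => ij.1 == i.

(** The order of the rows does not matter, so row [i] may be added last, and then a single gain
    depends on it. *)
Lemma regdet_isolate i : exists s : seq 'I_n, i \notin s /\ forall f,
 regdet f = gain (wts eta [seq hrow f j | j <- s]) eta (hrow f i) * Wm (wts eta [seq hrow f j | j <- s]).
Proof.
have ie : i \in enum 'I_n by rewrite mem_enum.
have us := enum_uniq 'I_n; rewrite /regdet; move: us; case/splitPr: ie => s1 s2.
rewrite cat_uniq /= negb_or => /and3P[_ /andP[is1 _] /andP[is2 _]].
exists (s1 ++ s2); split; first by rewrite mem_cat negb_or is1.
move=> f; rewrite /wts !map_cat /= Wm_move ?Wm_cons//.
by rewrite wge0_cat /= wge0_wts ?ltW//= wge0_wts ?ltW.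
Qed.

(** Its mean is at most [2 + 4 / eta] for every [n], as the [n] entries of a row have unit second
    moment. *)
Definition fluct (i : 'I_n) (f : A) : R := 2 + 4 * sqn (rowv f i) / (n%:R * eta).

Lemma fluct_ge2 i f : 2 <= fluct i f.
Proof. by rewrite lerDl divr_ge0 ?mulr_ge0 ?sqn_ge0 ?ler0n// ltW. Qed.

Lemma quad_parallelogram (Q : 'M[C]_n) (u v : 'rV[C]_n) :
 Re (dot ((u + v) *m Q) (u + v)) + Re (dot ((u - v) *m Q) (u - v)) =
 2 * Re (dot (u *m Q) u) + 2 * Re (dot (v *m Q) v).
Proof.
rewrite mulmxDl mulmxBl !dotDl !dotNl !dotDr !dotNr !(ReD, ReN).
move: (Re (dot (u *m Q) u)) (Re (dot (u *m Q) v)) (Re (dot (v *m Q) u)) (Re (dot (v *m Q) v)).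
by move=> a b c d'; ring.
Qed.

Lemma hrow_ext (f g : A) i : (forall k, f (i, k) = g (i, k)) -> hrow f i = hrow g i.
Proof.
by move=> fg; rewrite /hrow (_ : rowv f i = rowv g i)//; apply/rowP => k; rewrite !mxE.
Qed.

Lemma gain_ratio_le (N u v qf qg y : R) : 0 < N -> 0 <= u -> 0 <= v -> 0 <= qg ->
 qf <= 2 * qg + 2 * y -> y <= 2 * (u + v) / N ->
 eta + qf <= (2 + 4 * u / (N * eta)) * (2 + 4 * v / (N * eta)) * (eta + qg).
Proof.
move=> N0 u0 v0 qg0 hq hy; pose u' := u / (N * eta); pose v' := v / (N * eta).
have Ne : 0 < N * eta by rewrite mulr_gt0.
have u'0 : 0 <= u' by rewrite divr_ge0// ltW.
have v'0 : 0 <= v' by rewrite divr_ge0// ltW.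
have e1 : 2 * (u + v) / N = 2 * (u' + v') * eta by rewrite /u' /v'; field; rewrite !gt_eqF.
rewrite e1 in hy; rewrite -!mulrA -/u' -/v' mulrA.
clearbody u' v'.
have eq0 : 0 <= eta + qg by rewrite addr_ge0// ltW.
have h1 : 0 <= u' * v' * (eta + qg) by rewrite !mulr_ge0.
have h2 : 0 <= (u' + v') * qg by rewrite mulr_ge0// addr_ge0.
have h3 : 0 <= (u' + v') * eta by rewrite mulr_ge0 ?addr_ge0// ltW.
have -> : (2 + 4 * u') * (2 + 4 * v') * (eta + qg) =
 4 * eta + 4 * qg + 8 * ((u' + v') * eta) + 8 * ((u' + v') * qg) + 16 * (u' * v' * (eta + qg)) by ring.
have := eta0; lra.
Qed.

Lemma gain_fluct s (f g : A) i : wge0 s ->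
 gain s eta (hrow f i) <= fluct i f * fluct i g * gain s eta (hrow g i).
Proof.
move=> ws; pose y := (sn^-1)%:C *: (rowv f i - rowv g i).
have hE : hrow f i = hrow g i + y by rewrite /hrow /y scalerBr [RHS]addrAC [X in _ = X + _]addrCA subrr addr0.
apply: (@gain_ratio_le _ _ _ _ _ (sqn y)) => //; rewrite ?sqn_ge0 ?dot_Qm_ge0//.
 apply: (@le_trans _ _ (2 * Re (dot (hrow g i *m Qm s) (hrow g i)) + 2 * Re (dot (y *m Qm s) y))).
  by rewrite -quad_parallelogram -hE lerDl dot_Qm_ge0.
 by rewrite lerD2l; apply: ler_wpM2l => //; exact: dot_Qm_le.
rewrite /y sqnZ sqnorm_real exprVn sn2 mulrC; apply: ler_wpM2r; first by rewrite invr_ge0.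
by apply: le_trans (sqnD_le _ _) _; rewrite sqnN mulrDr.
Qed.

Lemma regdet_gt0 f : 0 < regdet f. Proof. exact: Wm_gt0. Qed.
Lemma regpow_gt0 f : 0 < regpow f. Proof. exact: expR_gt0. Qed.

Lemma regpow_slowly_varying i : slowly_varying fluct lam regpow i.
Proof.
move=> f g fg; have [s [is_ hs]] := regdet_isolate i.
have sE : [seq hrow f j | j <- s] = [seq hrow g j | j <- s].
 apply/eq_in_map => j js; apply: hrow_ext => k; apply: fg => /=.
 by apply: contraNneq is_ => <-.
rewrite -expRD ler_expR -mulrDr ler_pM2l; last by case/andP: hlam.
have f2 := fluct_ge2 i f; have g2 := fluct_ge2 i g.
rewrite -lnM ?posrE ?regdet_gt0//; last by nra.
rewrite ler_ln ?posrE ?regdet_gt0//; last by rewrite mulr_gt0 ?regdet_gt0//; nra.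
rewrite !hs sE mulrA ler_wpM2r//; first by rewrite ltW// Wm_gt0.
by apply: gain_fluct; rewrite wge0_wts// ltW.
Qed.

(** As [lam] lies in the unit interval, [(t / b) ^ lam] lies between [1] and [t / b], whichever of
    the two is larger. *)
Lemma expR_ln_dev (t b : R) : 0 < t -> 0 < b ->
 expR (lam * ln t) <= expR (lam * ln b) * (1 + `|t - b| / b) /\
 expR (lam * ln b) <= expR (lam * ln t) + expR (lam * ln b) * (`|t - b| / b).
Proof.
move=> t0 b0; have /andP[l0 l1] := hlam.
have bp := expR_gt0 (lam * ln b).
have [bt|tb] := leP b t.
 rewrite ger0_norm ?subr_ge0//.
 have e1 : 1 + (t - b) / b = t / b by field; rewrite gt_eqF.
 have e2 : 0 <= (t - b) / b by rewrite divr_ge0 ?subr_ge0// ltW.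
 have lbt : ln b <= ln t by rewrite ler_ln.
 split.
  rewrite e1 -ler_pdivrMl// -expRN -expRD -[leRHS]lnK ?posrE ?divr_gt0// ler_expR ln_div ?posrE//; nra.
 have : expR (lam * ln b) <= expR (lam * ln t) by rewrite ler_expR; nra.
 have : 0 <= expR (lam * ln b) * ((t - b) / b) by rewrite mulr_ge0 ?(ltW bp).
 by lra.
rewrite ltr0_norm ?subr_lt0//.
have e2 : 0 <= (- (t - b)) / b by rewrite divr_ge0 ?(ltW b0)//; lra.
have ltb : ln t <= ln b by rewrite ler_ln// ltW.
split.
 have h : expR (lam * ln t) <= expR (lam * ln b) by rewrite ler_expR; nra.
 by apply: (le_trans h); rewrite ler_peMr ?(ltW bp)//; lra.
have e1 : - (t - b) / b = 1 - t / b by field; rewrite gt_eqF.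
rewrite e1 mulrBr mulr1 addrCA lerDl subr_ge0 mulrC.
rewrite -ler_pdivlMr// -expRN -expRD -[leLHS]lnK ?posrE ?divr_gt0// ler_expR ln_div ?posrE//; nra.
Qed.

Section one_law.
Variables (X : T -> A) (B tau : R).
Hypotheses (mX : mble X) (iX : indep P X) (hX : std_entries P X B tau) (B0 : 0 <= B).

Let mXij ij : mble (fun w => X w ij). Proof. by move: ij; apply/meas_arrP. Qed.

Lemma int_fluct i : (\int[P]_w (fluct i (X w))%:E <= (2 + 4 / eta)%:E)%E.
Proof.
have ms : mble (fun w => sqn (rowv (X w) i)).
 by apply: meas_sqn; exact: (meas_mx_comp (@meas_rowv _ n n i)).
rewrite (eq_integral (fun w => (2 + 4 / (n%:R * eta) * sqn (rowv (X w) i))%:E)) => [|w _]; last first.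
 by rewrite /fluct; congr (_%:E); ring.
have c0 : 0 <= 4 / (n%:R * eta) by rewrite divr_ge0// mulr_ge0 ?ler0n// ltW.
rewrite int_D//; [|exact: mbleM|by move=> w; rewrite mulr_ge0 ?sqn_ge0].
rewrite int_cst int_Zl//; last by move=> w; exact: sqn_ge0.
have -> : (\int[P]_w (sqn (rowv (X w) i))%:E = n%:R%:E)%E.
 rewrite (eq_integral (fun w => (\sum_j sqnorm (X w (i, j)))%:E)) => [|w _]; last first.
  by congr (_%:E); apply: eq_bigr => j _; rewrite mxE.
 rewrite int_sum; [|by move=> j; exact: meas_sqnorm|by move=> j w; exact: sqnorm_ge0].
 rewrite (eq_bigr (fun=> 1%:E)) => [|j _]; last by case: (hX (i, j)).
 by rewrite sumEFin sumr_const card_ord.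
rewrite -EFinM -EFinD lee_fin; apply: eq_ler; field; rewrite !gt_eqF//.
Qed.

Let th : R := 2 + 4 / eta.

Lemma regpow_moments :
 (\int[P]_w (regpow (X w))%:E * \int[P]_w ((regpow (X w))^-1)%:E <=
  ((1 + 8 * lam ^+ 2 * th ^+ 2) ^+ n)%:E)%E.
Proof.
have /andP[l0 l1] := hlam.
apply: (laplace_concentration (Th := fluct)) => //.
- by rewrite ltW.
- move=> i; apply: mbleD => //; apply: mbleM => //; apply: mbleM => //.
 by apply: meas_sqn; exact: meas_rowv.
- by move=> i f; apply: le_trans (fluct_ge2 i f); rewrite ler1n.
- move=> i f g fg; rewrite /fluct (_ : rowv f i = rowv g i)//.
 by apply/rowP => j; rewrite !mxE.
- exact: int_fluct.
- exact: meas_regpow.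
- exact: regpow_gt0.
- exact: regpow_slowly_varying.
Qed.

Let mreg : mble (fun w => regpow (X w)).
Proof. exact: (mcomp meas_regpow mX). Qed.
Let mregV : mble (fun w => (regpow (X w))^-1).
Proof. exact: meas_invR. Qed.

Lemma regpow_fin : (\int[P]_w (regpow (X w))%:E < +oo)%E.
Proof.
have h := regpow_moments; rewrite ltey; apply/eqP => h'; move: h; rewrite h' gt0_mulye//.
by apply: int_gt0 => // w; rewrite invr_gt0 regpow_gt0.
Qed.

(** The logarithm of a mean of powers rather than the mean of the logarithm: it is the quantity that
    a multiplicative row replacement compares. *)
Definition logcenter : R := ln (fine (\int[P]_w (regpow (X w))%:E)%E) / lam.

Let mean := fine (\int[P]_w (regpow (X w))%:E)%E.
Let meanE : (\int[P]_w (regpow (X w))%:E = mean%:E)%E.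
Proof.
rewrite fineK// ge0_fin_numE; first exact: regpow_fin.
by apply: int_ge0 => w; rewrite ltW ?regpow_gt0.
Qed.
Let mean0 : 0 < mean.
Proof. by rewrite -lte_fin -meanE; apply: int_gt0 => // w; exact: regpow_gt0. Qed.

(** Markov's inequality for [regpow] above the centre and for its inverse below. The latter costs
    the factor of [regpow_moments], which by the condition on [dl] takes at most half of the
    exponent. *)
Lemma log_regdet_concentration (dl : R) : 0 <= dl -> 16 * lam * th ^+ 2 <= dl ->
 (P [set w | dl * n%:R < `|ln (regdet (X w)) - logcenter| ]%R <= (2 * expR (- (lam * dl / 2 * n%:R)))%:E)%E.
Proof.
move=> dl0 hdl; have /andP[l0 l1] := hlam.
pose a := dl * n%:R; have a0 : 0 <= a by rewrite mulr_ge0.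
have mln : mble (fun w => ln (regdet (X w))).
 by apply: mcomp => //; exact: (mcomp meas_regdet mX).
have cE : lam * logcenter = ln mean by rewrite /logcenter mulrCA divff ?mulr1// gt_eqF.
have h1 : (P [set w | a < ln (regdet (X w)) - logcenter]%R <= (expR (- (lam * a)))%:E)%E.
 apply: (@le_trans _ _ (\int[P]_w (expR (- (lam * a)) / mean * regpow (X w))%:E)%E).
  apply: prob_le_integral.
  - by apply: meas_set_bool; apply: mble_ltr => //; exact: mbleB.
  - exact: mbleM.
  - by move=> w; rewrite mulr_ge0 ?divr_ge0 ?expR_ge0 ?ltW// regpow_gt0.
  - move=> w /= h; rewrite mulrAC ler_pdivlMr// mul1r -[leLHS]lnK ?posrE// -expRD ler_expR -cE; nra.
 rewrite int_Zl ?divr_ge0 ?expR_ge0 ?(ltW mean0)//; last by move=> w; rewrite ltW ?regpow_gt0.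
 by rewrite meanE -EFinM divfK// gt_eqF.
have h2 : (P [set w | a < - (ln (regdet (X w)) - logcenter)]%R <= (expR (- (lam * a / 2)))%:E)%E.
 apply: (@le_trans _ _ (\int[P]_w (expR (- (lam * a)) * mean * (regpow (X w))^-1)%:E)%E).
  apply: prob_le_integral.
  - by apply: meas_set_bool; apply: mble_ltr => //; apply: mbleN; exact: mbleB.
  - exact: mbleM.
  - by move=> w; rewrite mulr_ge0 ?mulr_ge0 ?expR_ge0 ?ltW// invr_gt0 regpow_gt0.
  - move=> w /= h; rewrite -expRN -{1}[mean]lnK ?posrE// -!expRD -[leLHS]expR0 ler_expR -cE; nra.
 rewrite int_Zl ?mulr_ge0 ?expR_ge0 ?(ltW mean0)//; last by move=> w; rewrite invr_ge0 ltW ?regpow_gt0.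
 rewrite EFinM -muleA -meanE.
 apply: (@le_trans _ _ ((expR (- (lam * a)))%:E * ((1 + 8 * lam ^+ 2 * th ^+ 2) ^+ n)%:E)%E).
  by apply: lee_wpmul2l; [rewrite lee_fin expR_ge0|exact: regpow_moments].
 rewrite -EFinM lee_fin.
 apply: (@le_trans _ _ (expR (- (lam * a)) * expR (lam * a / 2))); last by rewrite -expRD ler_expR; lra.
 rewrite ler_wpM2l ?expR_ge0//; apply: (@le_trans _ _ (expR (8 * lam ^+ 2 * th ^+ 2) ^+ n)).
  apply: lerXn2r; rewrite ?nnegrE ?expR_ge0 ?expR_ge1Dx//.
  have : 0 <= lam ^+ 2 * th ^+ 2 by rewrite mulr_ge0 ?sqr_ge0.
  by lra.
 rewrite -expRM_natl ler_expR /a.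
 have -> : n%:R * (8 * lam ^+ 2 * th ^+ 2) = 16 * lam * th ^+ 2 * (lam * n%:R / 2) by field.
 have -> : lam * (dl * n%:R) / 2 = dl * (lam * n%:R / 2) by ring.
 by rewrite ler_wpM2r// divr_ge0// mulr_ge0 ?ltW.
apply: (@le_trans _ _ (P ([set w | a < ln (regdet (X w)) - logcenter] `|` [set w | a < - (ln (regdet (X w)) - logcenter)])%R)).
 apply: le_measure; rewrite ?inE.
 - apply: meas_set_bool; apply: mble_ltr => //.
  by apply: mcomp => //; exact: mbleB.
 - apply: measurableU; apply: meas_set_bool; apply: mble_ltr => //; first exact: mbleB.
  by apply: mbleN; exact: mbleB.
 - move=> w /=; rewrite -/a ltr_normr => /orP[h|h]; [by left|by right].
apply: le_trans (measureU2 _ _ _) _.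
- by apply: meas_set_bool; apply: mble_ltr => //; exact: mbleB.
- by apply: meas_set_bool; apply: mble_ltr => //; apply: mbleN; exact: mbleB.
apply: (@le_trans _ _ ((expR (- (lam * a)))%:E + (expR (- (lam * a / 2)))%:E)%E); first exact: leeD.
rewrite -EFinD lee_fin.
have : expR (- (lam * a)) <= expR (- (lam * a / 2)) by rewrite ler_expR; nra.
have -> : lam * dl / 2 * n%:R = lam * a / 2 by rewrite /a; ring.
by lra.
Qed.

Definition row_average i (g : A) : \bar R := (\int[P]_w (regpow (mix (rowmask i) (X w) g))%:E)%E.

Definition row_mean i (g : A) (s : seq 'I_n) : R := let Q := Qm (wts eta [seq hrow g j | j <- s]) in
 eta + Re (dot (row i F *m Q) (row i F)) + Re (\tr Q) / n%:R.

(** The centre [c] of the average over row [i] is computed from [F] and the other rows, hence is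
    common to all laws of that row; the law enters only through [eps]. *)
Lemma row_average_bounds i (s : seq 'I_n) g (eps : R) : i \notin s ->
 (forall f, regdet f = gain (wts eta [seq hrow f j | j <- s]) eta (hrow f i) * Wm (wts eta [seq hrow f j | j <- s])) ->
 ((33 + 2 * B ^+ 2) / eta + 16) / (2 * sn) + 2 * tau / eta <= eps ->
 let c := expR (lam * ln (row_mean i g s * Wm (wts eta [seq hrow g j | j <- s]))) in
 (row_average i g <= (c * (1 + eps))%:E)%E /\ ((c * (1 - eps))%:E <= row_average i g)%E.
Proof.
move=> is_ hs heps c; set S := wts eta [seq hrow g j | j <- s] in c *.
have wS : wge0 S by rewrite wge0_wts// ltW.
pose X' w : arr R 'I_n := fun j => X w (i, j).
have mX' : mble X' by exact: meas_reindex.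
have iX' : indep P X'.
 apply: (@indep_reindex _ _ _ P _ _ X (fun j => (i, j))) => //; first by move=> j j' [].
 by move=> ij; exact: EM.
have hX' : std_entries P X' B tau by move=> j; exact: hX.
have := quadratic_form_deviation mX' iX' hX' B0 (row i F) wS eta0 n0 heps.
set b := eta + _ + _ => hdev.
have bE : b = row_mean i g s by [].
have b0 : 0 < b.
 apply: lt_le_trans eta0 _; rewrite /b -addrA lerDl addr_ge0 ?dot_Qm_ge0//.
 by rewrite divr_ge0 ?ler0n// Re_trace; apply: sumr_ge0 => k _; exact: Qm_diag_ge0.
pose t w := gain S eta (((sqrt n%:R)^-1)%:C *: rv (X' w) + row i F).
have t0 w : 0 < t w by apply: lt_le_trans eta0 _; rewrite lerDl dot_Qm_ge0.
pose W' := Wm S; have W0 : 0 < W' by exact: Wm_gt0.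
have regE w : regpow (mix (rowmask i) (X w) g) = expR (lam * ln (t w)) * expR (lam * ln W').
 rewrite /regpow -expRD -mulrDr -lnM ?posrE// hs.
 have -> : [seq hrow (mix (rowmask i) (X w) g) j | j <- s] = [seq hrow g j | j <- s].
  apply/eq_in_map => j js; apply: hrow_ext => k; rewrite /mix /rowmask /=.
  by case: eqP => // ji; move: is_; rewrite -ji js.
 have hh : hrow (mix (rowmask i) (X w) g) i = ((sqrt n%:R)^-1)%:C *: rv (X' w) + row i F.
  rewrite /hrow (_ : rowv (mix (rowmask i) (X w) g) i = rv (X' w))//.
  by apply/rowP => k; rewrite !mxE /mix /rowmask eqxx.
 by rewrite hh -/S -/W' -/(t w).
have cE : c = expR (lam * ln b) * expR (lam * ln W').
 by rewrite /c -bE lnM ?posrE// mulrDr expRD.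
have mt : mble t.
 apply: mbleD => //; apply: meas_ReT; apply: meas_dot; first apply: meas_mxM.
 - apply: meas_mxD; last exact: meas_mx_cst.
  by apply: meas_mxZ => //; exact: (meas_mx_comp (@meas_rv _ n)).
 - exact: meas_mx_cst.
 - apply: meas_mxD; last exact: meas_mx_cst.
  by apply: meas_mxZ => //; exact: (meas_mx_comp (@meas_rv _ n)).
have c0 : 0 < c by exact: expR_gt0.
have mdev : mble (fun w => `|t w - b|).
 by apply: mcomp => //; exact: mbleB.
have cb0 : 0 <= c / b by rewrite divr_ge0 ?ltW.
have hdev2 : (\int[P]_w (c / b * `|t w - b|)%:E <= (c * eps)%:E)%E.
 rewrite int_Zl//; apply: (@le_trans _ _ ((c / b)%:E * (b * eps)%:E)%E).
  by apply: lee_wpmul2l; [rewrite lee_fin|exact: hdev].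
 by rewrite -EFinM lee_fin; apply: eq_ler; field; rewrite gt_eqF.
have mr : mble (fun w => regpow (mix (rowmask i) (X w) g)).
 by apply: (mcomp meas_regpow); apply: meas_mix => //; exact: measurable_cst.
have mcd : mble (fun w => c / b * `|t w - b|) by exact: mbleM.
have cd0 w : 0 <= c / b * `|t w - b| by rewrite mulr_ge0.
split.
 apply: (@le_trans _ _ (\int[P]_w (c + c / b * `|t w - b|)%:E)%E).
  apply: int_le => //; first exact: mbleD.
   by move=> w; rewrite ltW ?regpow_gt0.
  move=> w; rewrite regE; have [h _] := expR_ln_dev (t0 w) b0.
  have -> : c + c / b * `|t w - b| = expR (lam * ln b) * (1 + `|t w - b| / b) * expR (lam * ln W').
   by rewrite cE; ring.
  by rewrite ler_wpM2r ?expR_ge0.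
 rewrite int_D//; last by move=> _; exact: ltW.
 by rewrite int_cst mulrDr mulr1 EFinD; apply: leeD.
have h : (c%:E <= row_average i g + (c * eps)%:E)%E.
 apply: (@le_trans _ _ (\int[P]_w (regpow (mix (rowmask i) (X w) g) + c / b * `|t w - b|)%:E)%E).
  rewrite -[leLHS](int_cst P); apply: int_le => //; first exact: mbleD.
   by move=> _; exact: ltW.
  move=> w; rewrite regE; have [_ h] := expR_ln_dev (t0 w) b0.
  have -> : c / b * `|t w - b| = expR (lam * ln b) * (`|t w - b| / b) * expR (lam * ln W').
   by rewrite cE; ring.
  by rewrite cE -mulrDl ler_wpM2r ?expR_ge0.
 rewrite int_D//; last by move=> w; rewrite ltW ?regpow_gt0.
 exact: leeD.
by rewrite mulrBr mulr1 EFinB leeBlDr.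
Qed.

End one_law.
End log_determinant_concentration.

(** * Lindeberg replacement, row by row *)

Section row_replacement.
Context {R : realType} {d} {T : measurableType d} (P : probability T R).
Local Notation C := R[i].
Variable (n : nat).
Local Notation A := (arr R ('I_n * 'I_n)).
Variables (G : A -> R) (X Y : T -> A) (a b : R).
Hypotheses (mG : mble G) (G0 : forall f, 0 <= G f) (a0 : 0 <= a) (b0 : 0 <= b).
Hypotheses (mX : mble X) (iX : indep P X) (mY : mble Y) (iY : indep P Y).

Let rowmask (i : 'I_n) : pred ('I_n * 'I_n) := fun ij => ij.1 == i.
Let avg (Z : T -> A) i g : \bar R := (\int[P]_w (G (mix (fun ij => ij.1 == i) (Z w) g))%:E)%E.

Hypothesis row_swap : forall i g, (a%:E * avg Y i g <= b%:E * avg X i g)%E.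

Let before (m : nat) : pred ('I_n * 'I_n) := fun ij => (ij.1 < m)%N.
Let hybrid m : \bar R := (\int[P]_w \int[P]_v (G (mix (before m) (Y w) (X v)))%:E)%E.

Let mhyb m : mble (fun p : T * T => mix (before m) (Y p.1) (X p.2)).
Proof.
by apply: meas_mix; [exact: (mcomp mY measurable_fst)|exact: (mcomp mX measurable_snd)].
Qed.

Let mavg0 (Z : T -> A) i : mble Z -> mble (avg Z i).
Proof.
move=> mZ.
apply: (@measurable_fun_fubini_tonelli_F _ _ _ _ _ P (fun p : A * T => (G (mix (rowmask i) (Z p.2) p.1))%:E)).
 apply/mble_EFinP; apply: (mcomp mG).
 apply: meas_mix; last exact: measurable_fst.
 exact: (mcomp mZ measurable_snd).
by move=> p; rewrite lee_fin.
Qed.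

Let mavg (Z : T -> A) i m : mble Z ->
 mble (fun p : T * T => avg Z i (mix (before m) (Y p.1) (X p.2))).
Proof. by move=> mZ; exact: (mcomp (mavg0 i mZ) (mhyb m)). Qed.

Let avg0 (Z : T -> A) i g : (0 <= avg Z i g)%E.
Proof. by apply: int_ge0 => w; exact: G0. Qed.

Let mix_old (i : 'I_n) f g h :
 mix (before i) f (mix (rowmask i) g h) = mix (rowmask i) g (mix (before i) f h) :> A.
Proof.
apply/funext => ij; rewrite /mix /before /rowmask; case: eqP => [->|_]; first by rewrite ltnn.
by case: ifP.
Qed.

Let mix_new (i : 'I_n) f g h :
 mix (before i.+1) (mix (rowmask i) g f) h = mix (rowmask i) g (mix (before i) f h) :> A.
Proof.
apply/funext => ij; rewrite /mix /before /rowmask ltnS; case: (eqVneq ij.1 i) => [->|hi]; first by rewrite leqnn.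
by rewrite leq_eqVlt (inj_eq val_inj) (negbTE hi).
Qed.

Let hybrid_old (i : 'I_n) : hybrid i =
 (\int[P]_w \int[P]_v avg X i (mix (before i) (Y w) (X v)))%E.
Proof.
apply: eq_integral => w _.
etransitivity; first apply: (indep_integral (rowmask i) (g := fun f => (G (mix (before i) (Y w) f))%:E) mX iX).
- apply/mble_EFinP; apply: (mcomp mG); apply: meas_mix.
  exact: measurable_cst.
 exact: measurable_id.
- by move=> f; rewrite lee_fin.
by apply: eq_integral => v _; apply: eq_integral => u _; rewrite mix_old.
Qed.

Let hybrid_new (i : 'I_n) : hybrid i.+1 =
 (\int[P]_w \int[P]_v avg Y i (mix (before i) (Y w) (X v)))%E.
Proof.
etransitivity; first apply: (int_int_swap P P (g := fun p => G (mix (before i.+1) (Y p.1) (X p.2)))).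
- exact: (mcomp mG (mhyb i.+1)).
- by move=> p; exact: G0.
etransitivity; last first.
 apply/esym; exact: (@fubini_tonelli _ _ _ _ _ P P (fun p => avg Y i (mix (before i) (Y p.1) (X p.2))) (mavg i i mY) (fun p => avg0 _ _ _)).
apply: eq_integral => v _.
etransitivity; first apply: (indep_integral (rowmask i) (g := fun f => (G (mix (before i.+1) f (X v)))%:E) mY iY).
- apply/mble_EFinP; apply: (mcomp mG); apply: meas_mix.
  exact: measurable_id.
 exact: measurable_cst.
- by move=> f; rewrite lee_fin.
by apply: eq_integral => w _; apply: eq_integral => u _; rewrite mix_new.
Qed.

Let int_step (h1 h2 : T -> \bar R) : mble h1 -> mble h2 ->
 (forall w, 0 <= h1 w)%E -> (forall w, 0 <= h2 w)%E -> (forall w, a%:E * h1 w <= b%:E * h2 w)%E ->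
 (a%:E * \int[P]_w h1 w <= b%:E * \int[P]_w h2 w)%E.
Proof.
move=> m1 m2 p1 p2 h.
have -> : (a%:E * \int[P]_w h1 w = \int[P]_w (a%:E * h1 w))%E.
 by rewrite ge0_integralZl.
have -> : (b%:E * \int[P]_w h2 w = \int[P]_w (b%:E * h2 w))%E.
 by rewrite ge0_integralZl.
apply: ge0_le_integral => //.
- by move=> w _; rewrite mule_ge0 ?lee_fin.
- exact: emeasurable_funM.
- exact: emeasurable_funM.
Qed.

Let hybrid_step (i : 'I_n) : (a%:E * hybrid i.+1 <= b%:E * hybrid i)%E.
Proof.
have m1 (Z : T -> A) (w : T) : mble Z ->
  mble (fun v => avg Z i (mix (before i) (Y w) (X v))).
 by move=> mZ; exact: (mcomp (mavg i i mZ) (measurable_pair1 w)).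
have m2 (Z : T -> A) : mble Z ->
  mble (fun w => \int[P]_v avg Z i (mix (before i) (Y w) (X v)))%E.
 move=> mZ; apply: (@measurable_fun_fubini_tonelli_F _ _ _ _ _ P
  (fun p : T * T => avg Z i (mix (before i) (Y p.1) (X p.2)))); first exact: mavg.
 by move=> p; exact: avg0.
have i0 (Z : T -> A) w : (0 <= \int[P]_v avg Z i (mix (before i) (Y w) (X v)))%E.
 by apply: integral_ge0 => v _; exact: avg0.
rewrite hybrid_old hybrid_new; apply: int_step => [||w|w|w].
- exact: m2.
- exact: m2.
- exact: i0.
- exact: i0.
apply: int_step => [||v|v|v].
- exact: m1.
- exact: m1.
- exact: avg0.
- exact: avg0.
- exact: row_swap.
Qed.

(** Telescoping over hybrids whose first rows come from [Y] and the others from an independent draw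
    of [X]. The comparison is multiplicative, one factor [b / a] per row, as suits a power of the
    determinant. *)
Lemma row_replacement :
 ((a ^+ n)%:E * \int[P]_w (G (Y w))%:E <= (b ^+ n)%:E * \int[P]_w (G (X w))%:E)%E.
Proof.
have H m : (m <= n)%N -> ((a ^+ m)%:E * hybrid m <= (b ^+ m)%:E * hybrid 0)%E.
 elim: m => [|m ih] mn; first by rewrite !expr0.
 have hs : (a%:E * hybrid m.+1 <= b%:E * hybrid m)%E := hybrid_step (Ordinal mn).
 apply: (@le_trans _ _ ((a ^+ m)%:E * (b%:E * hybrid m))%E).
  rewrite exprSr EFinM -muleA; apply: lee_wpmul2l => //; by rewrite lee_fin exprn_ge0.
 have -> : ((b ^+ m.+1)%:E * hybrid 0 = b%:E * ((b ^+ m)%:E * hybrid 0))%E by rewrite exprS EFinM muleA.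
 rewrite [leLHS]muleCA; apply: lee_wpmul2l; first by rewrite lee_fin.
 by apply: ih; exact: ltnW.
have hn : hybrid n = (\int[P]_w (G (Y w))%:E)%E.
 apply: eq_integral => w _; rewrite -[RHS](int_cst P); apply: eq_integral => v _.
 by congr ((G _)%:E); apply/funext => ij; rewrite /mix /before ltn_ord.
have h0 : hybrid 0 = (\int[P]_w (G (X w))%:E)%E.
 transitivity (\int[P]_w \int[P]_v (G (X v))%:E)%E.
  by apply: eq_integral => w _; apply: eq_integral => v _.
 by rewrite integral_cst//= [P _]probability_setT mule1.
by have := H n (leqnn n); rewrite hn h0.
Qed.

End row_replacement.

(** * Comparison of the centres for two laws *)

Section centers.
Context {R : realType} {d} {T : measurableType d} (P : probability T R).
Local Notation C := R[i].
Variable (n : nat).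
Local Notation A := (arr R ('I_n * 'I_n)).

Lemma ratio_le_expR (eps : R) : 0 <= eps -> eps <= 1 / 2 -> (1 + eps) / (1 - eps) <= expR (4 * eps).
Proof.
move=> e0 e1; apply: le_trans (expR_ge1Dx _); rewrite ler_pdivrMr; last lra.
rewrite -subr_ge0; have -> : (1 + 4 * eps) * (1 - eps) - (1 + eps) = 2 * eps * (1 - 2 * eps) by ring.
by rewrite mulr_ge0//; lra.
Qed.

(** Both row averages are close to the same centre, so each swapped row costs the ratio
    [(1 + eps) / (1 - eps)], at most [expR (4 * eps)]; the division of the logarithm by [lam]
    explains the condition relating [eps] to [lam * dl]. *)
Lemma logcenter_close (eta lam : R) (F : 'M[C]_n) (X Y : T -> A) (B tau eps dl : R) :
 0 < eta -> 0 < lam <= 1 / 2 -> (0 < n)%N ->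
 mble X -> indep P X -> std_entries P X B tau ->
 mble Y -> indep P Y -> std_entries P Y B tau -> 0 <= B ->
 ((33 + 2 * B ^+ 2) / eta + 16) / (2 * sqrt n%:R) + 2 * tau / eta <= eps ->
 0 <= eps -> eps <= 1 / 2 -> 4 * eps <= lam * dl ->
 logcenter P eta lam F Y - logcenter P eta lam F X <= dl * n%:R.
Proof.
move=> eta0 hlam n0 mX iX hX mY iY hY B0 heps eps0 eps1 hdl; have /andP[l0 l1] := hlam.
have pos (Z : T -> A) : mble Z -> indep P Z -> std_entries P Z B tau ->
  exists2 r, 0 < r & (\int[P]_w (regpow eta lam F (Z w))%:E)%E = r%:E.
 move=> mZ iZ hZ; exists (fine (\int[P]_w (regpow eta lam F (Z w))%:E)%E).
  rewrite -lte_fin fineK.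
   apply: int_gt0; last by move=> w; exact: regpow_gt0.
   exact: (mcomp (meas_regpow eta lam F) mZ).
  rewrite ge0_fin_numE; first exact: (regpow_fin F eta0 hlam n0 mZ iZ hZ).
  by apply: int_ge0 => w; rewrite ltW ?regpow_gt0.
 rewrite fineK// ge0_fin_numE; first exact: (regpow_fin F eta0 hlam n0 mZ iZ hZ).
 by apply: int_ge0 => w; rewrite ltW ?regpow_gt0.
have [x x0 xE] := pos X mX iX hX; have [y y0 yE] := pos Y mY iY hY.
have p1 : 0 < 1 - eps by lra.
have p2 : 0 < 1 + eps by lra.
have h : ((1 - eps) ^+ n) * y <= ((1 + eps) ^+ n) * x.
 rewrite -lee_fin !EFinM -xE -yE.
 have mG := meas_regpow eta lam F.
 have G0 f : 0 <= regpow eta lam F f by exact/ltW/regpow_gt0.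
 refine (@row_replacement R d T P n (regpow eta lam F) X Y (1 - eps) (1 + eps) mG G0 (ltW p1) (ltW p2) mX iX mY iY _).
 move=> i g; have [s [is_ hs]] := regdet_isolate F eta0 i.
  have [hY1 _] := row_average_bounds eta0 hlam n0 mY iY hY B0 g is_ hs heps.
  have [_ hX1] := row_average_bounds eta0 hlam n0 mX iX hX B0 g is_ hs heps.
  set c := expR _ in hY1 hX1.
  apply: (@le_trans _ _ ((1 - eps)%:E * (c * (1 + eps))%:E)%E).
   by apply: lee_wpmul2l => //; rewrite lee_fin ltW.
  apply: (@le_trans _ _ ((1 + eps)%:E * (c * (1 - eps))%:E)%E).
   by rewrite -!EFinM lee_fin; apply: eq_ler; ring.
  by apply: lee_wpmul2l => //; rewrite lee_fin ltW.
have cX : logcenter P eta lam F X = ln x / lam by rewrite /logcenter xE.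
have cY : logcenter P eta lam F Y = ln y / lam by rewrite /logcenter yE.
rewrite cX cY -mulrBl ler_pdivrMr// -ln_div ?posrE//.
have h1 : y / x <= ((1 + eps) / (1 - eps)) ^+ n.
 by rewrite expr_div_n ler_pdivrMr// mulrAC ler_pdivlMr ?exprn_gt0// mulrC.
have h2 : (1 + eps) / (1 - eps) <= expR (4 * eps).
 exact: ratio_le_expR.
have h3 : ((1 + eps) / (1 - eps)) ^+ n <= expR (4 * eps) ^+ n.
 by apply: lerXn2r => //; rewrite nnegrE; [rewrite divr_ge0// ltW|exact: expR_ge0].
rewrite -[X in _ <= X]expRK ler_ln ?posrE ?divr_gt0 ?expR_gt0//.
apply: (le_trans h1); apply: (le_trans h3); rewrite -expRM_natl ler_expR.
have nn : 0 <= n%:R :> R by [].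
have := ler_wpM2r nn hdl; rewrite mulrC => /le_trans; apply.
by apply: eq_ler; ring.
Qed.

End centers.

(** * The determinant against its regularization, deterministically *)

Section deterministic_comparison.
Context {R : realType}.
Local Notation C := R[i].

Lemma Wm_Qm_perm n (s t : seq (R * 'rV[C]_n)) : perm_eq s t -> wge0 s ->
 Wm s = Wm t /\ (Wm s != 0 -> Qm s = Qm t).
Proof.
elim: s t => [|x s ih] t.
 by move=> st _; have -> : t = [::] by apply/nilP; rewrite /nilp -(perm_size st).
move=> st ws; have xt : x \in t by rewrite -(perm_mem st) inE eqxx.
have wt : wge0 t by rewrite /wge0 -(perm_all _ st).
move: st wt; case/splitPr: xt => t1 t2 st wt.
have st' : perm_eq s (t1 ++ t2).
 by move: st; rewrite perm_sym -cat1s perm_catCA /= perm_cons perm_sym.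
have [x0 ws'] : 0 <= x.1 /\ wge0 s by move: ws => /= /andP[].
have [w1 w2] : wge0 t1 /\ wge0 t2.
 by move: wt; rewrite wge0_cat => /andP[a /= /andP[_ b]].
have [e1 e2] := Wm_Qm_move x0 w1 w2.
have [f1 f2] := ih _ st' ws'.
have [g1 g2] := Wm_Qm_cons_congr x f1 f2.
split; first by rewrite g1 e1.
move=> h; etransitivity; first exact: (g2 h).
by symmetry; apply: e2; rewrite e1 -g1; exact: h.
Qed.

Lemma pre_rev n (r : nat -> 'rV[C]_n) m : pre r m = rev [seq r k | k <- iota 0 m].
Proof.
elim: m => // m ih; rewrite -[in RHS](addn1 m) iotaD map_cat rev_cat /= add0n -ih.
by [].
Qed.

Lemma perm_pre_enum n (r : nat -> 'rV[C]_n.+1) :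
 perm_eq [seq r (val i) | i <- enum 'I_n.+1] (pre r n.+1).
Proof.
rewrite pre_rev perm_sym perm_rev -val_enum_ord -map_comp; exact: perm_refl.
Qed.

Lemma mem_preP n (r : nat -> 'rV[C]_n) m h : h \in pre r m -> exists2 k, (k < m)%N & h = r k.
Proof.
elim: m => // m ih; rewrite /= inE => /orP[/eqP ->|/ih[k km ->]]; first by exists m.
by exists k => //; exact: ltnW.
Qed.

Lemma pre_splitP n (r : nat -> 'rV[C]_n) m A1 A2 h : pre r m = A1 ++ h :: A2 ->
 exists2 k, (k < m)%N & h = r k /\
  (forall g, g \in A1 ++ A2 -> exists2 l, (l < m)%N && (l != k) & g = r l).
Proof.
elim: m A1 => [|m ih] [|a A1] //; rewrite [pre _ _]/= ?cat_cons ?cat0s.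
 move=> [<- <-]; exists m => //; split => // g /mem_preP[k km ->].
 by exists k => //; rewrite ltnS (ltnW km) ltn_eqF.
move=> [<- /ih[k km [-> hs]]]; exists k; first exact: ltnW.
split=> // g; rewrite inE => /orP[/eqP ->|/hs [l /andP[lm lk] ->]].
 by exists m => //; rewrite ltnS leqnn gtn_eqF.
by exists l => //; rewrite ltnS ltnW.
Qed.

Definition hmat n (F : 'M[C]_n) f : 'M[C]_n := \matrix_i hrow F f i.

Lemma regdet_pre n (eta : R) (F : 'M[C]_n.+1) f : 0 <= eta ->
 regdet eta F f = Wm (wts eta (pre (fun k => row (inord k) (hmat F f)) n.+1)).
Proof.
move=> e0; set r := fun k => _; rewrite /regdet.
have -> : [seq hrow F f i | i <- enum 'I_n.+1] = [seq r (val i) | i <- enum 'I_n.+1].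
 by apply: eq_map => i; rewrite /r inord_val rowK.
exact: (proj1 (Wm_Qm_perm (perm_map _ (perm_pre_enum r)) (wge0_wts _ e0))).
Qed.

Lemma det_le_regdet n (eta : R) (F : 'M[C]_n.+1) f : 0 <= eta ->
 sqnorm (\det (hmat F f)) <= regdet eta F f.
Proof.
move=> e0; rewrite regdet_pre//; pose r k := row (inord k) (hmat F f); rewrite -/r.
rewrite sqnorm_det (eq_bigr (fun k : 'I_n.+1 => dist2 (pre r k) (r k))); last first.
 by move=> k _; rewrite /r inord_val.
rewrite -(big_mkord xpredT (fun k => dist2 (pre r k) (r k))).
suff gen m : \prod_(0 <= k < m) dist2 (pre r k) (r k) <= Wm (wts eta (pre r m)) by exact: gen.
elim: m => [|m ih]; first by rewrite big_geq.
rewrite big_nat_recr//= mulrC; apply: ler_pM; rewrite ?dist2_ge0//.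
 by apply: prodr_ge0 => k _; exact: dist2_ge0.
apply: le_trans (dist2_le_gain eta (r m) (wge0_wts _ e0)).
by rewrite unzip2_wts lerDr.
Qed.

(** The first [m0] rows are far from the span of one another, so dropping their weights costs a
    factor [1 + eta / d] each. The remaining rows may be closer: their regularized gain is bounded
    above by [eta + sqn (r k)] and their distance below by [l k]. *)
Lemma regdet_le_det n (eta d : R) (F : 'M[C]_n.+1) f m0 (l : nat -> R) :
 0 <= eta -> 0 < d -> (m0 <= n.+1)%N ->
 let r k := row (inord k) (hmat F f) in
 (forall k, (k < m0)%N -> d <= dist2 [seq r j | j <- iota 0 m0 & j != k] (r k)) ->
 (forall k, (m0 <= k < n.+1)%N -> 0 < l k <= dist2 (pre r k) (r k)) ->
 regdet eta F f <= sqnorm (\det (hmat F f)) * (1 + eta / d) ^+ m0 *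
  \prod_(m0 <= k < n.+1) ((eta + sqn (r k)) / l k) /\ 0 < sqnorm (\det (hmat F f)).
Proof.
move=> e0 d0 mn r hd hl; rewrite regdet_pre// -/r; set H := hmat F f.
pose W0 := Wm [seq (0, h) | h <- pre r m0].
have hW0 : Wm (wts eta (pre r m0)) <= W0 * (1 + eta / d) ^+ m0.
 rewrite -{2}(size_pre r m0); apply: (Wm_le_regularized (A1 := [::])) => // A' A'' h.
 move=> /pre_splitP[k km [-> hs]]; apply: le_trans (hd _ km) _; apply: dist2_subset => g.
 move=> /hs[j /andP[jm jk] ->]; apply/mapP; exists j => //.
 by rewrite mem_filter jk mem_iota.
have dE : sqnorm (\det H) = W0 * \prod_(m0 <= k < n.+1) dist2 (pre r k) (r k).
 rewrite sqnorm_det (eq_bigr (fun k : 'I_n.+1 => dist2 (pre r k) (r k))); last first.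
  by move=> k _; rewrite /r inord_val.
 by rewrite /W0 Wm_pre0 -(big_mkord xpredT (fun k => dist2 (pre r k) (r k))) (big_cat_nat (n := m0))//= big_mkord.
have W0p : 0 < W0.
 rewrite /W0 Wm_pre0; apply: prodr_gt0 => k _; apply: lt_le_trans d0 _.
 apply: le_trans (hd _ (ltn_ord k)) _; apply: dist2_subset => g /mem_preP[j jk ->].
 apply/mapP; exists j => //; rewrite mem_filter mem_iota /= add0n ltn_eqF//=.
 exact: ltn_trans jk (ltn_ord k).
have lp : 0 < \prod_(m0 <= k < n.+1) l k.
 by rewrite big_seq; apply: prodr_gt0 => k; rewrite mem_index_iota => /hl/andP[].
have ld : \prod_(m0 <= k < n.+1) l k <= \prod_(m0 <= k < n.+1) dist2 (pre r k) (r k).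
 rewrite !big_seq; apply: ler_prod => k; rewrite mem_index_iota => /hl/andP[a b].
 by rewrite ltW.
have dp : 0 < sqnorm (\det H) by rewrite dE mulr_gt0// (lt_le_trans lp ld).
split => //; apply: le_trans (Wm_pre_le r e0 mn) _.
have pp : 0 <= \prod_(m0 <= k < n.+1) (eta + sqn (r k)).
 by apply: prodr_ge0 => k _; rewrite addr_ge0 ?sqn_ge0.
rewrite prodf_div mulrA ler_pdivlMr//.
apply: (@le_trans _ _ (W0 * (1 + eta / d) ^+ m0 * \prod_(m0 <= k < n.+1) (eta + sqn (r k)) *
  \prod_(m0 <= k < n.+1) dist2 (pre r k) (r k))).
 apply: ler_pM => //; first by rewrite mulr_ge0// Wm_ge0// wge0_wts.
 - exact: ltW.
 - exact: ler_wpM2r.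
by rewrite dE le_eqVlt; apply/orP; left; apply/eqP; ring.
Qed.

End deterministic_comparison.

(** * Distances between the rows of the shifted matrix *)

Section row_distances.
Context {R : realType} {d} {T : measurableType d} (P : probability T R).
Local Notation C := R[i].

Lemma prob_union_le (I : finType) (b : T -> bool) (bi : I -> T -> bool) (c : I -> R) :
 mble b -> (forall i, mble (bi i)) ->
 (forall w, b w -> exists i, bi i w) ->
 (forall i, (P [set w | bi i w] <= (c i)%:E)%E) ->
 (P [set w | b w] <= (\sum_i c i)%:E)%E.
Proof.
move=> mb mbi h hc; rewrite prob_bool//.
apply: (@le_trans _ _ (\int[P]_w (\sum_i (bi i w)%:R)%:E)%E).
 apply: int_le => //; first exact: meas_natr_bool.
  by apply: measurable_sum => i; exact: meas_natr_bool.
 move=> w; have [/h[i hi]|_] := boolP (b w).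
  by rewrite (bigD1 i)//= hi lerDl; apply: sumr_ge0.
 by apply: sumr_ge0.
rewrite int_sum//; last by move=> i; exact: meas_natr_bool.
by rewrite -sumEFin; apply: lee_sum => i _; rewrite -prob_bool.
Qed.

Lemma dist2Z n (s : seq 'rV[C]_n) (a : C) h : dist2 s (a *: h) = sqnorm a * dist2 s h.
Proof. by rewrite /dist2 -scalemxAl sqnZ. Qed.

Lemma dist2_le_span n (r r' : seq 'rV[C]_n) h :
 (forall v, (forall g, g \in r' -> dot v g = 0) -> forall g, g \in r -> dot v g = 0) ->
 dist2 r' h <= dist2 r h.
Proof.
move=> rr'; have := Re_dot_le (h *m proj r') (h *m proj r).
rewrite -dot_Qm (mulmx_proj_orth (v := h *m proj r')); last first.
 by apply: rr' => g; exact: dot_proj0.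
by rewrite -/(dist2 r h) -[Re (dot _ h)]dist2E -/(dist2 r' h); lra.
Qed.

Lemma dist2_scale n (s : seq 'rV[C]_n) (a : C) h : a != 0 ->
 dist2 s h <= dist2 [seq a *: g | g <- s] h.
Proof.
move=> a0; apply: dist2_le_span => v vs g /mapP[g' gs ->].
by rewrite dotZr vs// mulr0.
Qed.

Variables (n : nat) (kap p : R) (F : 'M[C]_n.+1) (X : T -> arr R ('I_n.+1 * 'I_n.+1)).
Hypotheses (k0 : 0 < kap) (p0 : 0 < p) (p1 : p <= 1).
Hypotheses (mX : mble X) (iX : indep P X) (aX : anticonc P X kap p).
Local Notation N := n.+1.
Local Notation sn := (sqrt N%:R : R).
Let sn0 : 0 < sn. Proof. by rewrite sqrtr_gt0. Qed.
Let sn2 : sn ^+ 2 = N%:R. Proof. by rewrite sqr_sqrtr. Qed.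
Let a : C := (sn^-1)%:C.
Let sa : sqnorm a = N%:R^-1. Proof. by rewrite sqnorm_real exprVn sn2. Qed.

Definition hrown f k : 'rV[C]_N := row (inord k) (hmat F f).

Lemma hrownE f k : hrown f k = hrow F f (inord k).
Proof. by rewrite /hrown rowK. Qed.

Lemma meas_hrown k : meas_mx (fun w => hrown (X w) k).
Proof.
move=> i j; under eq_fun do rewrite hrownE.
exact: (mcomp (@meas_hrow R N F (inord k) i j) mX).
Qed.

Lemma meas_dist_rows (S : seq nat) i :
 mble (fun w => dist2 [seq hrown (X w) j | j <- S] (hrown (X w) i)).
Proof.
by apply: (@meas_dist2 _ _ _ _ _ (fun j w => hrown (X w) j)) => [j|]; exact: meas_hrown.
Qed.

Lemma hrow_shift f i : hrow F f i = a *: (rowv f i + sn%:C *: row i F).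
Proof.
have e : a * sn%:C = 1 by rewrite /a -rmorphM mulVf// gt_eqF.
by rewrite scalerDr scalerA e scale1r.
Qed.

Lemma row_small_ball (S : seq nat) i k : (i < N)%N -> i \notin S -> all (ltn^~ N) S ->
 (size S + k <= N)%N ->
 (P [set w | dist2 [seq hrown (X w) j | j <- S] (hrown (X w) i)
    <= p * kap / 12 * (k%:R / N%:R) ^+ 2]%R <= (expR (- (p / 6 * k%:R)))%:E)%E.
Proof.
move=> iN iS SN hk.
pose bf (f : arr R ('I_N * 'I_N)) := dist2 [seq hrown f j | j <- S] (hrown f i) <= p * kap / 12 * (k%:R / N%:R) ^+ 2.
pose J (ij : 'I_N * 'I_N) := ij.1 != inord i.
apply: (@indep_decouple _ _ _ P _ X J bf) => //.
 apply: mble_ler => //; apply: (@meas_dist2 _ _ _ _ _ (fun j f => hrown f j)) => [j|] u v;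
 under eq_fun do rewrite hrownE; exact: meas_hrow.
move=> v; pose s := [seq hrown v j | j <- S].
have sE f : [seq hrown (mix J v f) j | j <- S] = s.
 apply/eq_in_map => j jS; rewrite !hrownE; apply: hrow_ext => l; rewrite /mix /J /=.
 case: eqP => // /(congr1 val) /=; rewrite !inordK//; last by move/allP: SN; apply.
 by move=> ji; rewrite -ji jS in iS.
pose Y w : arr R 'I_N := fun j => X w (inord i, j).
have iE w : hrown (mix J v (X w)) i = a *: (rv (Y w) + sn%:C *: row (inord i) F).
 rewrite hrownE hrow_shift; congr (_ *: (_ + _)).
 by apply/rowP => l; rewrite !mxE /mix /J /= eqxx.
have iphi : injective (fun j : 'I_N => (inord i : 'I_N, j)) by move=> x y [].
have mY : mble Y by exact: (meas_reindex (fun j : 'I_N => (inord i : 'I_N, j)) mX).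
have iY : indep P Y by apply: (indep_reindex iphi _ iX) => ij; exact: EM.
have aY : anticonc P Y kap p by exact: (anticonc_reindex _ aX).
have hk' : (size s + k <= N)%N by rewrite size_map.
have bE w : bf (mix J v (X w)) =
  (dist2 s (rv (Y w) + sn%:C *: row (inord i) F) <= p * kap / 12 * (k%:R ^+ 2 / N%:R)).
 rewrite /bf sE iE dist2Z sa ler_pdivrMl ?ltr0n//; congr (_ <= _).
 have fe (x y z : R) : z != 0 -> z * (y * (x / z) ^+ 2) = y * (x ^+ 2 / z) by move=> z0; field.
 by apply: fe; rewrite pnatr_eq0.
rewrite (_ : [set w | _] = [set w | dist2 s (rv (Y w) + sn%:C *: row (inord i) F) <=
 p * kap / 12 * (k%:R ^+ 2 / N%:R)]); last by apply/funext => w /=; rewrite bE.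
exact: (dist_small_ball (sn%:C *: row (inord i) F) mY iY aY k0 (ltW p0) hk').
Qed.

(** The normalization by [sqrt N] is undone, so that the entries are deterministic shifts of those
    of [X] and keep their anticoncentration; the corner is square, as the recursive bound
    demands. *)
Definition corner j (f : arr R ('I_N * 'I_N)) : arr R ('I_j.+1 * 'I_j.+1) :=
 fun ab => f (inord ab.1, inord ab.2) + sn%:C * F (inord ab.1) (inord ab.2).
Arguments corner : clear implicits.

(** Markov's inequality: [sqnorm (X w ij)] exceeds [N ^ 4] with probability at most [N ^ -4]. The
    factor [64 = 2 ^ 6] in the size condition pays for [N <= 2 * j.+1]. *)
Lemma corner_class j (c : R) : (j < N)%N -> (N <= 2 * j.+1)%N ->
 (forall ij, (\int[P]_w (sqnorm (X w ij))%:E = 1)%E) ->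
 (forall i k, sqnorm (F i k) <= c * N%:R) ->
 64 * (2 * N%:R ^+ 4 + 2 * c * N%:R ^+ 2) <= N%:R ^+ 6 ->
 matrix_class P (fun w => corner j (X w)) kap p (j.+1%:R ^+ 6) (1 * j.+1%:R ^- 4).
Proof.
move=> jN Nj hX hF hN.
have mXij ij : mble (fun w => X w ij) by move: ij; apply/meas_arrP.
pose phi (ab : 'I_j.+1 * 'I_j.+1) : 'I_N * 'I_N := (inord ab.1, inord ab.2).
have lej (l : 'I_j.+1) : (l < N)%N by apply: leq_trans (ltn_ord l) _.
have iphi : injective phi.
 move=> [x y] [x' y'] h; have := congr1 (fun q => val q.2) h; have := congr1 (fun q => val q.1) h.
 by rewrite /phi /= !inordK// => /val_inj -> /val_inj ->.
split.
- by apply/meas_arrP => ab; apply: meas_addC.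
- apply: (@indep_comp _ _ _ P _ _ (fun w i => X w (phi i) : C)
  (fun f => (fun ab => f ab + sn%:C * F (inord ab.1) (inord ab.2)) : arr R _)).
 + by move=> J'; exists J' => f g; apply/funext => ab; rewrite /mix; case: (J' ab).
 + by apply/meas_arrP => ab; apply: meas_addC => //; exact: meas_coord.
 + by apply: indep_reindex => // ij; exact: EM.
- move=> ab c'; rewrite /corner; set z := _ * _.
 rewrite (_ : [set w | _] = [set w | sqnorm (X w (phi ab) - (c' - z)) <= kap]); first exact: aX.
 by apply/funext => w /=; rewrite opprB addrA.
- move=> ab; set z := sn%:C * F (inord ab.1) (inord ab.2).
 have hz : sqnorm z <= c * N%:R ^+ 2.
  rewrite sqnormM sqnorm_real sn2 expr2 mulrCA; apply: ler_wpM2l => //; exact: hF.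
 have N0 : 0 < N%:R :> R by rewrite ltr0n.
 have M0 : 0 < j.+1%:R :> R by rewrite ltr0n.
 have NM : N%:R <= 2 * j.+1%:R :> R by rewrite -natrM ler_nat.
 have MN : j.+1%:R <= N%:R :> R by rewrite ler_nat.
 have h6 : 2 * N%:R ^+ 4 + 2 * c * N%:R ^+ 2 <= j.+1%:R ^+ 6 :> R.
  have : (N%:R : R) ^+ 6 <= (2 * j.+1%:R) ^+ 6 by apply: lerXn2r => //; rewrite nnegrE ltW// mulr_gt0.
  rewrite exprMn (_ : 2 ^+ 6 = 64 :> R); last by ring.
  by move: (N%:R : R) (j.+1%:R ^+ 6 : R) hN => u v; lra.
 apply: (@le_trans _ _ (\int[P]_w ((N%:R ^+ 4)^-1 * sqnorm (X w (phi ab)))%:E)%E).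
  have iv : 0 <= ((N%:R : R) ^+ 4)^-1 by rewrite invr_ge0 exprn_ge0// ltW.
  apply: prob_le_integral.
  + apply: meas_set_bool; apply: mble_ltr => //.
   by apply: meas_sqnorm; apply: meas_addC.
  + by apply: mbleM => //; exact: meas_sqnorm.
  + by move=> w; rewrite mulr_ge0 ?sqnorm_ge0.
  + move=> w; rewrite /= /corner -/z -/(phi ab) => h.
   rewrite ler_pdivlMl ?mulr1; last by rewrite exprn_gt0.
   have h2 : sqnorm (X w (phi ab) + z) <= 2 * sqnorm (X w (phi ab)) + 2 * sqnorm z.
    by have := sqnormB_le (X w (phi ab)) (- z); rewrite opprK sqnormN.
   move: h h2 hz h6; rewrite -(mulrA 2 c); move: (sqnorm _) (sqnorm _) (sqnorm z) (j.+1%:R ^+ 6 : R) => q1 q2 q3 q4.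
   by move: (N%:R ^+ 4 : R) (c * N%:R ^+ 2 : R) => q5 q6 *; lra.
 rewrite int_Zl ?hX ?mule1; [|exact: meas_sqnorm|by move=> w; exact: sqnorm_ge0|by rewrite invr_ge0 exprn_ge0// ltW].
 rewrite mul1r lee_fin lef_pV2 ?posrE ?exprn_gt0//; apply: lerXn2r => //; rewrite nnegrE ltW//.
Qed.

(** Forgetting the last coordinates can only decrease the distance, and leaves the last row of a
    square corner against the other ones; the factor [N^-1] restores the normalization. *)
Lemma rowdist_corner_le j (f : arr R ('I_N * 'I_N)) : (j < N)%N ->
 N%:R^-1 * rowdist (corner j f) ord_max <= dist2 (pre (hrown f) j) (hrown f j).
Proof.
move=> jN; pose E : 'M[C]_(N, j.+1) := \matrix_(i, l) (i == inord l)%:R.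
have lej (l : 'I_j.+1) : (l < N)%N by apply: leq_trans (ltn_ord l) _.
have hE (h : 'rV[C]_N) l : (h *m E) 0 l = h 0 (inord l).
 rewrite mxE (bigD1 (inord l))//= mxE eqxx mulr1 big1 ?addr0// => i il.
 by rewrite mxE (negbTE il) mulr0.
have EE : E^t* *m E = 1%:M.
 apply/matrixP => l l'; rewrite mxE (bigD1 (inord l))//= big1 ?addr0 => [|i il].
  rewrite adjE !mxE eqxx cj1 mul1r; congr (nat_of_bool _)%:R.
  by apply/eqP/eqP => [/(congr1 val)/=|->//]; rewrite !inordK// => /val_inj.
 by rewrite adjE !mxE (negbTE il) cj0 mul0r.
apply: le_trans (dist2_isometry (pre (hrown f) j) (hrown f j) EE).
have rE k : (k < j.+1)%N -> hrown f k *m E = a *: rowv (corner j f) (inord k).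
 move=> kj; apply/rowP => l; rewrite hE hrownE hrow_shift !mxE /corner /= inordK//.
set L := [seq rowv (corner j f) (inord k) | k <- rev (iota 0 j)].
have -> : [seq h *m E | h <- pre (hrown f) j] = [seq a *: g | g <- L].
 rewrite pre_rev map_rev -!map_rev -!map_comp; apply/eq_in_map => k /=.
 by rewrite mem_rev mem_iota add0n => kj; rewrite rE// ltnS ltnW.
rewrite rE// dist2Z sa; apply: ler_wpM2l; first by rewrite invr_ge0.
have a0 : a != 0 by rewrite /a -[0]/(0%:C) (inj_eq (@complexI R)) invr_eq0 gt_eqF.
apply: le_trans (dist2_scale _ _ a0); rewrite /rowdist.
have -> : (inord j : 'I_j.+1) = ord_max by apply: val_inj; rewrite /= inordK.
apply: dist2_subset => g /mapP[k]; rewrite mem_rev mem_iota add0n /= => kj ->.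
apply/mapP; exists (Ordinal kj); first by rewrite mem_enum.
by congr rowv; apply: val_inj; rewrite /= inordK ?ltnS 1?ltnW// /bump leqNgt kj.
Qed.

Lemma row_least_distance (c D : R) (b j : nat) : (j < N)%N -> (N <= 2 * j.+1)%N ->
 (forall ij, (\int[P]_w (sqnorm (X w ij))%:E = 1)%E) ->
 (forall i k, sqnorm (F i k) <= c * N%:R) ->
 64 * (2 * N%:R ^+ 4 + 2 * c * N%:R ^+ 2) <= N%:R ^+ 6 ->
 (forall M (Y : T -> arr R ('I_M.+1 * 'I_M.+1)) r0,
  matrix_class P Y kap p (M.+1%:R ^+ 6) (1 * M.+1%:R ^- 4) ->
  (P [set w | (rowdist (Y w) r0 <= M.+1%:R ^- b)%R] <= (D / sqrt M.+1%:R ^+ 3)%:E)%E) ->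
 (P [set w | (dist2 (pre (hrown (X w)) j) (hrown (X w) j) <= N%:R ^- b.+1)%R] <=
  (D / sqrt j.+1%:R ^+ 3)%:E)%E.
Proof.
move=> jN Nj hX hF hN hD; have cl := corner_class jN Nj hX hF hN.
apply: le_trans (hD _ _ ord_max cl); apply: le_measure; rewrite ?inE.
- apply: meas_set_le => //; under eq_fun do rewrite pre_rev -map_rev.
 exact: meas_dist_rows.
- by apply: meas_rowdist_le; case: cl.
- move=> w /= h; have := le_trans (rowdist_corner_le (X w) jN) h.
 rewrite ler_pdivrMl ?ltr0n// exprS invfM mulVKf ?pnatr_eq0//.
 move=> h'; apply: le_trans h' _; rewrite lef_pV2 ?posrE ?exprn_gt0 ?ltr0n//.
 by apply: lerXn2r; rewrite ?nnegrE// ler_nat.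
Qed.

End row_distances.

(** * The event on which the regularization can be removed *)

Section good_event.
Context {R : realType} {d} {T : measurableType d} (P : probability T R).
Local Notation C := R[i].

Lemma prod1D_ge (I : Type) (s : seq I) (a : I -> R) : (forall i, 0 <= a i) ->
 1 + \sum_(i <- s) a i <= \prod_(i <- s) (1 + a i).
Proof.
move=> a0; elim: s => [|i s ih]; first by rewrite !big_nil addr0.
rewrite !big_cons; apply: (@le_trans _ _ ((1 + a i) * (1 + \sum_(j <- s) a j))).
 have : 0 <= a i * \sum_(j <- s) a j by rewrite mulr_ge0// sumr_ge0.
 by move: (\sum_(j <- s) a j) => q; nra.
by apply: ler_wpM2l => //; rewrite addr_ge0.
Qed.

Variables (n : nat) (kap p : R) (F : 'M[C]_n.+1) (X : T -> arr R ('I_n.+1 * 'I_n.+1)).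
Hypotheses (k0 : 0 < kap) (p0 : 0 < p) (p1 : p <= 1).
Hypotheses (mX : mble X) (iX : indep P X) (aX : anticonc P X kap p).
Hypothesis hX : forall ij, (\int[P]_w (sqnorm (X w ij))%:E = 1)%E.
Local Notation N := n.+1.
Local Notation NR := (N%:R : R).
Let N0 : 0 < NR. Proof. by rewrite ltr0n. Qed.
Variables (m0 q t b : nat) (D C0 : R).
Hypotheses (mq : (m0 + q = N)%N) (tq : (t <= q)%N) (tN : (2 * t <= N)%N) (D0 : 0 <= D).
Hypothesis hF : forall i k, sqnorm (F i k) <= C0 * NR.
Hypothesis hN : 64 * (2 * NR ^+ 4 + 2 * C0 * NR ^+ 2) <= NR ^+ 6.
Hypothesis hD : forall M (Y : T -> arr R ('I_M.+1 * 'I_M.+1)) r0,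
  matrix_class P Y kap p (M.+1%:R ^+ 6) (1 * M.+1%:R ^- 4) ->
  (P [set w | (rowdist (Y w) r0 <= M.+1%:R ^- b)%R] <= (D / sqrt M.+1%:R ^+ 3)%:E)%E.
Let c := p * kap / 12.

(** A product over entries, so that its mean factors by independence and is at most [expR (2 * q)];
    it dominates the product, over the same rows, of [1] plus [2 / N] times the squared norm. *)
Definition row_growth (f : arr R ('I_N * 'I_N)) : R :=
 \prod_(m0 <= i < N) \prod_(k < N) (1 + 2 * sqnorm (f (inord i, k)) / NR).

Let pairs := [seq (i, k) | i <- [seq inord i : 'I_N | i <- iota m0 q], k <- enum 'I_N].

Let row_growthE f : row_growth f = \prod_(ij <- pairs) (1 + 2 * sqnorm (f ij) / NR).
Proof.
have e : (N - m0)%N = q by lia.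
rewrite /row_growth /pairs big_allpairs big_map /index_iota e.
by apply: eq_bigr => i _; rewrite big_enum.
Qed.

Lemma row_growth_prob :
 (P [set w | expR (3 * q%:R) < row_growth (X w)]%R <= (expR (- q%:R))%:E)%E.
Proof.
have mXij ij : mble (fun w => X w ij) by move: ij; apply/meas_arrP.
pose phi (ij : 'I_N * 'I_N) (z : C) := 1 + 2 * sqnorm z / NR.
have phi0 ij z : 0 <= phi ij z by rewrite addr_ge0// divr_ge0 ?mulr_ge0 ?sqnorm_ge0.
have mphi ij : mble (phi ij).
 apply: mbleD => //; apply: mbleM => //; apply: mbleM => //.
 exact: meas_sqnorm.
have mrg : mble (fun w => row_growth (X w)).
 under eq_fun do rewrite row_growthE; apply: measurable_prod => ij _.
 exact: (mcomp (mphi ij) (mXij ij)).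
apply: (@le_trans _ _ (\int[P]_w (expR (- (3 * q%:R)) * row_growth (X w))%:E)%E).
 apply: prob_le_integral.
 - by apply: meas_set_bool; exact: mble_ltr.
 - exact: mbleM.
 - by move=> w; rewrite mulr_ge0 ?expR_ge0// row_growthE prodr_ge0// => ij _; exact: phi0.
 - by move=> w /= h; rewrite expRN ler_pdivlMl ?expR_gt0// mulr1 ltW.
rewrite int_Zl ?expR_ge0//; last first.
 by move=> w; rewrite row_growthE prodr_ge0// => ij _; exact: phi0.
under eq_integral do rewrite row_growthE.
have up : uniq pairs.
 apply: allpairs_uniq; [|exact: enum_uniq|by move=> [x y] [x' y'] _ _ [-> ->]].
 rewrite map_inj_in_uniq ?iota_uniq// => i j; rewrite !mem_iota => hi hj /(congr1 val) /=.
 by rewrite !inordK//; lia.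
rewrite (indep_integral_prod mX iX up mphi phi0).
have e1 ij : (\int[P]_w (phi ij (X w ij))%:E = (1 + 2 / NR)%:E)%E.
 rewrite int_D//; last 2 first.
 - by apply: mbleM => //; apply: mbleM => //; exact: meas_sqnorm.
 - by move=> w; rewrite divr_ge0 ?mulr_ge0 ?sqnorm_ge0.
 rewrite int_cst int_Zr ?invr_ge0//; last 2 first.
 - by apply: mbleM => //; exact: meas_sqnorm.
 - by move=> w; rewrite mulr_ge0 ?sqnorm_ge0.
 rewrite int_Zl//; last 2 first.
 - exact: meas_sqnorm.
 - by move=> w; exact: sqnorm_ge0.
 by rewrite hX mule1 -EFinM -EFinD.
rewrite (eq_bigr (fun=> (1 + 2 / NR)%:E)); last by move=> ij _; exact: e1.
rewrite prodEFin -EFinM lee_fin big_const_seq count_predT iter_mulr_1.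
have -> : size pairs = (q * N)%N by rewrite size_allpairs size_map size_iota size_enum_ord.
apply: (@le_trans _ _ (expR (- (3 * q%:R)) * expR (2 / NR) ^+ (q * N))).
 apply: ler_wpM2l; first exact: expR_ge0.
 by apply: lerXn2r; rewrite ?nnegrE ?expR_ge0 ?addr_ge0 ?divr_ge0 ?expR_ge1Dx.
rewrite -expRM_natl -expRD ler_expR natrM le_eqVlt; apply/orP; left; apply/eqP.
have fe (x y : R) : y != 0 -> - (3 * x) + x * y * (2 / y) = - x by move=> y0; field.
by apply: fe; rewrite gt_eqF.
Qed.

(** Down to codimension [t] the small ball scale, quadratic in the codimension, fails with
    exponentially small probability; for the last [t] rows that probability is no longer small and
    the polynomial bound takes over. *)
Definition row_bound k : R :=
 if (k < N - t)%N then c * ((N - k)%:R / NR) ^+ 2 else NR ^- b.+1.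

Let d0 := c * (q%:R / NR) ^+ 2.

Definition far_rows (f : arr R ('I_N * 'I_N)) :=
 [forall k : 'I_N, if (k < m0)%N
  then d0 < dist2 [seq hrown F f j | j <- iota 0 m0 & j != k :> nat] (hrown F f k)
  else row_bound k < dist2 (pre (hrown F f) k) (hrown F f k)] &&
 (row_growth f <= expR (3 * q%:R)).

(** Union bound. Every row before the last [t] faces a span of codimension at least [t], the first
    [m0] ones because [t <= q]. *)
Lemma far_rows_prob : (0 < q)%N -> mble (fun w => ~~ far_rows (X w)) /\
 (P [set w | ~~ far_rows (X w)] <=
 (NR * expR (- (p / 6 * t%:R)) + t%:R * (3 * D / (NR * sqrt NR)) + expR (- q%:R))%:E)%E.
Proof.
move=> q0.
pose h1 (k : 'I_N) w := dist2 [seq hrown F (X w) j | j <- iota 0 m0 & j != k :> nat] (hrown F (X w) k).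
pose h2 (k : 'I_N) w := dist2 (pre (hrown F (X w)) k) (hrown F (X w) k).
have mh1 k : mble (h1 k) by exact: meas_dist_rows.
have mh2 k : mble (h2 k).
 by rewrite /h2; under eq_fun do rewrite pre_rev -map_rev; exact: meas_dist_rows.
have mXij ij : mble (fun w => X w ij) by move: ij; apply/meas_arrP.
have mrg : mble (fun w => row_growth (X w)).
 under eq_fun do rewrite row_growthE; apply: measurable_prod => ij _.
 apply: mbleD => //; apply: mbleM => //; apply: mbleM => //.
 exact: meas_sqnorm.
pose bi (k : option 'I_N) w := if k is Some k then
  (if (k < m0)%N then h1 k w <= d0 else h2 k w <= row_bound k) else expR (3 * q%:R) < row_growth (X w).
pose ci (k : option 'I_N) : R := if k is Some k then
  (if (k < N - t)%N then expR (- (p / 6 * t%:R)) else 3 * D / (NR * sqrt NR)) else expR (- q%:R).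
have mbi k : mble (bi k).
 case: k => [k|]; last exact: mble_ltr.
 by rewrite /bi; have [_|_] := boolP (k < m0)%N; exact: mble_ler.
have bE w : ~~ far_rows (X w) = [exists k, bi k w].
 rewrite /far_rows negb_and negb_forall -ltNge; apply/orP/existsP.
  move=> [/existsP[k hk]|hk]; last by exists None.
  by exists (Some k); move: hk; rewrite /bi /h1 /h2; case: ifP => _; rewrite -leNgt.
 move=> [[k|] hk]; [left|by right]; apply/existsP; exists k; move: hk.
 by rewrite /bi /h1 /h2; case: ifP => _; rewrite -leNgt.
have mb : mble (fun w => [exists k, bi k w]).
 have e w : [exists k, bi k w] = (0 < \sum_k (bi k w)%:R :> R).
  rewrite lt_def sumr_ge0// andbT psumr_neq0//; apply/existsP/hasP => [[k hk]|[k _ hk]].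
   by exists k; rewrite ?mem_index_enum//= hk ltr01.
  by exists k; move: hk => /=; case: (bi k w) => //; rewrite ltxx.
 rewrite (_ : (fun w => _) = (fun w => 0 < \sum_k (bi k w)%:R :> R)); last exact/funext.
 apply: mble_ltr => //; apply: measurable_sum => k; exact: meas_natr_bool.
have hbi k : (P [set w | bi k w] <= (ci k)%:E)%E.
 case: k => [k|]; last exact: row_growth_prob.
 rewrite /bi /ci; have kN := ltn_ord k; have [km|mk] := ltnP k m0.
  rewrite (_ : (k < N - t)%N); last by apply: leq_trans km _; lia.
  apply: (@le_trans _ _ (expR (- (p / 6 * q%:R)))%:E).
   apply: (row_small_ball F k0 p0 mX iX aX (i := k) (S := [seq j <- iota 0 m0 | j != k :> nat])) => //.
   - by rewrite mem_filter eqxx.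
   - by apply/allP => j; rewrite mem_filter mem_iota => /andP[_ hj]; rewrite -[ltn _ _]/(j < N)%N; lia.
   - have := size_subseq (filter_subseq (fun j => j != k :> nat) (iota 0 m0)).
    by rewrite size_iota => hs; apply: leq_trans (leq_add hs (leqnn q)) _; rewrite mq.
  rewrite lee_fin ler_expR lerN2; apply: ler_wpM2l; first by rewrite divr_ge0// ltW.
  by rewrite ler_nat.
 rewrite /row_bound; have [kt|tk] := ltnP k (N - t).
  apply: (@le_trans _ _ (expR (- (p / 6 * (N - k)%:R)))%:E).
   rewrite /h2; have e w : pre (hrown F (X w)) k = [seq hrown F (X w) j | j <- rev (iota 0 k)].
    by rewrite map_rev pre_rev.
   rewrite (_ : [set w | _] = [set w | dist2 [seq hrown F (X w) j | j <- rev (iota 0 k)] (hrown F (X w) k)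
     <= p * kap / 12 * ((N - k)%:R / NR) ^+ 2]); last by apply/funext => w /=; rewrite e.
   apply: (row_small_ball F k0 p0 mX iX aX) => //.
   - by rewrite mem_rev mem_iota ltnn andbF.
   - by apply/allP => j; rewrite mem_rev mem_iota => hj; rewrite -[ltn _ _]/(j < N)%N; lia.
   - by rewrite size_rev size_iota; lia.
  rewrite lee_fin ler_expR lerN2; apply: ler_wpM2l; first by rewrite divr_ge0// ltW.
  by rewrite ler_nat; lia.
 have kN2 : (N <= 2 * k.+1)%N by lia.
 apply: le_trans (row_least_distance mX iX aX kN kN2 hX hF hN hD) _.
 have sM : 0 < sqrt k.+1%:R :> R by rewrite sqrtr_gt0.
 have sN : 0 < sqrt NR by rewrite sqrtr_gt0.
 rewrite lee_fin ler_pdivrMr ?exprn_gt0// mulrAC ler_pdivlMr ?mulr_gt0//.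
 rewrite [3 * D]mulrC -mulrA; apply: ler_wpM2l => //.
 have NM : NR <= 2 * k.+1%:R by rewrite -natrM ler_nat.
 have s2 : sqrt k.+1%:R ^+ 2 = k.+1%:R :> R by rewrite sqr_sqrtr.
 have S2 : sqrt NR ^+ 2 = NR by rewrite sqr_sqrtr// ltW.
 rewrite -S2 -s2 in NM; rewrite -[X in X * _ <= _]S2; move: (sqrt NR) (sqrt k.+1%:R : R) sM sN NM => x y y0 x0 xy.
 (* [sqrt 2 <= 3 / 2] turns [N <= 2 * k.+1] into [N ^ (3/2) <= 3 * k.+1 ^ (3/2)]. *)
 have x3 : x <= 3 / 2 * y by nra.
 have : x ^+ 2 * x <= 2 * y ^+ 2 * (3 / 2 * y) by apply: ler_pM => //; rewrite ltW// exprn_gt0.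
 by rewrite [y ^+ 3]exprSr; lra.
split; first by rewrite (_ : (fun w => _) = (fun w => [exists k, bi k w]))//; exact/funext.
rewrite (_ : [set w | _] = [set w | [exists k, bi k w]]); last by apply/funext => w /=; rewrite bE.
apply: (le_trans (prob_union_le (c := ci) mb mbi _ hbi)); first by move=> w /existsP.
have S0 : 0 <= 3 * D / (NR * sqrt NR) by rewrite divr_ge0 ?mulr_ge0 ?sqrtr_ge0// ltW.
rewrite lee_fin (bigD1 None)//= addrC lerD2r.
have -> : \sum_(i | i != None) ci i = \sum_(k : 'I_N) ci (Some k).
 rewrite (reindex_omap Some id) => [|[k|]//]; by apply: eq_bigl => k; rewrite eqxx.
rewrite /ci; apply: (@le_trans _ _ (\sum_(k < N) (expR (- (p / 6 * t%:R)) +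
  (if (N - t <= k)%N then 3 * D / (NR * sqrt NR) else 0)))).
 apply: ler_sum => k _; have [_|_] := ltnP k (N - t); first by rewrite addr0.
 by rewrite lerDr expR_ge0.
rewrite big_split /= sumr_const card_ord -[X in X + _ <= _]mulr_natl lerD2l.
rewrite -big_mkcond /= -(big_mkord (fun k => N - t <= k)%N (fun=> 3 * D / (NR * sqrt NR))).
rewrite (big_cat_nat (n := N - t)) ?leq_subr//= big_nat_cond big_pred0 ?add0r; last first.
 by move=> k; lia.
rewrite big_nat_cond (eq_bigl (fun k => (N - t <= k < N)%N)); last by move=> k; lia.
by rewrite -big_nat big_const_nat iter_addr addr0 -[leLHS]mulr_natl subKn//; lia.
Qed.

End good_event.

Section natural_number_facts.

Lemma reflected_index m q N i : (m + q = N -> i < q ->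
 N - (m + N - (i + m).+1) = i.+1)%N.
Proof. lia. Qed.

Lemma complement_le m q N t : (m + q = N -> t <= q ->
 [/\ m <= N, N - m = q, m <= N - t & t <= N])%N.
Proof. by move=> *; split; lia. Qed.

End natural_number_facts.

(** * Cost of removing the regularization *)

Section regularization_cost.
Context {R : realType}.
Local Notation C := R[i].

Lemma inv_sqrt_sum (q : nat) :
 \sum_(0 <= i < q) (sqrt i.+1%:R)^-1 <= 2 * sqrt q%:R :> R.
Proof.
elim: q => [|q ih]; first by rewrite big_geq// mulr_ge0// sqrtr_ge0.
rewrite big_nat_recr//=; apply: le_trans (lerD ih (lexx _)) _.
have x0 := sqrtr_ge0 (q%:R : R); have y0 : 0 < sqrt q.+1%:R :> R by rewrite sqrtr_gt0.
have x2 : sqrt q%:R ^+ 2 = q%:R :> R by rewrite sqr_sqrtr.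
have y2 : sqrt q.+1%:R ^+ 2 = q%:R + 1 :> R by rewrite sqr_sqrtr// -natr1.
rewrite -x2 in y2; move: (sqrt q%:R) (sqrt q.+1%:R : R) x0 y0 y2 => x y x0 y0 y2.
rewrite -(ler_pM2r y0) mulrDl mulVf ?gt_eqF//; nra.
Qed.

(** The slope in [y] is made as small as desired at the price of the constant [2 al]: the constant
    is paid by [q] rows only, the slope by the total squared norm of [F]. *)
Lemma oneD_le_expR (al y : R) : 0 < al -> 0 <= y -> 1 + 2 * y <= expR (2 * al + 2 * y / al).
Proof.
move=> a0 y0; set z := al + y / al; have z0 : 0 <= z by rewrite addr_ge0 ?divr_ge0// ltW.
have zy : 4 * y <= z ^+ 2.
 have -> : z ^+ 2 = 4 * y + (al - y / al) ^+ 2 by rewrite /z; field; rewrite gt_eqF.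
 by rewrite lerDl sqr_ge0.
have -> : 2 * al + 2 * y / al = z + z by rewrite /z; field; rewrite gt_eqF.
rewrite expRD -expr2; apply: (@le_trans _ _ ((1 + z) ^+ 2)); first by clearbody z; nra.
by apply: lerXn2r; rewrite ?nnegrE ?expR_ge0 ?expR_ge1Dx// addr_ge0.
Qed.

(** A crude bound of [2 ln x] by [4 sqrt x], convenient because its sum over the codimensions is of
    order [sqrt (N q)]. *)
Lemma sqr_le_expR_sqrt (x : R) : 0 <= x -> x ^+ 2 <= expR (4 * sqrt x).
Proof.
move=> x0; have s0 := sqrtr_ge0 x; rewrite -{1}(sqr_sqrtr x0) -exprM -[4 * _]/(4%:R * _) expRM_natl.
apply: lerXn2r; rewrite ?nnegrE ?expR_ge0//.
by apply: le_trans (expR_ge1Dx _); rewrite lerDr.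
Qed.

Variables (n : nat) (kap p : R) (F : 'M[C]_n.+1).
Hypotheses (k0 : 0 < kap) (k1 : kap <= 1) (p0 : 0 < p) (p1 : p <= 1).
Local Notation N := n.+1.
Local Notation NR := (N%:R : R).
Let N0 : 0 < NR. Proof. by rewrite ltr0n. Qed.
Variables (m0 q t b : nat) (C0 : R).
Hypotheses (mq : (m0 + q = N)%N) (tq : (t <= q)%N) (q0 : (0 < q)%N).
Hypothesis hF : \sum_(i < N) sqn (row i F) <= C0 * NR.
Let nat_facts := complement_le mq tq.
Let c := p * kap / 12.
Let c0 : 0 < c. Proof. by rewrite divr_gt0// mulr_gt0. Qed.
Let c1 : c <= 1. Proof. by rewrite /c; have := mulr_ile1 (ltW p0) (ltW k0) p1 k1; lra. Qed.

(** The terms in order: dropping the weights of the first rows; growth of the entries and constants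
    on the last [q] rows; the norm of [F]; the codimensions; the polynomial bound on the last [t]
    rows. *)
Lemma ln_regdet_le (eta al : R) (f : arr R ('I_N * 'I_N)) : 0 < eta <= 1 -> 0 < al ->
 far_rows kap p F m0 q t b f ->
 0 < sqnorm (\det (hmat F f)) /\
 ln (regdet eta F f) - ln (sqnorm (\det (hmat F f))) <=
  NR * (eta / (c * (q%:R / NR) ^+ 2)) + q%:R * (3 + 2 * al + ln c^-1) + 2 * C0 * NR / al +
  8 * sqrt (NR * q%:R) + t%:R * (b.+1%:R * ln NR).
Proof.
have [mN mNq mNt tN] := nat_facts.
move=> /andP[e0 e1] a0 /andP[/forallP hr hg].
pose d0 := c * (q%:R / NR) ^+ 2.
have d00 : 0 < d0 by rewrite mulr_gt0// exprn_gt0// divr_gt0 ?ltr0n.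
pose l := row_bound n kap p t b.
have l0 k : (k < N)%N -> 0 < l k.
 move=> kN; rewrite /l /row_bound; case: ifP => _; last by rewrite invr_gt0 exprn_gt0.
 by rewrite mulr_gt0// exprn_gt0// divr_gt0// ltr0n subn_gt0.
have h1 k : (k < m0)%N -> d0 <= dist2 [seq hrown F f j | j <- iota 0 m0 & j != k] (hrown F f k).
 move=> km; have kN : (k < N)%N by exact: leq_trans km mN.
 by have := hr (Ordinal kN); rewrite /= km => /ltW.
have h2 k : (m0 <= k < N)%N -> 0 < l k <= dist2 (pre (hrown F f) k) (hrown F f k).
 move=> /andP[mk kN]; have := hr (Ordinal kN); rewrite /= ltnNge mk /= => /ltW ->.
 by rewrite l0.
have [hW hdet] := regdet_le_det (l := l) (ltW e0) d00 mN h1 h2; split => //.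
set dt := sqnorm _ in hW hdet *.
pose x k := 2 * sqn (rowv f (inord k : 'I_N)) / NR; pose y k := sqn (row (inord k : 'I_N) F).
have x0 k : 0 <= x k by rewrite divr_ge0 ?mulr_ge0 ?sqn_ge0.
have y0 k : 0 <= y k by exact: sqn_ge0.
pose E k := 2 * al + 2 * y k / al + ln c^-1 + 4 * sqrt (NR / (N - k)%:R) + (if (N - t <= k)%N then b.+1%:R * ln NR else 0).
have lc0 : 0 <= ln c^-1 by rewrite ln_ge0// invf_ge1.
have lN0 : 0 <= ln NR by rewrite ln_ge0// ler1n.
have hk k : (m0 <= k < N)%N -> (eta + sqn (hrown F f k)) / l k <= (1 + x k) * expR (E k).
 move=> /andP[mk kN].
 have ha : eta + sqn (hrown F f k) <= (1 + x k) * (1 + 2 * y k).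
  have : sqn (hrown F f k) <= x k + 2 * y k.
   rewrite hrownE /hrow; apply: le_trans (sqnD_le _ _) _; rewrite lerD2r sqnZ sqnorm_real exprVn sqr_sqrtr; last exact: ltW.
   by rewrite /x mulrCA mulrC.
  have := x0 k; have := y0 k; move: (sqn _) (x k) (y k) => s x' y' y'0 x'0 hs; nra.
 have hl : (l k)^-1 <= expR (ln c^-1 + 4 * sqrt (NR / (N - k)%:R) + (if (N - t <= k)%N then b.+1%:R * ln NR else 0)).
  have sq0 := sqrtr_ge0 (NR / (N - k)%:R).
  rewrite /l /row_bound; have [kt|tk] := ltnP k (N - t).
   rewrite addr0 expRD lnK ?posrE ?invr_gt0// invfM; apply: ler_wpM2l; first by rewrite invr_ge0 ltW.
   by rewrite -exprVn invf_div; apply: sqr_le_expR_sqrt; rewrite divr_ge0.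
  rewrite invrK expRD; apply: (@le_trans _ _ (1 * expR (b.+1%:R * ln NR))).
   by rewrite mul1r expRM_natl lnK.
  apply: ler_wpM2r; first exact: expR_ge0.
  by rewrite -[leLHS]expR0 ler_expR addr_ge0// mulr_ge0.
 apply: (@le_trans _ _ ((1 + x k) * (1 + 2 * y k) / l k)).
  by apply: ler_wpM2r => //; rewrite invr_ge0 ltW// l0.
 rewrite -mulrA; apply: ler_wpM2l; first by rewrite addr_ge0.
 rewrite /E -!addrA [2 * al + (_ + _)]addrA expRD.
 apply: ler_pM; rewrite ?invr_ge0 ?addr_ge0 ?mulr_ge0//; last by rewrite addrA.
  by rewrite ltW// l0.
 by apply: oneD_le_expR.
have hx : \prod_(m0 <= k < N) (1 + x k) <= expR (3 * q%:R).
 apply: le_trans hg; rewrite /row_growth; apply: ler_prod => k _; rewrite addr_ge0//=.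
 apply: le_trans (prod1D_ge _ _); last by move=> i; rewrite divr_ge0 ?mulr_ge0 ?sqnorm_ge0.
 rewrite lerD2l /x /sqn mulr_sumr mulr_suml; apply: ler_sum => j _; rewrite mxE//.
have hE : \sum_(m0 <= k < N) E k <= q%:R * (2 * al + ln c^-1) + 2 * C0 * NR / al +
  8 * sqrt (NR * q%:R) + t%:R * (b.+1%:R * ln NR).
 have -> : \sum_(m0 <= k < N) E k = \sum_(m0 <= k < N) (2 * al + ln c^-1) +
   \sum_(m0 <= k < N) (2 * y k / al) + \sum_(m0 <= k < N) (4 * sqrt (NR / (N - k)%:R)) +
   \sum_(m0 <= k < N) (if (N - t <= k)%N then b.+1%:R * ln NR else 0).
  by rewrite -!big_split /=; apply: eq_bigr => k _; congr (_ + _ + _); exact: addrAC.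
 rewrite sumr_const_nat mNq -[X in X + _ + _ + _ <= _]mulr_natl.
 have hy : \sum_(m0 <= k < N) (2 * y k / al) <= 2 * C0 * NR / al.
  rewrite -mulr_suml -mulr_sumr; apply: ler_wpM2r; first by rewrite invr_ge0 ltW.
  rewrite -mulrA; apply: ler_wpM2l => //; apply: le_trans hF.
  rewrite (eq_bigr (fun i : 'I_N => y i)); last by move=> i _; rewrite /y inord_val.
  rewrite -(big_mkord xpredT y) [leRHS](big_cat_nat (n := m0))//= lerDr; apply: sumr_ge0 => k _; exact: y0.
 have hs : \sum_(m0 <= k < N) (4 * sqrt (NR / (N - k)%:R)) <= 8 * sqrt (NR * q%:R).
  rewrite -mulr_sumr (_ : 8 = 4 * 2); last by ring.
  rewrite -mulrA; apply: ler_wpM2l => //; rewrite (sqrtrM _ (ltW N0)).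
  rewrite big_nat_rev /= -{1}[m0]add0n big_addn mNq.
  apply: (@le_trans _ _ (sqrt NR * \sum_(0 <= i < q) (sqrt i.+1%:R)^-1)).
   rewrite mulr_sumr big_nat [leRHS]big_nat; apply: ler_sum => i /andP[_ iq].
   by rewrite (sqrtrM _ (ltW N0)) sqrtrV// (reflected_index mq iq).
  rewrite mulrCA; apply: ler_wpM2l; [exact: sqrtr_ge0|exact: inv_sqrt_sum].
 have ht : \sum_(m0 <= k < N) (if (N - t <= k)%N then b.+1%:R * ln NR else 0) <= t%:R * (b.+1%:R * ln NR).
  rewrite (big_cat_nat (n := N - t)) ?leq_subr//=.
  rewrite big_nat big1 ?add0r; last by move=> k /andP[_ kt]; rewrite leqNgt kt.
  rewrite big_nat (eq_bigr (fun=> b.+1%:R * ln NR)); last by move=> k /andP[-> _].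
  by rewrite -big_nat sumr_const_nat -[leLHS]mulr_natl subKn.
 rewrite mulrDr; move: hy hs ht; lra.
have m0N : (m0%:R : R) <= NR by rewrite ler_nat.
have hA : (1 + eta / d0) ^+ m0 <= expR (NR * (eta / d0)).
 apply: (@le_trans _ _ (expR (eta / d0) ^+ m0)).
  by apply: lerXn2r; rewrite ?nnegrE ?expR_ge0 ?addr_ge0 ?divr_ge0 ?expR_ge1Dx// ltW.
 by rewrite -expRM_natl ler_expR; apply: ler_wpM2r => //; rewrite divr_ge0// ltW.
have hP : \prod_(m0 <= k < N) ((eta + sqn (hrown F f k)) / l k) <=
  expR (3 * q%:R) * expR (\sum_(m0 <= k < N) E k).
 apply: (@le_trans _ _ (\prod_(m0 <= k < N) ((1 + x k) * expR (E k)))).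
  rewrite big_nat [leRHS]big_nat; apply: ler_prod => k mk; rewrite hk// andbT.
  by case/andP: mk => _ kN; rewrite divr_ge0 ?addr_ge0 ?sqn_ge0 ?ltW// l0.
 rewrite big_split /= -expR_sum; apply: ler_wpM2r => //; exact: expR_ge0.
rewrite -lnV ?posrE// -lnM ?posrE ?invr_gt0 ?regdet_gt0//.
rewrite -[leRHS]expRK ler_ln ?posrE ?expR_gt0//; last by rewrite mulr_gt0 ?invr_gt0 ?regdet_gt0.
rewrite ler_pdivrMr//; apply: le_trans hW _; rewrite -mulrA [leRHS]mulrC; apply: ler_wpM2l; first exact: ltW.
apply: (@le_trans _ _ (expR (NR * (eta / d0)) * (expR (3 * q%:R) * expR (\sum_(m0 <= k < N) E k)))).
 apply: ler_pM => //.
  by rewrite exprn_ge0// addr_ge0// divr_ge0// ltW.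
 rewrite big_nat; apply: prodr_ge0 => k /andP[_ kN].
 by rewrite divr_ge0 ?addr_ge0 ?sqn_ge0 ?ltW// l0.
rewrite -!expRD ler_expR -/d0; move: hE; move: (\sum_(m0 <= k < N) E k) => s; lra.
Qed.

End regularization_cost.

(** * Choice of the parameters *)

Section parameter_choice.
Context {R : realType}.

Lemma ln_le_id (x : R) : 0 < x -> ln x <= x.
Proof. by move=> x0; rewrite -ler_expR lnK ?posrE//; apply: le_trans (expR_ge1Dx _); rewrite lerDr. Qed.

Lemma quartic_root (N S0 : R) : 0 < N -> 0 <= S0 -> S0 ^+ 4 <= N ->
 [/\ sqrt (sqrt N) ^+ 4 = N, 0 < sqrt (sqrt N), S0 <= sqrt (sqrt N) &
  ln N <= 4 * sqrt (sqrt N)].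
Proof.
move=> N0 S0p hS; set s := sqrt (sqrt N).
have s0 : 0 < s by rewrite !sqrtr_gt0.
have s4 : s ^+ 4 = N by rewrite (exprM s 2 2) sqr_sqrtr ?sqrtr_ge0// sqr_sqrtr// ltW.
split => //; first by rewrite -(ler_pXn2r (n := 4)) ?nnegrE// ?s4// ltW.
by rewrite -s4 lnXn// -[leLHS]mulr_natl; apply: ler_wpM2l => //; exact: ln_le_id.
Qed.

(** For [q] of order [u ^ 2 N], weight [c u ^ 5] and slope parameter [u^-1], every term but the last
    is at most a multiple of [u N]; the last one takes at most half of the target, [t] and [ln N]
    being at most of order [N ^ (1/4)]. *)
Lemma cost_bound (N u q c C0 L t b1 dl s K1 lnN : R) :
 0 < N -> 0 < u -> u <= 1 / 2 -> 0 < c -> 0 <= L -> 0 <= C0 ->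
 u * (2 * (23 + 2 * C0 + 2 * L)) <= dl -> u ^+ 2 * N <= q -> q <= 2 * u ^+ 2 * N ->
 s ^+ 4 = N -> 1 <= s -> 0 <= t -> t <= K1 * s -> 0 <= lnN -> lnN <= 4 * s -> 0 <= b1 ->
 8 * K1 * b1 <= dl * s ^+ 2 ->
 N * (c * u ^+ 5 / (c * (q / N) ^+ 2)) + q * (3 + 2 * u^-1 + L) + 2 * C0 * N / u^-1 +
  8 * sqrt (N * q) + t * (b1 * lnN) <= dl * N.
Proof.
move=> N0 u0 u1 c0 L0 C00 hu hq1 hq2 s4 s1 t0 ht l0 hl b0 hb.
have q0 : 0 < q by apply: lt_le_trans hq1; rewrite mulr_gt0// exprn_gt0.
have h1 : N * (c * u ^+ 5 / (c * (q / N) ^+ 2)) <= u * N.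
 have qN : u ^+ 2 <= q / N by rewrite ler_pdivlMr.
 have qN2 : u ^+ 4 <= (q / N) ^+ 2.
  by rewrite (exprM u 2 2); apply: lerXn2r => //; rewrite nnegrE ?exprn_ge0 ?divr_ge0// ltW.
 rewrite [leRHS]mulrC; apply: ler_wpM2l; first exact: ltW.
 have u40 : 0 < (q / N) ^+ 2 by rewrite exprn_gt0// divr_gt0.
 rewrite ler_pdivrMr; last exact: mulr_gt0.
 rewrite [leRHS]mulrCA; apply: ler_wpM2l; first exact: ltW.
 by rewrite exprS; apply: ler_wpM2l => //; exact: ltW.
have h2 : q * (3 + 2 * u^-1 + L) <= u * N * (10 + 2 * L).
 apply: (@le_trans _ _ (2 * u ^+ 2 * N * (3 + 2 * u^-1 + L))).
  by apply: ler_wpM2r => //; rewrite !addr_ge0// mulr_ge0// invr_ge0 ltW.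
 have -> : 2 * u ^+ 2 * N * (3 + 2 * u^-1 + L) = u * N * (u * (6 + 2 * L) + 4).
  by field; rewrite gt_eqF.
 apply: ler_wpM2l; first by rewrite mulr_ge0// ltW.
 have : u * (6 + 2 * L) <= 1 * (6 + 2 * L) by apply: ler_wpM2r; lra.
 by lra.
have h3 : 2 * C0 * N / u^-1 = u * N * (2 * C0) by rewrite invrK; ring.
have h4 : 8 * sqrt (N * q) <= u * N * 12.
 have uN : 0 <= 3 / 2 * (u * N) by rewrite mulr_ge0 ?divr_ge0// mulr_ge0// ltW.
 have : sqrt (N * q) <= 3 / 2 * (u * N).
  rewrite -(ger0_norm uN) -sqrtr_sqr ler_sqrt; last exact: sqr_ge0.
  have : N * q <= N * (2 * u ^+ 2 * N) by apply: ler_wpM2l => //; exact: ltW.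
  have -> : (3 / 2 * (u * N)) ^+ 2 = 9 / 4 * (u ^+ 2 * N ^+ 2) by field.
  have -> : N * (2 * u ^+ 2 * N) = 2 * (u ^+ 2 * N ^+ 2) by ring.
  have : 0 <= u ^+ 2 * N ^+ 2 by rewrite mulr_ge0// sqr_ge0.
  by move: (u ^+ 2 * N ^+ 2) => z; lra.
 by lra.
have h5 : t * (b1 * lnN) <= dl / 2 * N.
 have : t * (b1 * lnN) <= (K1 * s) * (b1 * (4 * s)).
  by apply: ler_pM => //; [rewrite mulr_ge0|apply: ler_wpM2l].
 have -> : K1 * s * (b1 * (4 * s)) = 8 * K1 * b1 * s ^+ 2 / 2 by field.
 have : 8 * K1 * b1 * s ^+ 2 <= dl * s ^+ 2 * s ^+ 2 by apply: ler_wpM2r => //; rewrite sqr_ge0.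
 have -> : dl * s ^+ 2 * s ^+ 2 = dl * N by rewrite -s4; ring.
 by lra.
have h6 : u * (2 * (23 + 2 * C0 + 2 * L)) * N <= dl * N by apply: ler_wpM2r => //; exact: ltW.
rewrite h3; have -> : dl * N = dl * N / 2 + dl / 2 * N by field.
have e6 : u * (2 * (23 + 2 * C0 + 2 * L)) * N = 2 * (u * N * (23 + 2 * C0 + 2 * L)) by ring.
rewrite e6 in h6; have e7 : u * N * (10 + 2 * L) = 10 * (u * N) + 2 * (u * N * L) by ring.
rewrite e7 in h2; have e8 : u * N * (23 + 2 * C0 + 2 * L) = 23 * (u * N) + 2 * (u * N * C0) + 2 * (u * N * L) by ring.
rewrite e8 in h6; move: h1 h2 h4 h5 h6; rewrite [u * N * (2 * C0)]mulrCA.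
by move: (u * N * C0) (u * N * L) (u * N) => x y z; lra.
Qed.

End parameter_choice.

(** * The log-determinant against its regularization, in probability *)

Section log_determinant_comparison.
Context {R : realType} {d} {T : measurableType d} (P : probability T R).
Local Notation C := R[i].

Lemma log_det_regdet (kap p C0 dl : R) : 0 < kap <= 1 -> 0 < p <= 1 -> 0 <= C0 -> 0 < dl ->
 exists (eta D : R) (n0 : nat), [/\ 0 < eta, 0 <= D &
 forall n (X : T -> arr R ('I_n.+1 * 'I_n.+1)) (F : 'M[C]_n.+1), (n0 <= n.+1)%N ->
  mble X -> indep P X -> anticonc P X kap p ->
  (forall ij, (\int[P]_w (sqnorm (X w ij))%:E = 1)%E) ->
  \sum_(i < n.+1) sqn (row i F) <= C0 * n.+1%:R ->
  (P [set w | ~~ (0 < sqnorm (\det (hmat F (X w)))) ||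
    ~~ (ln (regdet eta F (X w)) - ln (sqnorm (\det (hmat F (X w)))) <= dl * n.+1%:R)]%R <=
   (D / (n.+1%:R * sqrt (sqrt n.+1%:R)))%:E)%E].
Proof.
move=> /andP[k0 k1] /andP[p0 p1] C00 dl0.
have [b [D [D0 hD]]] := least_distance P k0 p0 p1 6%N ler01.
pose c := p * kap / 12; have c0 : 0 < c by rewrite divr_gt0// mulr_gt0.
have c1 : c <= 1 by rewrite /c; have := mulr_ile1 (ltW p0) (ltW k0) p1 k1; lra.
pose L := ln c^-1; have L0 : 0 <= L by rewrite ln_ge0// invf_ge1.
pose G := 2 * (23 + 2 * C0 + 2 * L); have G0 : 0 < G by rewrite /G; lra.
pose u := Num.min (1 / 2) (dl / G).
have u0 : 0 < u by rewrite lt_min divr_gt0//= divr_gt0.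
have u1 : u <= 1 / 2 by rewrite ge_min lexx.
have uG : u * G <= dl by rewrite -ler_pdivlMr// ge_min lexx orbT.
(* From [t >= K ln N] the failure probability [expR (- (p / 6 * t))] of a single row is at most
   [N ^ -3]. *)
pose K := 18 / p; have K0 : 0 < K by rewrite divr_gt0.
pose K1 := 4 * K + 1; have K10 : 0 < K1 by rewrite /K1; lra.
have u20 : 0 < u ^+ 2 by rewrite exprn_gt0.
have iu0 : 0 <= (u ^+ 2)^-1 by rewrite invr_ge0 ltW.
have b10 : 0 <= b.+2%:R :> R by [].
pose S1 := 8 * K1 * b.+2%:R / dl; have S10 : 0 <= S1 by rewrite divr_ge0 ?mulr_ge0// ltW.
pose S0 := 1 + (K1 + 8) * (u ^+ 2)^-1 + S1 + 128 * (1 + C0).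
have K1u : 0 <= (K1 + 8) * (u ^+ 2)^-1 by rewrite mulr_ge0// addr_ge0// ltW.
have S00 : 0 <= S0 by rewrite /S0; lra.
exists (c * u ^+ 5), (2 + 3 * D * K1), (Num.truncn (S0 ^+ 4)).+1; split.
- by rewrite mulr_gt0// exprn_gt0.
- by rewrite addr_ge0// !mulr_ge0// ltW.
move=> n X F hn mX iX aX hX hF.
set NR : R := n.+1%:R; have N0 : 0 < NR by rewrite ltr0n.
have hS : S0 ^+ 4 <= NR.
 by apply: le_trans (ltW (truncnS_gt _)) _; rewrite ler_nat.
have [s4 s0 sS lnN] := quartic_root N0 S00 hS; set s := sqrt (sqrt NR) in s4 s0 sS lnN *.
have s1 : 1 <= s by apply: le_trans sS; rewrite /S0; lra.
have lnN0 : 0 <= ln NR by rewrite ln_ge0// ler1n.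
pose q := (Num.truncn (u ^+ 2 * NR)).+1; pose t := (Num.truncn (K * ln NR)).+1.
have su : (K1 + 8) <= u ^+ 2 * s by rewrite mulrC -ler_pdivrMr//; move: sS; rewrite /S0; lra.
have s3 : s <= s ^+ 3 by rewrite exprS ler_peMr ?exprn_ege1// ltW.
have ss : (K1 + 8) * s <= u ^+ 2 * NR.
 rewrite -s4 [s ^+ 4]exprSr mulrA; apply: ler_wpM2r; first exact: ltW.
 by apply: le_trans su _; apply: ler_wpM2l => //; exact: ltW.
have q1 : u ^+ 2 * NR <= q%:R by exact: ltW (truncnS_gt _).
have hq2 : q%:R <= 2 * u ^+ 2 * NR.
 rewrite /q -natr1; have : (Num.truncn (u ^+ 2 * NR))%:R <= u ^+ 2 * NR.
  by rewrite truncn_le mulr_ge0// ltW.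
 have : 1 <= u ^+ 2 * NR by apply: le_trans ss; nra.
 by rewrite -(mulrA 2); move: (u ^+ 2 * NR) => z; lra.
have tK : t%:R <= K1 * s.
 rewrite /t -natr1; have : (Num.truncn (K * ln NR))%:R <= K * ln NR.
  by rewrite truncn_le mulr_ge0// ltW.
 have : K * ln NR <= K * (4 * s) by apply: ler_wpM2l => //; exact: ltW.
 by rewrite /K1; lra.
have tK' : K * ln NR <= t%:R by exact: ltW (truncnS_gt _).
have tq : (t <= q)%N by rewrite -(ler_nat R); apply: le_trans tK _; nra.
have u21 : 4 * u ^+ 2 <= 1 by nra.
have q2N : (2 * q <= n.+1)%N.
 rewrite -(ler_nat R) natrM -/NR; have : 4 * u ^+ 2 * NR <= 1 * NR by apply: ler_wpM2r => //; exact: ltW.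
 by move: hq2; rewrite -!(mulrA _ (u ^+ 2)); move: (u ^+ 2 * NR) => z; lra.
pose m0 := (n.+1 - q)%N; have mq : (m0 + q = n.+1)%N by clear -q2N; rewrite /m0; lia.
have tN : (2 * t <= n.+1)%N by clear -tq q2N; lia.
have hF' i k : sqnorm (F i k) <= C0 * NR.
 apply: le_trans hF; rewrite (bigD1 i)//=; apply: (@le_trans _ _ (sqn (row i F))).
  by have := sqnorm_le_sqn (row i F) k; rewrite mxE.
 by rewrite lerDl; apply: sumr_ge0 => j _; exact: sqn_ge0.
have sN : s <= NR by rewrite -s4 exprS ler_peMr ?exprn_ege1// ltW.
have hN : 64 * (2 * NR ^+ 4 + 2 * C0 * NR ^+ 2) <= NR ^+ 6.
 have N1 : 128 * (1 + C0) <= NR by apply: le_trans sN; apply: le_trans sS; rewrite /S0; lra.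
 have N11 : 1 <= NR by rewrite ler1n.
 have h2 : NR ^+ 2 <= NR ^+ 4 by apply: ler_weXn2l.
 have h5 : NR ^+ 5 <= NR ^+ 6 by apply: ler_weXn2l.
 have h4 : 128 * (1 + C0) * NR ^+ 4 <= NR ^+ 5 by rewrite [leRHS]exprS; apply: ler_wpM2r => //; rewrite exprn_ge0// ltW.
 have h6 : C0 * NR ^+ 2 <= C0 * NR ^+ 4 by apply: ler_wpM2l.
 have e : 128 * (1 + C0) * NR ^+ 4 = 128 * NR ^+ 4 + 128 * (C0 * NR ^+ 4) by ring.
 move: h4 h5 h6; rewrite e -(mulrA 2 C0); move: (C0 * NR ^+ 4) (C0 * NR ^+ 2) (NR ^+ 4) (NR ^+ 5) (NR ^+ 6).
 by move=> x1 x2 x3 x4 x5; lra.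
have e01 : 0 < c * u ^+ 5 <= 1.
 rewrite mulr_gt0 ?exprn_gt0//=; apply: mulr_ile1; rewrite ?exprn_ge0 ?exprn_ile1// ?ltW//; lra.
have iu : 0 < u^-1 by rewrite invr_gt0.
have far w : far_rows kap p F m0 q t b (X w) -> 0 < sqnorm (\det (hmat F (X w))) /\
  ln (regdet (c * u ^+ 5) F (X w)) - ln (sqnorm (\det (hmat F (X w)))) <= dl * NR.
 move=> hw; have [h1 h2] := ln_regdet_le k0 k1 p0 p1 mq tq (ltn0Sn _) hF e01 iu hw.
 split => //; apply: le_trans h2 _; apply: (@cost_bound R NR u q%:R c C0 L t%:R b.+1%:R dl s K1 (ln NR)) => //; try exact: ltW.
 have h : S1 <= s by apply: le_trans sS; rewrite /S0; lra.
 have h' : S1 * dl <= s * dl by apply: ler_wpM2r => //; exact: ltW.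
 rewrite /S1 divfK ?gt_eqF// in h'.
 apply: (@le_trans _ _ (8 * K1 * b.+2%:R)).
  by apply: ler_wpM2l; [rewrite mulr_ge0// ltW|rewrite ler_nat].
 apply: le_trans h' _; rewrite mulrC; apply: ler_wpM2l; first exact: ltW.
 by rewrite expr2 ler_peMr// ltW.
have [mfar hP] := far_rows_prob k0 p0 p1 mX iX aX hX mq tq tN D0 hF' hN hD (ltn0Sn _).
have mdet : mble (fun w => sqnorm (\det (hmat F (X w)))).
 apply: meas_sqnorm; apply: meas_det => i j; under eq_fun do rewrite mxE.
 exact: (mcomp (@meas_hrow R n.+1 F i 0 j) mX).
have mreg : mble (fun w => regdet (c * u ^+ 5) F (X w)).
 exact: (mcomp (meas_regdet (c * u ^+ 5) F) mX).
apply: (@le_trans _ _ (P [set w | ~~ far_rows kap p F m0 q t b (X w)])).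
 apply: le_measure; rewrite ?inE.
 - apply: meas_set_bool; apply: measurable_or; apply: measurable_neg.
   exact: mble_ltr.
  apply: mble_ler => //; apply: mbleB.
   by apply: mcomp mreg.
  by apply: mcomp mdet.
 - exact: meas_set_bool.
 - by move=> w /=; apply: contraTN => /far[-> ->].
apply: le_trans hP _; rewrite lee_fin.
have N2 : NR ^- 2 <= (NR * s)^-1.
 rewrite lef_pV2 ?posrE ?exprn_gt0 ?mulr_gt0// expr2; apply: ler_wpM2l => //; exact: ltW.
have expN (x : R) (m : nat) : m%:R * ln NR <= x -> expR (- x) <= NR ^- m.
 move=> hx; rewrite expRN lef_pV2 ?posrE ?expR_gt0 ?exprn_gt0//.
 by rewrite -[leLHS]lnK ?posrE ?exprn_gt0// ler_expR lnXn// -[leLHS]mulr_natl.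
have hA : NR * expR (- (p / 6 * t%:R)) <= (NR * s)^-1.
 apply: le_trans N2; apply: (@le_trans _ _ (NR * NR ^- 3)).
  apply: ler_wpM2l; first exact: ltW.
  apply: expN; apply: (@le_trans _ _ (p / 6 * (K * ln NR))).
   by rewrite /K le_eqVlt; apply/orP; left; apply/eqP; field; rewrite gt_eqF.
  by apply: ler_wpM2l => //; rewrite divr_ge0// ltW.
 by rewrite exprS invfM mulVKf ?gt_eqF.
have hC : expR (- q%:R) <= (NR * s)^-1.
 by apply: le_trans N2; apply: expN; apply: le_trans q1; apply: le_trans ss; nra.
(* At most [K1 N ^ (1/4)] rows, each failing with probability [O(N ^ (-3/2))]: this term dictates
   the final [N ^ (-5/4)]. *)
have hB : t%:R * (3 * D / (NR * sqrt NR)) <= 3 * D * K1 * (NR * s)^-1.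
 have sq : sqrt NR = s * s by rewrite -expr2 sqr_sqrtr ?sqrtr_ge0.
 rewrite sq; apply: (@le_trans _ _ (K1 * s * (3 * D / (NR * (s * s))))).
  by apply: ler_wpM2r => //; rewrite divr_ge0 ?mulr_ge0// ltW.
 by rewrite le_eqVlt; apply/orP; left; apply/eqP; field; rewrite !gt_eqF.
have -> : (2 + 3 * D * K1) / (NR * s) = (NR * s)^-1 + 3 * D * K1 * (NR * s)^-1 + (NR * s)^-1 by ring.
exact: lerD (lerD hA hB) hC.
Qed.

End log_determinant_comparison.

(** * Comparison of the log-determinants of the two models *)

Section universality.
Context {R : realType} {d} {T : measurableType d} (P : probability T R).
Local Notation C := R[i].

Definition good_array {I} (kap p : R) (B : R -> R) (X : T -> arr R I) :=
 [/\ mble X, indep P X, anticonc P X kap p &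
   forall tau, 0 < tau -> std_entries P X (B tau) tau].

Definition close_dets n (F : 'M[C]_n) (a : R) (f g : arr R ('I_n * 'I_n)) :=
 [&& 0 < sqnorm (\det (hmat F f)), 0 < sqnorm (\det (hmat F g)) &
  `|ln (sqnorm (\det (hmat F f))) - ln (sqnorm (\det (hmat F g)))| <= a].

Lemma meas_hmat n (F : 'M[C]_n) : meas_mx (fun f : arr R ('I_n * 'I_n) => hmat F f).
Proof. by move=> i j; under eq_fun do rewrite mxE; exact: meas_hrow. Qed.

Lemma five_steps (l1 l2 r1 r2 c1 c2 a : R) : r1 - l1 <= a -> r2 - l2 <= a ->
 c2 - c1 <= a -> c1 - c2 <= a -> l1 <= r1 -> l2 <= r2 ->
 `|r1 - c1| <= a -> `|r2 - c2| <= a -> `|l1 - l2| <= 5 * a.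
Proof. by rewrite !ler_norml => *; lra. Qed.

(** A chain of five links of length [dl n / 5]: determinant, regularization, centre, and back
    through the other model. The link between the centres is deterministic, those from
    regularization to centre fail with exponentially small probability, and those to the
    determinants fix the rate. *)
Lemma log_det_universality (kap p C0 dl : R) (B : R -> R) :
 0 < kap <= 1 -> 0 < p <= 1 -> 0 <= C0 -> 0 < dl -> (forall tau, 0 <= B tau) ->
 exists (D : R) (n0 : nat), 0 <= D /\
 forall n (X Y : T -> arr R ('I_n.+1 * 'I_n.+1)) (F : 'M[C]_n.+1), (n0 <= n.+1)%N ->
  good_array kap p B X -> good_array kap p B Y ->
  \sum_(i < n.+1) sqn (row i F) <= C0 * n.+1%:R ->
  (P [set w | ~~ close_dets F (dl * n.+1%:R) (X w) (Y w)] <=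
   (D / (n.+1%:R * sqrt (sqrt n.+1%:R)))%:E)%E.
Proof.
move=> hk hp C00 dl0 B0; pose e := dl / 5; have e0 : 0 < e by rewrite divr_gt0.
have [eta [D [n1 [eta0 D0 hD]]]] := log_det_regdet P hk hp C00 e0.
pose G := 16 * (2 + 4 / eta) ^+ 2.
have G0 : 0 < G by rewrite mulr_gt0// exprn_gt0// addr_gt0// divr_gt0.
pose lam := Num.min (1 / 2) (e / G).
have l0 : 0 < lam by rewrite lt_min divr_gt0//= divr_gt0.
have hlam : 0 < lam <= 1 / 2 by rewrite l0 ge_min lexx.
have lG : 16 * lam * (2 + 4 / eta) ^+ 2 <= e.
 have : lam * G <= e by rewrite -ler_pdivlMr// ge_min lexx orbT.
 by rewrite /G mulrCA mulrA.
pose eps := Num.min (1 / 2) (lam * e / 4).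
have eps0 : 0 < eps by rewrite lt_min !divr_gt0// mulr_gt0.
have eps1 : eps <= 1 / 2 by rewrite ge_min lexx.
have eps2 : 4 * eps <= lam * e.
 have : eps <= lam * e / 4 by rewrite ge_min lexx orbT.
 by lra.
(* The truncated tail takes half of the allowed error, [2 * tau / eta = eps / 2]; the other half is
   obtained from [n] large. *)
pose tau := eps * eta / 4; have tau0 : 0 < tau by rewrite divr_gt0// mulr_gt0.
pose Q := ((33 + 2 * B tau ^+ 2) / eta + 16) / eps.
have Q0 : 0 <= Q by rewrite divr_ge0 ?addr_ge0 ?divr_ge0 ?addr_ge0 ?mulr_ge0 ?sqr_ge0// ltW.
pose a := lam * e / 2; have a0 : 0 < a by rewrite divr_gt0// mulr_gt0.
exists (2 * D + 4 * (4 / a) ^+ 4), (maxn n1 (Num.truncn (Q ^+ 2)).+1); split.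
 apply: addr_ge0; apply: mulr_ge0 => //; apply: exprn_ge0; apply: divr_ge0 => //; exact: ltW.
move=> n X Y F; rewrite geq_max => /andP[hn1 hn2] hX hY hF.
set NR : R := n.+1%:R; have N0 : 0 < NR by rewrite ltr0n.
have sN0 : 0 < sqrt NR by rewrite sqrtr_gt0.
have QN : Q <= sqrt NR.
 rewrite -(ger0_norm Q0) -sqrtr_sqr ler_sqrt; last exact: ltW.
 by apply: le_trans (ltW (truncnS_gt _)) _; rewrite ler_nat.
have epsN : ((33 + 2 * B tau ^+ 2) / eta + 16) / (2 * sqrt NR) + 2 * tau / eta <= eps.
 have -> : 2 * tau / eta = eps / 2 by rewrite /tau; field; rewrite gt_eqF.
 have : ((33 + 2 * B tau ^+ 2) / eta + 16) / (2 * sqrt NR) <= eps / 2.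
  rewrite ler_pdivrMr; last exact: mulr_gt0.
  have -> : eps / 2 * (2 * sqrt NR) = sqrt NR * eps by field.
  by rewrite -ler_pdivrMr.
 by lra.
have cl (X1 Y1 : T -> arr R ('I_n.+1 * 'I_n.+1)) : good_array kap p B X1 -> good_array kap p B Y1 ->
  logcenter P eta lam F Y1 - logcenter P eta lam F X1 <= e * NR.
 move=> [m1 i1 _ s1] [m2 i2 _ s2].
 by apply: (logcenter_close F eta0 hlam (ltn0Sn n) m1 i1 (s1 _ tau0) m2 i2 (s2 _ tau0) (B0 tau) epsN (ltW eps0) eps1 eps2).
pose Z (x : bool) := if x then X else Y.
have hZ x : good_array kap p B (Z x) by case: x.
have mZ x : mble (Z x) by case: (hZ x).
pose ld f := ln (sqnorm (\det (hmat F f))); pose lr f := ln (regdet eta F f).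
have mdet x : mble (fun w => sqnorm (\det (hmat F (Z x w)))).
 apply: meas_sqnorm; apply: meas_det => i j.
 exact: (mcomp (@meas_hmat _ F i j) (mZ x)).
have mld x : mble (fun w => ld (Z x w)) by apply: mcomp (mdet x).
have mlr x : mble (fun w => lr (Z x w)).
 have mr : mble (fun w => regdet eta F (Z x w)).
  exact: (mcomp (meas_regdet eta F) (mZ x)).
 by apply: mcomp mr.
pose bi (xy : bool * bool) w := if xy.2 then
  ~~ (0 < sqnorm (\det (hmat F (Z xy.1 w)))) || ~~ (lr (Z xy.1 w) - ld (Z xy.1 w) <= e * NR)
 else e * NR < `|lr (Z xy.1 w) - logcenter P eta lam F (Z xy.1)|.
pose ci (xy : bool * bool) : R := if xy.2 then D / (NR * sqrt (sqrt NR)) else 2 * expR (- (a * NR)).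
have mbi xy : mble (bi xy).
 case: xy => x [] /=; rewrite /bi /=.
  apply: measurable_or; apply: measurable_neg; first exact: mble_ltr.
  by apply: mble_ler => //; exact: mbleB.
 apply: mble_ltr => //; apply: mcomp => //; exact: mbleB.
have hbi xy : (P [set w | bi xy w] <= (ci xy)%:E)%E.
 case: xy => x y; have [m1 i1 a1 s1] := hZ x; case: y; rewrite /bi /ci /=.
  by apply: hD => // ij; case: (s1 _ tau0 ij).
 by apply: log_regdet_concentration => //; [exact: s1|exact: ltW].
pose b w := ~~ close_dets F (dl * NR) (X w) (Y w).
have mb : mble b.
 apply: measurable_neg; apply: measurable_and; first exact: (mble_ltr _ (mdet true)).
 apply: measurable_and; first exact: (mble_ltr _ (mdet false)).
 apply: mble_ler => //; apply: mcomp => //.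
 exact: (mbleB (mld true) (mld false)).
have hb w : b w -> exists xy, bi xy w.
 move=> bw; apply: contrapT => /forallNP h; move/negP: bw; apply.
 have ok x : 0 < sqnorm (\det (hmat F (Z x w))) /\ lr (Z x w) - ld (Z x w) <= e * NR.
  have := h (x, true); rewrite /bi /= => /negP; rewrite negb_or !negbK => /andP[] //.
 have dr x : ld (Z x w) <= lr (Z x w).
  have [hx0 _] := ok x; rewrite /ld /lr ler_ln ?posrE ?regdet_gt0//.
  exact: det_le_regdet (ltW eta0).
 have cc x : `|lr (Z x w) - logcenter P eta lam F (Z x)| <= e * NR.
  by have := h (x, false); rewrite /bi /= => /negP; rewrite -leNgt.
 have [ok1 ok2] := ok true; have [ok3 ok4] := ok false; apply/and3P; split; [exact: ok1|exact: ok3|].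
 have c1 := cl _ _ (hZ true) (hZ false); have c2 := cl _ _ (hZ false) (hZ true).
 rewrite -[X in X <= _]/(`|ld (Z true w) - ld (Z false w)|).
 have -> : dl * NR = 5 * (e * NR) by rewrite /e; field.
 exact: (five_steps ok2 ok4 c1 c2 (dr true) (dr false) (cc true) (cc false)).
apply: le_trans (prob_union_le mb mbi hb hbi) _; rewrite lee_fin.
rewrite -(pair_bigA _ (fun x y => ci (x, y))) !big_bool /= /ci /=.
have hexp : expR (- (a * NR)) <= (4 / a) ^+ 4 / (NR * sqrt (sqrt NR)).
 have aN : 0 < a * NR by rewrite mulr_gt0.
 apply: le_trans (expR_le_pow4 aN) _.
 have -> : (4 / (a * NR)) ^+ 4 = (4 / a) ^+ 4 * NR ^- 4 by field; rewrite !gt_eqF.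
 apply: ler_wpM2l; first by rewrite exprn_ge0// divr_ge0// ltW.
 have N1 : 1 ^+ 4 <= NR by rewrite expr1n ler1n.
 have [s4 s0 s1 _] := quartic_root N0 ler01 N1; move: s4 s0 s1; set s := sqrt (sqrt NR) => s4 s0 s1.
 rewrite lef_pV2 ?posrE ?exprn_gt0 ?mulr_gt0// [leRHS]exprS; apply: ler_wpM2l; first exact: ltW.
 rewrite -s4 -exprM; apply: (@le_trans _ _ (s ^+ 1)); first by rewrite expr1.
 by apply: ler_weXn2l.
move: (NR * _) hexp => M hexp.
have -> : (2 * D + 4 * (4 / a) ^+ 4) / M = 2 * (D / M) + 4 * ((4 / a) ^+ 4 / M) by rewrite mulrDl !mulrA.
move: hexp; move: (D / M) ((4 / a) ^+ 4 / M) (expR _) => x1 x2 x3; lra.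
Qed.

End universality.

(** * Consequences of zero mean and unit variance *)

Section standardized_variables.
Context {R : realType} {d} {T : measurableType d} (P : probability T R).
Local Notation C := R[i].

Lemma law_integral (U V : {RV P >-> C}) (phi : C -> R) : mble phi ->
 (forall B, measurable B -> distribution P U B = distribution P V B) ->
 (\int[P]_w (phi (U w))%:E = \int[P]_w (phi (V w))%:E)%E.
Proof.
move=> mphi hUV.
have mE : mble (EFin \o phi) by exact/mble_EFinP.
have key (g : C -> \bar R) : mble g -> (forall z, 0 <= g z)%E ->
  (\int[P]_w g (U w) = \int[P]_w g (V w))%E.
 move=> mg g0.
 have h (W : {RV P >-> C}) : (\int[P]_w g (W w) = \int[distribution P W]_z g z)%E.
  have := @ge0_integral_pushforward _ _ T C R W (measurable_funPT W) P setT g measurableT mg.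
  by rewrite preimage_setT => -> // z _; exact: g0.
 rewrite !h; apply: eq_measure_integral => A mA _; exact: hUV.
rewrite integralE [RHS]integralE; congr (_ - _)%E.
 etransitivity; first by apply: (eq_integral (fun w => (EFin \o phi)^\+ (U w)))%E => w _; rewrite !funeposE.
 rewrite (key _ (measurable_funepos mE) (fun z => funepos_ge0 _ z)).
 by apply: eq_integral => w _; rewrite !funeposE.
etransitivity; first by apply: (eq_integral (fun w => (EFin \o phi)^\- (U w)))%E => w _; rewrite !funenegE.
rewrite (key _ (measurable_funeneg mE) (fun z => funeneg_ge0 _ z)).
by apply: eq_integral => w _; rewrite !funenegE.
Qed.

Lemma law_prob (U V : {RV P >-> C}) (phi : C -> bool) : mble phi ->
 (forall B, measurable B -> distribution P U B = distribution P V B) ->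
 P [set w | phi (U w)] = P [set w | phi (V w)].
Proof. by move=> mphi h; apply: (h [set z | phi z]); exact: meas_set_bool. Qed.

Variables (x : {RV P >-> C}) (hx : standardized x).

Let mx : mble x. Proof. exact: measurable_funPT. Qed.
Let msq : mble (fun w => sqnorm (x w)). Proof. exact: meas_sqnorm. Qed.

Lemma Re_norm2 (z : C) : Re (`|z| ^+ 2) = sqnorm z.
Proof. by rewrite normr_sqnorm -rmorphXn /= sqr_sqrtr// sqnorm_ge0. Qed.

Lemma int_sqnorm1 : (\int[P]_w (sqnorm (x w))%:E = 1)%E.
Proof.
by case: hx => _ _; rewrite unlock => <-; apply: eq_integral => w _; rewrite Re_norm2.
Qed.

(** Monotone convergence of the truncated second moments towards [1]. *)
Lemma tail_exists (tau : R) : 0 < tau -> exists B : R, 0 <= B /\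
 (\int[P]_w (sqnorm (x w) - Num.min (sqnorm (x w)) B)%:E <= tau%:E)%E.
Proof.
move=> tau0; pose g (n : nat) w : R := Num.min (sqnorm (x w)) n%:R.
have mg n : mble (g n) by apply: measurable_minr.
have g0 n w : 0 <= g n w by rewrite le_min sqnorm_ge0 ler0n.
have lg w : limn (fun n => (g n w)%:E) = (sqnorm (x w))%:E.
 apply: cvg_lim => //; apply: cvg_near_cst; near=> n; congr (_%:E); apply/min_idPl.
 apply: le_trans (ltW (truncnS_gt _)) _; rewrite ler_nat; near: n.
 by exists (Num.truncn (sqnorm (x w))).+1.
have h : exists n, ((1 - tau)%:E < \int[P]_w (g n w)%:E)%E.
 apply: contrapT => /forallNP h.
 have nd w : nondecreasing_seq (fun n => (g n w)%:E).
  move=> m n mn; rewrite lee_fin /g le_min !ge_min lexx /=.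
  by rewrite ler_nat mn orbT.
 have := @monotone_convergence _ _ _ P setT measurableT (fun n w => (g n w)%:E)
  (fun n => proj2 (mble_EFinP _ _) (mg n)) (fun n w _ => g0 n w) (fun w _ => nd w).
 under eq_integral do rewrite lg.
 rewrite int_sqnorm1 => e.
 have : (1 <= (1 - tau)%:E)%E.
  rewrite e; apply: lime_le.
   apply: ereal_nondecreasing_is_cvgn => m n mn; apply: int_le => // w.
   by have := nd w _ _ mn; rewrite lee_fin.
  by apply: nearW => n; have /negP := h n; rewrite -leNgt.
 by rewrite lee_fin; lra.
have [n hn] := h; exists n%:R; split => //.
have ms : mble (fun w => sqnorm (x w) - g n w) by exact: mbleB.
have s0 w : 0 <= sqnorm (x w) - g n w by rewrite subr_ge0 ge_min lexx.
have : (\int[P]_w (sqnorm (x w) - g n w)%:E + \int[P]_w (g n w)%:E = 1)%E.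
 by rewrite -int_D// -int_sqnorm1; apply: eq_integral => w _; rewrite subrK.
move: hn; rewrite -/(g n); case: (\int[P]_w (g n w)%:E)%E => [a| |]//=.
 case: (\int[P]_w (sqnorm (x w) - g n w)%:E)%E => [b| |]//=.
 by rewrite lte_fin -EFinD => h1 [] h2; rewrite lee_fin; lra.
have := int_ge0 P s0; case: (\int[P]_w (sqnorm (x w) - g n w)%:E)%E => [b| |]//=.
Unshelve. all: by end_near. Qed.

Lemma second_moment_shift (c : C) : ((1 + sqnorm c)%:E <= \int[P]_w (sqnorm (x w - c))%:E)%E.
Proof.
have [h1 h2 _] := hx; rewrite unlock in h1; rewrite unlock in h2.
have i0 : P.-integrable setT (fun w => (sqnorm (x w))%:E).
 apply: (@integrable_le _ _ _ P (fun w => sqnorm (x w)) (fun w => sqnorm (x w)) 1) => //.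
  by move=> w; rewrite ger0_norm// sqnorm_ge0.
 by rewrite int_sqnorm1.
have i1s : (\int[P]_w (1 + sqnorm (x w))%:E <= 2%:E)%E.
 by rewrite int_D// ?int_cst ?int_sqnorm1//; move=> w; exact: sqnorm_ge0.
have mR : mble (fun w => Re (x w)) by exact: (mcomp (@meas_Re R) mx).
have mI : mble (fun w => Im (x w)) by exact: (mcomp (@meas_Im R) mx).
have iR : P.-integrable setT (fun w => (Re (x w))%:E).
 apply: (integrable_le mR _ _ i1s); first exact: mbleD.
 move=> w; rewrite /sqnorm; have := sqr_ge0 (Im (x w)); case: (ler0P (Re (x w))) => h; nra.
have iI : P.-integrable setT (fun w => (Im (x w))%:E).
 apply: (integrable_le mI _ _ i1s); first exact: mbleD.
 move=> w; rewrite /sqnorm; have := sqr_ge0 (Re (x w)); case: (ler0P (Im (x w))) => h; nra.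
have e w : (sqnorm (x w - c))%:E = ((sqnorm (x w))%:E + ((- (2 * Re c))%:E * (Re (x w))%:E +
  ((- (2 * Im c))%:E * (Im (x w))%:E + (sqnorm c)%:E)))%E.
 by rewrite -!EFinM -!EFinD /sqnorm ReB ImB; congr (_%:E); ring.
have ic : P.-integrable setT (fun=> (sqnorm c)%:E) by exact: finite_measure_integrable_cst.
have iI' := integrableZl measurableT (- (2 * Im c)) iI.
have iR' := integrableZl measurableT (- (2 * Re c)) iR.
under eq_integral do rewrite e.
rewrite integralD//; last by apply: integrableD => //; apply: integrableD.
rewrite integralD//; last by apply: integrableD.
rewrite integralD// !integralZl// h1 h2 !mule0 !add0e int_cst int_sqnorm1 -EFinD; exact: lexx.
Qed.

(** Were [x] within [1/2] of some [c] with probability above [1 - p], the mean of [sqnorm (x w - c)]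
    would fall below [1 + sqnorm c], against [second_moment_shift]; controlling the tail at a fixed
    level [B] makes [p] uniform in [c]. *)
Lemma anticonc_exists : exists kap p : R, [/\ 0 < kap <= 1, 0 < p <= 1 &
 forall c : C, (P [set w | sqnorm (x w - c)%R <= kap]%R <= (1 - p)%:E)%E].
Proof.
have [B [B0 hB]] := tail_exists (divr_gt0 ltr01 (ltr0Sn R 7)).
(* Gives [2 B p <= 1/8] and [2 p <= 1], so that the mean would be at most
   [1/4 + 2/8 + 1/8 + sqnorm c]. *)
pose p : R := (2 + 16 * B)^-1; have p0 : 0 < p by rewrite invr_gt0; lra.
have pB : p * (2 + 16 * B) = 1 by rewrite mulVf// gt_eqF//; lra.
have p12 : p <= 1 / 2 by nra.
have pB8 : B * p <= 1 / 16 by nra.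
exists (1 / 4), p; split; [lra|lra|move=> c].
have mc : mble (fun w => sqnorm (x w - c)).
 apply: meas_sqnorm; exact: (meas_addC mx (measurable_cst (- c))).
pose b w : bool := sqnorm (x w - c) <= 1 / 4.
have mb : mble b by exact: mble_ler.
have mB : measurable [set w | b w] by exact: meas_set_bool.
rewrite leNgt; apply/negP; rewrite (prob_fine P mB) lte_fin => hp.
set q := fine _ in hp.
pose nb w : R := (~~ b w)%:R.
have mnb : mble nb by apply: meas_natr_bool; exact: measurable_neg.
have hq : (\int[P]_w (nb w)%:E = (1 - q)%:E)%E.
 have : (\int[P]_w (nb w)%:E + \int[P]_w ((b w)%:R)%:E = 1)%E.
  rewrite -int_D//; [|exact: meas_natr_bool].
  by rewrite -[RHS](int_cst P 1); apply: eq_integral => w _; rewrite /nb; case: (b w); rewrite ?add0r ?addr0.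
 rewrite -prob_bool// (prob_fine P mB) -/q.
 by case: (\int[P]_w (nb w)%:E)%E => [a| |]//=; rewrite -EFinD => -[] h; congr (_%:E); lra.
pose tl w := sqnorm (x w) - Num.min (sqnorm (x w)) B.
have mtl : mble tl by apply: mbleB => //; exact: measurable_minr.
have tl0 w : 0 <= tl w by rewrite subr_ge0 ge_min lexx.
have le1 w : sqnorm (x w - c) <= 1 / 4 + 2 * tl w + (2 * B + 2 * sqnorm c) * nb w.
 rewrite /nb /b; have s0 := sqnorm_ge0 c; have t0 := tl0 w.
 have [h|h] := leP (sqnorm (x w - c)) (1 / 4); first by rewrite mulr0 addr0; lra.
 rewrite mulr1; have := sqnormB_le (x w) c; have : sqnorm (x w) <= tl w + B.
  by rewrite /tl -addrA lerDl addrC subr_ge0 ge_min lexx orbT.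
 by lra.
have c0 : 0 <= 2 * B + 2 * sqnorm c by have := sqnorm_ge0 c; lra.
have nb0 w : 0 <= nb w by rewrite /nb.
have := second_moment_shift c; rewrite leNgt => /negP; apply.
apply: (@le_lt_trans _ _ (\int[P]_w (1 / 4 + 2 * tl w + (2 * B + 2 * sqnorm c) * nb w)%:E)%E).
 apply: int_le => //; last by move=> w; exact: sqnorm_ge0.
 by apply: mbleD; [apply: mbleD => //; exact: mbleM|exact: mbleM].
rewrite int_D ?int_D ?int_cst ?int_Zl//; last 6 first.
- exact: mbleM.
- by move=> w; rewrite mulr_ge0.
- by apply: mbleD => //; exact: mbleM.
- exact: mbleM.
- by move=> w; rewrite addr_ge0 ?mulr_ge0.
- by move=> w; rewrite mulr_ge0.
rewrite hq; move: hB; rewrite -/tl; have := int_ge0 P tl0.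
case: (\int[P]_w (tl w)%:E)%E => [t| |]//; rewrite !lee_fin => t0 t1.
rewrite -!EFinM -!EFinD lte_fin.
have h1 : (2 * B + 2 * sqnorm c) * (1 - q) <= (2 * B + 2 * sqnorm c) * p by apply: ler_wpM2l => //; lra.
have h2 : sqnorm c * p <= sqnorm c * (1 / 2) by apply: ler_wpM2l => //; exact: sqnorm_ge0.
have -> : 1 + sqnorm c = 1 / 4 + 2 * (1 / 8) + (1 / 2 + sqnorm c) by field.
apply: ler_ltD; first by lra.
apply: le_lt_trans h1 _; rewrite mulrDl -!mulrA; lra.
Qed.

End standardized_variables.

(** * Averages over roots of unity *)

Section unity_roots.
Context {R : realType}.
Local Notation C := R[i].

Definition nm (z : C) : R := sqrt (sqnorm z).

Lemma nm_ge0 z : 0 <= nm z. Proof. exact: sqrtr_ge0. Qed.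
Lemma nm_sqr z : nm z ^+ 2 = sqnorm z. Proof. by rewrite sqr_sqrtr// sqnorm_ge0. Qed.
Lemma normC_nm z : `|z| = (nm z)%:C. Proof. exact: normr_sqnorm. Qed.
Lemma nmM z1 z2 : nm (z1 * z2) = nm z1 * nm z2.
Proof. by rewrite /nm sqnormM sqrtrM// sqnorm_ge0. Qed.
Lemma nm_triangle z1 z2 : nm (z1 + z2) <= nm z1 + nm z2.
Proof. by rewrite -lecR rmorphD /= -!normC_nm ler_normD. Qed.
Lemma nmN z : nm (- z) = nm z. Proof. by rewrite /nm sqnormN. Qed.
Lemma nmB_ge z1 z2 : nm z1 - nm z2 <= nm (z1 - z2).
Proof. by rewrite lerBlDr; have := nm_triangle (z1 - z2) z2; rewrite subrK. Qed.
Lemma nm_real (x : R) : nm x%:C = `|x|. Proof. by rewrite /nm sqnorm_real sqrtr_sqr. Qed.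
Lemma nm1 : nm 1 = 1. Proof. by rewrite -[1]/(1%:C) nm_real normr1. Qed.
Lemma nmX z k : nm (z ^+ k) = nm z ^+ k.
Proof. by elim: k => [|k ih]; rewrite ?expr0 ?nm1// !exprS nmM ih. Qed.
Lemma nm_eq0 z : (nm z == 0) = (z == 0).
Proof. by rewrite /nm sqrtr_eq0 -sqnorm_eq0 eq_le sqnorm_ge0 andbT. Qed.

Lemma unity_rootsP N : (0 < N)%N -> exists s : seq C, [/\ size s = N, uniq s,
 (forall z, z \in s -> z ^+ N = 1) &
 forall x y : C, \prod_(z <- s) (x - y * z) = x ^+ N - y ^+ N].
Proof.
move=> N0; have NC : N%:R != 0 :> C by rewrite pnatr_eq0 -lt0n.
pose p : {poly C} := 'X^N - 1; have [s hs] := closed_field_poly_normal p.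
have mp : p \is monic by rewrite monicXnsubC.
have pE : p = \prod_(z <- s) ('X - z%:P) by rewrite hs (monicP mp) scale1r.
have sz : size s = N.
 by apply/eqP; rewrite -eqSS -(size_prod_XsubC s id) -pE size_XnsubC.
have hx x : \prod_(z <- s) (x - z) = x ^+ N - 1.
 have := congr1 (fun q => q.[x]) pE; rewrite /p !hornerE horner_prod => ->.
 by apply: eq_bigr => z _; rewrite hornerXsubC.
exists s; split => //.
- rewrite -separable_prod_XsubC -pE; exact: separable_Xn_sub_1.
- by move=> z zs; apply/eqP; rewrite -subr_eq0 -hx (big_rem z)//= subrr mul0r.
- move=> x y; have [->|y0] := eqVneq y 0.
  rewrite (eq_bigr (fun=> x)); last by move=> z _; rewrite mul0r subr0.
  by rewrite big_const_seq count_predT iter_mulr_1 sz expr0n gtn_eqF// subr0.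
 rewrite (eq_bigr (fun z => y * (x / y - z))); last first.
  by move=> z _; rewrite mulrBr [y * (x / y)]mulrC divfK.
 rewrite big_split /= hx big_const_seq count_predT iter_mulr_1 sz mulrBr mulr1.
 by rewrite -exprMn [y * (x / y)]mulrC divfK.
Qed.

Lemma nm_unity_root N z : (0 < N)%N -> z ^+ N = 1 -> nm z = 1.
Proof.
move=> N0 zN; apply/eqP; rewrite -(@pexpr_eq1 _ _ N) ?nm_ge0//.
by rewrite -nmX zN nm1.
Qed.

Lemma nm_sub1_expr (z : C) k : nm z = 1 -> nm (1 - z ^+ k) <= k%:R * nm (1 - z).
Proof.
move=> z1; elim: k => [|k ih]; first by rewrite expr0 subrr mul0r -[0]/(0%:C) nm_real normr0.
have -> : 1 - z ^+ k.+1 = (1 - z ^+ k) + z ^+ k * (1 - z) by rewrite exprSr; ring.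
apply: le_trans (nm_triangle _ _) _; rewrite nmM nmX z1 expr1n mul1r -natr1 mulrDl mul1r.
by rewrite lerD2r.
Qed.

(** For [z = z2 / z1], different from [1], the powers of [z] sum to [0], so [N] is the sum of the
    [1 - z ^ k], each of modulus at most [N] times that of [1 - z]. *)
Lemma unity_root_spacing N (z1 z2 : C) : (0 < N)%N -> z1 ^+ N = 1 -> z2 ^+ N = 1 -> z1 != z2 ->
 N%:R^-1 <= nm (z1 - z2).
Proof.
move=> N0 h1 h2 z12; have n1 := nm_unity_root N0 h1; have n2 := nm_unity_root N0 h2.
have z10 : z1 != 0 by rewrite -nm_eq0 n1 oner_neq0.
pose z := z2 / z1; have zN : z ^+ N = 1 by rewrite /z exprMn exprVn h1 h2 invr1 mulr1.
have nz := nm_unity_root N0 zN.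
have z1z : z != 1.
 by apply: contra_neq z12 => e; rewrite -[z2](divfK z10) -/z e mul1r.
have -> : nm (z1 - z2) = nm (1 - z).
 by rewrite -[RHS]mul1r -n1 -nmM mulrBr mulr1 /z mulrC divfK.
have s0 : \sum_(k < N) z ^+ k = 0.
 have := subrX1 z N; rewrite zN subrr => /esym/eqP; rewrite mulf_eq0 subr_eq0 (negbTE z1z) /=.
 by move/eqP.
have hN : N%:R = \sum_(k < N) (1 - z ^+ k) :> C.
 by rewrite sumrB s0 subr0 sumr_const card_ord.
have NR : 0 < N%:R :> R by rewrite ltr0n.
have h : N%:R <= \sum_(k < N) (N%:R * nm (1 - z)).
 apply: (@le_trans _ _ (\sum_(k < N) nm (1 - z ^+ k))).
  have -> : (N%:R : R) = nm (N%:R : C) by rewrite -(rmorph_nat (real_complex R)) nm_real ger0_norm.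
  rewrite hN; elim/big_ind2: _ => //; first by rewrite -[0]/(0%:C) nm_real normr0.
  by move=> a b a' b' ha hb; apply: le_trans (nm_triangle _ _) _; exact: lerD.
 apply: ler_sum => k _; apply: le_trans (nm_sub1_expr k nz) _.
 by apply: ler_wpM2r; rewrite ?nm_ge0// ler_nat ltnW.
move: h; rewrite sumr_const card_ord -[leRHS]mulr_natl -{1}[N%:R]mulr1 ler_pM2l// => h.
by rewrite -(ler_pM2l NR) mulfV// gt_eqF.
Qed.

Variables (r kap : R) (N : nat) (s : seq C).
Hypotheses (r0 : 0 < r) (kap0 : 0 < kap) (N0 : (0 < N)%N).
Hypotheses (ss : size s = N) (us : uniq s) (hs : forall z, z \in s -> z ^+ N = 1)
 (ps : forall x y : C, \prod_(z <- s) (x - y * z) = x ^+ N - y ^+ N).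

Let sqnorm_sub (x y : C) : sqnorm (x - y) = sqnorm x + sqnorm y - 2 * Re (x * cj y).
Proof. rewrite /sqnorm ReB ImB ReM /cj ReJ ImJ; ring. Qed.

Let ns z : z \in s -> sqnorm z = 1.
Proof. by move=> /hs h; rewrite -nm_sqr (nm_unity_root N0 h) expr1n. Qed.

(** On the unit circle [sqnorm (x - r z) + kap ^ 2] equals [sqnorm (mu v - rho z)] for a unit vector
    [v] along [x] and suitable [mu], [rho] of product [r |x|]. The product over the roots is then
    exactly the squared modulus of [mu ^ N v ^ N - rho ^ N], comparable to [mu ^ (2 N)] because
    [mu - rho >= kap]. *)
Lemma regularized_average (x : C) : exists2 mu : R,
 Num.max (nm x) r <= mu <= Num.max (nm x) r + kap &
 2 * (N%:R - 1) * ln mu + 2 * ln kap <= \sum_(z <- s) ln (sqnorm (x - r%:C * z) + kap ^+ 2)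
  <= 2 * N%:R * ln mu + 2 * ln 2.
Proof.
set q := nm x; have q0 : 0 <= q by exact: nm_ge0.
(* These are [mu + rho] and [mu - rho]. *)
pose al := sqrt ((q + r) ^+ 2 + kap ^+ 2); pose be := sqrt ((q - r) ^+ 2 + kap ^+ 2).
have al2 : al ^+ 2 = (q + r) ^+ 2 + kap ^+ 2 by rewrite sqr_sqrtr// addr_ge0 ?sqr_ge0.
have be2 : be ^+ 2 = (q - r) ^+ 2 + kap ^+ 2 by rewrite sqr_sqrtr// addr_ge0 ?sqr_ge0.
have al0 : 0 <= al by exact: sqrtr_ge0.
have be0 : 0 <= be by exact: sqrtr_ge0.
have bek : kap <= be by rewrite -(ler_pXn2r (n := 2)) ?nnegrE// ?be2 ?lerDr ?sqr_ge0// ltW.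
have ab : be <= al.
 rewrite ler_sqrt ?addr_ge0 ?sqr_ge0// lerD2r.
 have h : 0 <= q * r by rewrite mulr_ge0// ltW.
 have -> : (q + r) ^+ 2 = (q - r) ^+ 2 + 4 * (q * r) by ring.
 by rewrite lerDl mulr_ge0.
have k0 : 0 < kap := kap0.
have sqb c b : 0 <= c -> 0 <= b -> b ^+ 2 = c ^+ 2 + kap ^+ 2 -> c <= b <= c + kap.
 by move=> c0 b0 e; apply/andP; split; nra.
have al1 : q + r <= al <= q + r + kap by apply: sqb => //; rewrite addr_ge0// ltW.
have be1 : `|q - r| <= be <= `|q - r| + kap.
 by apply: sqb => //; rewrite be2 real_normK// num_real.
pose mu := (al + be) / 2; pose rho := (al - be) / 2.
have mr : mu * rho = r * q.
 by rewrite /mu /rho; have -> : (al + be) / 2 * ((al - be) / 2) = (al ^+ 2 - be ^+ 2) / 4 by [field]; rewrite al2 be2; field.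
have mr2 : mu ^+ 2 + rho ^+ 2 = q ^+ 2 + r ^+ 2 + kap ^+ 2.
 by rewrite /mu /rho; have -> : ((al + be) / 2) ^+ 2 + ((al - be) / 2) ^+ 2 = (al ^+ 2 + be ^+ 2) / 2 by [field]; rewrite al2 be2; field.
have rho0 : 0 <= rho by rewrite divr_ge0// subr_ge0.
have murho : kap <= mu - rho by rewrite /mu /rho; lra.
have mu0 : 0 < mu by lra.
have maxE : Num.max q r = (q + r + `|q - r|) / 2.
 have [h|h] := leP q r.
  by rewrite ler0_norm ?subr_le0//; field.
 by rewrite gtr0_norm ?subr_gt0//; field.
exists mu; first by rewrite maxE /mu; move: al1 be1 => /andP[? ?] /andP[? ?]; apply/andP; split; lra.
have [v v1 xv] : exists2 v : C, nm v = 1 & x = q%:C * v.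
 have [x0|x0] := eqVneq x 0.
  by exists 1; rewrite ?nm1// x0 /q x0 /nm -[0]/(0%:C) sqnorm_real expr0n sqrtr0 mul0r.
 have q00 : q != 0 by rewrite /q nm_eq0.
 have qC : q%:C != 0 by rewrite -[0]/(0%:C) (inj_eq (@complexI R)).
 exists (x / q%:C); last by rewrite mulrC divfK.
 have e : nm (x / q%:C) * q = q.
  have -> : nm (x / q%:C) * q = nm (x / q%:C * q%:C) by rewrite [RHS]nmM nm_real ger0_norm.
  by rewrite divfK.
 by apply: (mulIf q00); rewrite e mul1r.
have sv : sqnorm v = 1 by rewrite -nm_sqr v1 expr1n.
have key z : z \in s -> sqnorm (x - r%:C * z) + kap ^+ 2 = sqnorm (mu%:C * v - rho%:C * z).
 move=> zs; rewrite !sqnorm_sub !sqnormM !sqnorm_real (ns zs) sv !mulr1 -nm_sqr -/q.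
 have -> : Re (x * cj (r%:C * z)) = (r * q) * Re (v * cj z).
  by rewrite xv cjM cj_real !ReM !ImM /=; ring.
 have -> : Re (mu%:C * v * cj (rho%:C * z)) = (mu * rho) * Re (v * cj z).
  by rewrite cjM cj_real !ReM !ImM /=; ring.
 by rewrite mr mr2; ring.
rewrite big_seq (eq_bigr (fun z => ln (sqnorm (mu%:C * v - rho%:C * z)))); last by move=> z /key ->.
have pos z : z \in s -> 0 < sqnorm (mu%:C * v - rho%:C * z).
 by move=> /key <-; rewrite ltr_wpDl ?sqnorm_ge0// exprn_gt0.
have lnprod (t : seq C) : {subset t <= s} -> \sum_(z <- t | z \in s) ln (sqnorm (mu%:C * v - rho%:C * z)) =
  ln (\prod_(z <- t) sqnorm (mu%:C * v - rho%:C * z)) /\ 0 < \prod_(z <- t) sqnorm (mu%:C * v - rho%:C * z).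
 elim: t => [|z t ih] ts; first by rewrite !big_nil ln1.
 have zs : z \in s by apply: ts; rewrite inE eqxx.
 have [i1 i2] : _ := ih (fun y yt => ts y (mem_behead (s := z :: t) yt)).
 by rewrite !big_cons zs i1 lnM ?posrE ?pos// mulr_gt0 ?pos.
have [-> _] := lnprod s (fun z h => h).
rewrite -sqnorm_prod ps -nm_sqr !exprMn -!rmorphXn /=.
have muN : 0 < mu ^+ N by rewrite exprn_gt0.
have n1 : nm ((mu ^+ N)%:C * v ^+ N) = mu ^+ N.
 by rewrite nmM nmX v1 expr1n mulr1 nm_real ger0_norm// ltW.
have n2 : nm ((rho ^+ N)%:C) = rho ^+ N by rewrite nm_real ger0_norm// exprn_ge0.
have rhomu : rho <= mu by lra.
have up : nm ((mu ^+ N)%:C * v ^+ N - (rho ^+ N)%:C) <= 2 * mu ^+ N.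
 apply: le_trans (nm_triangle _ _) _; rewrite nmN n1 n2.
 have : rho ^+ N <= mu ^+ N by apply: lerXn2r; rewrite ?nnegrE// ltW.
 by lra.
have lo : kap * mu ^+ N.-1 <= nm ((mu ^+ N)%:C * v ^+ N - (rho ^+ N)%:C).
 apply: le_trans (nmB_ge _ _); rewrite n1 n2.
 rewrite -(prednK N0) /= [mu ^+ _.+1]exprS [rho ^+ _.+1]exprS.
 have h : rho ^+ N.-1 <= mu ^+ N.-1 by apply: lerXn2r; rewrite ?nnegrE// ltW.
 have h2 : rho * rho ^+ N.-1 <= rho * mu ^+ N.-1 by apply: ler_wpM2l.
 have h3 : kap * mu ^+ N.-1 <= (mu - rho) * mu ^+ N.-1 by apply: ler_wpM2r => //; rewrite exprn_ge0// ltW.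
 by rewrite mulrBl in h3; lra.
have lo0 : 0 < kap * mu ^+ N.-1 by rewrite mulr_gt0// exprn_gt0.
move: up lo; move: (nm _) => y up lo.
have y0 : 0 < y by lra.
have e1 : N%:R - 1 = N.-1%:R :> R by rewrite -{1}(prednK N0) -natr1 addrK.
rewrite lnXn// -[X in _ <= X <= _]mulr_natl -!mulrA -mulrDr ler_pM2l// -mulrDr ler_pM2l//.
apply/andP; split.
 rewrite e1 -[X in X + _ <= _]/(_%:R * _) addrC mulr_natl -lnXn// -lnM ?posrE ?exprn_gt0//.
 by rewrite ler_ln ?posrE.
rewrite mulr_natl -lnXn// addrC -lnM ?posrE//.
by rewrite ler_ln ?posrE// mulr_gt0.
Qed.

End unity_roots.

(** * From log-determinants on a circle to sums of logarithms of maxima *)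

Section hermitization.
Context {R : realType}.
Local Notation C := R[i].
Variables (r kap : R) (N : nat) (s : seq C).
Hypotheses (r0 : 0 < r) (kap01 : 0 < kap <= 1) (N0 : (0 < N)%N).
Hypotheses (ss : size s = N) (us : uniq s) (hs : forall z, z \in s -> z ^+ N = 1)
 (ps : forall x y : C, \prod_(z <- s) (x - y * z) = x ^+ N - y ^+ N).
Let k0 : 0 < kap. Proof. by case/andP: kap01. Qed.
Let k1 : kap <= 1. Proof. by case/andP: kap01. Qed.
Let NR : 0 < N%:R :> R. Proof. by rewrite ltr0n. Qed.

Variables (Lam Mx : R).
Hypotheses (Lam0 : 0 <= Lam) (Mx1 : 2 * ln (Lam + r + 1) <= Mx) (Mx2 : 2 * ln kap^-1 <= Mx).

Definition near (x z : C) := nm (x - r%:C * z) < r / (2 * N%:R).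

(** Two such roots, scaled by [r], would be closer to each other than the spacing [r / N]. *)
Lemma near_count (x : C) : (count (near x) s <= 1)%N.
Proof.
rewrite -size_filter; have := filter_uniq (near x) us.
have : forall z, z \in [seq z <- s | near x z] -> (z \in s) && near x z by move=> z; rewrite mem_filter andbC.
case: [seq z <- s | near x z] => [//|z1 [//|z2 t]] h /= /andP[]; rewrite inE negb_or => /andP[z12 _] _.
have /andP[s1 n1] := h z1 (mem_head _ _).
have /andP[s2 n2] : (z2 \in s) && near x z2 by apply: h; rewrite !inE eqxx orbT.
have := unity_root_spacing N0 (hs s1) (hs s2) z12.
have h1 : nm (r%:C * (z1 - z2)) < r / N%:R.
 have -> : r%:C * (z1 - z2) = (x - r%:C * z2) - (x - r%:C * z1) by ring.
 apply: le_lt_trans (nm_triangle _ _) _; rewrite nmN.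
 have -> : r / N%:R = r / (2 * N%:R) + r / (2 * N%:R) by field; rewrite gt_eqF.
 exact: ltrD.
move: h1; rewrite nmM nm_real gtr0_norm// ltr_pM2l// => h1 h2.
by have := lt_le_trans h1 h2; rewrite ltxx.
Qed.

Let lreg (y : C) : R := ln (sqnorm y + kap ^+ 2).

Let k2 : 0 < kap ^+ 2. Proof. by rewrite exprn_gt0. Qed.

Let Mx0 : 0 <= Mx.
Proof. by apply: le_trans Mx2; rewrite mulr_ge0// ln_ge0// invf_ge1. Qed.

Let lreg_le y : nm y <= Lam + r -> `|lreg y| <= Mx.
Proof.
move=> hy; have y0 := nm_ge0 y; rewrite ler_norml /lreg -nm_sqr; apply/andP; split.
 rewrite lerNl; apply: le_trans Mx2; rewrite -lnV ?posrE; last by rewrite ltr_wpDl ?sqr_ge0.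
 rewrite mulr_natl -lnXn ?invr_gt0// ler_ln ?posrE ?exprn_gt0 ?invr_gt0//; last by rewrite ltr_wpDl ?sqr_ge0.
 by rewrite exprVn lef_pV2 ?posrE// ?lerDr ?sqr_ge0// ltr_wpDl ?sqr_ge0.
apply: le_trans Mx1; have L1 : 0 < Lam + r + 1 by move: Lam0 r0; lra.
rewrite mulr_natl -lnXn// ler_ln ?posrE ?exprn_gt0//; last by rewrite ltr_wpDl ?sqr_ge0.
have : nm y ^+ 2 <= (Lam + r) ^+ 2 by apply: lerXn2r; rewrite ?nnegrE// addr_ge0// ltW.
have : kap ^+ 2 <= 1 by rewrite exprn_ile1// ltW.
by move: Lam0 r0; move: (nm y ^+ 2) (kap ^+ 2) => a b *; nra.
Qed.

Let cost : R := 2 * N%:R * kap / r + 2 + 2 * Mx.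

Let average_close x : nm x <= Lam ->
 `|\sum_(z <- s) lreg (x - r%:C * z) - N%:R * (2 * ln (Num.max (nm x) r))| <= cost.
Proof.
move=> hx; have [mu /andP[m1 m2] /andP[a1 a2]] := regularized_average r0 k0 N0 hs ps x.
set m := Num.max (nm x) r in m1 m2 *; have rm : r <= m by rewrite le_max lexx orbT.
have m0 : 0 < m by apply: lt_le_trans r0 rm.
have mu0 : 0 < mu by apply: lt_le_trans m0 m1.
have l1 : ln m <= ln mu by rewrite ler_ln.
have l2 : ln mu <= ln m + kap / r.
 have : ln mu - ln m <= kap / r.
  rewrite -lnV ?posrE// -lnM ?posrE ?invr_gt0//.
  apply: (@le_trans _ _ (mu / m - 1)).
   rewrite -ler_expR lnK ?posrE ?divr_gt0//; apply: le_trans (expR_ge1Dx _); lra.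
  have -> : mu / m - 1 = (mu - m) / m by field; rewrite gt_eqF.
  apply: ler_pM; rewrite ?subr_ge0 ?invr_ge0 ?(ltW m0)//; first by lra.
  by rewrite lef_pV2.
 by lra.
have l3 : 2 * ln mu <= Mx.
 apply: le_trans Mx1; rewrite ler_pM2l// ler_ln ?posrE//; last by move: Lam0 r0; lra.
 apply: le_trans m2 _; have : m <= Lam + r.
  by rewrite ge_max (le_trans hx) ?lerDl ?(ltW r0)//= lerDr.
 by move: k1; lra.
have l4 : 2 * - ln kap <= Mx by rewrite -lnV ?posrE.
have ln2 : ln 2 <= 1 :> R.
 by rewrite -ler_expR lnK ?posrE//; apply: le_trans (expR_ge1Dx _); lra.
have kr : 0 <= kap / r by rewrite divr_ge0// ltW.
have N1 : 1 <= N%:R :> R by rewrite ler1n.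
have M0 := Mx0.
have e : 2 * N%:R * kap / r = 2 * (N%:R * (kap / r)) by rewrite !mulrA.
have p1 : N%:R * ln mu <= N%:R * ln m + N%:R * (kap / r) by rewrite -mulrDr; apply: ler_wpM2l => //; exact: ltW.
have p2 : N%:R * ln m <= N%:R * ln mu by apply: ler_wpM2l => //; exact: ltW.
have p3 : 0 <= N%:R * (kap / r) by rewrite mulr_ge0.
move: a1 a2; rewrite /cost e -/lreg; rewrite -[2 * N%:R * _]mulrA -[2 * (N%:R - 1) * _]mulrA [(N%:R - 1) * _]mulrBl mul1r [N%:R * (2 * _)]mulrCA.
move: p1 p2 p3 l3 l4 ln2 M0; move: (\sum_(z <- s) _) (N%:R * ln mu) (N%:R * ln m) (N%:R * (kap / r)) (ln mu) (ln kap) (ln 2).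
by move=> S x1 x2 x3 x4 x5 x6 *; rewrite ler_norml; apply/andP; split; lra.
Qed.

Let eta : R := 4 * kap ^+ 2 * N%:R ^+ 2 / r ^+ 2.

Let lreg_far x z : ~~ near x z -> 0 <= lreg (x - r%:C * z) - ln (sqnorm (x - r%:C * z)) <= eta.
Proof.
rewrite /near -leNgt => h; set y := x - _ in h *.
have q0 : 0 < r / (2 * N%:R) by rewrite divr_gt0// mulr_gt0.
have y0 : 0 < nm y by apply: lt_le_trans q0 h.
have s0 : 0 < sqnorm y by rewrite -nm_sqr exprn_gt0.
have sk : 0 < sqnorm y + kap ^+ 2 by rewrite addr_gt0.
rewrite /lreg subr_ge0 ler_ln ?posrE//; apply/andP; split; first by rewrite lerDl ltW.
rewrite -lnV ?posrE// -lnM ?posrE ?invr_gt0//.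
apply: (@le_trans _ _ (kap ^+ 2 / sqnorm y)).
 rewrite -ler_expR lnK; last by rewrite posrE divr_gt0.
 apply: le_trans (expR_ge1Dx _); by rewrite mulrDl mulfV// gt_eqF.
have -> : eta = kap ^+ 2 / (r / (2 * N%:R)) ^+ 2 by rewrite /eta; field; rewrite !gt_eqF.
apply: ler_wpM2l; first exact: ltW.
by rewrite lef_pV2 ?posrE ?exprn_gt0// -nm_sqr; apply: lerXn2r; rewrite ?nnegrE// ltW.
Qed.

Variables (n : nat) (la lb : 'I_n -> C) (good : pred C) (dl : R).
Hypotheses (hla : forall i, nm (la i) <= Lam) (hlb : forall i, nm (lb i) <= Lam).
Hypotheses (dl0 : 0 <= dl) (hgood : forall z, z \in s -> good z ->
 `|\sum_i ln (sqnorm (la i - r%:C * z)) - \sum_i ln (sqnorm (lb i - r%:C * z))| <= dl * n%:R).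

(** Up to [cost] per point, summing the regularized logarithm over the roots gives [N] times
    [2 ln (Num.max (nm x) r)]. At a good root far from all points the regularization changes little
    and [hgood] compares the two sums; at the other roots the trivial bound [Mx] is used, and each
    point spoils at most one root. *)
Lemma log_max_difference :
 N%:R * `|\sum_i 2 * ln (Num.max (nm (la i)) r) - \sum_i 2 * ln (Num.max (nm (lb i)) r)| <=
 n%:R * (2 * cost) + N%:R * (n%:R * (dl + 2 * eta)) +
 ((count (predC good) s)%:R + 2 * n%:R) * (n%:R * (2 * Mx)).
Proof.
pose S (l : 'I_n -> C) z := \sum_i lreg (l i - r%:C * z).
have eta0 : 0 <= eta by rewrite /eta divr_ge0 ?mulr_ge0 ?exprn_ge0// ltW.
have hS l : (forall i, nm (l i) <= Lam) ->
  `|\sum_(z <- s) S l z - N%:R * \sum_i 2 * ln (Num.max (nm (l i)) r)| <= n%:R * cost.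
 move=> hl; rewrite /S exchange_big /= mulr_sumr -sumrB.
 apply: le_trans (ler_norm_sum _ _ _) _.
 apply: (@le_trans _ _ (\sum_(i < n) cost)); first by apply: ler_sum => i _; exact: average_close.
 by rewrite sumr_const card_ord mulr_natl.
have nz z : z \in s -> nm z = 1 by move=> /hs; exact: nm_unity_root.
have hnm x z : z \in s -> nm x <= Lam -> nm (x - r%:C * z) <= Lam + r.
 move=> zs hx; apply: le_trans (nm_triangle _ _) _; rewrite nmN nmM (nz _ zs) mulr1 nm_real gtr0_norm//.
 by rewrite lerD2r.
have SM l z : z \in s -> (forall i, nm (l i) <= Lam) -> `|S l z| <= n%:R * Mx.
 move=> zs hl; apply: le_trans (ler_norm_sum _ _ _) _.
 apply: (@le_trans _ _ (\sum_(i < n) Mx)); last by rewrite sumr_const card_ord mulr_natl.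
 by apply: ler_sum => i _; apply: lreg_le; exact: hnm.
pose bad z : R := (~~ good z)%:R + \sum_i (near (la i) z)%:R + \sum_i (near (lb i) z)%:R.
have sn0 (l : 'I_n -> C) z : 0 <= \sum_i (near (l i) z)%:R :> R by apply: sumr_ge0.
have bad0 z : 0 <= bad z by rewrite !addr_ge0.
have pt z : z \in s -> `|S la z - S lb z| <= n%:R * (dl + 2 * eta) + bad z * (n%:R * (2 * Mx)).
 move=> zs; have nM : 0 <= n%:R * (2 * Mx) by rewrite !mulr_ge0// Mx0.
 have nd : 0 <= n%:R * (dl + 2 * eta) by rewrite mulr_ge0// addr_ge0// mulr_ge0.
 have big1 : 1 <= bad z -> `|S la z - S lb z| <= n%:R * (dl + 2 * eta) + bad z * (n%:R * (2 * Mx)).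
  move=> b1; have := SM la z zs hla; have := SM lb z zs hlb.
  have := ler_normB (S la z) (S lb z).
  have : 1 * (n%:R * (2 * Mx)) <= bad z * (n%:R * (2 * Mx)) by apply: ler_wpM2r.
  by rewrite mul1r [n%:R * (2 * _)]mulrCA; move: (n%:R * Mx) (bad z * _) => x1 x2; lra.
 have [gz|gz] := boolP (good z); last first.
  by apply: big1; rewrite /bad gz -addrA lerDl addr_ge0.
 have [/existsP[i hi]|/existsPn ha] := boolP [exists i, near (la i) z].
  apply: big1; rewrite /bad (bigD1 i)//= hi.
  have : 0 <= \sum_(j | j != i) (near (la j) z)%:R :> R by apply: sumr_ge0.
  move=> h; have := sn0 lb z; have b0 : 0 <= (~~ good z)%:R :> R by [].
  by rewrite -[true%:R]/(1 : R); move: h; move: (\sum_(j | _) _) (\sum_i _) => x1 x2; lra.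
 have [/existsP[i hi]|/existsPn hb] := boolP [exists i, near (lb i) z].
  apply: big1; rewrite /bad (bigD1 (P := xpredT) (F := fun j => (near (lb j) z)%:R) i)//= hi.
  have : 0 <= \sum_(j | j != i) (near (lb j) z)%:R :> R by apply: sumr_ge0.
  move=> h; have := sn0 la z; have b0 : 0 <= (~~ good z)%:R :> R by [].
  by rewrite -[true%:R]/(1 : R); move: h; move: (\sum_(j | _) _) (\sum_i _) => x1 x2; lra.
 apply: (@le_trans _ _ (n%:R * (dl + 2 * eta))); last by rewrite lerDl mulr_ge0.
 have far l : (forall i, ~~ near (l i) z) ->
   0 <= S l z - \sum_i ln (sqnorm (l i - r%:C * z)) <= n%:R * eta.
  move=> hl; rewrite /S -sumrB; apply/andP; split.
   by apply: sumr_ge0 => i _; case/andP: (lreg_far (hl i)).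
  apply: (@le_trans _ _ (\sum_(i < n) eta)); last by rewrite sumr_const card_ord mulr_natl.
  by apply: ler_sum => i _; case/andP: (lreg_far (hl i)).
 have /andP[f1 f2] := far la ha; have /andP[f3 f4] := far lb hb.
 have := hgood zs gz; rewrite !ler_norml => /andP[g1 g2].
 rewrite mulrDr [n%:R * (2 * _)]mulrCA [n%:R * dl]mulrC; move: f1 f2 f3 f4 g1 g2.
 have : 0 <= n%:R * eta by rewrite mulr_ge0.
 move: (S la z) (S lb z) (n%:R * eta) (dl * n%:R) (\sum_i ln _) (\sum_i ln _) => x1 x2 x3 x4 x5 x6 *.
 by apply/andP; split; lra.
have near_le (l : 'I_n -> C) : \sum_(z <- s) \sum_i (near (l i) z)%:R <= n%:R :> R.
 rewrite exchange_big /=; apply: (@le_trans _ _ (\sum_(i < n) 1)); last by rewrite sumr_const card_ord.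
 apply: ler_sum => i _; have := near_count (l i); rewrite -(ler_nat R) -sum1_count natr_sum big_mkcond /=.
 by apply: le_trans; apply: ler_sum => z _; case: near.
have tot : \sum_(z <- s) `|S la z - S lb z| <= N%:R * (n%:R * (dl + 2 * eta)) +
  ((count (predC good) s)%:R + 2 * n%:R) * (n%:R * (2 * Mx)).
 apply: (@le_trans _ _ (\sum_(z <- s) (n%:R * (dl + 2 * eta) + bad z * (n%:R * (2 * Mx))))).
  by rewrite big_seq [leRHS]big_seq; apply: ler_sum => z zs; exact: pt.
 rewrite big_split /= big_const_seq count_predT ss iter_addr addr0 -[X in X + _ <= _]mulr_natl lerD2l.
 rewrite -mulr_suml; apply: ler_wpM2r; first by rewrite !mulr_ge0// Mx0.
 rewrite /bad !big_split /= -addrA; apply: lerD.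
  rewrite -sum1_count natr_sum [leRHS]big_mkcond /=; apply: ler_sum => z _; by case: (good z).
 by have := near_le la; have := near_le lb; move: (\sum_(z <- s) _) (\sum_(z <- s) _) => x1 x2; lra.
rewrite -(ger0_norm (ltW NR)) -normrM (ger0_norm (ltW NR)) mulrBr.
have := hS la hla; have := hS lb hlb; have := le_trans (ler_norm_sum _ _ _) tot; rewrite sumrB.
move: (\sum_(z <- s) S la z) (\sum_(z <- s) S lb z) (N%:R * \sum_i 2 * ln (Num.max (nm (la i)) r)).
move: (N%:R * \sum_i 2 * ln (Num.max (nm (lb i)) r)) => x1 x2 x3 x4.
rewrite [n%:R * (2 * cost)]mulrCA -addrA; move: (n%:R * cost) => x5.
set W := N%:R * _ + _; move: W => x6.
rewrite !ler_norml => /andP[h1 h2] /andP[h3 h4] /andP[h5 h6]; apply/andP; split; lra.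
Qed.

End hermitization.

(** * Approximation of test functions by logarithmic potentials *)

Section log_potential_combinations.
Context {R : realType}.
Local Notation C := R[i].

(** Twice the logarithmic potential at [y] of the uniform measure on the circle of radius [r] about
    the origin. *)
Definition lmax (r : R) (y : C) : R := 2 * ln (Num.max (nm y) r).

Definition lcomb (L : seq (R * C * R)) (x : C) : R :=
 \sum_(q <- L) q.1.1 * lmax q.2 (x - q.1.2).

(** Uniformly continuous functions with bounded support. *)
Definition ucc (f : C -> R) := (exists R0 : R, forall x, R0 < nm x -> f x = 0) /\
 forall e : R, 0 < e -> exists2 dl : R, 0 < dl & forall x y, nm (x - y) <= dl -> `|f x - f y| <= e.

Lemma ucc_lin (c : R) (f g : C -> R) : ucc f -> ucc g -> ucc (fun x => f x + c * g x).
Proof.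
move=> [[R1 h1] u1] [[R2 h2] u2]; split.
 by exists (Num.max R1 R2) => x; rewrite gt_max => /andP[/h1 -> /h2 ->]; rewrite mulr0 addr0.
move=> e e0; have e2 : 0 < e / 2 by rewrite divr_gt0.
have c1 : 0 < `|c| + 1 by rewrite ltr_wpDl.
have ec : 0 < e / 2 / (`|c| + 1) by rewrite divr_gt0.
have [d1 d10 k1] := u1 _ e2; have [d2 d20 k2] := u2 _ ec.
exists (Num.min d1 d2); first by rewrite lt_min d10.
move=> x y; rewrite le_min => /andP[/k1 a1 /k2 a2].
have -> : f x + c * g x - (f y + c * g y) = (f x - f y) + c * (g x - g y) by ring.
apply: le_trans (ler_normD _ _) _; rewrite normrM (splitr e); apply: lerD => //.
apply: (@le_trans _ _ ((`|c| + 1) * (e / 2 / (`|c| + 1)))).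
 by apply: ler_pM => //; rewrite lerDl.
by rewrite mulrC divfK// gt_eqF.
Qed.

Lemma ucc0 : ucc (fun=> 0).
Proof. by split; [exists 0|move=> e e0; exists 1 => // x y _; rewrite subrr normr0 ltW]. Qed.

Lemma ucc_sum (I : Type) (s : seq I) (c : I -> R) (g : I -> C -> R) :
 (forall i, ucc (g i)) -> ucc (fun x => \sum_(i <- s) c i * g i x).
Proof.
move=> ug; elim: s => [|i s ih].
 by rewrite (_ : (fun x => _) = (fun=> 0)); [exact: ucc0|apply/funext => x; rewrite big_nil].
rewrite (_ : (fun x => _) = (fun x => \sum_(j <- s) c j * g j x + c i * g i x)).
 exact: ucc_lin.
by apply/funext => x; rewrite big_cons addrC.
Qed.

(** Unlike a single potential it has bounded support: it equals [2 ln 2] up to distance [2 rho] and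
    vanishes beyond [4 rho]. *)
Definition bump (rho : R) (y : C) : R := lmax (4 * rho) y - lmax (2 * rho) y.

Lemma lmax_lipschitz r (x y : C) : 0 < r -> `|lmax r x - lmax r y| <= 2 / r * nm (x - y).
Proof.
move=> r0; have key (a b : C) : lmax r a - lmax r b <= 2 / r * nm (a - b).
 rewrite /lmax; set p := Num.max (nm a) r; set q := Num.max (nm b) r.
 have q0 : 0 < q by apply: lt_le_trans r0 _; rewrite le_max lexx orbT.
 have p0 : 0 < p by apply: lt_le_trans r0 _; rewrite le_max lexx orbT.
 have pq : p - q <= nm (a - b).
  have h := nmB_ge a b; have n0 := nm_ge0 (a - b).
  rewrite lerBlDr ge_max; apply/andP; split.
   have : nm b <= q by rewrite le_max lexx.
   by lra.
  have : r <= q by rewrite le_max lexx orbT.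
  by lra.
 rewrite -mulrBr -mulrA; apply: ler_wpM2l => //.
 rewrite -lnV ?posrE// -lnM ?posrE ?invr_gt0//.
 apply: (@le_trans _ _ (p / q - 1)).
  rewrite -ler_expR lnK ?posrE ?divr_gt0//; apply: le_trans (expR_ge1Dx _); lra.
 have -> : p / q - 1 = (p - q) / q by field; rewrite gt_eqF.
 have [h|h] := leP p q.
  apply: (@le_trans _ _ 0); first by rewrite mulr_le0_ge0 ?subr_le0 ?invr_ge0// ltW.
  by rewrite mulr_ge0 ?nm_ge0// invr_ge0 ltW.
 rewrite mulrC; apply: ler_pM; rewrite ?invr_ge0 ?subr_ge0 ?(ltW h) ?(ltW q0)//.
 by rewrite lef_pV2 ?posrE// le_max lexx orbT.
rewrite ler_norml key andbT lerNl opprB; apply: le_trans (key _ _) _.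
by rewrite -nmN opprB.
Qed.

Lemma bump_far rho y : 0 < rho -> 4 * rho <= nm y -> bump rho y = 0.
Proof.
move=> r0 h; rewrite /bump /lmax !max_l ?subrr//; apply: le_trans h; lra.
Qed.

Lemma bump_bound rho y : 0 < rho -> 0 <= bump rho y <= 2 * ln 2.
Proof.
move=> r0; rewrite /bump /lmax -mulrBr; have p1 : 0 < Num.max (nm y) (2 * rho) by rewrite lt_max mulr_gt0 ?orbT.
have p2 : 0 < Num.max (nm y) (4 * rho) by rewrite lt_max mulr_gt0 ?orbT.
apply/andP; split.
 rewrite mulr_ge0// subr_ge0 ler_ln ?posrE// ge_max !le_max lexx /=.
 by apply/orP; right; lra.
apply: ler_wpM2l => //; rewrite lerBlDr -lnM ?posrE// ler_ln ?posrE ?mulr_gt0//.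
have n0 := nm_ge0 y; have h1 : nm y <= Num.max (nm y) (2 * rho) by rewrite le_max lexx.
have h2 : 2 * rho <= Num.max (nm y) (2 * rho) by rewrite le_max lexx orbT.
by rewrite ge_max; apply/andP; split; lra.
Qed.

Lemma bump_near rho y : 0 < rho -> nm y <= 2 * rho -> bump rho y = 2 * ln 2.
Proof.
move=> r0 h; rewrite /bump /lmax !max_r//; last by apply: le_trans h _; lra.
rewrite -mulrBr -lnV ?posrE ?mulr_gt0// -lnM ?posrE ?invr_gt0 ?mulr_gt0//; congr (_ * ln _).
by field; rewrite gt_eqF.
Qed.

Lemma ucc_bump rho (a : C) : 0 < rho -> ucc (fun x => bump rho (x - a)).
Proof.
move=> r0; split.
 exists (4 * rho + nm a) => x hx; apply: bump_far => //.
 by have := nmB_ge x a; lra.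
move=> e e0; exists (e * rho / 2); first by rewrite divr_gt0// mulr_gt0.
move=> x y hxy; rewrite /bump.
have -> : lmax (4 * rho) (x - a) - lmax (2 * rho) (x - a) - (lmax (4 * rho) (y - a) - lmax (2 * rho) (y - a)) =
 (lmax (4 * rho) (x - a) - lmax (4 * rho) (y - a)) - (lmax (2 * rho) (x - a) - lmax (2 * rho) (y - a)) by ring.
apply: le_trans (ler_normB _ _) _.
have exy : x - a - (y - a) = x - y by ring.
have := @lmax_lipschitz (4 * rho) (x - a) (y - a) (mulr_gt0 (ltr0Sn _ _) r0).
have := @lmax_lipschitz (2 * rho) (x - a) (y - a) (mulr_gt0 (ltr0Sn _ _) r0).
rewrite exy => h1 h2; apply: le_trans (lerD h2 h1) _; rewrite -mulrDl.
apply: (@le_trans _ _ ((2 / (4 * rho) + 2 / (2 * rho)) * (e * rho / 2))).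
 by apply: ler_wpM2l => //; rewrite addr_ge0// divr_ge0// mulr_ge0// ltW.
have -> : (2 / (4 * rho) + 2 / (2 * rho)) * (e * rho / 2) = 3 / 4 * e by field; rewrite gt_eqF.
by lra.
Qed.

Lemma count_near_nat (u : R) n : \sum_(0 <= k < n) (`|k%:R - u| < 4)%R%:R <= 9 :> R.
Proof.
pose m := Num.truncn (Num.max 0 (u - 4)).
have -> : \sum_(0 <= k < n) (`|k%:R - u| < 4)%R%:R = (count (fun k => `|k%:R - u| < 4) (iota 0 n))%:R :> R.
 rewrite -sum1_count natr_sum [RHS]big_mkcond /= /index_iota subn0; apply: eq_bigr => k _; by case: ifP.
rewrite -[9]/(9%N%:R) ler_nat -size_filter -(size_iota m 9); apply: uniq_leq_size.
 by rewrite filter_uniq// iota_uniq.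
move=> k; rewrite mem_filter mem_iota => /andP[hk _]; move: hk; rewrite ltr_norml => /andP[h1 h2].
have m1 : m%:R <= Num.max 0 (u - 4) by rewrite truncn_le le_max lexx.
have m2 := truncnS_gt (Num.max 0 (u - 4)); rewrite -/m in m2.
have h3 : u - 4 < m.+1%:R by apply: le_lt_trans m2; rewrite le_max lexx orbT.
rewrite mem_iota; apply/andP; split.
 rewrite -ltnS -(ltr_nat R) -natr1; apply: le_lt_trans m1 _; rewrite gt_max.
 have : 0 <= k%:R :> R by [].
 by move=> k0; apply/andP; split; lra.
rewrite -(ltr_nat R) natrD; move: h3; rewrite -natr1 => h3; lra.
Qed.

Definition grid (rho : R) (B : nat) (kl : nat * nat) : C :=
 (rho * (kl.1%:R - B%:R)) +i* (rho * (kl.2%:R - B%:R)).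

Lemma nm_ge_Re (z : C) : `|Re z| <= nm z. Proof. exact: ler_normRe. Qed.
Lemma nm_ge_Im (z : C) : `|Im z| <= nm z. Proof. exact: ler_normIm. Qed.

(* A countable family of centres and radii that is dense enough for the approximation. *)
Definition lattice_param (q : R * C * R) := exists m k l B b : nat,
 q.1.2 = grid m.+1%:R^-1 B (k, l) /\ q.2 = 2 * b.+1%:R * m.+1%:R^-1.

Lemma lattice_param_gt0 q : lattice_param q -> 0 < q.2.
Proof. by move=> [m [k [l [B [b [_ ->]]]]]]; rewrite !mulr_gt0// invr_gt0. Qed.

(** Bumps on a fine grid, with coefficients the values of [f], do not come from a partition of
    unity: the total weight of the normalized bumps is only known to lie between [1/81] and [1] on
    the support of [f], [81 = 9 * 9] bounding the number that overlap. Subtracting them still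
    shrinks the supremum norm by a fixed factor, since [f] varies by at most [M / 162] across a
    bump. *)
Lemma lcomb_step (f : C -> R) (M : R) : ucc f -> 0 < M -> (forall x, `|f x| <= M) ->
 exists L : seq (R * C * R), [/\ (forall q, q \in L -> lattice_param q),
  ucc (lcomb L) & forall x, `|f x - lcomb L x| <= (1 - 1 / 162) * M].
Proof.
move=> [[R0 hR] uf] M0 fM.
have e0 : 0 < M / 162 by rewrite divr_gt0.
have [dl dl0 hdl] := uf _ e0; pose m := Num.truncn (4 / dl); pose rho : R := m.+1%:R^-1.
have rho0 : 0 < rho by rewrite invr_gt0.
have hrho : 4 * rho <= dl.
 have : 4 / dl < m.+1%:R by exact: truncnS_gt.
 by rewrite ltr_pdivrMr// mulrC => h; rewrite ler_pdivrMr// ltW.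
(* The grid reaches beyond [R0] in every direction, so that each point of the support lies in one of
   its cells. *)
pose B := (Num.truncn (Num.max R0 0 / rho)).+2; pose n := (2 * B)%N.
pose I := [seq (k, l) | k <- iota 0 n, l <- iota 0 n].
have ln20 : 0 < 2 * ln 2 :> R by rewrite mulr_gt0// ln_gt0// ltr1n.
pose K : R := 81 * (2 * ln 2); have K0 : 0 < K by rewrite mulr_gt0.
pose c kl := f (grid rho B kl) / K.
pose L := flatten [seq [:: (c kl, grid rho B kl, 4 * rho); (- c kl, grid rho B kl, 2 * rho)] | kl <- I].
have LE x : lcomb L x = \sum_(kl <- I) c kl * bump rho (x - grid rho B kl).
 suff gen (J : seq (nat * nat)) : lcomb (flatten [seq [:: (c kl, grid rho B kl, 4 * rho);
   (- c kl, grid rho B kl, 2 * rho)] | kl <- J]) x = \sum_(kl <- J) c kl * bump rho (x - grid rho B kl).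
  exact: gen.
 rewrite /lcomb; elim: J => [|kl J ih]; first by rewrite !big_nil.
 by rewrite /= !big_cons ih /bump /=; ring.
exists L; split.
- move=> q /flattenP[t /mapP[[k l] _ ->]]; rewrite !inE => /orP[] /eqP -> /=; exists m, k, l, B.
  by exists 1%N; split => //=; congr (_ * _); ring.
 by exists 0%N; split => //=; rewrite mulr1.
- rewrite (_ : lcomb L = fun x => \sum_(kl <- I) c kl * bump rho (x - grid rho B kl)); last exact/funext.
 by apply: ucc_sum => kl; exact: ucc_bump.
move=> x; rewrite LE; pose w kl := bump rho (x - grid rho B kl) / K.
have w0 kl : 0 <= w kl by rewrite divr_ge0 ?(ltW K0)//; case/andP: (bump_bound (x - grid rho B kl) rho0).
have W1 : \sum_(kl <- I) w kl <= 1.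
 rewrite /w -mulr_suml ler_pdivrMr// mul1r.
 pose p (u : R) (k : nat) : R := (`|k%:R - u| < 4)%R%:R.
 pose u1 := Re x / rho + B%:R; pose u2 := Im x / rho + B%:R.
 apply: (@le_trans _ _ (\sum_(kl <- I) p u1 kl.1 * p u2 kl.2 * (2 * ln 2))).
  apply: ler_sum => kl _; have /andP[b0 b1] := bump_bound (x - grid rho B kl) rho0.
  have hsmall (v : R) k (v' : R) : ~~ (`|k%:R - (v / rho + B%:R)| < 4) ->
    `|v - rho * (k%:R - B%:R)| <= nm (x - grid rho B kl) -> bump rho (x - grid rho B kl) = 0.
   move=> + hn; rewrite -leNgt => hk; apply: bump_far => //; apply: le_trans hn.
   have -> : v - rho * (k%:R - B%:R) = - (rho * (k%:R - (v / rho + B%:R))) by field; rewrite gt_eqF.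
   by rewrite normrN normrM gtr0_norm// mulrC ler_pM2l.
  rewrite /p; have [h1|h1] := boolP (`|kl.1%:R - u1| < 4); last first.
   rewrite (hsmall _ _ 0 h1) ?mul0r//; apply: le_trans (nm_ge_Re _); rewrite ReB//.
  have [h2|h2] := boolP (`|kl.2%:R - u2| < 4); last first.
   rewrite (hsmall _ _ 0 h2) ?mulr0 ?mul0r//; apply: le_trans (nm_ge_Im _); rewrite ImB//.
  by rewrite !mul1r.
 rewrite -mulr_suml /K; apply: ler_wpM2r; first exact: ltW.
 rewrite /I big_allpairs (eq_bigr (fun k => p u1 k * \sum_(l <- iota 0 n) p u2 l)); last first.
  by move=> k _; rewrite mulr_sumr.
 rewrite -mulr_suml.
 have hp u : 0 <= \sum_(k <- iota 0 n) p u k <= 9.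
  by rewrite sumr_ge0//=; have := count_near_nat u n; rewrite /index_iota subn0.
 have /andP[a1 a2] := hp u1; have /andP[a3 a4] := hp u2.
 have -> : 81 = 9 * 9 :> R by ring.
 exact: ler_pM.
have sE : f x - \sum_(kl <- I) c kl * bump rho (x - grid rho B kl) =
  f x * (1 - \sum_(kl <- I) w kl) + \sum_(kl <- I) w kl * (f x - f (grid rho B kl)).
 rewrite mulrBr mulr1 mulr_sumr -addrA; congr (_ + _); rewrite addrC -sumrB -sumrN.
 by apply: eq_bigr => kl _; rewrite /w /c; ring.
have h2 : `|\sum_(kl <- I) w kl * (f x - f (grid rho B kl))| <= M / 162.
 apply: le_trans (ler_norm_sum _ _ _) _.
 apply: (@le_trans _ _ (\sum_(kl <- I) w kl * (M / 162))); last first.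
  by rewrite -mulr_suml ler_piMl// ltW.
 apply: ler_sum => kl _; rewrite normrM ger0_norm//.
 have [h|h] := leP (nm (x - grid rho B kl)) (4 * rho).
  apply: ler_wpM2l => //; apply: hdl; exact: le_trans h hrho.
 by rewrite /w bump_far ?mul0r// ltW.
rewrite sE; apply: le_trans (ler_normD _ _) _.
have [fx|fx] := eqVneq (f x) 0.
 have -> : f x * (1 - \sum_(kl <- I) w kl) = 0 by rewrite fx mul0r.
 by rewrite normr0 add0r; apply: le_trans h2 _; move: M0; lra.
have xR : nm x <= R0 by rewrite leNgt; apply/negP => /hR h; rewrite h eqxx in fx.
have cell (v : R) : `|v| <= nm x -> exists2 k, (k < n)%N & 0 <= v - rho * (k%:R - B%:R) <= rho.
 move=> hv; have vB : 0 <= v / rho + B%:R.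
  have : - (Num.max R0 0 / rho) <= v / rho.
   rewrite -mulNr; apply: ler_wpM2r; first by rewrite invr_ge0 ltW.
   rewrite lerNl; apply: le_trans (_ : nm x <= _); first by apply: le_trans hv; rewrite lerNl -normrN lerNl; have := ler_norm (- v); rewrite normrN; lra.
   by rewrite le_max xR.
  have := truncnS_gt (Num.max R0 0 / rho); rewrite /B -natr1; lra.
 have hB : v / rho + 2 <= B%:R + 1.
  have : v / rho <= Num.max R0 0 / rho.
   apply: ler_wpM2r; first by rewrite invr_ge0 ltW.
   by apply: le_trans (ler_norm _) _; apply: le_trans hv _; rewrite le_max xR.
  have := truncnS_gt (Num.max R0 0 / rho); rewrite /B -natr1; lra.
 have t1 : (Num.truncn (v / rho + B%:R))%:R <= v / rho + B%:R by rewrite truncn_le.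
 have t2 := truncnS_gt (v / rho + B%:R); rewrite -natr1 in t2.
 exists (Num.truncn (v / rho + B%:R)).
  rewrite -(ltr_nat R) /n natrM; lra.
 have -> : v - rho * ((Num.truncn (v / rho + B%:R))%:R - B%:R) =
   rho * (v / rho + B%:R - (Num.truncn (v / rho + B%:R))%:R) by field; rewrite gt_eqF.
 apply/andP; split; first by rewrite mulr_ge0 ?subr_ge0// ltW.
 by apply: ler_piMr; [exact: ltW|move: t2; lra].
have [k kn /andP[k1 k2]] := cell (Re x) (nm_ge_Re x).
have [l ln_ /andP[l1 l2]] := cell (Im x) (nm_ge_Im x).
have W81 : 1 / 81 <= \sum_(kl <- I) w kl.
 have kI : (k, l) \in I by apply/allpairsP; exists (k, l); rewrite !mem_iota.
 rewrite (big_rem _ kI) /=; have -> : w (k, l) = 1 / 81.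
  rewrite /w bump_near//; first by rewrite /K invfM mulrCA divff ?mulr1 ?div1r// gt_eqF.
  suff : nm (x - grid rho B (k, l)) ^+ 2 <= (2 * rho) ^+ 2.
   by rewrite ler_pXn2r// nnegrE ?nm_ge0// mulr_ge0// ltW.
  rewrite nm_sqr /sqnorm ReB ImB /=.
  by move: k1 k2 l1 l2; move: (_ - rho * (k%:R - _)) (_ - rho * (l%:R - _)) => y1 y2; nra.
 by rewrite lerDl; apply: sumr_ge0.
have h1 : `|f x * (1 - \sum_(kl <- I) w kl)| <= M * (1 - 1 / 81).
 rewrite normrM; apply: ler_pM => //; rewrite ger0_norm; lra.
apply: le_trans (lerD h1 h2) _; move: M0; lra.
Qed.

Lemma lcomb_dense (f : C -> R) (M e : R) : ucc f -> (forall x, `|f x| <= M) -> 0 < e ->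
 exists L : seq (R * C * R), (forall q, q \in L -> lattice_param q) /\
  forall x, `|f x - lcomb L x| <= e.
Proof.
move=> uf fM e0; pose th : R := 1 - 1 / 162.
pose M' := Num.max M 1; have M0 : 0 < M' by rewrite lt_max ltr01 orbT.
have fM' x : `|f x| <= M' by rewrite le_max fM.
have it k : exists L : seq (R * C * R), [/\ (forall q, q \in L -> lattice_param q),
  ucc (lcomb L) & forall x, `|f x - lcomb L x| <= th ^+ k * M'].
 elim: k => [|k [L [L1 L2 L3]]].
  exists [::]; split => //; first by rewrite (_ : lcomb _ = fun=> 0); [exact: ucc0|apply/funext => x; rewrite /lcomb big_nil].
  by move=> x; rewrite /lcomb big_nil subr0 expr0 mul1r.
 have th0 : 0 < th by rewrite /th; lra.
 have ug : ucc (fun x => f x - lcomb L x).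
  by have := ucc_lin (-1) uf L2; under eq_fun do rewrite mulN1r.
 have Mk : 0 < th ^+ k * M' by rewrite mulr_gt0// exprn_gt0.
 have [L' [L1' L2' L3']] := lcomb_step ug Mk L3.
 have cE x : lcomb (L ++ L') x = lcomb L x + lcomb L' x by rewrite /lcomb big_cat.
 exists (L ++ L'); split.
 - by move=> q; rewrite mem_cat => /orP[/L1|/L1'].
 - rewrite (_ : lcomb _ = fun x => lcomb L x + 1 * lcomb L' x); first exact: ucc_lin.
  by apply/funext => x; rewrite cE mul1r.
 - by move=> x; rewrite cE opprD addrA exprS -mulrA; exact: L3'.
have [k hk] : exists k, th ^+ k * M' <= e.
 pose q := Num.truncn (162 * M' / e); exists q.+1.
 (* Bernoulli's inequality for the inverse of [th], in a form without division. *)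
 have h : (1 + 1 / 162 * q.+1%:R) * th ^+ q.+1 <= 1 :> R.
  elim: q.+1 => [|m ih]; first by rewrite mulr0 addr0 mulr1.
  have tm : 0 <= th ^+ m by rewrite exprn_ge0// /th; lra.
  apply: le_trans ih; rewrite exprS mulrA; apply: ler_wpM2r => //.
  have m0 : 0 <= m%:R :> R by [].
  by rewrite /th -natr1; nra.
 have hq : 162 * M' / e < q.+1%:R by exact: truncnS_gt.
 have tq : 0 <= th ^+ q.+1 by rewrite exprn_ge0// /th; lra.
 rewrite ltr_pdivrMr// in hq.
 have : th ^+ q.+1 * (162 * M') <= th ^+ q.+1 * (q.+1%:R * e) by apply: ler_wpM2l => //; exact: ltW.
 have : (1 + 1 / 162 * q.+1%:R) * th ^+ q.+1 * e <= 1 * e by apply: ler_wpM2r => //; exact: ltW.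
 have : 0 <= th ^+ q.+1 * e by rewrite mulr_ge0// ltW.
 have -> : (1 + 1 / 162 * q.+1%:R) * th ^+ q.+1 * e = th ^+ q.+1 * e + 1 / 162 * (th ^+ q.+1 * (q.+1%:R * e)) by ring.
 rewrite [th ^+ q.+1 * (162 * _)]mulrCA mul1r; move: (th ^+ _ * e) (th ^+ _ * (_ * e)) (th ^+ _ * M') => x1 x2 x3; lra.
have [L [L1 _ L3]] := it k; exists L; split => // x; exact: le_trans (L3 x) hk.
Qed.

End log_potential_combinations.

(** * Test functions are bounded and uniformly continuous *)

Section test_functions.
Context {R : realType}.
Local Notation C := R[i].

Lemma open_nm_ball (x : C) (e : R) : open [set y : C | nm (x - y) < e].
Proof.
rewrite openE => y /= hy; apply/nbhs_complexP; exists (e - nm (x - y)); first by rewrite subr_gt0.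
move=> w hw /=; have h : nm (y - w) < e - nm (x - y).
 rewrite -(ltr_pXn2r (n := 2)) ?nnegrE ?nm_ge0 ?subr_ge0 ?nm_sqr// ltW//.
have -> : x - w = (x - y) + (y - w) by ring.
by apply: le_lt_trans (nm_triangle _ _) _; lra.
Qed.

(** Three finite subcovers of the closed support: by discs of integer radius for its boundedness, by
    discs of continuity for a bound on [f], and by discs of half such radii for uniform continuity,
    as in the Heine-Cantor theorem. *)
Lemma test_function_ucc (f : C -> R) : test_function f -> ucc f /\ exists M : R, forall x, `|f x| <= M.
Proof.
move=> [cf]; set K := closure _; rewrite compact_cover => hK.
have fK x : ~ K x -> f x = 0.
 by move=> nK; apply/eqP; apply: contrapT => /negP fx; apply: nK; exact: subset_closure.
have bdd : exists R0 : R, forall x, K x -> nm x < R0.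
 have [] := hK nat setT (fun n => [set y : C | nm (0 - y) < n%:R]).
 - by move=> n _; exact: open_nm_ball.
 - by move=> x _; exists (Num.truncn (nm (0 - x))).+1 => //=; exact: truncnS_gt.
 - move=> D _ hD; exists (\sum_(n <- finmap.enum_fset D) n%:R) => x /hD [n /= nD].
  rewrite sub0r nmN => /lt_le_trans; apply; rewrite (big_rem n nD) /= lerDl.
  by apply: sumr_ge0.
have cfx x (e : R) : 0 < e -> exists2 d : R, 0 < d & forall y, nm (x - y) < d -> `|f x - f y| <= e.
 move=> e0; have := cf x; move=> /cvgrPdist_le/(_ _ e0)/nbhs_complexP[d d0 hd].
 exists d => // y hy; apply: hd; rewrite -nm_sqr ltr_pXn2r ?nnegrE ?nm_ge0// ltW//.
split; last first.
 have [] := hK C setT (fun x => [set y : C | nm (x - y) < sval (cid2 (cfx x 1 ltr01))]).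
 - by move=> x _; exact: open_nm_ball.
 - move=> x _; exists x => //=; case: cid2 => d d0 hd /=.
  by rewrite subrr -[0]/(0%:C) nm_real normr0.
 - move=> D _ hD; exists (\sum_(x <- finmap.enum_fset D) (`|f x| + 1)) => y.
  have s0 (s : seq C) : 0 <= \sum_(x <- s) (`|f x| + 1) by apply: sumr_ge0 => z _; rewrite addr_ge0.
  have [Ky|/fK ->] := pselect (K y); last by rewrite normr0.
  have [x /= xD] := hD y Ky; case: cid2 => d d0 hd /= hy; have h1 := hd y hy.
  rewrite (big_rem x xD) /=; apply: (@le_trans _ _ (`|f x| + 1)); last by rewrite lerDl.
  have -> : f y = f x - (f x - f y) by ring.
  by apply: le_trans (ler_normB _ _) _; rewrite lerD2l.
split.
 by have [R0 h] := bdd; exists R0 => x hx; apply: fK => /h h'; have := lt_trans hx h'; rewrite ltxx.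
move=> e e0; have e2 : 0 < e / 2 by rewrite divr_gt0.
pose dx x := sval (cid2 (cfx x _ e2)).
have dx0 x : 0 < dx x by rewrite /dx; case: cid2.
have dxP x y : nm (x - y) < dx x -> `|f x - f y| <= e / 2 by rewrite /dx; case: cid2 => d d0 hd /=; exact: hd.
have [] := hK C setT (fun x => [set y : C | nm (x - y) < dx x / 2]).
- by move=> x _; exact: open_nm_ball.
- by move=> x _; exists x => //=; rewrite subrr -[0]/(0%:C) nm_real normr0 divr_gt0.
move=> D _ hD.
have [dl dl0 hdl] : exists2 dl : R, 0 < dl & forall x, x \in finmap.enum_fset D -> dl < dx x / 2.
 elim: (finmap.enum_fset D) => [|x s [dl dl0 ih]]; first by exists 1.
 exists (Num.min dl (dx x / 4)); first by rewrite lt_min dl0 divr_gt0.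
 move=> y; rewrite inE => /orP[/eqP ->|/ih h]; last by rewrite gt_min h.
 by rewrite gt_min; apply/orP; right; have := dx0 x; lra.
have key x y : K x -> nm (x - y) <= dl -> `|f x - f y| <= e.
 move=> Kx hxy; have [z /= zD hz] := hD x Kx; have hd := hdl z zD.
 have h1 : `|f z - f x| <= e / 2 by apply: dxP; have := dx0 z; lra.
 have h2 : `|f z - f y| <= e / 2.
  apply: dxP; have -> : z - y = (z - x) + (x - y) by ring.
  by apply: le_lt_trans (nm_triangle _ _) _; lra.
 have -> : f x - f y = (f z - f y) - (f z - f x) by ring.
 by apply: le_trans (ler_normB _ _) _; lra.
exists dl => // x y hxy; have [/key|/fK fx] := pselect (K x); first exact.
have [Ky|/fK ->] := pselect (K y); last by rewrite fx subrr normr0 ltW.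
rewrite distrC; apply: key => //; by rewrite -nmN opprB.
Qed.

End test_functions.

(** * Eigenvalues and empirical spectral distributions *)

Section spectra.
Context {R : realType}.
Local Notation C := R[i].

Lemma char_poly_eigenvalues n (A : 'M[C]_n) :
 char_poly A = \prod_(z <- eigenvalues A) ('X - z%:P).
Proof.
by rewrite /eigenvalues; case: closed_field_poly_normal => s /= ->; rewrite (monicP (char_poly_monic A)) scale1r.
Qed.

Lemma size_eigenvalues n (A : 'M[C]_n) : size (eigenvalues A) = n.
Proof.
by apply/eqP; rewrite -eqSS -(size_prod_XsubC _ id) -char_poly_eigenvalues size_char_poly.
Qed.

Definition eigen n (A : 'M[C]_n) (i : 'I_n) : C := (eigenvalues A)`_i.

Lemma prod_eigen n (A : 'M[C]_n) z : \prod_i (eigen A i - z) = (-1) ^+ n * \det (z%:M - A).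
Proof.
have h : \det (z%:M - A) = \prod_i (z - eigen A i).
 have -> : \det (z%:M - A) = (char_poly A).[z].
  rewrite /char_poly -horner_evalE -det_map_mx; congr (\det _); apply/matrixP => i j.
  by rewrite [RHS]mxE -[RHS]/((char_poly_mx A i j).[z]) !mxE !hornerE hornerMn hornerX.
 rewrite char_poly_eigenvalues horner_prod (big_nth 0) size_eigenvalues big_mkord.
 by apply: eq_bigr => i _; rewrite hornerXsubC.
rewrite h (eq_bigr (fun i => (-1) * (z - eigen A i))); last by move=> i _; rewrite mulN1r opprB.
by rewrite big_split /= prodr_const card_ord.
Qed.

Lemma sqnorm_prod_eigen n (A : 'M[C]_n) z :
 \prod_i sqnorm (eigen A i - z) = sqnorm (\det (A - z%:M)).
Proof.
rewrite -sqnorm_prod prod_eigen; congr sqnorm.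
have -> : z%:M - A = (-1) *: (A - z%:M) by rewrite scaleN1r opprB.
by rewrite detZ mulrA -exprMn mulrNN mulr1 expr1n mul1r.
Qed.

(** Cauchy-Schwarz applied to each coordinate of [v *m A] for an eigenvector [v]. *)
Lemma eigen_bound n (A : 'M[C]_n) i : sqnorm (eigen A i) <= \sum_j sqn (row j A).
Proof.
case: n A i => [A [] //|n] A i; set z := eigen A i.
have d0 : \det (A - z%:M) = 0.
 apply/eqP; rewrite -sqnorm_eq0 -sqnorm_prod_eigen (bigD1 i)//= subrr.
 by rewrite -[X in sqnorm X]/(0%:C) sqnorm_real expr0n mul0r.
have [v v0 vA] : exists2 v : 'rV[C]_n.+1, v != 0 & v *m (A - z%:M) = 0.
 by apply/det0P; rewrite d0.
have vz : z *: v = v *m A by apply/eqP; rewrite -subr_eq0 -mul_mx_scalar -opprB -mulmxBr vA oppr0.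
have sv : 0 < sqn v by rewrite lt_def sqn_ge0 sqn_eq0 v0.
rewrite -(ler_pM2r sv) -sqnZ vz.
have -> : \sum_j sqn (row j A) = \sum_k sqn (row k A^T).
 rewrite /sqn exchange_big /=; apply: eq_bigr => k _; apply: eq_bigr => j _; by rewrite !mxE.
rewrite {1}/sqn mulr_suml; apply: ler_sum => k _.
have -> : (v *m A) 0 k = dot v (map_mx cj (row k A^T)).
 by rewrite dotE mxE; apply: eq_bigr => j _; rewrite !mxE cjK.
apply: le_trans (cauchy_schwarz _ _) _; rewrite mulrC; apply: ler_wpM2r; first exact: sqn_ge0.
by rewrite /sqn le_eqVlt; apply/orP; left; apply/eqP; apply: eq_bigr => j _; rewrite !mxE sqnormJ.
Qed.

Lemma hs_norm_sqr n (A : 'M[C]_n) : hs_norm A ^+ 2 = \sum_i sqn (row i A).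
Proof.
have e : Re (\tr (A *m A ^t*)) = \sum_i sqn (row i A).
 rewrite Re_trace; apply: eq_bigr => i _; rewrite sqnE; congr Re.
 rewrite mxE dotE; apply: eq_bigr => j _; by rewrite adjE !mxE.
by rewrite /hs_norm e sqr_sqrtr// sumr_ge0// => i _; exact: sqn_ge0.
Qed.

Lemma ge0_int_esd n (A : 'M[C]_n) (g : C -> R) : mble g -> (forall z, 0 <= g z) ->
 (\int[esd A]_z (g z)%:E = (n%:R^-1 * \sum_i g (eigen A i))%:E)%E.
Proof.
move=> mg g0; have mE : mble (EFin \o g) by exact/mble_EFinP.
have gE z : setT z -> (0 <= (g z)%:E)%E by rewrite lee_fin.
rewrite /esd ge0_integral_mscale//.
rewrite ge0_integral_measure_sum//.
rewrite (eq_bigr (fun i : 'I_n => (g (eigen A i))%:E)) => [|i _]; last first.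
 by rewrite integral_dirac// diracT mul1e.
by rewrite sumEFin -EFinM.
Qed.

Lemma int_esd n (A : 'M[C]_n) (f : C -> R) : mble f ->
 \int[esd A]_z f z = n%:R^-1 * \sum_i f (eigen A i).
Proof.
move=> mf; rewrite /Rintegral integralE.
have -> : (\int[esd A]_z ((fun x => (f x)%:E)^\+ z) = \int[esd A]_z (Num.max (f z) 0)%:E)%E.
 by apply: eq_integral => z _; rewrite funeposE EFin_max.
have -> : (\int[esd A]_z ((fun x => (f x)%:E)^\- z) = \int[esd A]_z (Num.max (- f z) 0)%:E)%E.
 by apply: eq_integral => z _; rewrite funenegE EFin_max.
rewrite !ge0_int_esd.
- rewrite /= -mulrBr -sumrB; congr (_ * _); apply: eq_bigr => i _.
 by case: (lerP (f (eigen A i)) 0) => h; [rewrite max_l ?oppr_ge0// sub0r opprK|rewrite max_r ?subr0// oppr_le0 ltW].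
- by apply: measurable_maxr => //; exact: mbleN.
- by move=> z; rewrite le_max lexx orbT.
- exact: measurable_maxr.
- by move=> z; rewrite le_max lexx orbT.
Qed.

End spectra.

(** * Measurability of sums over the eigenvalues *)

Section measurability_of_spectral_sums.
Context {R : realType} {d} {T : measurableType d}.
Local Notation C := R[i].

Lemma ln_le_sqrt (x : R) : 0 < x -> ln x <= 2 * sqrt x.
Proof.
move=> x0; have s0 : 0 < sqrt x by rewrite sqrtr_gt0.
by rewrite -{1}(sqr_sqrtr (ltW x0)) lnXn// -[leLHS]mulr_natl; apply: ler_wpM2l => //; exact: ln_le_id.
Qed.

(** The modulus of [y] keeps a distance of order [1 / N] from the radius [rho], which is slightly
    above [r]. Hence [y ^ N - rho ^ N] is comparable to the [N]-th power of the larger modulus, up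
    to a factor that disappears after division of the logarithm by [N]. *)
Lemma log_power_gap (r : R) (y : C) (N : nat) : 0 < r -> (0 < N)%N ->
 let rho := r + N.+1%:R^-1 in
 (r < nm y -> rho + N.+1%:R^-1 <= nm y) ->
 y ^+ N - rho%:C ^+ N != 0 /\
 `|N%:R^-1 * ln (sqnorm (y ^+ N - rho%:C ^+ N)) - lmax r y| <=
   (2 / r + 4 + 2 * (nm y + r + r^-1)) / N%:R + 4 * sqrt N.+1%:R / N%:R.
Proof.
move=> r0 N0 rho hy; pose u : R := N.+1%:R^-1; have u0 : 0 < u by rewrite invr_gt0.
have NR : 0 < N%:R :> R by rewrite ltr0n.
have u1 : u <= N%:R^-1 by rewrite lef_pV2 ?posrE// ler_nat.
have rhor : r < rho by rewrite /rho ltrDl.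
have rho0 : 0 < rho by apply: lt_trans rhor.
have y0 := nm_ge0 y; set q := nm y in hy y0 *.
pose M := Num.max q rho; have M0 : 0 < M by rewrite lt_max rho0 orbT.
have hX : nm (rho%:C ^+ N) = rho ^+ N by rewrite nmX nm_real gtr0_norm.
have hY : nm (y ^+ N) = q ^+ N by rewrite nmX.
have geo (a b : R) : 0 <= a -> a + u <= b -> u * b ^+ N.-1 <= b ^+ N - a ^+ N.
 move=> a0 ab; have b0 : 0 <= b by lra.
 rewrite -(prednK N0) /= [b ^+ _.+1]exprS [a ^+ _.+1]exprS.
 have h : a * a ^+ N.-1 <= a * b ^+ N.-1 by apply: ler_wpM2l => //; apply: lerXn2r; rewrite ?nnegrE//; lra.
 have h3 : u * b ^+ N.-1 <= (b - a) * b ^+ N.-1 by apply: ler_wpM2r; [exact: exprn_ge0|lra].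
 by rewrite mulrBl in h3; lra.
set Z := y ^+ N - rho%:C ^+ N.
have lo : u * M ^+ N.-1 <= nm Z.
 have [h|h] := leP q r.
  have -> : M = rho by rewrite /M max_r// (le_trans h)// ltW.
  apply: le_trans (geo q rho y0 _) _; first by rewrite /rho lerD2r.
  have -> : nm Z = nm (rho%:C ^+ N - y ^+ N) by rewrite -nmN /Z opprB.
  by rewrite -hX -hY; exact: nmB_ge.
 have hq := hy h; have -> : M = q by rewrite /M max_l//; apply: le_trans hq; rewrite lerDl invr_ge0.
 apply: le_trans (geo rho q (ltW rho0) hq) _.
 by rewrite -hX -hY /Z; exact: nmB_ge.
have up : nm Z <= 2 * M ^+ N.
 apply: le_trans (nm_triangle _ _) _; rewrite nmN hX hY mulr2n mulrDl mul1r; apply: lerD.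
  by apply: lerXn2r; rewrite ?nnegrE ?(ltW M0)// le_max lexx.
 by apply: lerXn2r; rewrite ?nnegrE ?(ltW M0) ?(ltW rho0)// le_max lexx orbT.
have lo0 : 0 < u * M ^+ N.-1 by rewrite mulr_gt0// exprn_gt0.
have Z0 : 0 < nm Z by apply: lt_le_trans lo0 lo.
split; first by rewrite -nm_eq0 gt_eqF.
pose m := Num.max q r; have m0 : 0 < m by rewrite lt_max r0 orbT.
have rm : r <= m by rewrite le_max lexx orbT.
have mM : m <= M by rewrite ge_max !le_max lexx (ltW rhor) orbT.
have Mm : M <= m + u.
 rewrite ge_max; apply/andP; split; last by rewrite /rho lerD2r.
 by apply: (@le_trans _ _ m); rewrite ?lerDl ?(ltW u0)// le_max lexx.
have l1 : ln m <= ln M by rewrite ler_ln.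
have l2 : ln M - ln m <= r^-1 * N%:R^-1.
 rewrite -lnV ?posrE// -lnM ?posrE ?invr_gt0//.
 apply: (@le_trans _ _ (M / m - 1)).
  rewrite -ler_expR lnK ?posrE ?divr_gt0//; apply: le_trans (expR_ge1Dx _); lra.
 have -> : M / m - 1 = m^-1 * (M - m) by field; rewrite gt_eqF.
 apply: ler_pM; rewrite ?invr_ge0 ?subr_ge0 ?(ltW m0)// ?lef_pV2//; lra.
have lM : ln M <= q + r + 1.
 apply: le_trans (ln_le_id M0) _; apply: le_trans Mm _.
 have : m <= q + r by rewrite ge_max lerDl lerDr y0 (ltW r0).
 have : u <= 1 by rewrite /u invf_le1// ler1n.
 by lra.
have lM' : - r^-1 <= ln M.
 rewrite lerNl -lnV ?posrE//; apply: le_trans (ln_le_id _) _; rewrite ?invr_gt0//.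
 by rewrite lef_pV2 ?posrE//; apply: le_trans rm mM.
have sZ : ln (sqnorm Z) = 2 * ln (nm Z) by rewrite -nm_sqr lnXn// mulr_natl.
have h1 : ln (nm Z) <= ln 2 + N%:R * ln M.
 by rewrite mulr_natl -lnXn// -lnM ?posrE ?exprn_gt0// ler_ln ?posrE ?mulr_gt0 ?exprn_gt0.
have h2 : - ln N.+1%:R + (N%:R - 1) * ln M <= ln (nm Z).
 have -> : N%:R - 1 = N.-1%:R :> R by rewrite -{1}(prednK N0) -natr1 addrK.
 rewrite mulr_natl -lnXn// -lnV ?posrE// -lnM ?posrE ?invr_gt0 ?exprn_gt0//.
 by rewrite ler_ln ?posrE.
have lnN : ln N.+1%:R <= 2 * sqrt N.+1%:R :> R by apply: ln_le_sqrt.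
have ln2 : ln 2 <= 1 :> R.
 by rewrite -ler_expR lnK ?posrE//; apply: le_trans (expR_ge1Dx _); lra.
have s0 : 0 <= sqrt N.+1%:R :> R by exact: sqrtr_ge0.
rewrite sZ /lmax -/q -/m.
have -> : N%:R^-1 * (2 * ln (nm Z)) - 2 * ln m = (2 * ln (nm Z) - N%:R * (2 * ln m)) / N%:R.
 by field; rewrite gt_eqF.
rewrite normrM [`|N%:R^-1|]gtr0_norm ?invr_gt0// -mulrDl; apply: ler_wpM2r; first by rewrite invr_ge0 ltW.
have l3 : N%:R * ln M <= N%:R * ln m + r^-1.
 have : N%:R * (ln M - ln m) <= N%:R * (r^-1 * N%:R^-1) by apply: ler_wpM2l => //; exact: ltW.
 rewrite [_ * (r^-1 * _)]mulrCA mulfV ?gt_eqF// mulr1 mulrBr; lra.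
have l4 : N%:R * ln m <= N%:R * ln M by apply: ler_wpM2l => //; exact: ltW.
have ir : 0 <= r^-1 by rewrite invr_ge0 ltW.
rewrite mulrBl mul1r in h2; rewrite mulrCA.
move: h1 h2 l3 l4 lnN ln2 s0 lM lM' ir y0 r0; clear.
move: (ln (nm Z)) (N%:R * ln M) (N%:R * ln m) (ln M) (ln N.+1%:R) (ln 2) (sqrt _) (r^-1) => x1 x2 x3 x4 x5 x6 x7 x8.
by move=> *; rewrite ler_norml; apply/andP; split; lra.
Qed.

(** The eigenvalues are produced by a choice that need not be measurable in [w], whereas
    determinants are measurable. Products of determinants over roots of unity are products of
    [y ^ N - rho ^ N] over the eigenvalues, and their logarithms divided by [N] converge pointwise
    to the sum. *)
Lemma meas_lmax_sum n (A : T -> 'M[C]_n) (r : R) (a : C) : 0 < r -> meas_mx A ->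
 mble (fun w => \sum_i lmax r (eigen (A w) i - a)).
Proof.
move=> r0 mA.
have sP N : exists s : seq C, (0 < N)%N -> forall x y : C, \prod_(z <- s) (x - y * z) = x ^+ N - y ^+ N.
 by case: N => [|N]; [exists [::]|have [s [_ _ _ h]] := @unity_rootsP R N.+1 isT; exists s].
pose s N := sval (cid (sP N)).
have hs N : (0 < N)%N -> forall x y : C, \prod_(z <- s N) (x - y * z) = x ^+ N - y ^+ N.
 by rewrite /s; case: cid.
(* The radius decreases to [r], and eventually every eigenvalue, taken about [a], has a modulus at
   least [1 / N.+1] away from it. *)
pose rho N : R := r + N.+1%:R^-1.
pose g N w : R := N%:R^-1 * ln (\prod_(z <- s N) sqnorm (\det (A w - (a + (rho N)%:C * z)%:M))).
have mg N : mble (g N).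
 apply: mbleM => //.
 have mp : mble (fun w => \prod_(z <- s N) sqnorm (\det (A w - (a + (rho N)%:C * z)%:M))).
  apply: measurable_prod => z _; apply: meas_sqnorm; apply: meas_det.
  by apply: meas_mxD => //; exact: meas_mx_cst.
 exact: mcomp mp.
have gE N w : (0 < N)%N -> g N w = N%:R^-1 * ln (\prod_i sqnorm ((eigen (A w) i - a) ^+ N - (rho N)%:C ^+ N)).
 move=> N0; rewrite /g; congr (_ * ln _).
 rewrite (eq_bigr (fun z => \prod_i sqnorm (eigen (A w) i - a - (rho N)%:C * z))); last first.
  by move=> z _; rewrite -sqnorm_prod_eigen; apply: eq_bigr => i _; rewrite opprD addrA.
 by rewrite exchange_big /=; apply: eq_bigr => i _; rewrite -sqnorm_prod hs.
apply: (@measurable_fun_cvg _ _ _ setT g) => // w _.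
apply/cvgrPdist_le => e e0.
have ln_prod (F : 'I_n -> C) : (forall i, F i != 0) -> ln (\prod_i sqnorm (F i)) = \sum_i ln (sqnorm (F i)).
 move=> F0; have pos i : 0 < sqnorm (F i) by rewrite lt_def sqnorm_ge0 sqnorm_eq0 F0.
 suff : ln (\prod_i sqnorm (F i)) = \sum_i ln (sqnorm (F i)) /\ 0 < \prod_i sqnorm (F i) by case.
 elim/big_ind2 : _ => //; first by rewrite ln1.
 by move=> x1 x2 y1 y2 [<- x0] [<- y0]; rewrite lnM ?posrE// mulr_gt0.
pose K : R := \sum_(i < n) ((2 / r + 4 + 2 * (nm (eigen (A w) i - a) + r + r^-1)) + 8).
have K0 : 0 <= K.
 apply: sumr_ge0 => i _; rewrite !addr_ge0 ?mulr_ge0 ?addr_ge0 ?nm_ge0 ?invr_ge0 ?(ltW r0)//.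
have gap i : exists N0, forall N, (N0 <= N)%N ->
  r < nm (eigen (A w) i - a) -> rho N + N.+1%:R^-1 <= nm (eigen (A w) i - a).
 have [h|h] := leP (nm (eigen (A w) i - a)) r; first by exists 0%N.
 set q := nm _ in h *; exists (Num.truncn (2 / (q - r))) => N hN _.
 have qr : 0 < q - r by rewrite subr_gt0.
 have : 2 / (q - r) <= N.+1%:R by apply: le_trans (ltW (truncnS_gt _)) _; rewrite ler_nat.
 rewrite ler_pdivrMr// mulrC -ler_pdivrMr// /rho => h1; have : 2 / N.+1%:R = N.+1%:R^-1 + N.+1%:R^-1 :> R by field.
 by move=> e2; rewrite -addrA -e2 -lerBrDl.
pose N1 := \max_i sval (cid (gap i)).
have N1P i N : (N1 <= N)%N -> r < nm (eigen (A w) i - a) -> rho N + N.+1%:R^-1 <= nm (eigen (A w) i - a).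
 move=> hN; case: (cid (gap i)) (leq_bigmax (F := fun i => sval (cid (gap i))) i) => N0 h /= hi.
 by apply: h; apply: leq_trans hN; exact: leq_trans hi _.
exists (maxn 1 (maxn N1 (Num.truncn ((K / e) ^+ 2)).+1)) => // N /=.
rewrite !geq_max => /and3P[N0 hN1 hNK]; have NR : 0 < N%:R :> R by rewrite ltr0n.
have gp i := @log_power_gap r (eigen (A w) i - a) N r0 N0 (@N1P i N hN1).
rewrite gE// ln_prod; last by move=> i; case: (gp i).
rewrite mulr_sumr -sumrB; apply: le_trans (ler_norm_sum _ _ _) _.
have sN : 0 < sqrt N%:R :> R by rewrite sqrtr_gt0.
have s2 : sqrt N%:R ^+ 2 = N%:R :> R by rewrite sqr_sqrtr.
apply: (@le_trans _ _ (K / sqrt N%:R)).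
 rewrite /K mulr_suml; apply: ler_sum => i _; rewrite distrC; case: (gp i) => _ h.
 apply: le_trans h _; rewrite [leRHS]mulrDl; apply: lerD.
  apply: ler_wpM2l; first by rewrite !addr_ge0 ?mulr_ge0 ?addr_ge0 ?nm_ge0 ?invr_ge0 ?(ltW r0).
  rewrite lef_pV2 ?posrE// -{2}s2 expr2 ler_peMr ?(ltW sN)//.
  by rewrite -[leLHS]sqrtr1 ler_sqrt// ler1n.
 rewrite ler_pdivrMr// -[X in _ / _ * X]s2 expr2 mulrA divfK ?gt_eqF//.
 have : sqrt N.+1%:R <= 2 * sqrt N%:R :> R.
  have -> : 2 * sqrt N%:R = sqrt (4 * N%:R) :> R.
   by rewrite sqrtrM// (_ : 4 = 2 ^+ 2) ?sqrtr_sqr ?ger0_norm//; ring.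
  rewrite ler_sqrt ?mulr_ge0// -natrM ler_nat; lia.
 by move: (sqrt N%:R) => x; lra.
rewrite ler_pdivrMr// mulrC -ler_pdivrMr//.
have Ke : 0 <= K / e by rewrite divr_ge0// ltW.
rewrite -(ger0_norm Ke) -sqrtr_sqr ler_sqrt//.
by apply: le_trans (ltW (truncnS_gt _)) _; rewrite ler_nat.
Qed.

Lemma meas_lcomb_sum n (A : T -> 'M[C]_n) (L : seq (R * C * R)) :
 (forall q, q \in L -> 0 < q.2) -> meas_mx A ->
 mble (fun w => \sum_i lcomb L (eigen (A w) i)).
Proof.
move=> hL mA; rewrite (_ : (fun w => _) = (fun w => \sum_(q <- L) q.1.1 * \sum_i lmax q.2 (eigen (A w) i - q.1.2))).
 elim: L hL => [|q L ih] hL; first by under eq_fun do rewrite big_nil; exact: measurable_cst.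
 under eq_fun do rewrite big_cons; apply: mbleD.
  by apply: mbleM => //; apply: meas_lmax_sum => //; apply: hL; rewrite mem_head.
 by apply: ih => q' hq; apply: hL; rewrite inE hq orbT.
apply/funext => w; rewrite /lcomb exchange_big /=; apply: eq_bigr => q _; by rewrite mulr_sumr.
Qed.

Lemma meas_spectral_sum n (A : T -> 'M[C]_n) (f : C -> R) : test_function f ->
 meas_mx A -> mble (fun w => \sum_i f (eigen (A w) i)).
Proof.
move=> /test_function_ucc[uf [M fM]] mA.
have ex' (k : nat) : exists L : seq (R * C * R), (forall q, q \in L -> lattice_param q) /\
  forall x, `|f x - lcomb L x| <= k.+1%:R^-1.
 by apply: lcomb_dense uf fM _; rewrite invr_gt0.
pose L k := sval (cid (ex' k)).
have [L1 L2] : (forall k q, q \in L k -> lattice_param q) /\ forall k x, `|f x - lcomb (L k) x| <= k.+1%:R^-1.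
 by split => k; rewrite /L; case: cid => ? [].
apply: (@measurable_fun_cvg _ _ _ setT (fun k w => \sum_i lcomb (L k) (eigen (A w) i))).
- by move=> k; apply: meas_lcomb_sum => // q /L1; exact: lattice_param_gt0.
move=> w _; apply/cvgrPdist_le => e e0.
exists (Num.truncn (n%:R / e)) => // k /= hk.
rewrite -sumrB; apply: le_trans (ler_norm_sum _ _ _) _.
apply: (@le_trans _ _ (\sum_(i < n) k.+1%:R^-1)); first by apply: ler_sum => i _; exact: L2.
rewrite sumr_const card_ord -[leLHS]mulr_natl ler_pdivrMr// mulrC -ler_pdivrMr//.
by apply: le_trans (ltW (truncnS_gt _)) _; rewrite ler_nat.
Qed.

End measurability_of_spectral_sums.

(** * Freezing one of two independent families *)

Section decoupling.
Context {R : realType} {d} {T : measurableType d} (P : probability T R).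
Local Notation C := R[i].

Definition generators (F : set (T -> C)) : set (set T) :=
 [set A | exists2 f, F f & exists2 B : set C, measurable B & A = f @^-1` B].

Lemma sigma_of_measurable {I} (F : set (T -> C)) (U : T -> arr R I) (A : set (arr R I)) :
 (forall i, measurable_fun [set: g_sigma_algebraType (generators F)] (fun w => U w i : C)) ->
 measurable A -> sigma_of F (U @^-1` A).
Proof.
move=> mU mA; have h : measurable_fun [set: g_sigma_algebraType (generators F)] (U : g_sigma_algebraType (generators F) -> arr R I).
 by apply/meas_arrP.
by have := h measurableT A mA; rewrite setTI.
Qed.

Lemma decouple {I J} (F G : set (T -> C)) (U : T -> arr R I) (V : T -> arr R J)
  (b : arr R I * arr R J -> bool) (c : R) :
 independent_families P F G ->
 (forall i, measurable_fun [set: g_sigma_algebraType (generators F)] (fun w => U w i : C)) ->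
 (forall i, measurable_fun [set: g_sigma_algebraType (generators G)] (fun w => V w i : C)) ->
 mble U -> mble V -> mble b ->
 (forall u, (P [set w | b (u, V w)] <= c%:E)%E) -> (P [set w | b (U w, V w)] <= c%:E)%E.
Proof.
move=> hind sU sV mU mV mb h.
pose phi1 (w : T) := (U w, V w); pose phi2 (p : T * T) := (U p.1, V p.2).
have m1 : mble phi1 by exact: measurable_fun_pair.
have m2 : mble phi2.
 by apply: measurable_fun_pair; [exact: (mcomp mU measurable_fst)|exact: (mcomp mV measurable_snd)].
pose S : set (arr R I * arr R J) := [set p | b p].
have mS : measurable S by exact: meas_set_bool.
have key : pushforward P phi1 S = pushforward (P \x P)%E phi2 S.
 pose Gr : set (set (arr R I * arr R J)) := [set A `*` B | A in measurable & B in measurable].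
 apply: (measure_unique Gr (fun=> setT)) => //.
 - exact: measurable_prod_measurableType.
 - move=> _ _ [A mA [B mB <-]] [A' mA' [B' mB' <-]].
  exists (A `&` A'); first exact: measurableI.
  by exists (B `&` B'); [exact: measurableI|rewrite setXI].
 - by move=> _; exists setT => //; exists setT => //; rewrite setXTT.
 - by rewrite bigcup_const//; exists 0%N.
 - move=> _ [A mA [B mB <-]]; rewrite /pushforward.
  rewrite -[LHS]/(P (U @^-1` A `&` V @^-1` B)) -[RHS]/((P \x P)%E ((U @^-1` A) `*` (V @^-1` B))).
  rewrite product_measure1E; [|by rewrite -[X in measurable X]setTI; exact: mU|by rewrite -[X in measurable X]setTI; exact: mV].
  by apply: hind; exact: sigma_of_measurable.
 - by move=> _; rewrite -[X in (X < _)%E]/(P setT) probability_setT ltry.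
have -> : P [set w | b (U w, V w)] = pushforward P phi1 S by [].
rewrite key -[X in (X <= _)%E]/((P \x P)%E (phi2 @^-1` S)); apply: prod_prob_le; first by rewrite -[X in measurable X]setTI; exact: m2.
by move=> w; exact: (h (U w)).
Qed.

End decoupling.

(** * Arrays of iid copies *)

Section iid_arrays.
Context {R : realType} {d} {T : measurableType d} (P : probability T R).
Local Notation C := R[i].

Definition block n (X : nat -> nat -> {RV P >-> C}) (w : T) : arr R ('I_n * 'I_n) :=
 fun ij => X ij.1 ij.2 w.

(** The constants are stated up to weakening, so that common ones can be chosen for [x] and [y] and
    for all sizes. *)
Lemma iid_good_array (x : {RV P >-> C}) (X : nat -> nat -> {RV P >-> C}) : standardized x ->
 iid_copies x X -> exists kap p : R, exists B : R -> R, [/\ 0 < kap <= 1, 0 < p <= 1,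
  (forall tau, 0 <= B tau) &
  forall kap' p' (B' : R -> R) n, kap' <= kap -> p' <= p -> (forall tau, B tau <= B' tau) ->
   good_array P kap' p' B' (block (n := n) X)].
Proof.
move=> hx [miX law]; have [kap [p [hk hp hc]]] := anticonc_exists hx.
have tB tau : exists B : R, 0 <= B /\ (0 < tau ->
  (\int[P]_w (sqnorm (x w) - Num.min (sqnorm (x w)) B)%:E <= tau%:E)%E).
 have [t0|t0] := ltP 0 tau; last by exists 0; split => // t1; move: t0; rewrite leNgt t1.
 by have [B [B0 hB]] := tail_exists hx t0; exists B.
pose B tau := sval (cid (tB tau)).
have hB tau : 0 <= B tau /\ (0 < tau ->
  (\int[P]_w (sqnorm (x w) - Num.min (sqnorm (x w)) (B tau))%:E <= tau%:E)%E).
 by rewrite /B; case: cid.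
have msn : mble (fun z : C => sqnorm z) by apply: meas_sqnorm.
exists kap, p, B; split => // [tau|kap' p' B' n hk' hp' hB']; first by case: (hB tau).
have mb : mble (block (n := n) X) by apply/meas_arrP => ij; exact: measurable_funPT.
have lw i j : forall A, measurable A -> distribution P (X i j) A = distribution P x A by move=> A; exact: law.
split => //.
- pose phi (ij : 'I_n * 'I_n) : nat * nat := (val ij.1, val ij.2).
 have iphi : injective phi by move=> [a b] [a' b'] [/val_inj -> /val_inj ->].
 by apply: (indep_reindex iphi _ (mutually_independent_indep miX)) => ij; exact: EM.
- move=> ij c; have mc : mble (fun z : C => sqnorm (z - c)).
  by apply: meas_sqnorm; exact: (meas_addC (@measurable_id _ C setT) (measurable_cst (- c))).
 have mbool k : mble (fun z : C => sqnorm (z - c) <= k) by exact: mble_ler.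
 rewrite /block (law_prob (mbool kap') (lw _ _)).
 apply: (@le_trans _ _ (1 - p)%:E); last by rewrite lee_fin lerD2l lerN2.
 apply: le_trans (hc c); apply: le_measure; rewrite ?inE.
 + by apply: meas_set_bool; exact: (mcomp (mbool kap') (measurable_funPT x)).
 + by apply: meas_set_bool; exact: (mcomp (mbool kap) (measurable_funPT x)).
 + by move=> w /= /le_trans; apply.
move=> tau t0 ij; have [h1 h2 _] := hx; rewrite unlock in h1; rewrite unlock in h2.
split.
- by rewrite -[RHS]h1; apply: (law_integral (@meas_Re R) (lw _ _)).
- by rewrite -[RHS]h2; apply: (law_integral (@meas_Im R) (lw _ _)).
- by rewrite -(int_sqnorm1 hx); apply: (law_integral msn (lw _ _)).
have [B0 hBt] := hB tau.
have mt (b : R) : mble (fun z : C => sqnorm z - Num.min (sqnorm z) b).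
 by apply: mbleB => //; exact: measurable_minr.
rewrite [leLHS](law_integral (mt (B' tau)) (lw ij.1 ij.2)); apply: le_trans (hBt t0); apply: int_le.
- exact: (mcomp (mt (B' tau)) (measurable_funPT x)).
- exact: (mcomp (mt (B tau)) (measurable_funPT x)).
- by move=> w; rewrite subr_ge0 ge_min lexx.
- by move=> w; rewrite lerD2l lerN2 le_min !ge_min lexx (hB' tau) !orbT.
Qed.

End iid_arrays.

(** * The hermitized model *)

Section hermitized_model.
Context {R : realType}.
Local Notation C := R[i].

Lemma meas_shifted d' (T' : measurableType d') n (M K L : T' -> 'M[C]_n) z :
 meas_mx M -> meas_mx K -> meas_mx L ->
 (forall w, K w \in unitmx) -> (forall w, L w \in unitmx) ->
 meas_mx (fun w => shifted (M w) (K w) (L w) z).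
Proof.
move=> mM mK mL uK uL; have iK := meas_invmx mK uK; have iL := meas_invmx mL uL.
apply: meas_mxD.
 apply: meas_mxZ; first exact: measurable_cst.
 by apply: meas_mxM => //; exact: meas_mxM.
by apply: meas_mxN; apply: meas_mxZ; [exact: measurable_cst|exact: meas_mxM].
Qed.

Lemma shifted_factor n (M K L Q : 'M[C]_n) z : K \in unitmx -> L \in unitmx ->
 normalize (M + K *m Q *m L) - z%:M = K *m (normalize Q + shifted M K L z) *m L.
Proof.
move=> uK uL; pose c : C := ((sqrt (n%:R : R))^-1)%:C.
have e1 : K *m (c *: Q) *m L = c *: (K *m Q *m L) by rewrite -scalemxAr -scalemxAl.
have e2 : K *m (c *: (invmx K *m M *m invmx L)) *m L = c *: M.
 by rewrite -scalemxAr -scalemxAl !mulmxA mulmxV// mul1mx -mulmxA mulVmx// mulmx1.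
have e3 : K *m (z *: (invmx K *m invmx L)) *m L = z%:M.
 by rewrite -scalemxAr -scalemxAl !mulmxA mulmxV// mul1mx mulVmx// scalemx1.
rewrite /shifted /normalize -/c mulmxDr mulmxBr mulmxDl mulmxBl e1 e2 e3 scalerDr.
by rewrite [c *: M + _]addrC addrA.
Qed.

Definition mxof n (f : arr R ('I_n * 'I_n)) : 'M[C]_n := \matrix_(i, j) f (i, j).

Lemma hmatE n (F : 'M[C]_n) f : hmat F f = normalize (mxof f) + F.
Proof. by apply/matrixP => i j; rewrite !mxE. Qed.

Lemma sum_sqnZ n (c : C) (Q : 'M[C]_n) : \sum_i sqn (row i (c *: Q)) = sqnorm c * \sum_i sqn (row i Q).
Proof. by rewrite mulr_sumr; apply: eq_bigr => i _; rewrite linearZ sqnZ. Qed.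

Lemma sum_sqn_normalize n (Q : 'M[C]_n) : \sum_i sqn (row i (normalize Q)) = n%:R^-1 * hs_norm Q ^+ 2.
Proof. by rewrite sum_sqnZ hs_norm_sqr sqnorm_real exprVn sqr_sqrtr. Qed.

Lemma summands_le (a b c d' e : R) : 0 <= a -> 0 <= b -> 0 <= c -> 0 <= d' ->
 a + b + c + d' <= e -> [/\ 0 <= e, a <= e, b <= e, c <= e & d' <= e].
Proof. by move=> *; split; lra. Qed.

Lemma sum_sqnB n (S1 S2 : 'M[C]_n) :
 \sum_i sqn (row i (S1 - S2)) <= 2 * \sum_i sqn (row i S1) + 2 * \sum_i sqn (row i S2).
Proof.
rewrite !mulr_sumr -big_split; apply: ler_sum => i _ /=.
by rewrite linearB /= -[sqn (row i S2)]sqnN; exact: sqnD_le.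
Qed.

Lemma bound_expr_parts n (A B M K L : 'M[C]_n.+1) c : bound_expr A B M K L <= c ->
 [/\ 0 <= c, \sum_i sqn (row i (normalize A)) <= c * n.+1%:R,
  \sum_i sqn (row i (normalize B)) <= c * n.+1%:R,
  \sum_i sqn (row i (normalize (invmx K *m M *m invmx L))) <= c * n.+1%:R &
  \sum_i sqn (row i (invmx K *m invmx L)) <= c * n.+1%:R].
Proof.
have N0 : 0 < n.+1%:R :> R by rewrite ltr0n.
have p2 (Q : 'M[C]_n.+1) : 0 <= n.+1%:R ^- 2 * hs_norm Q ^+ 2 by rewrite mulr_ge0 ?sqr_ge0// invr_ge0 exprn_ge0// ltW.
have p1 (Q : 'M[C]_n.+1) : 0 <= n.+1%:R^-1 * hs_norm Q ^+ 2 by rewrite mulr_ge0 ?sqr_ge0// invr_ge0 ltW.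
have k2 (Q : 'M[C]_n.+1) : n.+1%:R ^- 2 * hs_norm Q ^+ 2 <= c -> \sum_i sqn (row i (normalize Q)) <= c * n.+1%:R.
 rewrite sum_sqn_normalize -(ler_pM2r N0); apply: le_trans.
 by rewrite mulrAC expr2 invfM divfK// gt_eqF.
have k1 (Q : 'M[C]_n.+1) : n.+1%:R^-1 * hs_norm Q ^+ 2 <= c -> \sum_i sqn (row i Q) <= c * n.+1%:R.
 by rewrite -hs_norm_sqr ler_pdivrMl// mulrC.
move=> /(summands_le (p2 _) (p2 _) (p2 _) (p1 _))[c0 a1 a2 a3 a4].
by split; [exact: c0|exact: k2|exact: k2|exact: k2|exact: k1].
Qed.

Lemma combine_le (s1 s2 c N q : R) : s1 <= c * N -> s2 <= q * (c * N) ->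
 2 * s1 + 2 * s2 <= (2 * c + 2 * q * c) * N.
Proof.
move=> h1 h2; have -> : (2 * c + 2 * q * c) * N = 2 * (c * N) + 2 * (q * (c * N)) by ring.
by lra.
Qed.

Lemma diff_common_le (s1 s2 k x y l a : R) : s1 = k + x + l -> s2 = k + y + l ->
 `|x - y| <= a -> `|s1 - s2| <= a.
Proof. by move=> -> -> h; have -> : k + x + l - (k + y + l) = x - y by ring. Qed.

Lemma shifted_bound n (A B M K L : 'M[C]_n.+1) c z rho : bound_expr A B M K L <= c -> nm z <= rho ->
 \sum_i sqn (row i (shifted M K L z)) <= (2 * c + 2 * rho ^+ 2 * c) * n.+1%:R.
Proof.
move=> /bound_expr_parts[c0 _ _ h3 h4] hz.
apply: (@le_trans _ _ (2 * \sum_i sqn (row i (normalize (invmx K *m M *m invmx L))) +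
 2 * \sum_i sqn (row i (z *: (invmx K *m invmx L))))).
 exact: sum_sqnB.
have zz : sqnorm z <= rho ^+ 2.
 by rewrite -nm_sqr; apply: lerXn2r; rewrite ?nnegrE ?nm_ge0// (le_trans (nm_ge0 z)).
have h5 : sqnorm z * \sum_i sqn (row i (invmx K *m invmx L)) <= rho ^+ 2 * (c * n.+1%:R).
 by apply: ler_pM; rewrite ?sqnorm_ge0// sumr_ge0// => i _; exact: sqn_ge0.
by apply: (combine_le h3); rewrite sum_sqnZ.
Qed.

Lemma eigen_le n (A : 'M[C]_n.+1) c i : 0 <= c -> \sum_i sqn (row i A) <= c * n.+1%:R ->
 nm (eigen A i) <= c + n.+1%:R.
Proof.
move=> c0 h; suff : nm (eigen A i) ^+ 2 <= (c + n.+1%:R) ^+ 2.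
 by rewrite ler_pXn2r// nnegrE ?nm_ge0// addr_ge0.
rewrite nm_sqr; apply: le_trans (eigen_bound A i) _; apply: le_trans h _.
have := ler0n R n.+1; move: (n.+1%:R : R) => N N0; nra.
Qed.

Lemma ln_prod_sqnorm (I : finType) (F : I -> C) : 0 < \prod_i sqnorm (F i) ->
 ln (\prod_i sqnorm (F i)) = \sum_i ln (sqnorm (F i)).
Proof.
move=> h; have pos i : 0 < sqnorm (F i).
 rewrite lt_def sqnorm_ge0 andbT; apply: contraTneq h => e.
 by rewrite (bigD1 i)//= e mul0r ltxx.
suff : ln (\prod_i sqnorm (F i)) = \sum_i ln (sqnorm (F i)) /\ 0 < \prod_i sqnorm (F i) by case.
elim/big_ind2 : _ => //; first by rewrite ln1.
by move=> x1 x2 y1 y2 [<- x0] [<- y0]; rewrite lnM ?posrE// mulr_gt0.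
Qed.

(** The determinants of [K] and [L] contribute the same terms to both models and cancel. *)
Lemma close_dets_eigen n (M K L : 'M[C]_n.+1) (f g : arr R ('I_n.+1 * 'I_n.+1)) z a :
 K \in unitmx -> L \in unitmx -> close_dets (shifted M K L z) a f g ->
 `|\sum_i ln (sqnorm (eigen (normalize (M + K *m mxof f *m L)) i - z)) -
  \sum_i ln (sqnorm (eigen (normalize (M + K *m mxof g *m L)) i - z))| <= a.
Proof.
move=> uK uL /and3P[f0 g0 h].
have sK : 0 < sqnorm (\det K) by rewrite lt_def sqnorm_ge0 sqnorm_eq0 -unitfE -unitmxE uK.
have sL : 0 < sqnorm (\det L) by rewrite lt_def sqnorm_ge0 sqnorm_eq0 -unitfE -unitmxE uL.
have key q : 0 < sqnorm (\det (hmat (shifted M K L z) q)) ->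
  \sum_i ln (sqnorm (eigen (normalize (M + K *m mxof q *m L)) i - z)) =
  ln (sqnorm (\det K)) + ln (sqnorm (\det (hmat (shifted M K L z) q))) + ln (sqnorm (\det L)).
 move=> q0; have e := sqnorm_prod_eigen (normalize (M + K *m mxof q *m L)) z.
 rewrite shifted_factor// -hmatE !det_mulmx !sqnormM in e.
 rewrite -ln_prod_sqnorm e ?mulr_gt0// !lnM ?posrE ?mulr_gt0//.
exact: (diff_common_le (key f f0) (key g g0) h).
Qed.

Lemma eighth_root (N : R) : 1 <= N -> let v := sqrt (sqrt (sqrt N)) in
 [/\ v ^+ 8 = N, 1 <= v, v * v = sqrt (sqrt N) & ln N <= 8 * v].
Proof.
move=> N1 v; have N0 : 0 <= N by apply: le_trans N1.
have vv : v ^+ 2 = sqrt (sqrt N) by rewrite sqr_sqrtr ?sqrtr_ge0.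
have v8 : v ^+ 8 = N.
 by rewrite (exprM v 2 4) vv (exprM _ 2 2) !sqr_sqrtr ?sqrtr_ge0.
have v1 : 1 <= v.
 have s1 (q : R) : 1 <= q -> 1 <= sqrt q.
  by move=> q1; rewrite -[leLHS]sqrtr1 ler_sqrt// (le_trans _ q1).
 by rewrite !s1.
split => //; have v0 : 0 < v by apply: lt_le_trans v1.
by rewrite -v8 lnXn// -[leLHS]mulr_natl; apply: ler_wpM2l => //; exact: ln_le_id.
Qed.

(** With [n ^ 3] roots and [kap = n ^ -6] the regularization is negligible, and the at most [2 n]
    roots close to an eigenvalue are a negligible fraction even against the bound [Kc v] for the
    logarithms. *)
Lemma hermitization_error (n0 : nat) (v r dl c2 Kc cnt D : R) (N kap : R) : 
 let n : R := n0.+1%:R in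
 0 < r -> 1 <= v -> v <= n -> 0 <= Kc -> 0 <= cnt -> N = n ^+ 3 -> kap = n ^- 6 ->
 N * D <= n * (2 * (2 * N * kap / r + 2 + 2 * (Kc * v))) +
  N * (n * (dl + 2 * (4 * kap ^+ 2 * N ^+ 2 / r ^+ 2))) + (cnt + 2 * n) * (n * (2 * (Kc * v))) ->
 n^-1 * D <= dl + (4 / r + 4 + 8 * Kc + 8 / r ^+ 2) / n + 2 * Kc * v * cnt / N.
Proof.
move=> n r0 v1 vn K0 cnt0 NE kE h.
have n1 : 1 <= n by rewrite /n ler1n.
clearbody n.
have np : 0 < n by apply: lt_le_trans n1.
have Np : 0 < N by rewrite NE exprn_gt0.
rewrite -(ler_pM2l (mulr_gt0 np Np)).
have -> : n * N * (n^-1 * D) = N * D by field; rewrite gt_eqF.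
apply: le_trans h _.
have e1 : n * (2 * (2 * N * kap / r + 2 + 2 * (Kc * v))) = 4 * (n * N) / r * n ^- 6 + 4 * n + 4 * Kc * (v * n).
 by rewrite kE; field; rewrite !gt_eqF// exprn_gt0.
have e2 : N * (n * (dl + 2 * (4 * kap ^+ 2 * N ^+ 2 / r ^+ 2))) = n * N * dl + 8 * (n * N) / r ^+ 2 * n ^- 6.
 by rewrite kE {2}NE; field; rewrite !gt_eqF// exprn_gt0.
have e3 : n * N * (dl + (4 / r + 4 + 8 * Kc + 8 / r ^+ 2) / n + 2 * Kc * v * cnt / N) =
  n * N * dl + (4 * (n * N) / r * n^-1 + 4 * N + 8 * Kc * N + 8 * (n * N) / r ^+ 2 * n^-1) + cnt * (n * (2 * (Kc * v))).
 by field; rewrite !gt_eqF// exprn_gt0.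
rewrite e1 e2 e3 [(cnt + 2 * n) * _]mulrDl.
have i6 : n ^- 6 <= n^-1 by rewrite lef_pV2 ?posrE ?exprn_gt0// exprS ler_peMr ?exprn_ege1// ltW.
have t1 : 4 * (n * N) / r * n ^- 6 <= 4 * (n * N) / r * n^-1.
 by apply: ler_wpM2l => //; rewrite divr_ge0 ?mulr_ge0// ltW.
have t2 : 8 * (n * N) / r ^+ 2 * n ^- 6 <= 8 * (n * N) / r ^+ 2 * n^-1.
 by apply: ler_wpM2l => //; rewrite divr_ge0 ?mulr_ge0 ?sqr_ge0// ltW.
have nN : n <= N by rewrite NE exprS ler_peMr ?exprn_ege1// ltW.
have nnN : n * n <= N by rewrite NE exprSr expr2 ler_peMr// mulr_ge0// ltW.
have vnN : v * n <= N by apply: le_trans nnN; apply: ler_wpM2r => //; exact: ltW.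
have t3 : 4 * Kc * (v * n) <= 4 * Kc * N by apply: ler_wpM2l => //; rewrite mulr_ge0.
have t4 : 2 * n * (n * (2 * (Kc * v))) <= 4 * Kc * N.
 have -> : 2 * n * (n * (2 * (Kc * v))) = 4 * Kc * (v * n * n) by ring.
 apply: ler_wpM2l; first by rewrite mulr_ge0.
 have -> : N = n * n * n by rewrite NE; ring.
 by apply: ler_wpM2r; [exact: ltW|apply: ler_wpM2r => //; exact: ltW].
by move: t1 t2 t3 t4 nN; lra.
Qed.

End hermitized_model.

(** * Smallness outside events of summable probability *)

Section controlled_sequences.
Context {R : realType} {d} {T : measurableType d} (P : probability T R).
Variable bnd : nat -> T -> R.

Let decay n : R := n%:R * sqrt (sqrt (sqrt n%:R)).

(** Smallness is only claimed where the random bound [bnd] is at most [c], so that boundedness in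
    either sense can be inserted later. Indices [n.+1] leave out the empty matrix. *)
Definition controlled (c : R) (Z : nat -> T -> R) := forall e, 0 < e ->
 exists (D : R) (n0 : nat) (Bad : nat -> set T), 0 <= D /\ forall n, (n0 <= n.+1)%N ->
  [/\ measurable (Bad n.+1), (P (Bad n.+1) <= (D / decay n.+1)%:E)%E &
    forall w, bnd n.+1 w <= c -> ~ Bad n.+1 w -> `|Z n.+1 w| <= e].

Lemma controlled0 c : controlled c (fun _ _ => 0).
Proof.
move=> e e0; exists 0, 0%N, (fun=> set0); split => // n _; split; first exact: measurable0.
 by rewrite measure0 mul0r.
by move=> w _ _; rewrite normr0 ltW.
Qed.

Lemma controlled_lin c (a : R) Z1 Z2 : controlled c Z1 -> controlled c Z2 ->
 controlled c (fun n w => a * Z1 n w + Z2 n w).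
Proof.
move=> h1 h2 e e0; have a0 : 0 < `|a| + 1 by rewrite ltr_wpDl.
have e1 : 0 < e / 2 / (`|a| + 1) by rewrite !divr_gt0.
have e2 : 0 < e / 2 by rewrite divr_gt0.
have [D1 [n1 [B1 [D10 H1]]]] := h1 _ e1; have [D2 [n2 [B2 [D20 H2]]]] := h2 _ e2.
exists (D1 + D2), (maxn n1 n2), (fun n => B1 n `|` B2 n); split; first exact: addr_ge0.
move=> n; rewrite geq_max => /andP[/H1[m1 p1 b1] /H2[m2 p2 b2]]; split.
- exact: measurableU.
- by apply: le_trans (measureU2 P m1 m2) _; rewrite mulrDl EFinD; exact: leeD.
move=> w hw nb; have z1 := b1 w hw (fun h => nb (or_introl h)); have z2 := b2 w hw (fun h => nb (or_intror h)).
apply: le_trans (ler_normD _ _) _; rewrite normrM [leRHS](splitr e); apply: lerD z2.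
rewrite ler_pdivlMr// mulrC in z1; apply: le_trans z1; rewrite ler_wpM2r//; by rewrite lerDl.
Qed.

Lemma controlled_approx c Z : (forall e, 0 < e ->
  exists2 Z', controlled c Z' & forall n w, `|Z n.+1 w - Z' n.+1 w| <= e) -> controlled c Z.
Proof.
move=> h e e0; have e2 : 0 < e / 2 by rewrite divr_gt0.
have [Z' hZ' hZ] := h _ e2; have [D [n0 [B [D0 H]]]] := hZ' _ e2.
exists D, n0, B; split => // n /H[mB pB bB]; split => // w hw nb.
rewrite -[Z _ _](subrK (Z' n.+1 w)); apply: le_trans (ler_normD _ _) _.
by rewrite [leRHS](splitr e); apply: lerD; [exact: hZ|exact: bB].
Qed.

Lemma decay_ge n : n.+1%:R <= decay n.+1.
Proof.
have [_ v1 _ _] := @eighth_root R n.+1%:R (ler1n _ _).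
by rewrite ler_peMr.
Qed.

Lemma bounded_in_probability_tail (e : R) : bounded_in_probability P bnd -> 0 < e ->
 exists (c : R) (n0 : nat), 0 <= c /\
  forall n, (n0 <= n)%N -> ((1 - e)%:E < P [set w | (`|bnd n w| <= c)%R])%E.
Proof.
move=> hb e0.
have nb : nbhs (1%E : \bar R) [set z | ((1 - e)%:E < z)%E].
 by apply: open_nbhs_nbhs; split; [exact: open_ereal_gt_ereal|rewrite /= lte_fin gtrBl].
have [C0 [_ hC]] := hb _ nb; pose c := Num.max 0 (C0 + 1).
have : ((1 - e)%:E < limn_einf (fun n => P [set w | (`|bnd n w| <= c)%R]))%E.
 by apply: hC; rewrite lt_max ltrDl ltr01 orbT.
rewrite limn_einf_lim; have /cvg_lim -> // := @cvg_einfs_sup R (fun n => P [set w | (`|bnd n w| <= c)%R]).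
move=> /ereal_sup_gt[_ [m _ <-] hm]; exists c, m; split; first by rewrite le_max lexx.
by move=> n mn; apply: lt_le_trans hm _; apply: ereal_inf_lbound; exists n.
Qed.

(** For a suitable [c] the failure of [bnd <= c] eventually has probability at most half of the
    target; the exceptional event takes the other half. *)
Lemma controlled_in_probability Z : (forall n, mble (bnd n)) ->
 (forall n, mble (Z n)) -> (forall c, 0 <= c -> controlled c Z) ->
 bounded_in_probability P bnd -> cvg_in_probability P Z 0.
Proof.
move=> mb mZ hZ hb e e0.
have mZe n : measurable [set w | e < `|Z n w - 0|].
 have -> : [set w | e < `|Z n w - 0|] = setT `&` (fun w => `|Z n w|) @^-1` `]e, +oo[%classic.
  by apply/seteqP; split => w /=; rewrite subr0 in_itv/= andbT; [split|case].
 by apply: mcomp => //.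
have mbc c n : measurable [set w | `|bnd n w| <= c].
 have -> : [set w | `|bnd n w| <= c] = setT `&` (fun w => `|bnd n w|) @^-1` `]-oo, c]%classic.
  by apply/seteqP; split => w /=; rewrite in_itv/=; [split|case].
 by apply: mcomp => //.
apply/fine_cvgP; split; first by apply: nearW => n; exact: fin_num_measure.
apply/cvgrPdist_le => eta eta0.
have h2 : 0 < eta / 2 by rewrite divr_gt0.
have [c [n1 [c0 hc]]] := bounded_in_probability_tail hb h2.
have [D [n2 [Bad [D0 hD]]]] := hZ c c0 _ e0.
exists (maxn (maxn n1 n2) (Num.truncn (D / (eta / 2)))).+1 => // -[//|n] /=.
rewrite ltnS !geq_max -andbA => /and3P[k1 k2 k3].
have [mB pB zB] := hD n (leq_trans k2 (leqnSn _)).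
have {}hc := hc n.+1 (leq_trans k1 (leqnSn _)).
rewrite sub0r normrN ger0_norm ?fine_ge0//.
rewrite -lee_fin fineK ?fin_num_measure//.
have sub : [set w | e < `|Z n.+1 w - 0|] `<=` ~` [set w | `|bnd n.+1 w| <= c] `|` Bad n.+1.
 move=> w /= hw; have [hb'|/negP hb'] := boolP (`|bnd n.+1 w| <= c); last by left.
 right; apply: contrapT => nB; move: hw; rewrite subr0 ltNge => /negP; apply.
 by apply: zB => //; apply: le_trans (ler_norm _) hb'.
have mC := measurableC (mbc c n.+1).
apply: le_trans (le_measure P _ _ sub) _; rewrite ?inE//; first exact: measurableU.
apply: le_trans (measureU2 P mC mB) _.
rewrite [eta]splitr EFinD; apply: leeD.
 apply: (@le_trans _ _ (1 - P [set w | (`|bnd n.+1 w| <= c)%R])%E).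
  by rewrite le_eqVlt; apply/orP; left; apply/eqP; exact: probability_setC.
 move: hc; rewrite -(fineK (fin_num_measure P _ (mbc c n.+1))) lte_fin -EFinB lee_fin.
 by move: (fine _) => p hp; lra.
apply: le_trans pB _; rewrite lee_fin.
apply: (@le_trans _ _ (D / n.+1%:R)).
 by apply: ler_wpM2l => //; rewrite lef_pV2 ?posrE ?(lt_le_trans _ (decay_ge n))//; exact: decay_ge.
rewrite ler_pdivrMr// mulrC -ler_pdivrMr//.
by apply: le_trans (ltW (truncnS_gt _)) _; rewrite ler_nat.
Qed.

(** Telescoping: with [a] and [b] the eighth roots of consecutive integers, [b ^ -9] is dominated by
    a difference of inverses. *)
Lemma decay_step (a b : R) : 1 <= a -> a <= b -> b ^+ 8 = a ^+ 8 + 1 ->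
 (b ^+ 8 * b)^-1 <= 8 * (a^-1 - b^-1).
Proof.
move=> a1 ab e; have a0 : 0 < a by lra.
have b0 : 0 < b by lra.
have h : 1 <= 8 * (b - a) * b ^+ 7.
 have {1}-> : 1 = (b - a) * ((b + a) * (b ^+ 2 + a ^+ 2) * (b ^+ 4 + a ^+ 4)) by rewrite (_ : 1 = b ^+ 8 - a ^+ 8 :> R); [ring|rewrite e addrC addKr].
 rewrite [8 * (b - a)]mulrC -[leRHS]mulrA; apply: ler_wpM2l; first by rewrite subr_ge0.
 have -> : 8 * b ^+ 7 = (b + b) * (b ^+ 2 + b ^+ 2) * (b ^+ 4 + b ^+ 4) by ring.
 have q k : a ^+ k <= b ^+ k by apply: lerXn2r; rewrite // ?nnegrE; exact: ltW.
 by repeat apply: ler_pM; rewrite ?mulr_ge0 ?addr_ge0 ?exprn_ge0 ?(ltW a0) ?(ltW b0) ?lerD2l ?q.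
have -> : 8 * (a^-1 - b^-1) = 8 * (b - a) / (a * b) by field; rewrite !gt_eqF.
rewrite -[leLHS]mul1r ler_pdivrMr ?mulr_gt0 ?exprn_gt0//.
apply: le_trans h _; rewrite -[leRHS]mulrA ler_wpM2l ?mulr_ge0 ?subr_ge0//.
have -> : (a * b)^-1 * (b ^+ 8 * b) = b ^+ 7 * (b / a) by field; rewrite !gt_eqF.
by rewrite ler_peMr ?exprn_ge0 ?(ltW b0)// ler_pdivlMr// mul1r.
Qed.

Lemma sum_decay m : \sum_(0 <= k < m) (decay k.+1)^-1 <= 9.
Proof.
pose v k : R := sqrt (sqrt (sqrt k.+1%:R)).
have [v8 v1] : (forall k, v k ^+ 8 = k.+1%:R) /\ forall k, 1 <= v k.
 by split => k; have [] := @eighth_root R k.+1%:R (ler1n _ _).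
have v0 k : 0 < v k by apply: lt_le_trans (v1 k).
have dE k : decay k.+1 = v k ^+ 8 * v k by rewrite v8.
suff h k : \sum_(0 <= i < k.+1) (decay i.+1)^-1 <= 9 - 8 / v k.
 case: m => [|m]; first by rewrite big_geq.
 by apply: le_trans (h m) _; rewrite gerBl divr_ge0// ltW.
elim: k => [|k ih].
 by rewrite big_nat1 dE /v !sqrtr1 expr1n !mulr1 invr1; lra.
rewrite big_nat_recr//=.
have := @decay_step (v k) (v k.+1) (v1 k) _ _; rewrite -dE => hh.
have {}hh : (decay k.+2)^-1 <= 8 * ((v k)^-1 - (v k.+1)^-1).
 apply: hh; first by rewrite /v !ler_sqrt ?ler_nat.
 by rewrite !v8 -natr1.
by apply: le_trans (lerD ih hh) _; rewrite le_eqVlt; apply/orP; left; apply/eqP; ring.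
Qed.

(** Borel-Cantelli, applied to each accuracy [1 / j.+1]. *)
Lemma controlled_ae c Z : controlled c Z -> {ae P, forall w, forall j : nat,
 \forall n \near \oo, bnd n w <= c -> `|Z n w| <= j.+1%:R^-1}.
Proof.
move=> hZ; apply: ae_foralln => j.
have [|D [n0 [Bad [D0 hD]]]] := hZ j.+1%:R^-1; first by rewrite invr_gt0.
pose F n := if (n0 <= n.+1)%N then Bad n.+1 else set0.
have mF n : measurable (F n) by rewrite /F; case: ifPn => // /hD[].
have pF n : (P (F n) <= (D / decay n.+1)%:E)%E.
 rewrite /F; case: ifPn => [/hD[]//|_]; rewrite measure0 lee_fin divr_ge0//.
 exact: le_trans (ler0n _ _) (decay_ge n).
exists (lim_sup_set F); split.
- by apply: bigcap_measurable => // k _; exact: bigcup_measurable.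
- apply: lim_sup_set_cvg0 => //; apply: (@le_lt_trans _ _ (D * 9)%:E); last exact: ltry.
 apply: lime_le; first exact: is_cvg_nneseries.
 apply: nearW => m; apply: (@le_trans _ _ (\sum_(0 <= k < m) (D / decay k.+1)%:E)%E).
  by rewrite !big_mkord; apply: lee_sum => k _; exact: pF.
 by rewrite sumEFin lee_fin -mulr_sumr ler_wpM2l// sum_decay.
move=> w /= hw k _; apply: contrapT => nF; apply: hw.
exists (maxn n0 k).+1 => // -[//|n] /=; rewrite ltnS geq_max => /andP[k1 k2] hb.
have k1' : (n0 <= n.+1)%N by exact: leq_trans k1 (leqnSn _).
have [_ _] := hD n k1'; apply => // hB; apply: nF; exists n => //=.
by rewrite /F k1'.
Qed.

Lemma as_bounded_nat : as_bounded P bnd ->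
 {ae P, forall w, exists c : nat, \forall n \near \oo, bnd n w <= c%:R}.
Proof.
apply: filterS => w; rewrite limn_esup_lim.
have /cvg_lim -> // := @cvg_esups_inf R (fun n => `|bnd n w|%:E).
move=> /ereal_inf_lt[_ [m _ <-] hm].
have h n : (m <= n)%N -> (`|bnd n w|%:E <= esups (fun n => `|bnd n w|%:E) m)%E.
 by move=> mn; apply: ereal_sup_ubound; exists n.
move: hm h; case: (esups _ m) => [r _|//|_] h; last by have := h m (leqnn _).
exists (Num.truncn r).+1; exists m => // n /h; rewrite lee_fin => hr.
by apply: le_trans (ler_norm _) (le_trans hr _); exact: ltW (truncnS_gt _).
Qed.

End controlled_sequences.

(** * Differences of spectral averages *)

Section spectral_differences.
Context {R : realType}.
Local Notation C := R[i].

Definition eigen_diff n (Q S : 'M[C]_n) (f : C -> R) : R :=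
 n%:R^-1 * (\sum_i f (eigen Q i) - \sum_i f (eigen S i)).

Lemma eigen_diff_esd n (Q S : 'M[C]_n) f : test_function f ->
 \int[esd Q]_z f z - \int[esd S]_z f z = eigen_diff Q S f.
Proof.
move=> [cf _]; have mf := meas_continuousC cf.
have r (u a b a' b' : R) : a = u * a' -> b = u * b' -> a - b = u * (a' - b') by move=> -> ->; rewrite mulrBr.
exact: (r _ _ _ _ _ (int_esd Q mf) (int_esd S mf)).
Qed.

Lemma eigen_diff_cons n (Q S : 'M[C]_n) q l : eigen_diff Q S (lcomb (q :: l)) =
 q.1.1 * eigen_diff Q S (fun z => lmax q.2 (z - q.1.2)) + eigen_diff Q S (lcomb l).
Proof.
have e (W : 'M[C]_n) : \sum_i lcomb (q :: l) (eigen W i) =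
  q.1.1 * \sum_i lmax q.2 (eigen W i - q.1.2) + \sum_i lcomb l (eigen W i).
 by rewrite mulr_sumr -big_split /=; apply: eq_bigr => i _; rewrite /lcomb big_cons.
have r (k u a b a1 b1 a2 b2 : R) : a = k * a1 + a2 -> b = k * b1 + b2 ->
  u * (a - b) = k * (u * (a1 - b1)) + u * (a2 - b2) by move=> -> ->; ring.
exact: (r _ _ _ _ _ _ _ _ (e Q) (e S)).
Qed.

Lemma eigen_diff_nil n (Q S : 'M[C]_n) : eigen_diff Q S (lcomb [::]) = 0.
Proof.
have e (W : 'M[C]_n) : \sum_i lcomb [::] (eigen W i) = 0.
 by apply: big1 => i _; rewrite /lcomb big_nil.
have r (u a b : R) : a = 0 -> b = 0 -> u * (a - b) = 0 by move=> -> ->; rewrite subr0 mulr0.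
exact: (r _ _ _ (e Q) (e S)).
Qed.

Lemma eigen_diff_close n (Q S : 'M[C]_n.+1) (f g : C -> R) e : (forall z, `|f z - g z| <= e) ->
 `|eigen_diff Q S f - eigen_diff Q S g| <= e + e.
Proof.
move=> h; have s (W : 'M[C]_n.+1) : `|\sum_i f (eigen W i) - \sum_i g (eigen W i)| <= n.+1%:R * e.
 rewrite -sumrB; apply: le_trans (ler_norm_sum _ _ _) _.
 apply: (@le_trans _ _ (\sum_(i < n.+1) e)); first by apply: ler_sum => i _; exact: h.
 by rewrite sumr_const card_ord -[leLHS]mulr_natl.
have comb (u a1 a2 b1 b2 : R) : 0 < u -> `|a1 - a2| <= u * e -> `|b1 - b2| <= u * e ->
  `|u^-1 * (a1 - b1) - u^-1 * (a2 - b2)| <= e + e.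
 move=> u0 h1 h2; rewrite -mulrBr normrM gtr0_norm ?invr_gt0// ler_pdivrMl// mulrDr.
 apply: le_trans (lerD h1 h2).
 by rewrite (_ : a1 - b1 - (a2 - b2) = (a1 - a2) - (b1 - b2)); [exact: ler_normB|ring].
exact: (comb _ _ _ _ _ (ltr0Sn _ _) (s Q) (s S)).
Qed.

Lemma meas_eigen_diff {d} {T : measurableType d} n (Q S : T -> 'M[C]_n) f : test_function f ->
 meas_mx Q -> meas_mx S -> mble (fun w => eigen_diff (Q w) (S w) f).
Proof.
move=> tf mQ mS; apply: mbleM; first exact: measurable_cst.
by apply: mbleB; exact: meas_spectral_sum.
Qed.

Lemma meas_normalize {d} {T : measurableType d} n (Q : T -> 'M[C]_n) : meas_mx Q ->
 meas_mx (fun w => normalize (Q w)).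
Proof. by move=> mQ; apply: meas_mxZ => //; exact: measurable_cst. Qed.

Lemma meas_hs_norm_sqr {d} {T : measurableType d} n (Q : T -> 'M[C]_n) : meas_mx Q ->
 mble (fun w => hs_norm (Q w) ^+ 2).
Proof.
move=> mQ; rewrite (_ : (fun w => _) = fun w => \sum_i \sum_j sqnorm (Q w i j)); last first.
 apply/funext => w; rewrite hs_norm_sqr; apply: eq_bigr => i _; rewrite /sqn.
 by apply: eq_bigr => j _; rewrite !mxE.
by apply: measurable_sum => i; apply: measurable_sum => j; exact: meas_sqnorm.
Qed.

End spectral_differences.

(** * Application to the two matrix models *)

Section model.
Context {R : realType} {d} {T : measurableType d} (P : probability T R).
Local Notation C := R[i].
Variables (x y : {RV P >-> C}) (X Y : nat -> nat -> {RV P >-> C}) (M K L A B : forall n, T -> 'M[C]_n).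
Hypotheses (hx : standardized x) (hy : standardized y) (hX : iid_copies x X) (hY : iid_copies y Y)
 (hM : random_matrices M) (hK : random_matrices K) (hL : random_matrices L)
 (hKu : forall n w, K n w \in unitmx) (hLu : forall n w, L n w \in unitmx)
 (hind : independent_families P (matrix_entries M `|` matrix_entries K `|` matrix_entries L)
   (array_entries X `|` array_entries Y))
 (hA : forall n w, A n w = M n w + K n w *m top_left_block X n w *m L n w)
 (hB : forall n w, B n w = M n w + K n w *m top_left_block Y n w *m L n w).

Let shift n z (w : T) : 'M[C]_n := shifted (M n w) (K n w) (L n w) z.
Let U n z (w : T) : arr R ('I_n * 'I_n) := fun ij => shift n z w ij.1 ij.2.
(** Both arrays in one family, since the event to be decoupled compares the two determinants for the
    same outcome. *)
Let V n (w : T) : arr R (bool * ('I_n * 'I_n)) := fun q => if q.1 then X q.2.1 q.2.2 w else Y q.2.1 q.2.2 w.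

Arguments U : clear implicits.
Arguments V : clear implicits.

Let mshift n z : meas_mx (shift n z).
Proof. exact: meas_shifted. Qed.

Let top_left_mxof (Z : nat -> nat -> {RV P >-> C}) n w : top_left_block Z n w = mxof (block Z w).
Proof. by apply/matrixP => i j; rewrite !mxE. Qed.

(** The norm condition belongs to the event: a frozen value violating it makes the event empty, so
    the bound holds for every frozen value, as [decouple] requires. *)
Definition bad n (C0 a : R) (p : arr R ('I_n * 'I_n) * arr R (bool * ('I_n * 'I_n))) : bool :=
 (\sum_i sqn (row i (mxof p.1)) <= C0 * n%:R) &&
 ~~ close_dets (mxof p.1) a (fun ij => p.2 (true, ij)) (fun ij => p.2 (false, ij)).

Lemma meas_bad n C0 a : mble (@bad n C0 a).
Proof.
have mm : meas_mx (fun p : arr R ('I_n * 'I_n) * arr R (bool * ('I_n * 'I_n)) => mxof p.1).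
 move=> i j; under eq_fun do rewrite mxE.
 exact: (mcomp (meas_coord (i, j)) measurable_fst).
have mh b : meas_mx (fun p : arr R ('I_n * 'I_n) * arr R (bool * ('I_n * 'I_n)) =>
  hmat (mxof p.1) (fun ij => p.2 (b, ij))).
 have e p : hmat (mxof p.1) (fun ij => p.2 (b, ij)) = normalize (\matrix_(i, j) p.2 (b, (i, j))) + mxof p.1 :> 'M[C]_n.
  exact: hmatE.
 move=> i j; under eq_fun do rewrite e; apply: (meas_mxD _ mm).
 apply: meas_mxZ; first exact: measurable_cst.
 move=> k l; under eq_fun do rewrite mxE.
 exact: (mcomp (meas_coord (b, (k, l))) measurable_snd).
have md b := meas_sqnorm (meas_det (mh b)).
apply: measurable_and.
 apply: mble_ler => //; apply: measurable_sum => i; apply: meas_sqn => k l.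
 by under eq_fun do rewrite mxE; exact: mm.
apply: measurable_neg; apply: measurable_and; first exact: (mble_ltr _ (md true)).
apply: measurable_and; first exact: (mble_ltr _ (md false)).
apply: mble_ler => //; apply: mcomp => //.
by apply: mbleB; apply: mcomp (md _).
Qed.

Let mU n z : mble (U n z).
Proof. by apply/meas_arrP => ij; exact: mshift. Qed.

Let mV n : mble (V n).
Proof. by apply/meas_arrP => -[b ij]; rewrite /V /=; case: b; exact: measurable_funPT. Qed.

Let meas_generator (F : set (T -> C)) f : F f ->
 measurable_fun [set: g_sigma_algebraType (generators F)] (f : g_sigma_algebraType (generators F) -> C).
Proof.
move=> Ff _ S mS; rewrite setTI; apply: sub_sigma_algebra; exists f => //; by exists S.
Qed.

Lemma bad_prob C0 dl : 0 <= C0 -> 0 < dl -> exists (D : R) (n0 : nat), 0 <= D /\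
 forall n z, (n0 <= n.+1)%N -> (P [set w | bad C0 (dl * n.+1%:R) (U n.+1 z w, V n.+1 w)] <=
  (D / (n.+1%:R * sqrt (sqrt n.+1%:R)))%:E)%E.
Proof.
move=> C00 dl0.
have [k1 [p1 [B1 [/andP[k10 k11] /andP[p10 p11] B10 g1]]]] := iid_good_array hx hX.
have [k2 [p2 [B2 [/andP[k20 k21] /andP[p20 p21] B20 g2]]]] := iid_good_array hy hY.
pose kap := Num.min k1 k2; pose p := Num.min p1 p2; pose BB tau := Num.max (B1 tau) (B2 tau).
have hk : 0 < kap <= 1 by rewrite lt_min k10 k20 ge_min k11.
have hp : 0 < p <= 1 by rewrite lt_min p10 p20 ge_min p11.
have BB0 tau : 0 <= BB tau by rewrite le_max B10.
have [D [n0 [D0 h]]] := log_det_universality P hk hp C00 dl0 BB0.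
exists D, n0; split => // n z hn.
have s0 : 0 <= D / (n.+1%:R * sqrt (sqrt n.+1%:R)) by rewrite divr_ge0// mulr_ge0// sqrtr_ge0.
apply: (decouple (b := @bad n.+1 C0 (dl * n.+1%:R)) hind) => //.
- move=> ij; apply: meas_shifted => // i j; apply: meas_generator.
 + by left; left; exists n.+1, i, j.
 + by left; right; exists n.+1, i, j.
 + by right; exists n.+1, i, j.
- move=> [b ij]; apply: meas_generator; rewrite /V /=; case: b.
  by left; exists ij.1, ij.2.
 by right; exists ij.1, ij.2.
- exact: meas_bad.
move=> u; have [hu|hu] := boolP (\sum_i sqn (row i (mxof u)) <= C0 * n.+1%:R); last first.
 rewrite (_ : [set w | _] = set0) ?measure0 ?lee_fin//.
 by apply/seteqP; split => w //=; rewrite /bad /= (negbTE hu).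
have gX : good_array P kap p BB (block (n := n.+1) X).
 by apply: g1; rewrite ?ge_min ?lexx// => tau; rewrite le_max lexx.
have gY : good_array P kap p BB (block (n := n.+1) Y).
 by apply: g2; rewrite ?ge_min ?lexx ?orbT// => tau; rewrite le_max lexx orbT.
have := h n _ _ (mxof u) hn gX gY hu; apply: le_trans; rewrite le_eqVlt; apply/orP; left; apply/eqP.
by congr (P _); apply/funext => w /=; rewrite /bad /= hu.
Qed.

Definition lmax_diff n r a (w : T) : R :=
 n%:R^-1 * (\sum_i lmax r (eigen (normalize (A n w)) i - a) - \sum_i lmax r (eigen (normalize (B n w)) i - a)).

Let bnd n w : R := bound_expr (A n w) (B n w) (M n w) (K n w) (L n w).

(** The number of roots at which the determinants are not close has mean [O(n ^ 3 n ^ (-5/4))].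
    Markov's inequality at a level of order [n ^ 3 / v], where [v = n ^ (1/8)] bounds the logarithms
    up to a constant, leaves the probability [O(n ^ (-9/8))]. *)
Lemma lmax_diff_small (c r e : R) (a : C) : 0 <= c -> 0 < r -> 0 < e ->
 exists (D : R) (n0 : nat) (Bad : nat -> set T), 0 <= D /\ forall n, (n0 <= n.+1)%N ->
  [/\ measurable (Bad n.+1),
    (P (Bad n.+1) <= (D / (n.+1%:R * sqrt (sqrt (sqrt n.+1%:R))))%:E)%E &
    forall w, bnd n.+1 w <= c -> ~ Bad n.+1 w -> `|lmax_diff n.+1 r a w| <= e].
Proof.
move=> c0 r0 e0; pose rho := nm a + r; pose C0 := 2 * c + 2 * rho ^+ 2 * c.
have C00 : 0 <= C0 by apply: addr_ge0; [exact: mulr_ge0|apply: mulr_ge0 => //; apply: mulr_ge0 => //; exact: sqr_ge0].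
pose dl := e / 3; have dl0 : 0 < dl by rewrite divr_gt0.
have [D [n1 [D0 hD]]] := bad_prob C00 dl0.
have na0 := nm_ge0 a.
pose c2 := c + nm a + r + 2; have c20 : 0 < c2 by rewrite /c2; lra.
(* From [ln n <= 8 v]: [2 ln kap^-1 = 12 ln n <= 96 v] and [2 ln (n c2) <= 16 v + 2 c2 v]; the sum
   of both bounds is taken. *)
pose Kc := 112 + 2 * c2; have Kc0 : 0 < Kc by rewrite /Kc; lra.
pose K2 := 4 / r + 4 + 8 * Kc + 8 / r ^+ 2.
have K20 : 0 <= K2 by rewrite !addr_ge0 ?divr_ge0 ?mulr_ge0 ?sqr_ge0// ltW.
have sP n : exists s : seq C, [/\ size s = (n.+1 ^ 3)%N, uniq s, (forall z, z \in s -> z ^+ (n.+1 ^ 3) = 1) &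
  forall z t : C, \prod_(q <- s) (z - t * q) = z ^+ (n.+1 ^ 3) - t ^+ (n.+1 ^ 3)].
 by apply: unity_rootsP; rewrite expn_gt0.
pose s n := sval (cid (sP n.-1)).
have hs n : [/\ size (s n.+1) = (n.+1 ^ 3)%N, uniq (s n.+1), (forall z, z \in s n.+1 -> z ^+ (n.+1 ^ 3) = 1) &
  forall z t : C, \prod_(q <- s n.+1) (z - t * q) = z ^+ (n.+1 ^ 3) - t ^+ (n.+1 ^ 3)].
 by rewrite /s /=; case: cid.
pose isbad n z w := @bad n C0 (dl * n%:R) (U n (a + r%:C * z) w, V n w).
pose cnt n w : R := \sum_(z <- s n) (isbad n z w)%:R.
pose v n : R := sqrt (sqrt (sqrt n%:R)).
(* The event that the last term of [hermitization_error] exceeds [dl]. *)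
pose Bad n : set T := [set w | dl * n%:R ^+ 3 < 2 * Kc * v n * cnt n w].
exists (2 * Kc * D / dl), (maxn n1 (Num.truncn (K2 / dl)).+1), Bad; split.
 by rewrite divr_ge0 ?mulr_ge0// ltW.
move=> n; rewrite geq_max => /andP[hn1 hn2].
have [ss us hsN ps] := hs n.
set NR : R := n.+1%:R; have N0 : 0 < NR by rewrite ltr0n.
have N1 : 1 <= NR by rewrite ler1n.
have [v8 v1 vv lnN] := eighth_root N1; rewrite -/(v n.+1) in v8 v1 vv lnN.
have v0 : 0 < v n.+1 by apply: lt_le_trans v1.
have mis z : mble (isbad n.+1 z).
 by apply: (mcomp (@meas_bad n.+1 C0 (dl * NR))); exact: measurable_fun_pair.
have mcnt : mble (cnt n.+1).
 by apply: measurable_sum => z; exact: meas_natr_bool.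
have cnt0 w : 0 <= cnt n.+1 w by apply: sumr_ge0.
have KN : K2 / NR <= dl.
 rewrite ler_pdivrMr// mulrC -ler_pdivrMr//.
 by apply: le_trans (ltW (truncnS_gt _)) _; rewrite ler_nat.
split.
- by apply: meas_set_bool; apply: mble_ltr => //; exact: mbleM.
- pose g w := 2 * Kc * v n.+1 / (dl * NR ^+ 3) * cnt n.+1 w.
 have q0 : 0 <= 2 * Kc * v n.+1 / (dl * NR ^+ 3).
  by rewrite divr_ge0 ?mulr_ge0 ?exprn_ge0// ltW.
 apply: (@le_trans _ _ (\int[P]_w (g w)%:E)%E).
  apply: prob_le_integral.
  + by apply: meas_set_bool; apply: mble_ltr => //; exact: mbleM.
  + exact: mbleM.
  + by move=> w; rewrite mulr_ge0.
  + move=> w; rewrite /Bad /g /= => h; rewrite mulrAC ler_pdivlMr ?mul1r; last by rewrite mulr_gt0// exprn_gt0.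
   exact: ltW.
 rewrite int_Zl//.
 have ic : (\int[P]_w (cnt n.+1 w)%:E <= (NR ^+ 3 * (D / (NR * sqrt (sqrt NR))))%:E)%E.
  have mz z : mble (fun w => (isbad n.+1 z w)%:R : R) by exact: meas_natr_bool.
  under eq_integral do rewrite /cnt -sumEFin.
  rewrite ge0_integral_sum//; last first.
   by move=> z; exact/mble_EFinP.
  apply: (@le_trans _ _ (\sum_(z <- s n.+1) (D / (NR * sqrt (sqrt NR)))%:E)%E).
   by apply: lee_sum => z _; rewrite -prob_bool//; exact: hD.
  rewrite sumEFin lee_fin big_const_seq count_predT iter_addr addr0 ss -[leLHS]mulr_natl.
  by rewrite natrX.
 apply: le_trans (lee_wpmul2l _ ic) _; first by rewrite lee_fin.
 rewrite -EFinM lee_fin -/(v n.+1) -/NR.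
 have fe (q dd vv' DD NN : R) : dd != 0 -> vv' != 0 -> NN != 0 ->
   2 * q * vv' / (dd * NN ^+ 3) * (NN ^+ 3 * (DD / (NN * (vv' * vv')))) = 2 * q * DD / dd / (NN * vv').
  by move=> d0 w0 n0; field; rewrite d0 w0 n0.
 have -> : 2 * Kc * v n.+1 / (dl * NR ^+ 3) * (NR ^+ 3 * (D / (NR * sqrt (sqrt NR)))) =
   2 * Kc * D / dl / (NR * v n.+1) by rewrite -vv fe ?gt_eqF.
 exact: lexx.
move=> w hw nb; have [c0' hAr hBr _ _] := bound_expr_parts hw.
pose la i := eigen (normalize (A n.+1 w)) i - a; pose lb i := eigen (normalize (B n.+1 w)) i - a.
pose Lam := c + NR + nm a.
have Lam0 : 0 <= Lam by rewrite /Lam; lra.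
have hla i : nm (la i) <= Lam.
 by apply: le_trans (nm_triangle _ _) _; rewrite nmN lerD2r; exact: eigen_le.
have hlb i : nm (lb i) <= Lam.
 by apply: le_trans (nm_triangle _ _) _; rewrite nmN lerD2r; exact: eigen_le.
pose kap : R := NR ^- 6.
have kap01 : 0 < kap <= 1 by rewrite invr_gt0 exprn_gt0//= invf_le1 ?exprn_gt0// exprn_ege1.
have v1' : 1 <= v n.+1 by exact: v1.
have Mx1 : 2 * ln (Lam + r + 1) <= Kc * v n.+1.
 have h : Lam + r + 1 <= NR * c2.
  have : c + nm a + r + 1 <= (c + nm a + r + 1) * NR by rewrite ler_peMr//; lra.
  by rewrite /Lam /c2; move: N1; nra.
 have l0 : 0 < Lam + r + 1 by rewrite /Lam; lra.
 apply: (@le_trans _ _ (2 * ln (NR * c2))).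
  by apply: ler_wpM2l => //; rewrite ler_ln ?posrE ?mulr_gt0.
 rewrite lnM ?posrE//; have := ln_le_id c20; have : c2 <= c2 * v n.+1 by rewrite ler_peMr// ltW.
 by rewrite /Kc; move: lnN v0; nra.
have Mx2 : 2 * ln kap^-1 <= Kc * v n.+1.
 rewrite /kap invrK lnXn// -mulr_natl.
 have : 0 <= c2 * v n.+1 by rewrite mulr_ge0// ltW.
 by rewrite /Kc; move: lnN v0; nra.
have rC z : z \in s n.+1 -> nm (a + r%:C * z) <= rho.
 move=> zs; apply: le_trans (nm_triangle _ _) _; rewrite nmM nm_real gtr0_norm//.
 by rewrite (nm_unity_root _ (hsN z zs)) ?expn_gt0// mulr1.
have mxofU z : mxof (U n.+1 z w) = shift n.+1 z w by apply/matrixP => i j; rewrite mxE.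
have hgood z : z \in s n.+1 -> ~~ isbad n.+1 z w ->
  `|\sum_i ln (sqnorm (la i - r%:C * z)) - \sum_i ln (sqnorm (lb i - r%:C * z))| <= dl * NR.
 move=> zs; rewrite /isbad /bad /= mxofU negb_and negbK => /orP[|hc].
  by rewrite (shifted_bound hw (rC z zs)).
 have := close_dets_eigen (hKu n.+1 w) (hLu n.+1 w) hc.
 have eb (Z : nat -> nat -> {RV P >-> C}) (f : arr R ('I_n.+1 * 'I_n.+1)) :
   f = block Z w -> M n.+1 w + K n.+1 w *m mxof f *m L n.+1 w =
   M n.+1 w + K n.+1 w *m top_left_block Z n.+1 w *m L n.+1 w.
  by move=> ->; rewrite top_left_mxof.
 rewrite (eb X)// (eb Y)// -hA -hB.
 apply: le_trans; rewrite le_eqVlt; apply/orP; left; apply/eqP; congr (`|_ - _|);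
  by apply: eq_bigr => i _; rewrite /la /lb opprD addrA.
have kap3 : (0 < n.+1 ^ 3)%N by rewrite expn_gt0.
have := log_max_difference r0 kap01 kap3 ss us hsN ps Lam0 Mx1 Mx2 hla hlb (ltW dl0) hgood.
have cE : (count (predC (fun z => ~~ isbad n.+1 z w)) (s n.+1))%:R = cnt n.+1 w.
 rewrite /cnt -sum1_count natr_sum big_mkcond /=; apply: eq_bigr => z _.
 by rewrite negbK; case: (isbad n.+1 z w).
rewrite cE => hh.
have vN : v n.+1 <= NR by rewrite -v8 exprS ler_peMr ?exprn_ege1// ltW.
have N3 : ((n.+1 ^ 3)%:R : R) = NR ^+ 3 by rewrite natrX.
have := @hermitization_error R n (v n.+1) r dl c2 Kc (cnt n.+1 w) _ _ _ r0 v1 vN (ltW Kc0) (cnt0 w) N3 erefl hh.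
have hb : 2 * Kc * v n.+1 * cnt n.+1 w / NR ^+ 3 <= dl.
 by rewrite ler_pdivrMr ?exprn_gt0// leNgt; apply/negP; exact: nb.
rewrite -/NR -/K2 N3 => hfin.
rewrite /lmax_diff normrM ger0_norm ?invr_ge0 ?(ltW N0)//.
apply: (@le_trans _ _ (dl + K2 / NR + 2 * Kc * v n.+1 * cnt n.+1 w / NR ^+ 3)); first exact: hfin.
have -> : e = dl + dl + dl by rewrite /dl; field.
by apply: lerD => //; rewrite lerD2l.
Qed.

Definition spectral_diff (f : C -> R) n w : R :=
 eigen_diff (normalize (A n w)) (normalize (B n w)) f.

Lemma controlled_lmax c r a : 0 <= c -> 0 < r ->
 controlled P bnd c (spectral_diff (fun z => lmax r (z - a))).
Proof.
move=> c0 r0 e e0; exact: (lmax_diff_small a c0 r0 e0).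
Qed.

Lemma controlled_lcomb c l : 0 <= c -> (forall q, q \in l -> 0 < q.2) ->
 controlled P bnd c (spectral_diff (lcomb l)).
Proof.
move=> c0; elim: l => [_|q l ih hl].
 rewrite (_ : spectral_diff _ = fun _ _ => 0); first exact: controlled0.
 by apply/funext => n; apply/funext => w; exact: eigen_diff_nil.
rewrite (_ : spectral_diff _ = fun n w => q.1.1 * spectral_diff (fun z => lmax q.2 (z - q.1.2)) n w +
  spectral_diff (lcomb l) n w); last by apply/funext => n; apply/funext => w; exact: eigen_diff_cons.
apply: controlled_lin; first by apply: controlled_lmax => //; apply: hl; rewrite mem_head.
by apply: ih => q' h; apply: hl; rewrite inE h orbT.
Qed.

Lemma controlled_test c f : 0 <= c -> test_function f -> controlled P bnd c (spectral_diff f).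
Proof.
move=> c0 /test_function_ucc[uf [b fb]]; apply: controlled_approx => e e0.
have [|l [hl fl]] := lcomb_dense (e := e / 2) uf fb; first by rewrite divr_gt0.
exists (spectral_diff (lcomb l)).
 by apply: controlled_lcomb => // q /hl; exact: lattice_param_gt0.
by move=> n w; rewrite [e]splitr; exact: eigen_diff_close.
Qed.

Lemma meas_perturbed (Z : nat -> nat -> {RV P >-> C}) n :
 meas_mx (fun w => M n w + K n w *m top_left_block Z n w *m L n w).
Proof.
apply: meas_mxD; first exact: hM.
apply: meas_mxM; last exact: hL.
apply: meas_mxM; first exact: hK.
move=> i j; under eq_fun do rewrite mxE; exact: measurable_funPT.
Qed.

Let mA n : meas_mx (A n).
Proof.
have -> : A n = fun w => M n w + K n w *m top_left_block X n w *m L n w by apply/funext => w; exact: hA.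
exact: meas_perturbed.
Qed.

Let mB n : meas_mx (B n).
Proof.
have -> : B n = fun w => M n w + K n w *m top_left_block Y n w *m L n w by apply/funext => w; exact: hB.
exact: meas_perturbed.
Qed.

Lemma meas_spectral_diff f n : test_function f -> mble (spectral_diff f n).
Proof.
move=> tf; exact: (@meas_eigen_diff R d T n (fun w => normalize (A n w)) (fun w => normalize (B n w)) f
 tf (meas_normalize (mA (n := n))) (meas_normalize (mB (n := n)))).
Qed.

Lemma meas_bound_expr n : mble (bnd n).
Proof.
have iK := meas_invmx (@hK n) (@hKu n); have iL := meas_invmx (@hL n) (@hLu n).
have mc (k : R) (g : T -> R) : mble g -> mble (fun w => k * g w).
 by move=> mg; apply: mbleM => //; exact: measurable_cst.
apply: mbleD; [apply: mbleD; [apply: mbleD|]|];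
 apply: mc; apply: meas_hs_norm_sqr; [exact: mA|exact: mB| |].
 by apply: (meas_mxM _ iL); apply: (meas_mxM iK); exact: hM.
exact: (meas_mxM iK iL).
Qed.

Lemma esd_diff_in_probability : bounded_in_probability P bnd -> diff_cvg0_in_probability P
 (fun n w => esd (normalize (A n w))) (fun n w => esd (normalize (B n w))).
Proof.
move=> hbd f tf.
rewrite (_ : (fun n w => _) = (fun n w => spectral_diff f n w)); last first.
 by apply/funext => n; apply/funext => w; exact: eigen_diff_esd.
apply: (@controlled_in_probability _ _ _ P bnd _ meas_bound_expr) hbd => [n|c c0].
 exact: meas_spectral_diff.
exact: controlled_test.
Qed.

(* Almost sure convergence is obtained simultaneously for countably many
  functions, from which all test functions are uniformly approximated. *)
Lemma lmax_diff_as : as_bounded P bnd -> {ae P, forall w, forall q, lattice_param q ->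
 spectral_diff (fun z => lmax q.2 (z - q.1.2)) n w @[n --> \oo] --> 0}.
Proof.
move=> /as_bounded_nat hb.
have h : {ae P, forall w, forall m k l b' b c j : nat, \forall n \near \oo, bnd n w <= c%:R ->
  `|spectral_diff (fun z => lmax (2 * b.+1%:R * m.+1%:R^-1) (z - grid m.+1%:R^-1 b' (k, l))) n w| <= j.+1%:R^-1}.
 do 6 (apply: ae_foralln => ?); apply: controlled_ae; by apply: controlled_lmax.
apply: filterS2 hb h => w [c hc] h q [m [k [l [b' [b [-> ->]]]]]].
apply/cvgrPdist_le => e e0; near=> n; rewrite sub0r normrN.
have hn : bnd n w <= c%:R by near: n; exact: hc.
pose j := Num.truncn e^-1.
have je : j.+1%:R^-1 <= e.
 by rewrite -[leRHS]invrK lef_pV2 ?posrE ?invr_gt0//; exact: ltW (truncnS_gt _).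
apply: le_trans je; move: hn; near: n; exact: h.
Unshelve. all: by end_near. Qed.

Lemma spectral_diff_cvg w : (forall q, lattice_param q ->
  spectral_diff (fun z => lmax q.2 (z - q.1.2)) n w @[n --> \oo] --> 0) ->
 forall f, test_function f -> spectral_diff f n w @[n --> \oo] --> 0.
Proof.
move=> h f /test_function_ucc[uf [b fb]]; apply/cvgrPdist_le => e e0.
have [|l [hl fl]] := lcomb_dense (e := e / 4) uf fb; first by rewrite divr_gt0.
have cl : spectral_diff (lcomb l) n w @[n --> \oo] --> 0.
 elim: l hl {fl} => [_|q l ih hl].
  by under eq_fun do rewrite /spectral_diff eigen_diff_nil; exact: cvg_cst.
 under eq_fun do rewrite /spectral_diff eigen_diff_cons.
 have c1 : spectral_diff (fun z => lmax q.2 (z - q.1.2)) n w @[n --> \oo] --> 0.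
  by apply: h; apply: hl; rewrite mem_head.
 have c2 : spectral_diff (lcomb l) n w @[n --> \oo] --> 0.
  by apply: ih => q' h'; apply: hl; rewrite inE h' orbT.
 by have := cvgD (cvgM (cvg_cst q.1.1) c1) c2; rewrite mulr0 addr0; apply.
have e2 : 0 < e / 2 by rewrite divr_gt0.
move/cvgrPdist_le: cl => /(_ _ e2) cl; near=> n; rewrite sub0r normrN.
have n0 : (0 < n)%N by near: n; exact: nbhs_infty_gt.
have hn : `|0 - spectral_diff (lcomb l) n w| <= e / 2 by near: n; exact: cl.
rewrite sub0r normrN in hn; rewrite -(prednK n0) in hn *.
rewrite -[spectral_diff f _ w](subrK (spectral_diff (lcomb l) n.-1.+1 w)).
apply: le_trans (ler_normD _ _) _; apply: le_trans (lerD (eigen_diff_close _ _ fl) hn) _.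
by rewrite le_eqVlt; apply/orP; left; apply/eqP; field.
Unshelve. all: by end_near. Qed.

Lemma esd_diff_as : as_bounded P bnd -> diff_cvg0_as P
 (fun n w => esd (normalize (A n w))) (fun n w => esd (normalize (B n w))).
Proof.
move=> /lmax_diff_as; apply: filterS => w /spectral_diff_cvg h f tf.
by under eq_fun do rewrite (eigen_diff_esd _ _ tf); exact: h.
Qed.

End model.

Theorem theorem1p18 (R : realType) (d : measure_display)
    (T : measurableType d) (P : probability T R)
    (x y : {RV P >-> R[i]})
    (X Y : nat -> nat -> {RV P >-> R[i]})
    (M K L A B : forall n, T -> 'M[R[i]]_n)
    (hx : standardized x) (hy : standardized y)
    (hX : iid_copies x X) (hY : iid_copies y Y)
    (hM : random_matrices M) (hK : random_matrices K)
    (hL : random_matrices L)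
    (hKu : forall n w, K n w \in unitmx)
    (hLu : forall n w, L n w \in unitmx)
    (hind : independent_families P
      (matrix_entries M `|` matrix_entries K `|` matrix_entries L)
      (array_entries X `|` array_entries Y))
    (hA : forall n w,
      A n w = M n w + K n w *m top_left_block X n w *m L n w)
    (hB : forall n w,
      B n w = M n w + K n w *m top_left_block Y n w *m L n w)
    (hbd : bounded_in_probability P (fun n w =>
      bound_expr (A n w) (B n w) (M n w) (K n w) (L n w))) :
  diff_cvg0_in_probability P
    (fun n w => esd (normalize (A n w))) (fun n w => esd (normalize (B n w)))
  /\
  (as_bounded P (fun n w =>
     bound_expr (A n w) (B n w) (M n w) (K n w) (L n w)) ->
   {ae @lebesgueC R, forall z, cvg_as P (fun n w =>
     esd (shifted (M n w) (K n w) (L n w) z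
          *m (shifted (M n w) (K n w) (L n w) z) ^t*))} ->
   diff_cvg0_as P
    (fun n w => esd (normalize (A n w))) (fun n w => esd (normalize (B n w)))).
Proof.
split=> [|hb _].
  exact: (esd_diff_in_probability hx hy hX hY hM hK hL hKu hLu hind hA hB hbd).
exact: (esd_diff_as hx hy hX hY hM hK hL hKu hLu hind hA hB hb).
Qed.
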